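(* Let $n, m, n', N$ be positive integers with $n' < n \le N$, and write points of the torus $\mathbb{T}^{n+m}$ as $(t,x)$ with $t = (t', t'') \in \mathbb{T}^{n}$, $t' \in \mathbb{T}^{n'}$, $t'' \in \mathbb{T}^{n-n'}$, $x \in \mathbb{T}^{m}$. Let $X_{1}, \ldots, X_{N}$ be vector fields with real analytic coefficients defined on $\mathbb{T}^{n+m}$ and let $$P = \sum_{j=1}^{N} X_{j}^{2}.$$ Assume the following. (i) For $1 \le j \le n'$, $$X_{j} = \sum_{i=1}^{n'} a_{ji}(t') D_{t_{i}},$$ where the $a_{ji}$ are real analytic functions on $\mathbb{T}^{n'}$, and the vector fields $X_{1}, \ldots, X_{n'}$ are linearly independent at every $t' \in \mathbb{T}^{n'}$. (ii) For $n'+1 \le j \le N$, $$X_{j} = a_{j}(t') D_{t_{q(j)}} + \sum_{k=1}^{m} b_{jk}(t) D_{x_{k}},$$ where the $a_{j}$ are real analytic functions on $\mathbb{T}^{n'}$, the $b_{jk}$ are real analytic functions on $\mathbb{T}^{n}$, and $q$ is a surjective map from $\{n'+1, \ldots, N\}$ onto $\{n'+1, \ldots, n\}$. (iii) For each $j \in \{n'+1, \ldots, n\}$ there exists $\lambda_{j} \in q^{-1}(\{j\})$ such that, for some constant $C > 0$, for every $\ell \in \{\lambda_{j} \mid j \in \{n'+1, \ldots, n\}\}$ and every $t = (t',t'') \in \mathbb{T}^{n}$, $$\sum_{r=n'+1}^{N} \sum_{k=1}^{m} |b_{rk}(t)| \le C |a_{\ell}(t')| \qquad \text{and} \qquad \sum_{r=n'+1}^{N}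 |a_{r}(t')| \le C |a_{\ell}(t')|.$$ (iv) The vector fields $X_{1}, \ldots, X_{N}$ satisfy Hörmander's condition on $\mathbb{T}^{n+m}$: the vector fields and their iterated commutators generate a Lie algebra of dimension $n+m$ (the dimension of the ambient space) at every point. Then $P$ is globally analytic hypoelliptic on $\mathbb{T}^{n+m}$: if $u \in \mathscr{D}'(\mathbb{T}^{n+m})$ and $Pu \in C^{\omega}(\mathbb{T}^{n+m})$, then $u \in C^{\omega}(\mathbb{T}^{n+m})$.
   Context: Here $D_{t_{i}} = \frac{1}{\sqrt{-1}}\,\partial_{t_{i}}$ and $D_{x_{k}} = \frac{1}{\sqrt{-1}}\,\partial_{x_{k}}$, and the coefficient functions $a_{ji}, a_{j}, b_{jk}$ are real-valued. $\mathbb{T}^{d}$ denotes the $d$-dimensional torus, $\mathscr{D}'(\mathbb{T}^{d})$ the space of distributions on it, and $C^{\omega}(\mathbb{T}^{d})$ the space of real analytic functions on it, i.e. (Gevrey class $G^{1}(\mathbb{T}^{d})$) the set of $f \in C^{\infty}(\mathbb{T}^{d})$ for which there is a constant $C>0$ with $|D^{\alpha} f(x)| \le C^{|\alpha|+1} |\alpha|^{|\alpha|}$ for all multi-indices $\alpha \in \mathbb{Z}_{+}^{d}$ and all $x \in \mathbb{T}^{d}$. *)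

(* Defs.v *)
From HB Require Import structures.
From mathcomp Require Import all_boot all_order all_algebra.
From mathcomp Require Import complex.
From mathcomp Require Import all_classical all_reals all_analysis.

Set Implicit Arguments.
Unset Strict Implicit.
Unset Printing Implicit Defensive.

Import Order.TTheory GRing.Theory Num.Theory numFieldNormedType.Exports.

Local Open Scope ring_scope.
Local Open Scope complex_scope.

(* The torus T^d is R^d / (2 pi Z)^d.  Functions on T^d are functions on
   'rV[R]_d that are [periodic] in the sense below. *)
Section Torus.
Variables (R : realType) (d : nat).
Local Notation C := R[i].
Implicit Types (f g : 'rV[R]_d -> C) (k : 'I_d).

Definition basis_vec k : 'rV[R]_d := delta_mx 0 k.

Definition periodic f : Prop :=
  forall x k, f (x + (2 * pi) *: basis_vec k) = f x.

Definition re_part f : 'rV[R]_d -> R := fun x => complex.Re (f x).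
Definition im_part f : 'rV[R]_d -> R := fun x => complex.Im (f x).

Definition ccontinuous f : Prop :=
  continuous (re_part f) /\ continuous (im_part f).

Definition cderivable k f : Prop :=
  forall x, derivable (re_part f) x (basis_vec k) /\
            derivable (im_part f) x (basis_vec k).

(* D_k = (1 / sqrt(-1)) d/dx_k, taken componentwise on real and imaginary
   parts. *)
Definition D k f : 'rV[R]_d -> C := fun x =>
  'i^-1 * ('D_(basis_vec k) (re_part f) x +i* 'D_(basis_vec k) (im_part f) x).

(* All iterated partial derivatives, in any order, exist and are continuous. *)
Definition smooth f : Prop :=
  forall s : seq 'I_d,
    ccontinuous (foldr D f s) /\ forall k, cderivable k (foldr D f s).

Definition Cinfty f : Prop := periodic f /\ smooth f.

Definition mlen (alpha : 'I_d -> nat) : nat := (\sum_k alpha k)%N.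

Definition Dmulti (alpha : 'I_d -> nat) f : 'rV[R]_d -> C :=
  foldr (fun k g => iter (alpha k) (D k) g) f (enum 'I_d).

Definition Comega f : Prop :=
  Cinfty f /\
  exists2 K : R, 0 < K &
    forall (alpha : 'I_d -> nat) (x : 'rV[R]_d),
      `|Dmulti alpha f x|
        <= (K ^+ (mlen alpha).+1 * (mlen alpha)%:R ^+ mlen alpha)%:C.

Definition Comega_real (h : 'rV[R]_d -> R) : Prop :=
  Comega (fun x => (h x)%:C).

(* A distribution is a continuous linear functional on C^infty(T^d).  It is
   carried by a functional on all functions, of which only the values on
   C^infty(T^d) are meaningful; continuity is the seminorm estimate
   |u(phi)| <= K * max_{|alpha| <= p} sup |D^alpha phi|. *)
Definition functional : Type := ('rV[R]_d -> C) -> C.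
Implicit Types u : functional.

Definition distribution u : Prop :=
  (forall (c : C) f g, Cinfty f -> Cinfty g ->
     u (fun x => c * f x + g x) = c * u f + u g) /\
  (exists (p : nat) (K : R), forall f (M : R), Cinfty f ->
     (forall alpha x, (mlen alpha <= p)%N -> `|Dmulti alpha f x| <= M%:C) ->
     `|u f| <= (K * M)%:C).

Definition dist_D k u : functional := fun phi => - u (D k phi).
Definition dist_mul (c : 'rV[R]_d -> C) u : functional :=
  fun phi => u (fun x => c x * phi x).

(* Vector fields are given by their (complex) coefficients in the frame
   D_1, ..., D_d : X stands for \sum_k (X _ 0 k) D_k. *)
Definition vfield : Type := 'rV[R]_d -> 'rV[C]_d.
Implicit Types X Y : vfield.

Definition vf_D k : vfield := fun=> delta_mx 0 k.

Definition vf_app X f : 'rV[R]_d -> C := fun x => \sum_k X x 0 k * D k f x.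

Definition vf_dist X u : functional :=
  fun phi => \sum_k dist_mul (fun x => X x 0 k) (dist_D k u) phi.

Definition vf_bracket X Y : vfield := fun x =>
  \row_k (vf_app X (fun y => Y y 0 k) x - vf_app Y (fun y => X y 0 k) x).

Inductive Lie_generated (N : nat) (X : 'I_N -> vfield) : vfield -> Prop :=
| Lie_gen j : Lie_generated X (X j)
| Lie_lin (c : C) Y Z : Lie_generated X Y -> Lie_generated X Z ->
    Lie_generated X (fun x => c *: Y x + Z x)
| Lie_bracket Y Z : Lie_generated X Y -> Lie_generated X Z ->
    Lie_generated X (vf_bracket Y Z).

(* At every point z, { Y z | Y in the generated Lie algebra } has dimension d,
   i.e. contains d linearly independent vectors. *)
Definition Hormander (N : nat) (X : 'I_N -> vfield) : Prop :=
  forall z, exists Y : 'I_d -> vfield,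
    (forall k, Lie_generated X (Y k)) /\ row_free (\matrix_k Y k z).

Definition sum_of_squares (N : nat) (X : 'I_N -> vfield) u : functional :=
  fun phi => \sum_(j < N) vf_dist (X j) (vf_dist (X j) u) phi.

End Torus.

Section Hypoellipticity.
Variable R : realType.

(* Iterated integral over [0, 2 pi]^d; it is only used on continuous
   functions. *)
Fixpoint torus_integral (d : nat) : ('rV[R]_d -> R) -> R :=
  match d with
  | 0 => fun f => f 0
  | d'.+1 => fun f =>
      \int[lebesgue_measure]_(s in `[0, 2 * pi]%classic)
        torus_integral (fun y : 'rV[R]_d' => f (row_mx (s%:M : 'rV[R]_1) y))
  end.

Variable d : nat.
Local Notation C := R[i].

Definition torus_cintegral (f : 'rV[R]_d -> C) : C :=
  torus_integral (re_part f) +i* torus_integral (im_part f).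

Definition dist_of (f : 'rV[R]_d -> C) : functional R d :=
  fun phi => torus_cintegral (fun x => f x * phi x).

Definition dist_Comega (u : functional R d) : Prop :=
  exists2 f, Comega f & forall phi, Cinfty phi -> u phi = dist_of f phi.

Definition globally_analytic_hypoelliptic
    (P : functional R d -> functional R d) : Prop :=
  forall u, distribution u -> dist_Comega (P u) -> dist_Comega u.

End Hypoellipticity.

(* Points of T^(n+m) are z = row_mx t x, and t = (t', t''). *)
Definition t_part (R : realType) (n m : nat) (z : 'rV[R]_(n + m)) : 'rV[R]_n :=
  lsubmx z.
Definition prime_part (R : realType) (n' n : nat) (h : (n' <= n)%N)
  (t : 'rV[R]_n) : 'rV[R]_n' := colsub (widen_ord h) t.

(* Main.v *)
(* Everything is done on Fourier coefficients, over the lattice of frequencies.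
   Hormander's condition gives, for every eta > 0, Kohn's compactness estimate
     |v|^2 <= eta (sum_j |X_j v|^2 + |v|^2) + C |v|_(-1)^2,
   because the fields Z for which br^(-1) Z is compact relative to the energy are
   stable under brackets with the X_j.  Hence, if conjugating the X_j by a weight m
   on frequencies costs at most a multiple of the energy, m u^ is bounded by m f^
   and by finitely many coefficients.  The weights br^q give smoothness.  Then,
   for lam > 1 close to 1, the weights lam^|xi|, lam^(|eta| - M|xi|)_+ and
   lam^(|tau| - |eta| - |xi|)_+, where (tau, eta, xi) is dual to (t', t'', x), give
   exponential decay of u^ in all directions.  The coefficients do not depend
   on x, so the first weight commutes with the X_j.  The second one only interacts
   with the b_jk, whose partial Fourier coefficients in t'' must be bounded by
   C w^|zeta| |a_l(t')| with w < 1: the convergent power series dominated by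
   |a_l| form an ideal of germs, and division by a standard basis bounds
   each of them by |a_l| times its own norm, uniformly.  The third one uses the
   ellipticity of X_1, ..., X_n' in t'. *)
Require Import Defs.
From HB Require Import structures.
From mathcomp Require Import all_boot all_order all_algebra.
From mathcomp Require Import complex.
From mathcomp Require Import all_classical all_reals all_analysis.
From mathcomp Require Import ring lra zify.

Set Implicit Arguments.
Unset Strict Implicit.
Unset Printing Implicit Defensive.

Import Order.TTheory GRing.Theory Num.Theory numFieldNormedType.Exports.

Local Open Scope ring_scope.
Local Open Scope complex_scope.

(** * Unordered sums *)

(** The crux is the weight [lam^(|eta| - M|xi|)_+]. Its commutators with the terms [b_jk D_x] have
    the size of [a_l D_x (m u)], which the energy does not contain. Where [|eta| <= M|xi|] the
    weight is 1 and such terms are bounded by the already smooth [u]. Elsewhere [|xi| < |eta| / M],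
    and the fields [X_l] bound [a_l D_t'' (m u)] by the energy plus [a_l D_x (m u)] again, so a
    large [M] absorbs them. This requires the commutator to keep the factor [a_l]. Averaging over
    t'' gives each partial Fourier coefficient the factor [|a_l|] but no decay in zeta; analyticity
    gives the decay but not the factor. Uniform division of germs gives both at once. Weights must
    also be bounded before anything is known about [m u]. They are therefore truncated, and every
    constant is fixed before the weight: first the share of the energy that the errors may use, then
    the multiple of the norm of [m u], which compactness absorbs however large it is. *)

Section ComplexModulus.
Variable R : realType.
Implicit Types (z w : R[i]) (x : R).

(** The norm of [R[i]] has its values in [R[i]]; this copy with values in [R] gives access to
    suprema and to the order of [R]. *)
Definition nm z : R := Num.sqrt (complex.Re z ^+ 2 + complex.Im z ^+ 2).

Lemma nmE z : `|z| = (nm z)%:C.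
Proof. exact: normc_def. Qed.

Lemma nm_ge0 z : 0 <= nm z.
Proof. exact: sqrtr_ge0. Qed.

Lemma nmM z w : nm (z * w) = nm z * nm w.
Proof. by apply: complexI; rewrite -nmE normrM !nmE rmorphM. Qed.

Lemma ler_nmD z w : nm (z + w) <= nm z + nm w.
Proof. by rewrite -lecR -nmE rmorphD /= -!nmE ler_normD. Qed.

Lemma nmN z : nm (- z) = nm z.
Proof. by apply: complexI; rewrite -!nmE normrN. Qed.

Lemma nm0 : nm 0 = 0.
Proof. by apply: complexI; rewrite -nmE normr0. Qed.

Lemma nm1 : nm 1 = 1.
Proof. by apply: complexI; rewrite -nmE normr1. Qed.

Lemma nm_eq0 z : nm z = 0 -> z = 0.
Proof. by move=> h; apply/eqP; rewrite -normr_eq0 nmE h. Qed.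

Lemma nmX z n : nm (z ^+ n) = nm z ^+ n.
Proof. by apply: complexI; rewrite -nmE normrX nmE rmorphXn. Qed.

Lemma nmV z : nm z^-1 = (nm z)^-1.
Proof. by apply: complexI; rewrite -nmE normfV nmE fmorphV. Qed.

Lemma nm_real x : nm x%:C = `|x|.
Proof. by rewrite /nm /= expr0n addr0 sqrtr_sqr. Qed.

Lemma nm_i : nm 'i = 1.
Proof. by rewrite /nm /= expr0n add0r expr1n sqrtr1. Qed.

Lemma nmJ z : nm (conjc z) = nm z.
Proof. by case: z => a b; rewrite /nm /= sqrrN. Qed.

Lemma nm_sqr z : nm z ^+ 2 = complex.Re z ^+ 2 + complex.Im z ^+ 2.
Proof. by rewrite sqr_sqrtr // addr_ge0 ?sqr_ge0. Qed.

Lemma nm_sqrJ z : (nm z ^+ 2)%:C = z * (conjc z).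
Proof. by rewrite rmorphXn /= -nmE sqr_normc. Qed.

Lemma Re_le_nm z : `|complex.Re z| <= nm z.
Proof. by rewrite -lecR -nmE normc_ge_Re. Qed.

Lemma Im_le_nm z : `|complex.Im z| <= nm z.
Proof. by rewrite -sqrtr_sqr /nm ler_wsqrtr // lerDr sqr_ge0. Qed.

Lemma nm_le_ReIm z : nm z <= `|complex.Re z| + `|complex.Im z|.
Proof.
rewrite -(@ler_pXn2r _ 2) ?nnegrE ?nm_ge0 ?addr_ge0 // nm_sqr.
rewrite sqrrD !real_normK ?num_real //.
by rewrite addrAC lerDl mulrn_wge0 // mulr_ge0.
Qed.

Lemma ler_nm_sum (I : Type) (r : seq I) (P : pred I) (F : I -> R[i]) :
  nm (\sum_(i <- r | P i) F i) <= \sum_(i <- r | P i) nm (F i).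
Proof.
elim/big_rec2: _ => [|i y1 y2 _ h]; first by rewrite nm0.
by apply: (le_trans (ler_nmD _ _)); rewrite lerD2l.
Qed.

Lemma nm_prod (I : Type) (r : seq I) (P : pred I) (F : I -> R[i]) :
  nm (\prod_(i <- r | P i) F i) = \prod_(i <- r | P i) nm (F i).
Proof. by apply: (big_morph nm nmM nm1). Qed.

End ComplexModulus.

Section NonnegativeSums.
Variable R : realType.

(* nsm includes nonnegativity; without nsm the supremum nsum is a junk value. *)
Definition nsm (T : eqType) (f : T -> R) : Prop :=
  (forall x, 0 <= f x) /\
  exists M, forall s : seq T, uniq s -> \sum_(x <- s) f x <= M.

Definition nsum (T : eqType) (f : T -> R) : R :=
  sup [set y | exists2 s : seq T, uniq s & y = \sum_(x <- s) f x].

Section OneIndex.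
Variable T : eqType.
Implicit Types (f g : T -> R) (s : seq T).

Lemma nsum_ub f s : nsm f -> uniq s -> \sum_(x <- s) f x <= nsum f.
Proof.
move=> [_ [M hM]] us; apply: ub_le_sup; last by exists s.
by exists M => _ [s' us' ->]; apply: hM.
Qed.

Lemma nsum_le f M : (forall s, uniq s -> \sum_(x <- s) f x <= M) -> nsum f <= M.
Proof.
move=> h; apply: ge_sup; first by exists 0, [::]; rewrite ?big_nil.
by move=> _ [s us ->]; apply: h.
Qed.

Lemma nsum_ge0 f : nsm f -> 0 <= nsum f.
Proof. by move=> h; have := nsum_ub h (isT : uniq [::]); rewrite big_nil. Qed.

Lemma nsum_ge f x : nsm f -> f x <= nsum f.
Proof. by move=> h; have := nsum_ub h (isT : uniq [:: x]); rewrite big_seq1. Qed.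

Lemma eq_nsum f g : f =1 g -> nsum f = nsum g.
Proof. by move=> /funext ->. Qed.

Lemma nsm_le f g : nsm g -> (forall x, 0 <= f x <= g x) -> nsm f.
Proof.
move=> [_ [M hM]] h; split=> [x|]; first by case/andP: (h x).
exists M => s us; apply: le_trans (hM s us).
by apply: ler_sum => x _; case/andP: (h x).
Qed.

Lemma le_nsum f g : nsm g -> (forall x, f x <= g x) -> nsum f <= nsum g.
Proof.
move=> hg h; apply: nsum_le => s us; apply: le_trans (nsum_ub hg us).
by apply: ler_sum => x _.
Qed.

Lemma nsm0 : nsm (fun _ : T => 0).
Proof. by split=> //; exists 0 => s _; rewrite big1. Qed.

Lemma nsum0 : nsum (fun _ : T => 0) = 0.
Proof.
apply/le_anti/andP; split; last exact/nsum_ge0/nsm0.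
by apply: nsum_le => s _; rewrite big1.
Qed.

Lemma nsmD f g : nsm f -> nsm g -> nsm (fun x => f x + g x).
Proof.
move=> [f0 [M hM]] [g0 [N hN]]; split=> [x|]; first by rewrite addr_ge0.
by exists (M + N) => s us; rewrite big_split lerD ?hM ?hN.
Qed.

Lemma sub_sum_le f s1 s2 : (forall x, 0 <= f x) -> uniq s1 ->
  {subset s1 <= s2} -> \sum_(x <- s1) f x <= \sum_(x <- s2) f x.
Proof.
elim: s1 s2 => [|a s1 IH] s2 f0 /=.
  by move=> _ _; rewrite big_nil sumr_ge0.
move=> /andP[an us] sub; have ain : a \in s2 by apply: sub; rewrite mem_head.
rewrite (perm_big _ (perm_to_rem ain)) !big_cons lerD2l; apply: IH => // x xs.
have : x \in s2 by apply: sub; rewrite in_cons xs orbT.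
rewrite (perm_mem (perm_to_rem ain)) in_cons => /orP[/eqP xa|//].
by move: an; rewrite -xa xs.
Qed.

(** For the lower bound, two finite families are merged into the duplicate-free list
    [undup (s ++ s')], which dominates both because the terms are nonnegative. *)
Lemma nsumD f g : nsm f -> nsm g ->
  nsum (fun x => f x + g x) = nsum f + nsum g.
Proof.
move=> hf hg; apply/le_anti/andP; split.
  by apply: nsum_le => s us; rewrite big_split lerD ?nsum_ub.
rewrite -lerBrDr; apply: nsum_le => s us; rewrite lerBrDr -lerBrDl.
apply: nsum_le => s' us'; rewrite lerBrDl.
pose t := undup (s ++ s').
have := nsum_ub (nsmD hf hg) (undup_uniq (s ++ s')); apply: le_trans.
rewrite big_split; apply: lerD.
  apply: sub_sum_le => //; first by case: hf.
  by move=> x xs; rewrite mem_undup mem_cat xs.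
apply: sub_sum_le => //; first by case: hg.
by move=> x xs; rewrite mem_undup mem_cat xs orbT.
Qed.

Lemma nsmZ c f : 0 <= c -> nsm f -> nsm (fun x => c * f x).
Proof.
move=> c0 [f0 [M hM]]; split=> [x|]; first by rewrite mulr_ge0.
by exists (c * M) => s us; rewrite -mulr_sumr ler_wpM2l ?hM.
Qed.

Lemma nsumZ c f : 0 <= c -> nsm f -> nsum (fun x => c * f x) = c * nsum f.
Proof.
rewrite le_eqVlt => /orP[/eqP <- _|c0 hf].
  by rewrite mul0r (eq_nsum (g := fun=> 0)) ?nsum0 // => x; rewrite mul0r.
apply/le_anti/andP; split.
  apply: nsum_le => s us; rewrite -mulr_sumr.
  by rewrite ler_wpM2l ?nsum_ub ?(ltW c0).
rewrite -ler_pdivlMl //; apply: nsum_le => s us.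
rewrite ler_pdivlMl // mulr_sumr.
by apply: (@nsum_ub (fun x => c * f x)) => //; apply: nsmZ => //; apply: ltW.
Qed.

Lemma nsm_sum (I : Type) (r : seq I) (P : pred I) (F : I -> T -> R) :
  (forall i, P i -> nsm (F i)) ->
  nsm (fun x => \sum_(i <- r | P i) F i x) /\
  nsum (fun x => \sum_(i <- r | P i) F i x) = \sum_(i <- r | P i) nsum (F i).
Proof.
move=> h; elim: r => [|i r [IH1 IH2]].
  have -> : (fun x => \sum_(i <- [::] | P i) F i x) = (fun=> 0).
    by apply/funext => x; rewrite big_nil.
  by rewrite big_nil nsum0; split=> //; apply: nsm0.
have -> : (fun x => \sum_(i <- i :: r | P i) F i x) =
  (fun x => if P i then F i x + \sum_(i <- r | P i) F i x
            else \sum_(i <- r | P i) F i x).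
  by apply/funext => x; rewrite big_cons.
rewrite big_cons; case: ifP => Pi //.
by split; [apply: nsmD => //; apply: h | rewrite nsumD ?IH2 //; apply: h].
Qed.

(** The partial sum over [s] comes within [e] of the supremum, so a finite family disjoint from [s]
    cannot sum to more than [e]. *)
Lemma nsum_tail f e : nsm f -> 0 < e ->
  exists2 s, uniq s & nsum (fun x => if x \in s then 0 else f x) <= e.
Proof.
move=> hf e0.
have hS : has_sup [set y | exists2 s : seq T, uniq s & y = \sum_(x <- s) f x].
  split; first by exists 0, [::]; rewrite ?big_nil.
  by case: hf => _ [M hM]; exists M => _ [s us ->]; apply: hM.
have [_ [s us ->] hs] := sup_adherent e0 hS.
exists s => //; apply: nsum_le => t ut.
have h : \sum_(x <- t) (if x \in s then 0 else f x) =
         \sum_(x <- [seq x <- t | x \notin s]) f x.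
  by rewrite big_filter [RHS]big_mkcond; apply: eq_bigr => x _; case: ifP.
rewrite h; have := @nsum_ub f ([seq x <- t | x \notin s] ++ s) hf.
rewrite big_cat cat_uniq us filter_uniq // andbT.
have -> : ~~ has (in_mem^~ (mem [seq x <- t | x \notin s])) s.
  by apply/hasPn => x xs; rewrite mem_filter xs.
move=> /(_ isT) h2; move: hs; rewrite -/(nsum f) => hs.
by rewrite -(lerD2r (\sum_(x <- s) f x)) (le_trans h2) // -lerBlDl ltW.
Qed.

Lemma nsum_fin f s : uniq s -> (forall x, 0 <= f x) ->
  nsm (fun x => if x \in s then f x else 0) /\
  nsum (fun x => if x \in s then f x else 0) = \sum_(x <- s) f x.
Proof.
move=> us f0.
have bd t : uniq t -> \sum_(x <- t) (if x \in s then f x else 0) <=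
   \sum_(x <- s) f x.
  move=> ut; rewrite -big_mkcond -big_filter sub_sum_le ?filter_uniq // => x.
  by rewrite mem_filter => /andP[].
have h : nsm (fun x => if x \in s then f x else 0).
  by split; [move=> x; case: ifP | exists (\sum_(x <- s) f x)].
split=> //; apply/le_anti/andP; split; first exact: nsum_le.
apply: le_trans (nsum_ub h us).
by rewrite big_seq [leRHS]big_seq; apply: ler_sum => x ->.
Qed.

End OneIndex.

Lemma nsum_reindex (T U : eqType) (h : U -> T) (f : T -> R) :
  injective h -> (forall x, f x != 0 -> exists u, h u = x) -> nsm f ->
  nsm (f \o h) /\ nsum (f \o h) = nsum f.
Proof.
move=> hi hs hf.
have b (s : seq U) : uniq s -> \sum_(u <- s) (f \o h) u <= nsum f.
  move=> us; have := nsum_ub hf (_ : uniq (map h s)).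
  by rewrite map_inj_uniq // big_map => /(_ us).
have sm : nsm (f \o h) by split; [move=> u; case: hf => /(_ (h u)) | exists (nsum f)].
split=> //; apply/le_anti/andP; split; first exact: nsum_le.
apply: nsum_le => s us.
pose t := [seq x <- s | f x != 0].
have -> : \sum_(x <- s) f x = \sum_(x <- t) f x.
  rewrite big_filter [RHS]big_mkcond; apply: eq_bigr => x _.
  by case: ifP => // /negbFE/eqP.
have [t' ht] : exists t', map h t' = t.
  have : all (fun x => f x != 0) t by rewrite filter_all.
  elim: t => [_|x t IH] /=; first by exists [::].
  by move=> /andP[/hs[u <-] /IH[t' <-]]; exists (u :: t').
rewrite -ht big_map; apply: (nsum_ub sm).
by rewrite -(map_inj_uniq hi) ht filter_uniq.
Qed.

(** Tonelli: a finite set of pairs lies in the rectangle of its projections, and rectangles exhaust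
    the iterated sum. *)
Lemma nsm_pair (T U : eqType) (f : T -> U -> R) :
  (forall x, nsm (f x)) -> nsm (fun x => nsum (f x)) ->
  nsm (fun p : T * U => f p.1 p.2) /\
  nsum (fun p : T * U => f p.1 p.2) = nsum (fun x => nsum (f x)).
Proof.
move=> h1 h2.
have f0 x y : 0 <= f x y by case: (h1 x).
have b (s : seq (T * U)) : uniq s -> \sum_(p <- s) f p.1 p.2 <= nsum (fun x => nsum (f x)).
  move=> us; pose s1 := undup (map fst s); pose s2 := undup (map snd s).
  apply: (@le_trans _ _ (\sum_(p <- [seq (x, y) | x <- s1, y <- s2]) f p.1 p.2)).
    apply: sub_sum_le => // -[x y] xs; apply/allpairsP; exists (x, y).
    by rewrite !mem_undup; split=> //; apply/mapP; exists (x, y).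
  rewrite big_allpairs_dep; apply: le_trans (nsum_ub h2 (undup_uniq (map fst s))).
  by apply: ler_sum => x _; apply: nsum_ub => //=; apply: undup_uniq.
have sm : nsm (fun p : T * U => f p.1 p.2).
  by split=> //; exists (nsum (fun x => nsum (f x))).
split=> //; apply/le_anti/andP; split; first exact: nsum_le.
apply: nsum_le => s us.
have -> : \sum_(x <- s) nsum (f x) = nsum (fun y => \sum_(x <- s) f x y).
  by have [_ ->] := @nsm_sum _ _ s xpredT f (fun i _ => h1 i).
apply: nsum_le => t ut; rewrite exchange_big /=.
have := nsum_ub sm (_ : uniq [seq (x, y) | x <- s, y <- t]).
rewrite big_allpairs_dep; apply; apply: allpairs_uniq => //.
by move=> [? ?] [? ?] _ _ [-> ->].
Qed.

Lemma nsm_pairI (T U : eqType) (f : T -> U -> R) :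
  nsm (fun p : T * U => f p.1 p.2) ->
  (forall x, nsm (f x)) /\ nsm (fun x => nsum (f x)).
Proof.
move=> hf; have f0 x y : 0 <= f x y by case: hf => /(_ (x, y)).
have h1 x : nsm (f x).
  split=> //; case: hf => _ [M hM]; exists M => s us.
  have := hM [seq (x, y) | y <- s]; rewrite big_map; apply.
  by rewrite map_inj_uniq // => ? ? [].
split=> //; split=> [x|]; first exact: nsum_ge0.
exists (nsum (fun p : T * U => f p.1 p.2)) => s us.
have [_ <-] := @nsm_sum _ _ s xpredT f (fun i _ => h1 i).
apply: nsum_le => t ut; rewrite exchange_big /=.
have := nsum_ub hf (_ : uniq [seq (x, y) | x <- s, y <- t]).
rewrite big_allpairs_dep; apply; apply: allpairs_uniq => //.
by move=> [? ?] [? ?] _ _ [-> ->].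
Qed.

Lemma nsm_swap (T U : eqType) (f : T * U -> R) : nsm f ->
  nsm (fun p : U * T => f (p.2, p.1)) /\
  nsum (fun p : U * T => f (p.2, p.1)) = nsum f.
Proof.
move=> hf; apply: (@nsum_reindex _ _ (fun p : U * T => (p.2, p.1)) f) => //.
  by move=> [? ?] [? ?] [-> ->].
by move=> [x y] _; exists (y, x).
Qed.

End NonnegativeSums.

Arguments nm : simpl never.

Section RealSums.
Variable R : realType.

Definition pospart (x : R) := Num.max x 0.
Definition negpart (x : R) := Num.max (- x) 0.

Lemma pospart_bound x : 0 <= pospart x <= `|x|.
Proof. by rewrite /pospart le_max lexx orbT ge_max ler_norm normr_ge0. Qed.

Lemma negpart_bound x : 0 <= negpart x <= `|x|.
Proof. by rewrite /negpart -normrN; apply: pospart_bound. Qed.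

Lemma pos_negE x : x = pospart x - negpart x.
Proof.
rewrite /pospart /negpart; case: (leP 0 x) => x0.
  by rewrite max_r ?oppr_le0 // subr0.
by rewrite max_l ?oppr_ge0 ?(ltW x0) // opprK add0r.
Qed.

Definition rsum (T : eqType) (f : T -> R) : R :=
  nsum (fun x => pospart (f x)) - nsum (fun x => negpart (f x)).

Section OneIndex.
Variable T : eqType.
Implicit Types (f g : T -> R).

Lemma nsm_pos f : nsm (fun x => `|f x|) -> nsm (fun x => pospart (f x)).
Proof. by move=> h; apply: (nsm_le h) => x; apply: pospart_bound. Qed.

Lemma nsm_neg f : nsm (fun x => `|f x|) -> nsm (fun x => negpart (f x)).
Proof. by move=> h; apply: (nsm_le h) => x; apply: negpart_bound. Qed.

(** The value does not depend on how [f] is written as a difference of summable nonnegative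
    families. Additivity and Fubini then follow from the nonnegative case by choosing a convenient
    difference. *)
Lemma rsumE f g h : nsm g -> nsm h -> (forall x, f x = g x - h x) ->
  rsum f = nsum g - nsum h.
Proof.
move=> hg hh e.
have sf : nsm (fun x => `|f x|).
  apply: (nsm_le (nsmD hg hh)) => x; rewrite normr_ge0 e /=.
  by rewrite (le_trans (ler_normB _ _)) // !ger0_norm //; case: hg; case: hh.
suff : nsum (fun x => pospart (f x)) + nsum h =
  nsum g + nsum (fun x => negpart (f x)) by rewrite /rsum; lra.
rewrite -(nsumD (nsm_pos sf) hh) -(nsumD hg (nsm_neg sf)); apply: eq_nsum => x.
by have := pos_negE (f x); have := e x; lra.
Qed.

Lemma rsumD f g : nsm (fun x => `|f x|) -> nsm (fun x => `|g x|) ->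
  rsum (fun x => f x + g x) = rsum f + rsum g.
Proof.
move=> hf hg; rewrite (rsumE (nsmD (nsm_pos hf) (nsm_pos hg))
  (nsmD (nsm_neg hf) (nsm_neg hg))); last first.
  by move=> x; rewrite {1}(pos_negE (f x)) {1}(pos_negE (g x)) opprD addrACA.
rewrite (nsumD (nsm_pos hf) (nsm_pos hg)) (nsumD (nsm_neg hf) (nsm_neg hg)).
by rewrite /rsum; lra.
Qed.

Lemma rsumZ c f : nsm (fun x => `|f x|) -> rsum (fun x => c * f x) = c * rsum f.
Proof.
move=> hf; have hp := nsm_pos hf; have hn := nsm_neg hf.
have [p0 _] := andP (pospart_bound c); have [n0 _] := andP (negpart_bound c).
rewrite (rsumE (nsmD (nsmZ p0 hp) (nsmZ n0 hn)) (nsmD (nsmZ p0 hn) (nsmZ n0 hp))).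
  rewrite (nsumD (nsmZ p0 hp) (nsmZ n0 hn)) (nsumD (nsmZ p0 hn) (nsmZ n0 hp)).
  by rewrite !nsumZ // {5}(pos_negE c) /rsum; ring.
by move=> x; rewrite {1}(pos_negE (f x)) {1}(pos_negE c); ring.
Qed.

Lemma rsum_nsum f : nsm f -> rsum f = nsum f.
Proof.
move=> hf; rewrite (rsumE hf (nsm0 R T)) ?nsum0 ?subr0 // => x.
by rewrite subr0.
Qed.

Lemma rsum_le_nsum f g : nsm g -> (forall x, `|f x| <= g x) -> rsum f <= nsum g.
Proof.
move=> hg h; have hf : nsm (fun x => `|f x|).
  by apply: (nsm_le hg) => x; rewrite normr_ge0 h.
rewrite /rsum lerBlDr -[leLHS]addr0 lerD ?nsum_ge0 //; last exact: nsm_neg.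
by apply: le_nsum => // x; apply: le_trans (h x); case/andP: (pospart_bound (f x)).
Qed.

End OneIndex.

Lemma rsum_reindex (T U : eqType) (h : U -> T) (f : T -> R) :
  injective h -> (forall x, f x != 0 -> exists u, h u = x) ->
  nsm (fun x => `|f x|) -> rsum (f \o h) = rsum f.
Proof.
move=> hi hs hf; rewrite /rsum.
have hp x : pospart (f x) != 0 -> exists u, h u = x.
  by move=> h0; apply: hs; apply: contra_neq h0 => ->; rewrite /pospart maxxx.
have hn x : negpart (f x) != 0 -> exists u, h u = x.
  move=> h0; apply: hs; apply: contra_neq h0 => ->.
  by rewrite /negpart oppr0 maxxx.
have [_ <-] := nsum_reindex hi hp (nsm_pos hf).
by have [_ <-] := nsum_reindex hi hn (nsm_neg hf).
Qed.

Lemma rsum_pair (T U : eqType) (f : T -> U -> R) :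
  nsm (fun p : T * U => `|f p.1 p.2|) ->
  rsum (fun p : T * U => f p.1 p.2) = rsum (fun x => rsum (f x)).
Proof.
move=> hf; have hp := nsm_pos hf; have hn := nsm_neg hf.
have [p1 p2] := nsm_pairI (f := fun x y => pospart (f x y)) hp.
have [n1 n2] := nsm_pairI (f := fun x y => negpart (f x y)) hn.
have [_ ep] := nsm_pair p1 p2; have [_ en] := nsm_pair n1 n2.
by rewrite [in RHS](rsumE p2 n2) // /rsum ep en.
Qed.

End RealSums.

Section ComplexSums.
Variable R : realType.
Local Notation C := R[i].

Definition csm (T : eqType) (f : T -> C) : Prop := nsm (fun x => nm (f x)).

Definition csum (T : eqType) (f : T -> C) : C :=
  rsum (fun x => complex.Re (f x)) +i* rsum (fun x => complex.Im (f x)).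

Section OneIndex.
Variable T : eqType.
Implicit Types (f g : T -> C).

Lemma csm_le f (g : T -> R) : nsm g -> (forall x, nm (f x) <= g x) -> csm f.
Proof. by move=> hg h; apply: (nsm_le hg) => x; rewrite nm_ge0 h. Qed.

Lemma csm_Re f : csm f -> nsm (fun x => `|complex.Re (f x)|).
Proof. by move=> h; apply: (nsm_le h) => x; rewrite normr_ge0 Re_le_nm. Qed.

Lemma csm_Im f : csm f -> nsm (fun x => `|complex.Im (f x)|).
Proof. by move=> h; apply: (nsm_le h) => x; rewrite normr_ge0 Im_le_nm. Qed.

Lemma eq_csum f g : f =1 g -> csum f = csum g.
Proof. by move=> /funext ->. Qed.

Lemma csmD f g : csm f -> csm g -> csm (fun x => f x + g x).
Proof. by move=> hf hg; apply: (csm_le (nsmD hf hg)) => x; apply: ler_nmD. Qed.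

Lemma csumD f g : csm f -> csm g ->
  csum (fun x => f x + g x) = csum f + csum g.
Proof.
move=> hf hg; rewrite /csum.
have -> : (fun x => complex.Re (f x + g x)) =
  (fun x => complex.Re (f x) + complex.Re (g x)).
  by apply/funext => x; case: (f x) (g x) => [? ?] [? ?].
have -> : (fun x => complex.Im (f x + g x)) =
  (fun x => complex.Im (f x) + complex.Im (g x)).
  by apply/funext => x; case: (f x) (g x) => [? ?] [? ?].
by rewrite !rsumD //; do ?[exact: csm_Re | exact: csm_Im].
Qed.

Lemma csmZ c f : csm f -> csm (fun x => c * f x).
Proof.
by move=> hf; apply: (csm_le (nsmZ (nm_ge0 c) hf)) => x; rewrite nmM.
Qed.

Lemma csumZ c f : csm f -> csum (fun x => c * f x) = c * csum f.
Proof.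
move=> hf; rewrite /csum; case: c => a b.
have hr := csm_Re hf; have hi := csm_Im hf.
have hZ (e : R) (h : T -> R) : nsm (fun x => `|h x|) -> nsm (fun x => `|e * h x|).
  by move=> hh; apply: (nsm_le (nsmZ (normr_ge0 e) hh)) => x; rewrite normrM lexx andbT mulr_ge0.
have -> : (fun x => complex.Re ((a +i* b) * f x)) =
  (fun x => a * complex.Re (f x) + (- b) * complex.Im (f x)).
  by apply/funext => x; case: (f x) => [? ?] /=; rewrite mulNr.
have -> : (fun x => complex.Im ((a +i* b) * f x)) =
  (fun x => a * complex.Im (f x) + b * complex.Re (f x)).
  by apply/funext => x; case: (f x) => [? ?] /=.
by rewrite !rsumD ?rsumZ ?mulNr //; apply: hZ.
Qed.

Lemma csumZr c f : csm f -> csum (fun x => f x * c) = csum f * c.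
Proof.
by move=> hf; rewrite mulrC -csumZ //; apply: eq_csum => x; rewrite mulrC.
Qed.

Lemma csmN f : csm f -> csm (fun x => - f x).
Proof. by move=> hf; apply: (csm_le hf) => x; rewrite nmN. Qed.

Lemma csumN f : csm f -> csum (fun x => - f x) = - csum f.
Proof.
by move=> hf; rewrite -mulN1r -csumZ //; apply: eq_csum => x; rewrite mulN1r.
Qed.

Lemma csmB f g : csm f -> csm g -> csm (fun x => f x - g x).
Proof. by move=> hf hg; apply: csmD => //; apply: csmN. Qed.

Lemma csumB f g : csm f -> csm g ->
  csum (fun x => f x - g x) = csum f - csum g.
Proof. by move=> hf hg; rewrite csumD ?csumN //; apply: csmN. Qed.

Lemma csmJ f : csm f -> csm (fun x => (conjc (f x))).
Proof. by move=> hf; apply: (csm_le hf) => x; rewrite nmJ. Qed.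

Lemma csumJ f : csm f -> csum (fun x => (conjc (f x))) = (conjc (csum f)).
Proof.
move=> hf; rewrite /csum /=; congr (_ +i* _).
  by congr rsum; apply/funext => x; case: (f x).
rewrite -mulN1r -rsumZ; last exact: csm_Im.
by congr rsum; apply/funext => x; case: (f x) => a b; rewrite mulN1r.
Qed.

Lemma csum_real (f : T -> R) : nsm f -> csum (fun x => (f x)%:C) = (nsum f)%:C.
Proof.
move=> hf; rewrite /csum /= rsum_nsum // rsum_nsum ?nsum0 //; exact: nsm0.
Qed.

Lemma csm0 : csm (fun _ : T => 0).
Proof. by apply: (csm_le (nsm0 R T)) => x; rewrite nm0. Qed.

Lemma csum0 : csum (fun _ : T => 0) = 0.
Proof. by rewrite (csum_real (nsm0 R T)) nsum0. Qed.

(** The sum is rotated onto the real axis: its squared modulus is the real part of the sum of the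
    [conjc z * f x], so only real sums have to be compared. *)
Lemma nm_csum f : csm f -> nm (csum f) <= nsum (fun x => nm (f x)).
Proof.
move=> hf; set z := csum f; have := nm_ge0 z.
rewrite le_eqVlt => /orP[/eqP <-|z0]; first exact: nsum_ge0.
rewrite -(ler_pM2l z0) -expr2.
have -> : nm z ^+ 2 = complex.Re ((conjc z) * z).
  by rewrite mulrC -nm_sqrJ.
rewrite -[X in (conjc z) * X]/(csum f) -csumZ //.
rewrite -[complex.Re _]/(rsum (fun x => complex.Re (conjc z * f x))).
rewrite -nsumZ ?nm_ge0 //; apply: rsum_le_nsum.
  by apply: nsmZ => //; apply: nm_ge0.
by move=> x; apply: le_trans (Re_le_nm _) _; rewrite nmM nmJ.
Qed.

Lemma nm_csum_le f (g : T -> R) : nsm g -> (forall x, nm (f x) <= g x) ->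
  nm (csum f) <= nsum g.
Proof.
move=> hg h; apply: le_trans (nm_csum (csm_le hg h)) _; exact: le_nsum.
Qed.

Lemma csm_sum (I : Type) (r : seq I) (P : pred I) (F : I -> T -> C) :
  (forall i, P i -> csm (F i)) ->
  csm (fun x => \sum_(i <- r | P i) F i x) /\
  csum (fun x => \sum_(i <- r | P i) F i x) = \sum_(i <- r | P i) csum (F i).
Proof.
move=> h; elim: r => [|i r [IH1 IH2]].
  have -> : (fun x => \sum_(i <- [::] | P i) F i x) = (fun=> 0).
    by apply/funext => x; rewrite big_nil.
  by rewrite big_nil csum0; split=> //; apply: csm0.
have -> : (fun x => \sum_(i <- i :: r | P i) F i x) =
  (fun x => if P i then F i x + \sum_(i <- r | P i) F i x
            else \sum_(i <- r | P i) F i x).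
  by apply/funext => x; rewrite big_cons.
rewrite big_cons; case: ifP => Pi //.
by split; [apply: csmD => //; apply: h | rewrite csumD ?IH2 //; apply: h].
Qed.

Lemma csum_fin f (s : seq T) : uniq s ->
  csm (fun x => if x \in s then f x else 0) /\
  csum (fun x => if x \in s then f x else 0) = \sum_(x <- s) f x.
Proof.
move=> us.
have h1 g : csm (fun x => if x \in s then g x else 0).
  have [h _] := nsum_fin us (fun x => nm_ge0 (g x)).
  by apply: (csm_le h) => x; case: ifP => _; rewrite ?nm0.
split=> //.
have step x : x \in s -> csum (fun y => if y == x then f x else 0) = f x.
  move=> xs; rewrite {2}(complexE (f x)).
  have e : (fun y => if y == x then f x else 0) =
    (fun y => f x * ((if y \in [:: x] then 1 else 0) : R)%:C).
    apply/funext => y; rewrite inE; case: ifP => _; first by rewrite mulr1.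
    by rewrite mulr0.
  rewrite e; have [h2 h3] := @nsum_fin R T (fun=> 1) [:: x] isT (fun=> ler01).
  rewrite csumZ; first by rewrite (csum_real h2) h3 big_seq1 mulr1 -complexE.
  by apply: (csm_le h2) => y; rewrite nm_real; case: ifP; rewrite ?normr1 ?normr0.
have -> : (fun x => if x \in s then f x else 0) =
  (fun y => \sum_(x <- s) if y == x then f x else 0).
  apply/funext => y; case: ifP => ys.
    rewrite (bigD1_seq y) //= eqxx big1 ?addr0 // => i.
    by rewrite eq_sym => /negbTE ->.
  rewrite big_seq big1 // => i si; case: eqP => // yi.
  by move: ys; rewrite yi si.
have sm1 x : x \in s -> csm (fun y => if y == x then f x else 0).
  move=> xs; have [h _] := @nsum_fin R T (fun y => nm (f y)) [:: x] isT (fun y => nm_ge0 (f y)).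
  apply: (csm_le h) => y; rewrite inE; case: ifP => [/eqP ->|] //; by rewrite nm0.
have eq1 : (fun y => \sum_(x <- s) if y == x then f x else 0) =
   (fun y => \sum_(x <- s | x \in s) if y == x then f x else 0).
  by apply/funext => y; rewrite big_seq.
rewrite eq1; have [_ ->] := csm_sum s (P := fun x => x \in s) sm1.
by rewrite [RHS]big_seq; apply: eq_bigr => x xs; apply: step.
Qed.

Lemma csum_delta f x : (forall y, y != x -> f y = 0) -> csm f /\ csum f = f x.
Proof.
move=> h; have [h1 h2] := @csum_fin f [:: x] isT.
have e : (fun y => if y \in [:: x] then f y else 0) = f.
  by apply/funext => y; rewrite inE; case: eqP => // /eqP/h.
by move: h1 h2; rewrite e big_seq1.
Qed.

Lemma csum_split f (s : seq T) : csm f -> uniq s ->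
  csm (fun x => if x \in s then 0 else f x) /\
  csum f = \sum_(x <- s) f x + csum (fun x => if x \in s then 0 else f x).
Proof.
move=> hf us; have [h1 <-] := csum_fin f us.
have h2 : csm (fun x => if x \in s then 0 else f x).
  by apply: (csm_le hf) => x; case: ifP; rewrite ?nm0 ?nm_ge0.
by split=> //; rewrite -csumD //; apply: eq_csum => x; case: ifP; rewrite ?addr0 ?add0r.
Qed.

End OneIndex.

Lemma csum_reindex (T U : eqType) (h : U -> T) (f : T -> C) :
  injective h -> (forall x, f x != 0 -> exists u, h u = x) -> csm f ->
  csm (f \o h) /\ csum (f \o h) = csum f.
Proof.
move=> hi hs hf; split.
  have hn x : nm (f x) != 0 -> exists u, h u = x.
    by move=> h0; apply: hs; apply: contra_neq h0 => ->; rewrite nm0.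
  by have [] := nsum_reindex hi hn hf.
rewrite /csum.
rewrite -(rsum_reindex hi (f := fun x => complex.Re (f x))) //; last exact: csm_Re.
  rewrite -(rsum_reindex hi (f := fun x => complex.Im (f x))) //; last exact: csm_Im.
  by move=> x h0; apply: hs; apply: contra_neq h0 => ->.
by move=> x h0; apply: hs; apply: contra_neq h0 => ->.
Qed.

Lemma csum_pair (T U : eqType) (f : T -> U -> C) :
  csm (fun p : T * U => f p.1 p.2) ->
  [/\ forall x, csm (f x), csm (fun x => csum (f x)) &
  csum (fun p : T * U => f p.1 p.2) = csum (fun x => csum (f x))].
Proof.
move=> hf; have [h1 h2] := nsm_pairI (f := fun x y => nm (f x y)) hf.
split; first exact: h1.
  by apply: (csm_le h2) => x; apply: nm_csum; apply: h1.
rewrite /csum (rsum_pair (f := fun x y => complex.Re (f x y))); last exact: csm_Re hf.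
by rewrite (rsum_pair (f := fun x y => complex.Im (f x y))); last exact: csm_Im hf.
Qed.

Lemma csum_swap (T U : eqType) (f : T -> U -> C) :
  csm (fun p : T * U => f p.1 p.2) ->
  csm (fun p : U * T => f p.2 p.1) /\
  csum (fun x => csum (f x)) = csum (fun y => csum (f^~ y)).
Proof.
move=> hf.
have hi : injective (fun p : U * T => (p.2, p.1)).
  by move=> [? ?] [? ?] [-> ->].
have [|h1 h2] := @csum_reindex _ _ (fun p : U * T => (p.2, p.1)) _ hi _ hf.
  by move=> [x y] _; exists (y, x).
split=> //.
have [_ _ <-] := csum_pair hf.
by have [_ _ <-] := csum_pair (f := fun y x => f x y) h1.
Qed.

Lemma csm_pair (T U : eqType) (f : T -> U -> C) (g : T -> U -> R) :
  (forall x, nsm (g x)) -> nsm (fun x => nsum (g x)) ->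
  (forall x y, nm (f x y) <= g x y) -> csm (fun p : T * U => f p.1 p.2).
Proof.
by move=> h1 h2 h; have [h3 _] := nsm_pair h1 h2; apply: (csm_le h3) => p.
Qed.

End ComplexSums.

Arguments csum : simpl never.
Arguments complex.conjc : simpl never.

(** * Sequences on the frequency lattice *)

Section LatticeSums.
Variable R : realType.

(** A finite set of vectors lies in a cube over the list [t] of all their entries; distributing the
    product over that cube gives the [d]-th power of a partial sum of [g]. *)
Lemma nsm_prod (T : choiceType) (d : nat) (g : T -> R) : nsm g ->
  nsm (fun k : 'rV[T]_d => \prod_j g (k 0 j)).
Proof.
move=> hg; have g0 x : 0 <= g x by case: hg.
split=> [k|]; first exact: prodr_ge0.
exists (nsum g ^+ d) => s us.
pose t := undup (flatten [seq [seq k 0 j | j : 'I_d] | k : 'rV[T]_d <- s]).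
have mt (k : 'rV[T]_d) j : k \in s -> k 0 j \in t.
  move=> ks; rewrite mem_undup; apply/flattenP.
  by exists [seq k 0 j | j : 'I_d]; apply/mapP; [exists k | exists j; rewrite ?mem_enum].
pose F (f : {ffun 'I_d -> seq_sub t}) : 'rV[T]_d := \row_j ssval (f j).
have Finj : injective F.
  move=> f1 f2 /rowP e; apply/ffunP => j; apply: val_inj.
  by have := e j; rewrite !mxE.
apply: (@le_trans _ _ (\sum_(k <- [seq F f | f : {ffun 'I_d -> seq_sub t}])
   \prod_j g (k 0 j))).
  apply: sub_sum_le => // [k|k ks]; first exact: prodr_ge0.
  apply/mapP; exists [ffun j => SeqSub (mt k j ks)]; rewrite ?mem_enum //.
  by apply/rowP => j; rewrite !mxE ffunE.
rewrite big_map big_enum /=.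
under eq_bigr => f _ do under eq_bigr => j _ do rewrite mxE.
rewrite -(bigA_distr_bigA (fun j (x : seq_sub t) => g (ssval x))) /=.
rewrite prodr_const card_ord lerXn2r ?nnegrE ?nsum_ge0 ?sumr_ge0 //.
have -> : \sum_(x : seq_sub t) g (ssval x) = \sum_(x <- map val (enum {: seq_sub t})) g x.
  by rewrite big_map big_enum.
apply: nsum_ub => //; rewrite map_inj_uniq ?enum_uniq //; exact: val_inj.
Qed.

Lemma nsm_int (u : nat -> R) : nsm u -> nsm (fun n : int => u `|n|%N).
Proof.
move=> hu; have u0 x : 0 <= u x by case: hu.
split=> //; exists (nsum u + nsum u) => s us.
rewrite (bigID (fun n : int => 0 <= n)) /=.
have b (P : pred int) : {in P &, injective absz} ->
    \sum_(i <- s | P i) u `|i|%N <= nsum u.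
  move=> inj; rewrite -big_filter -(big_map absz xpredT u).
  apply: nsum_ub => //; rewrite map_inj_in_uniq ?filter_uniq // => x y.
  by rewrite !mem_filter => /andP[xP _] /andP[yP _]; apply: inj.
by apply: lerD; apply: b => x y; rewrite /in_mem /=; lia.
Qed.

Lemma nsm_nat (u : nat -> R) M : (forall n, 0 <= u n) ->
  (forall n, \sum_(i < n) u i <= M) -> nsm u.
Proof.
move=> u0 h; split=> //; exists M => s us.
apply: le_trans (h (\max_(i <- s) i).+1).
rewrite -(big_mkord xpredT u); apply: sub_sum_le => // i si.
by rewrite mem_index_iota /= ltnS (@leq_bigmax_seq _ s xpredT id i).
Qed.

Lemma nsm_invsq : nsm (fun n : nat => (n.+1%:R ^+ 2)^-1 : R).
Proof.
apply: (@nsm_nat _ 2) => [n|n]; first by rewrite invr_ge0 sqr_ge0.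
(* The induction needs this sharper bound; it works because [1 / a^2 <= 2 / a - 2 / (a + 1)] for
   [a >= 1]. *)
suff : \sum_(i < n) (i.+1%:R ^+ 2)^-1 <= 2 - 2 / n.+1%:R :> R.
  move/le_trans; apply; rewrite lerBlDr lerDl divr_ge0 //.
elim: n => [|n IH]; first by rewrite big_ord0 divr1 subrr.
rewrite big_ord_recr /=; apply: le_trans (lerD IH (lexx _)) _.
have a0 : (0 : R) < n.+1%:R by rewrite ltr0n.
have -> : n.+2%:R = n.+1%:R + 1 :> R by rewrite -natr1.
have a1 : 1 <= n.+1%:R :> R by rewrite ler1n.
move: (n.+1%:R : R) a0 a1 => a a0 a1.
rewrite -subr_ge0.
have -> : 2 - 2 / (a + 1) - (2 - 2 / a + (a ^+ 2)^-1) = (a - 1) / (a ^+ 2 * (a + 1)).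
  by field; apply/andP; split; apply: lt0r_neq0 => //; lra.
by apply: divr_ge0; [lra | apply: mulr_ge0; [exact: sqr_ge0 | lra]].
Qed.

Lemma nsm_geom (w : R) : 0 <= w < 1 -> nsm (fun n : nat => w ^+ n).
Proof.
move=> /andP[w0 w1]; apply: (@nsm_nat _ (1 - w)^-1) => [n|n].
  exact: exprn_ge0.
have h : 0 < 1 - w by rewrite subr_gt0.
rewrite -(ler_pM2l h) mulfV ?gt_eqF //.
have -> : (1 - w) * \sum_(i < n) w ^+ i = 1 - w ^+ n.
  elim: n => [|n IH]; first by rewrite big_ord0 mulr0 expr0 subrr.
  by rewrite big_ord_recr /= mulrDr IH exprS; ring.
by rewrite lerBlDr lerDl exprn_ge0.
Qed.

(** Summing [2 t x <= x^2 + t^2] against [a] gives [key], which is used at the optimal [t = S / A];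
    if [A = 0] every term vanishes. *)
Lemma weighted_cauchy (T : eqType) (a x : T -> R) : nsm a -> (forall l, 0 <= x l) ->
  nsm (fun l => a l * x l ^+ 2) ->
  nsm (fun l => a l * x l) /\
  nsum (fun l => a l * x l) ^+ 2 <= nsum a * nsum (fun l => a l * x l ^+ 2).
Proof.
move=> ha x0 hq; have a0 l : 0 <= a l by case: ha.
have sm : nsm (fun l => a l * x l).
  apply: (nsm_le (nsmD ha hq)) => l; rewrite mulr_ge0 //=.
  rewrite -{2}[a l]mulr1 -mulrDr ler_wpM2l //.
  by have := x0 l; set y := x l => y0; nra.
split=> //; set S := nsum _; set A := nsum a; set Q := nsum (fun l => _ * _ ^+ 2).
have key t : 0 <= t -> 2 * t * S <= Q + t ^+ 2 * A.
  move=> t0; rewrite -nsumZ ?mulr_ge0 // -nsumZ ?sqr_ge0 // -nsumD //; last first.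
    by apply: nsmZ; rewrite ?sqr_ge0.
  apply: le_nsum => [|l].
    by apply: nsmD => //; apply: nsmZ; rewrite ?sqr_ge0.
  have -> : 2 * t * (a l * x l) = a l * (2 * t * x l) by ring.
  rewrite [t ^+ 2 * a l]mulrC -mulrDr ler_wpM2l //.
  by have := sqr_ge0 (x l - t); set y := x l; nra.
have S0 : 0 <= S by apply: nsum_ge0.
have Q0 : 0 <= Q by apply: nsum_ge0.
have A0 : 0 <= A by apply: nsum_ge0.
move: A0; rewrite le_eqVlt => /orP[/eqP A0|A0]; last first.
  have := key (S / A) (divr_ge0 S0 (ltW A0)).
  have -> : 2 * (S / A) * S = 2 * (S ^+ 2 / A) by ring.
  have -> : (S / A) ^+ 2 * A = S ^+ 2 / A by field; rewrite gt_eqF.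
  by rewrite mulr_natl mulr2n lerD2r ler_pdivrMr // mulrC.
have a00 l : a l = 0.
  by apply/le_anti; rewrite a0 andbT A0 nsum_ge.
have -> : S = 0.
  by rewrite /S (eq_nsum (g := fun=> 0)) ?nsum0 // => l; rewrite a00 mul0r.
by rewrite expr0n /= mulr_ge0 // -A0.
Qed.

End LatticeSums.

Section Lattice.
Variables (R : realType) (d : nat).
Local Notation Z := 'rV[int]_d.
Implicit Types k l : Z.

Definition absn k : nat := (\sum_j `|k 0%R j|)%N.
(* Decay is measured with the product weight pr, whose inverse square is summable
   by Fubini; Sobolev norms use br, the weight with good commutators. *)
Definition br k : R := (absn k).+1%:R.
Definition pr k : R := \prod_j `|k 0%R j|%N.+1%:R.

Lemma absnD k l : (absn (k + l) <= absn k + absn l)%N.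
Proof.
rewrite /absn -big_split /=; apply: leq_sum => j _; rewrite mxE.
move: (k 0 j) (l 0 j) => a b; lia.
Qed.

Lemma absnN k : absn (- k) = absn k.
Proof. by apply: eq_bigr => j _; rewrite mxE abszN. Qed.

Lemma absn_ge k j : (`|k 0%R j| <= absn k)%N.
Proof. by rewrite /absn (bigD1 j) //= leq_addr. Qed.

Lemma br_ge1 k : 1 <= br k.
Proof. by rewrite ler1n. Qed.

Lemma br_gt0 k : 0 < br k.
Proof. by rewrite ltr0n. Qed.

Lemma brD k l : br (k + l) <= br k * br l.
Proof. by rewrite /br -natrM ler_nat; have := absnD k l; nia. Qed.

Lemma brN k : br (- k) = br k.
Proof. by rewrite /br absnN. Qed.

Lemma pr_ge1 k : 1 <= pr k.
Proof. by rewrite /pr; elim/big_ind: _ => // [x y|j _]; [exact: mulr_ege1 | rewrite ler1n]. Qed.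

Lemma pr_gt0 k : 0 < pr k.
Proof. exact: lt_le_trans ltr01 (pr_ge1 k). Qed.

Lemma prD k l : pr (k + l) <= pr k * pr l.
Proof.
rewrite /pr -big_split; apply: ler_prod => j _; rewrite ler0n /=.
by rewrite -natrM ler_nat mxE; move: (k 0 j) (l 0 j) => a b; nia.
Qed.

Lemma prN k : pr (- k) = pr k.
Proof. by apply: eq_bigr => j _; rewrite mxE abszN. Qed.

Lemma br_le_pr k : br k <= pr k.
Proof.
rewrite /br /pr /absn -natr_prod ler_nat.
elim/big_ind2: _ => // [x1 x2 y1 y2]; nia.
Qed.

Lemma pr_le_br k : pr k <= br k ^+ d.
Proof.
rewrite /pr -[X in _ ^+ X](card_ord d) -prodr_const.
by apply: ler_prod => j _; rewrite ler0n /= ler_nat ltnS absn_ge.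
Qed.

Lemma nsm_pr2 : nsm (fun k => (pr k ^+ 2)^-1).
Proof.
have := nsm_prod d (nsm_int (nsm_invsq R)); congr nsm; apply/funext => k.
by rewrite -prodrXl -prodfV.
Qed.

Lemma nsm_geomZ (w : R) : 0 <= w < 1 -> nsm (fun k => w ^+ absn k).
Proof.
move=> hw; have := nsm_prod d (nsm_int (nsm_geom hw)); congr nsm; apply/funext => k.
by rewrite /absn; elim/big_ind2: _ => // x1 x2 y1 y2 -> ->; rewrite exprD.
Qed.

End Lattice.

(** * Growth classes of sequences, convolution and Young's inequality *)

Section Convolution.
Variables (R : realType) (d : nat).
Local Notation C := R[i].
Local Notation Z := 'rV[int]_d.
Local Notation pr := (@pr R d).
Implicit Types (k l : Z) (u v h g : Z -> C) (r s : int).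

(** Growth classes of Fourier coefficients: distributions satisfy some [ord r], smooth functions are
    [rapid]. *)
Definition ord r v : Prop := exists c, forall k, nm (v k) <= c * pr k ^ r.
Definition rapid v : Prop := forall r, ord r v.

Lemma prz_gt0 k r : 0 < pr k ^ r.
Proof. exact/exprz_gt0/pr_gt0. Qed.
Hint Resolve prz_gt0 : core.

Lemma prz_ge0 k r : 0 <= pr k ^ r.
Proof. exact: ltW. Qed.
Hint Resolve prz_ge0 : core.

Lemma pr_neq0 k : pr k != 0.
Proof. by rewrite gt_eqF // pr_gt0. Qed.

Lemma prz_mono k r s : r <= s -> pr k ^ r <= pr k ^ s.
Proof. by move=> rs; apply: ler_weXz2l => //; apply: pr_ge1. Qed.

(** Peetre's inequality, for exponents of either sign: [pr k] and [pr l] differ by a factor of at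
    most [pr (k - l)] in both directions. *)
Lemma prz_shift k l r : pr l ^ r <= pr k ^ r * pr (k - l) ^+ `|r|%N.
Proof.
have h1 : pr l <= pr k * pr (k - l).
  by rewrite -[pr (k - l)]prN opprB; apply: le_trans (prD R _ _); rewrite addrC subrK.
have h2 : pr k <= pr l * pr (k - l).
  by apply: le_trans (prD R _ _); rewrite addrC subrK.
case: r => n.
  rewrite -!exprnP absz_nat -exprMn.
  by rewrite lerXn2r // nnegrE ?mulr_ge0 // ltW // pr_gt0.
rewrite NegzE abszN absz_nat -!exprnN.
rewrite -(@ler_pM2l _ (pr k ^+ n.+1 * pr l ^+ n.+1)); last first.
  by rewrite mulr_gt0 // exprn_gt0 // pr_gt0.
rewrite mulfK ?expf_neq0 ?pr_neq0 // mulrA [X in _ <= X * _]mulrAC.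
rewrite mulfV ?expf_neq0 ?pr_neq0 // mul1r -exprMn.
by rewrite lerXn2r // nnegrE ?mulr_ge0 // ltW // pr_gt0.
Qed.

Lemma ordP r v : ord r v -> exists2 c, 0 <= c & forall k, nm (v k) <= c * pr k ^ r.
Proof.
move=> [c hc]; exists `|c|; first exact: normr_ge0.
by move=> k; apply: le_trans (hc k) _; rewrite ler_wpM2r // ler_norm.
Qed.

Lemma ord_mono r s v : r <= s -> ord r v -> ord s v.
Proof.
move=> rs /ordP[c c0 hc]; exists c => k; apply: le_trans (hc k) _.
by rewrite ler_wpM2l // prz_mono.
Qed.

Lemma ordD r u v : ord r u -> ord r v -> ord r (fun k => u k + v k).
Proof.
move=> [c hc] [e he]; exists (c + e) => k.
by apply: le_trans (ler_nmD _ _) _; rewrite mulrDl lerD.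
Qed.

Lemma ord_mulf r s v (m : Z -> C) e : (forall k, nm (m k) <= e * pr k ^ s) ->
  ord r v -> ord (s + r) (fun k => m k * v k).
Proof.
move=> hm /ordP[c c0 hc]; exists (e * c) => k; rewrite nmM expfzDr ?pr_neq0 //.
rewrite mulrACA; apply: ler_pM; rewrite ?nm_ge0 //.
Qed.

Lemma ordZ r (a : C) v : ord r v -> ord r (fun k => a * v k).
Proof.
move=> h; rewrite -[r]add0r; apply: (@ord_mulf _ _ _ _ (nm a)) => // k.
by rewrite expr0z mulr1.
Qed.

Lemma ordN r v : ord r v -> ord r (fun k => - v k).
Proof. by move=> [c hc]; exists c => k; rewrite nmN. Qed.

Lemma ordB r u v : ord r u -> ord r v -> ord r (fun k => u k - v k).
Proof. by move=> hu hv; apply: ordD => //; apply: ordN. Qed.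

Lemma ord_zero r : ord r (fun=> 0).
Proof. by exists 0 => k; rewrite nm0 mul0r. Qed.

Lemma ord_sum r (I : Type) (t : seq I) (P : pred I) (F : I -> Z -> C) :
  (forall i, P i -> ord r (F i)) -> ord r (fun k => \sum_(i <- t | P i) F i k).
Proof.
move=> h; elim: t => [|i t IH].
  by exists 0 => k; rewrite big_nil nm0 mul0r.
have -> : (fun k => \sum_(i <- i :: t | P i) F i k) =
  (fun k => if P i then F i k + \sum_(i <- t | P i) F i k
            else \sum_(i <- t | P i) F i k).
  by apply/funext => k; rewrite big_cons.
case: (P i) (h i) => // hi; exact: ordD (hi isT) IH.
Qed.

Lemma rapidD u v : rapid u -> rapid v -> rapid (fun k => u k + v k).
Proof. by move=> hu hv r; apply: ordD. Qed.
Lemma rapidB u v : rapid u -> rapid v -> rapid (fun k => u k - v k).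
Proof. by move=> hu hv r; apply: ordB. Qed.
Lemma rapidZ a v : rapid v -> rapid (fun k => a * v k).
Proof. by move=> hv r; apply: ordZ. Qed.
Lemma rapid0 : rapid (fun=> 0).
Proof. by move=> r; apply: ord_zero. Qed.
Lemma rapid_sum (I : Type) (t : seq I) (P : pred I) (F : I -> Z -> C) :
  (forall i, P i -> rapid (F i)) -> rapid (fun k => \sum_(i <- t | P i) F i k).
Proof. by move=> h r; apply: ord_sum => i Pi; apply: h. Qed.

Lemma nsm_ord2 v : ord (-2) v -> nsm (fun k => nm (v k)).
Proof.
move=> /ordP[c c0 hc]; apply: (nsm_le (nsmZ c0 (nsm_pr2 R d))) => k.
by rewrite nm_ge0 /= (le_trans (hc k)).
Qed.

Lemma nsm_ord1 v : ord (-1) v -> nsm (fun k => nm (v k) ^+ 2).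
Proof.
move=> /ordP[c c0 hc]; apply: (nsm_le (nsmZ (sqr_ge0 c) (nsm_pr2 R d))) => k.
rewrite sqr_ge0 /= -exprVn -exprMn lerXn2r ?nnegrE ?nm_ge0 //.
by rewrite mulr_ge0 // invr_ge0 ltW // pr_gt0.
Qed.

Lemma rapid_nsm h n : rapid h -> nsm (fun k => nm (h k) * pr k ^+ n).
Proof.
move=> hh; have := hh (- (n%:Z) - 2)%R => /ordP[c c0 hc].
apply: (nsm_le (nsmZ c0 (nsm_pr2 R d))) => k.
rewrite mulr_ge0 ?nm_ge0 ?exprn_ge0 ?(ltW (pr_gt0 _ _)) //=.
apply: le_trans (ler_wpM2r _ (hc k)) _; first by rewrite exprn_ge0 // ltW // pr_gt0.
by rewrite -mulrA exprnP -expfzDr ?pr_neq0 // addrAC addNr add0r.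
Qed.

Lemma nsm_shift (a : Z -> R) k : nsm a ->
  nsm (fun l => a (k - l)) /\ nsum (fun l => a (k - l)) = nsum a.
Proof.
move=> ha; apply: (@nsum_reindex _ _ _ (fun l => k - l) a) => //.
  by move=> x y /addrI /oppr_inj.
by move=> x _; exists (k - x); rewrite opprB addrC subrK.
Qed.

Lemma nsm_shiftl (a : Z -> R) k : nsm a ->
  nsm (fun l => a (l - k)) /\ nsum (fun l => a (l - k)) = nsum a.
Proof.
move=> ha; apply: (@nsum_reindex _ _ _ (fun l => l - k) a) => //.
  by move=> x y /(congr1 (fun z => z + k)); rewrite !subrK.
by move=> x _; exists (x + k); rewrite addrK.
Qed.

Lemma nsum_conv (a y : Z -> R) : nsm a -> nsm y ->
  [/\ forall k, nsm (fun l => a (k - l) * y l),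
      nsm (fun k => nsum (fun l => a (k - l) * y l)) &
      nsum (fun k => nsum (fun l => a (k - l) * y l)) = nsum a * nsum y].
Proof.
move=> ha hy; have y0 l : 0 <= y l by case: hy.
have h1 l : nsm (fun k => y l * a (k - l)) by apply: nsmZ => //; case: (nsm_shiftl l ha).
have h1s l : nsum (fun k => y l * a (k - l)) = y l * nsum a.
  by have [hs <-] := nsm_shiftl l ha; apply: nsumZ.
have h2 : nsm (fun l => nsum (fun k => y l * a (k - l))).
  rewrite (_ : (fun l => _) = (fun l => nsum a * y l)).
    by apply: nsmZ => //; apply: nsum_ge0.
  by apply/funext => l; rewrite h1s mulrC.
have [h3 h4] := nsm_pair h1 h2; have [h5 h6] := nsm_swap h3.
have [h7 h8] := nsm_pairI (f := fun k l => y l * a (k - l)) h5.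
have [_ h9] := nsm_pair h7 h8.
have e k : (fun l => a (k - l) * y l) = (fun l => y l * a (k - l)).
  by apply/funext => l; rewrite mulrC.
split=> [k||]; rewrite ?e //.
  by rewrite (_ : (fun k => _) = (fun k => nsum (fun l => y l * a (k - l)))) //;
    apply/funext => k; rewrite e.
rewrite (_ : (fun k => _) = (fun k => nsum (fun l => y l * a (k - l)))); last first.
  by apply/funext => k; rewrite e.
rewrite -h9 h6 h4 -nsumZ ?nsum_ge0 //.
by apply: eq_nsum => l; rewrite h1s mulrC.
Qed.

Definition N2 v : R := nsum (fun k => nm (v k) ^+ 2).
Definition sq v : Prop := nsm (fun k => nm (v k) ^+ 2).

Lemma N2_ge0 v : sq v -> 0 <= N2 v.
Proof. exact: nsum_ge0. Qed.

(** Young's inequality for an l^1 kernel acting on l^2: Cauchy-Schwarz in [l] with the weight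
    [a (k - l)], then [nsum_conv]. *)
Lemma young (a : Z -> R) v u : nsm a -> sq v ->
  (forall k, nm (u k) <= nsum (fun l => a (k - l) * nm (v l))) ->
  sq u /\ N2 u <= nsum a ^+ 2 * N2 v.
Proof.
move=> ha hv hu; have [h1 h2 h3] := nsum_conv ha hv.
have b k : 0 <= nm (u k) ^+ 2 <=
    nsum a * nsum (fun l => a (k - l) * nm (v l) ^+ 2).
  rewrite sqr_ge0 /=; have [hs <-] := nsm_shift k ha.
  have [hw] := weighted_cauchy hs (fun l => nm_ge0 (v l)) (h1 k).
  apply: le_trans; rewrite lerXn2r ?nnegrE ?nm_ge0 ?nsum_ge0 //.
have h4 := nsmZ (nsum_ge0 ha) h2.
split; first exact: (nsm_le h4).
rewrite expr2 -mulrA -h3 -nsumZ ?nsum_ge0 //.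
by apply: le_nsum => // k; case/andP: (b k).
Qed.

(** On Fourier coefficients, multiplication by the function whose coefficients are [h]. *)
Definition cv h v : Z -> C := fun k => csum (fun l => h (k - l) * v l).

Lemma cv_bound h v r c : rapid h -> 0 <= c -> (forall l, nm (v l) <= c * pr l ^ r) ->
  forall k, nsm (fun l => c * pr k ^ r * (nm (h (k - l)) * pr (k - l) ^+ `|r|%N)) /\
   forall l, nm (h (k - l) * v l) <= c * pr k ^ r * (nm (h (k - l)) * pr (k - l) ^+ `|r|%N).
Proof.
move=> hh c0 hc k; split.
  apply: nsmZ; first by rewrite mulr_ge0.
  by have [] := nsm_shift k (rapid_nsm `|r|%N hh).
move=> l; rewrite nmM mulrC.
apply: le_trans (ler_wpM2r (nm_ge0 _) (hc l)) _.
rewrite [leRHS]mulrCA [leRHS]mulrC ler_wpM2r ?nm_ge0 // -mulrA ler_wpM2l //.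
exact: prz_shift.
Qed.

Lemma cv_sm h v r k : rapid h -> ord r v -> csm (fun l => h (k - l) * v l).
Proof.
move=> hh /ordP[c c0 hc]; have [h1 h2] := cv_bound hh c0 hc k.
exact: csm_le h1 h2.
Qed.

Lemma ord_cv h v r : rapid h -> ord r v -> ord r (cv h v).
Proof.
move=> hh /ordP[c c0 hc].
exists (c * nsum (fun k => nm (h k) * pr k ^+ `|r|%N)) => k.
have [h1 h2] := cv_bound hh c0 hc k; apply: le_trans (nm_csum_le h1 h2) _.
have [hs1 hs2] := nsm_shift k (rapid_nsm `|r|%N hh).
by rewrite nsumZ ?mulr_ge0 // hs2 mulrAC.
Qed.

Lemma rapid_cv h v : rapid h -> rapid v -> rapid (cv h v).
Proof. by move=> hh hv r; apply: ord_cv. Qed.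

Lemma cvDr h u v r : rapid h -> ord r u -> ord r v ->
  cv h (fun k => u k + v k) = (fun k => cv h u k + cv h v k).
Proof.
move=> hh hu hv; apply/funext => k; rewrite /cv -csumD.
- by apply: eq_csum => l; rewrite mulrDr.
- exact: cv_sm hu.
- exact: cv_sm hv.
Qed.

Lemma cvZr h a v r : rapid h -> ord r v ->
  cv h (fun k => a * v k) = (fun k => a * cv h v k).
Proof.
move=> hh hv; apply/funext => k; rewrite /cv -csumZ.
  by apply: eq_csum => l; rewrite mulrCA.
exact: cv_sm hv.
Qed.

Lemma cvDl h g v r : rapid h -> rapid g -> ord r v ->
  cv (fun k => h k + g k) v = (fun k => cv h v k + cv g v k).
Proof.
move=> hh hg hv; apply/funext => k; rewrite /cv -csumD.
- by apply: eq_csum => l; rewrite mulrDl.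
- exact: cv_sm hv.
- exact: cv_sm hv.
Qed.

Lemma cvZl a h v r : rapid h -> ord r v ->
  cv (fun k => a * h k) v = (fun k => a * cv h v k).
Proof.
move=> hh hv; apply/funext => k; rewrite /cv -csumZ.
  by apply: eq_csum => l; rewrite mulrA.
exact: cv_sm hv.
Qed.

Lemma cv_suml (I : Type) (t : seq I) (P : pred I) (F : I -> Z -> C) v r :
  (forall i, P i -> rapid (F i)) -> ord r v ->
  cv (fun k => \sum_(i <- t | P i) F i k) v =
  (fun k => \sum_(i <- t | P i) cv (F i) v k).
Proof.
move=> hF hv; apply/funext => k; rewrite /cv.
have [_ <-] := @csm_sum R Z I t P (fun i l => F i (k - l) * v l) (fun i Pi => cv_sm k (hF i Pi) hv).
by apply: eq_csum => l; rewrite mulr_suml.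
Qed.

Lemma cv_sumr (I : Type) (t : seq I) (P : pred I) h (F : I -> Z -> C) r :
  rapid h -> (forall i, P i -> ord r (F i)) ->
  cv h (fun k => \sum_(i <- t | P i) F i k) =
  (fun k => \sum_(i <- t | P i) cv h (F i) k).
Proof.
move=> hh hF; apply/funext => k; rewrite /cv.
have [_ <-] := @csm_sum R Z I t P (fun i l => h (k - l) * F i l) (fun i Pi => cv_sm k hh (hF i Pi)).
by apply: eq_csum => l; rewrite mulr_sumr.
Qed.

Lemma cvC h g : rapid h -> rapid g -> cv h g = cv g h.
Proof.
move=> hh hg; apply/funext => k; rewrite /cv.
have i : injective (fun l : Z => k - l).
  by move=> x y /addrI /oppr_inj.
have [|_ <-] := csum_reindex i _ (cv_sm k hh (hg 0)).
  by move=> x _; exists (k - x); rewrite opprB addrC subrK.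
by apply: eq_csum => l /=; rewrite opprB addrC subrK mulrC.
Qed.

(** Fubini needs absolute convergence of the double sum. Peetre's inequality moves the growth of [v]
    from [p] to [l] and then from [l] to [k], at the price of powers of [pr] that [g] and [h]
    absorb. *)
Lemma cvA h g v r : rapid h -> rapid g -> ord r v ->
  cv h (cv g v) = cv (cv h g) v.
Proof.
move=> hh hg /ordP[c c0 hc]; apply/funext => k; rewrite /cv.
have hv : ord r v by exists c.
transitivity (csum (fun l => csum (fun p => h (k - l) * (g (l - p) * v p)))).
  by apply: eq_csum => l; rewrite -csumZ //; apply: cv_sm hv.
have sm : csm (fun q : Z * Z => h (k - q.1) * (g (q.1 - q.2) * v q.2)).
  pose b l p := c * pr k ^ r * (nm (h (k - l)) * pr (k - l) ^+ `|r|%N) *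
                (nm (g (l - p)) * pr (l - p) ^+ `|r|%N).
  have h1 l : nsm (b l).
    apply: nsmZ; last by have [] := nsm_shift l (rapid_nsm `|r|%N hg).
    by rewrite !mulr_ge0 ?nm_ge0 ?exprn_ge0 // ltW // pr_gt0.
  apply: (@csm_pair _ _ _ (fun l p => h (k - l) * (g (l - p) * v p)) b) => //.
    rewrite (_ : (fun l => _) = (fun l => nsum (fun k => nm (g k) * pr k ^+ `|r|%N) *
      (c * pr k ^ r * (nm (h (k - l)) * pr (k - l) ^+ `|r|%N)))); last first.
      apply/funext => l; have [hs1 hs2] := nsm_shift l (rapid_nsm `|r|%N hg).
      rewrite /b nsumZ ?hs2 1?mulrC //.
      by rewrite !mulr_ge0 ?nm_ge0 ?exprn_ge0 // ltW // pr_gt0.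
    apply: nsmZ; first by apply: nsum_ge0; apply: rapid_nsm.
    apply: nsmZ; first by rewrite mulr_ge0.
    by have [] := nsm_shift k (rapid_nsm `|r|%N hh).
  move=> l p; rewrite nmM; have [_ /(_ p)] := cv_bound hg c0 hc l.
  move=> /(ler_wpM2l (nm_ge0 (h (k - l)))) => hb; apply: le_trans hb _.
  rewrite /b mulrA ler_wpM2r //; first by rewrite mulr_ge0 ?nm_ge0 ?exprn_ge0 // ltW // pr_gt0.
  rewrite mulrCA -!mulrA ler_wpM2l // mulrCA ler_wpM2l ?nm_ge0 //.
  exact: prz_shift.
have [_ ->] := csum_swap (f := fun l p => h (k - l) * (g (l - p) * v p)) sm.
apply: eq_csum => p.
transitivity (csum (fun l => h (k - l) * g (l - p)) * v p).
  rewrite -csumZr; first by apply: eq_csum => l; rewrite mulrA.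
  have := @cv_sm h (fun l => g (l - p)) 0 k hh; apply.
  have [e he] := hg 0; exists e => l; have := he (l - p); by rewrite !expr0z.
congr (_ * _).
have i : injective (fun q : Z => q + p) by move=> x y /addIr.
have sm1 : csm (fun l => h (k - l) * g (l - p)).
  have := @cv_sm h (fun l => g (l - p)) 0 k hh; apply.
  have [e he] := hg 0; exists e => l; have := he (l - p); by rewrite !expr0z.
have [|_ <-] := csum_reindex i _ sm1.
  by move=> x _; exists (x - p); rewrite subrK.
by apply: eq_csum => q /=; rewrite addrK opprD addrAC addrA.
Qed.

(** The symbol of [D j]: the factor [1 / sqrt(-1)] in [D] makes it real, hence [Dm] is symmetric
    ([ip_Dm]). *)
Definition Dm (j : 'I_d) v : Z -> C := fun k => (k 0 j)%:~R * v k.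

Lemma nm_int (n : int) : nm (n%:~R : C) = `|n|%N%:R.
Proof.
by rewrite -[n%:~R](rmorph_int (real_complex R)) nm_real natr_absz intr_norm.
Qed.

Lemma entry_le_pr k j : (`|k 0%R j|%N%:R : R) <= pr k.
Proof.
apply: le_trans (br_le_pr R k); rewrite /br ler_nat ltnW // ltnS.
exact: absn_ge.
Qed.

Lemma ord_Dm j v r : ord r v -> ord (r + 1) (Dm j v).
Proof.
move=> h; rewrite addrC; apply: (@ord_mulf _ 1 _ _ 1) => // k.
by rewrite nm_int mul1r expr1z entry_le_pr.
Qed.

Lemma rapid_Dm j v : rapid v -> rapid (Dm j v).
Proof. by move=> h r; rewrite -(subrK 1 r); apply: ord_Dm. Qed.

Lemma Dm_cv j h v r : rapid h -> ord r v ->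
  Dm j (cv h v) = (fun k => cv (Dm j h) v k + cv h (Dm j v) k).
Proof.
move=> hh hv; apply/funext => k; rewrite /Dm /cv.
have h1 : csm (fun l => Dm j h (k - l) * v l) by apply: cv_sm hv; apply: rapid_Dm.
have h2 : csm (fun l => h (k - l) * Dm j v l) by apply: cv_sm (ord_Dm j hv).
rewrite -csumZ; last exact: cv_sm hv.
rewrite -(csumD h1 h2); apply: eq_csum => l.
rewrite /Dm !mxE rmorphB /=; ring.
Qed.

Lemma DmD j u v : Dm j (fun k => u k + v k) = (fun k => Dm j u k + Dm j v k).
Proof. by apply/funext => k; rewrite /Dm mulrDr. Qed.

Lemma DmC i j v : Dm i (Dm j v) = Dm j (Dm i v).
Proof. by apply/funext => k; rewrite /Dm mulrCA. Qed.

Definition ip u v : C := csum (fun k => u k * (conjc (v k))).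
(** Coefficients of the complex conjugate function. *)
Definition cbar h : Z -> C := fun k => (conjc (h (- k))).

Lemma ordJ r v : ord r v -> ord r (fun k => (conjc (v k))).
Proof. by move=> [c hc]; exists c => k; rewrite nmJ. Qed.

Lemma rapid_cbar h : rapid h -> rapid (cbar h).
Proof. by move=> hh r; have [c hc] := hh r; exists c => k; rewrite nmJ -[pr k]prN. Qed.

Lemma cbarK h : cbar (cbar h) = h.
Proof. by apply/funext => k; rewrite /cbar opprK conjcK. Qed.

Lemma ip_sm u v r s : ord r u -> ord s v -> r + s <= -2 -> csm (fun k => u k * (conjc (v k))).
Proof.
move=> /ordP[c c0 hu] hv rs; apply: nsm_ord2; apply: ord_mono rs _.
by apply: ord_mulf hu _; apply: ordJ.
Qed.

Lemma ip_cv h u v r s : rapid h -> ord r u -> ord s v -> r + s <= -2 ->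
  ip (cv h u) v = ip u (cv (cbar h) v).
Proof.
move=> hh /ordP[c c0 hu] /ordP[e e0 hv] rs.
have ou : ord r u by exists c.
have ov : ord s v by exists e.
transitivity (csum (fun k => csum (fun l => h (k - l) * u l * (conjc (v k))))).
  by apply: eq_csum => k; rewrite -csumZr //; apply: cv_sm ou.
have sm : csm (fun q : Z * Z => h (q.1 - q.2) * u q.2 * (conjc (v q.1))).
  pose a := nsum (fun k => nm (h k) * pr k ^+ `|r|%N).
  pose b k l := c * e * pr k ^ (r + s) * (nm (h (k - l)) * pr (k - l) ^+ `|r|%N).
  have b0 k : 0 <= c * e * pr k ^ (r + s) by rewrite mulr_ge0 ?mulr_ge0.
  have hk k := nsm_shift k (rapid_nsm `|r|%N hh).
  apply: (@csm_pair _ _ _ (fun k l => h (k - l) * u l * (conjc (v k))) b).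
  - by move=> k; apply: nsmZ => //; case: (hk k).
  - have -> : (fun k => nsum (b k)) = (fun k => (a * (c * e)) * pr k ^ (r + s)).
      apply/funext => k; rewrite /b nsumZ //; last by case: (hk k).
      by have [_ ->] := hk k; rewrite -/a mulrC mulrA.
    apply: nsmZ; first by rewrite !mulr_ge0 // nsum_ge0 //; apply: rapid_nsm.
    apply: (nsm_le (nsm_pr2 R d)) => k; rewrite prz_ge0 /=.
    exact: (prz_mono k rs).
  move=> k l; have [_ /(_ l) h2] := cv_bound hh c0 hu k.
  rewrite nmM nmJ; apply: le_trans (ler_pM (nm_ge0 _) (nm_ge0 _) h2 (hv k)) _.
  by rewrite /b expfzDr ?pr_neq0 // le_eqVlt; apply/orP; left; apply/eqP; ring.
have [_ ->] := csum_swap (f := fun k l => h (k - l) * u l * (conjc (v k))) sm.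
rewrite /ip; apply: eq_csum => l /=; rewrite /cv -csumJ; last by apply: cv_sm ov; apply: rapid_cbar.
rewrite -csumZ; last first.
  by apply: csmJ; apply: cv_sm ov; apply: rapid_cbar.
by apply: eq_csum => k; rewrite rmorphM /= /cbar conjcK opprB mulrAC mulrC mulrA.
Qed.

Lemma ip_Dm j u v : ip (Dm j u) v = ip u (Dm j v).
Proof.
apply: eq_csum => k; rewrite /Dm rmorphM /=.
have -> : conjc ((k 0 j)%:~R : C) = (k 0 j)%:~R by rewrite rmorph_int.
by rewrite mulrAC mulrA [u k * _]mulrC mulrAC.
Qed.

End Convolution.

(** * Fourier series *)

Section Exponentials.
Variable R : realType.
Local Notation C := R[i].
Implicit Types (a b t : R).

Definition cis t : C := cos t +i* sin t.

Lemma cisD a b : cis (a + b) = cis a * cis b.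
Proof. by rewrite /cis cosD sinD; congr (_ +i* _); rewrite addrC. Qed.

Lemma cis0 : cis 0 = 1.
Proof. by rewrite /cis cos0 sin0. Qed.

Lemma nm_cis t : nm (cis t) = 1.
Proof. by rewrite /nm /= cos2Dsin2 sqrtr1. Qed.

Lemma cisN t : cis (- t) = (conjc (cis t)).
Proof. by rewrite /cis cosN sinN. Qed.

Lemma cis2pi : cis (2 * pi) = 1.
Proof. by rewrite /cis mulr_natl cos2pi sin2pi. Qed.

Lemma cis_nat t n : cis (n%:R * t) = cis t ^+ n.
Proof.
elim: n => [|n IH]; first by rewrite mul0r cis0.
by rewrite -natr1 mulrDl mul1r cisD IH exprSr.
Qed.

Lemma cis_int2pi (n : int) : cis (n%:~R * (2 * pi)) = 1.
Proof.
case: n => n; first by rewrite -pmulrn cis_nat cis2pi expr1n.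
by rewrite NegzE mulrNz mulNr cisN -pmulrn cis_nat cis2pi expr1n conjc1.
Qed.

(** With [t = pi * r / q] and [r > 0], [cos (2 t) = 1] would force [sin t = 0], impossible since
    [0 < t < pi]. Negative [r] is reduced to this by conjugation. *)
Lemma cis_root_neq1 (r : int) (q : nat) : r != 0 -> (`|r|%N < q)%N ->
  cis (2 * pi * (r%:~R / q%:R)) != 1.
Proof.
move=> r0 rq; apply/eqP.
wlog rp : r r0 rq / 0 < r => [hw|].
  case: (ltrP 0 r) => [|rle h]; first exact: hw.
  apply: (hw (- r)); rewrite ?oppr_eq0 ?abszN ?oppr_gt0 ?lt_neqAle ?r0 //.
  by rewrite mulrNz mulNr mulrN cisN h conjc1.
have q0 : (0 : R) < q%:R by rewrite ltr0n (leq_trans _ rq).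
set x : R := r%:~R / q%:R.
have x0 : 0 < x by rewrite divr_gt0 // ltr0z.
have x1 : x < 1.
  rewrite ltr_pdivrMr // mul1r pmulrn ltr_int; move: rq rp; lia.
have s0 : 0 < sin (pi * x).
  apply: sin_gt0_pi; rewrite mulr_gt0 ?pi_gt0 //=.
  by rewrite -[ltRHS]mulr1 ltr_pM2l ?pi_gt0.
rewrite /cis => /(congr1 (@complex.Re R)) /=.
have -> : 2 * pi * x = pi * x *+ 2 by rewrite mulr2n; ring.
rewrite cos_mulr2n => h; have := cos2Dsin2 (pi * x); nra.
Qed.

End Exponentials.

(** * Grid averages, Parseval's formula and pointwise comparison *)

Section GridAverages.
Variables (R : realType) (d : nat).
Local Notation C := R[i].
Local Notation Z := 'rV[int]_d.
Implicit Types (k l : Z) (x y : 'rV[R]_d) (c u v h : Z -> C).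

Definition dot k x : R := \sum_j (k 0 j)%:~R * x 0 j.
Definition fmode k x : C := cis (dot k x).

Lemma nm_ex k x : nm (fmode k x) = 1.
Proof. exact: nm_cis. Qed.

Lemma dotDl k l x : dot (k + l) x = dot k x + dot l x.
Proof.
by rewrite -big_split; apply: eq_bigr => j _; rewrite mxE rmorphD /= mulrDl.
Qed.

Lemma dotDr k x y : dot k (x + y) = dot k x + dot k y.
Proof. by rewrite -big_split; apply: eq_bigr => j _; rewrite mxE mulrDr. Qed.

Lemma dotNl k x : dot (- k) x = - dot k x.
Proof.
by rewrite /dot -sumrN; apply: eq_bigr => j _; rewrite mxE rmorphN /= mulNr.
Qed.

Lemma exD k l x : fmode (k + l) x = fmode k x * fmode l x.
Proof. by rewrite /fmode dotDl cisD. Qed.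

Lemma exDr k x y : fmode k (x + y) = fmode k x * fmode k y.
Proof. by rewrite /fmode dotDr cisD. Qed.

Lemma exN k x : fmode (- k) x = (conjc (fmode k x)).
Proof. by rewrite /fmode dotNl cisN. Qed.

Lemma ex0 x : fmode 0 x = 1.
Proof. by rewrite /fmode /dot big1 ?cis0 // => j _; rewrite mxE mul0r. Qed.

Definition grid (q : nat) (g : {ffun 'I_d -> 'I_q}) : 'rV[R]_d :=
  \row_j (2 * pi * (g j)%:R / q%:R).

(** A discrete substitute for the normalized integral: it annihilates every nonzero frequency of
    size less than [q], so letting [q] grow replaces integration over the torus. *)
Definition avg (q : nat) (f : 'rV[R]_d -> C) : C :=
  (q%:R ^+ d)^-1 * \sum_(g : {ffun 'I_d -> 'I_q}) f (grid g).

Lemma avg_ex_prod q k : avg q (fmode k) =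
  \prod_j (q%:R^-1 * \sum_(i < q) cis (2 * pi * ((k 0 j)%:~R / q%:R)) ^+ i).
Proof.
rewrite /avg big_split /= prodr_const card_ord exprVn; congr (_ * _).
rewrite bigA_distr_bigA /=; apply: eq_bigr => g _.
rewrite /fmode /dot (big_morph (@cis R) (@cisD R) (cis0 R)); apply: eq_bigr => j _.
rewrite mxE -cis_nat; congr cis; ring.
Qed.

Lemma geom_root (z : C) q : z ^+ q = 1 -> z != 1 -> \sum_(i < q) z ^+ i = 0.
Proof.
move=> zq z1; apply/eqP; have := subrX1 z q; rewrite zq subrr => /esym/eqP.
by rewrite mulf_eq0 subr_eq0 (negbTE z1).
Qed.

Lemma cis_rootX (r : int) q : (0 < q)%N -> cis (2 * pi * (r%:~R / q%:R)) ^+ q = 1 :> C.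
Proof.
move=> q0; rewrite -cis_nat -[RHS](cis_int2pi R r); congr cis.
by field; rewrite pnatr_eq0 -lt0n.
Qed.

Lemma avg_ex_far q k : k != 0 -> (absn k < q)%N -> avg q (fmode k) = 0.
Proof.
move=> k0 kq; have [j kj] : exists j, k 0 j != 0.
  apply/existsP; apply: contraNT k0; rewrite negb_exists => /forallP h.
  by apply/eqP/rowP => j; rewrite mxE; apply/eqP; have := h j; rewrite negbK.
rewrite avg_ex_prod (bigD1 j) //= geom_root ?mulr0 ?mul0r //.
  by apply: cis_rootX; apply: leq_ltn_trans kq.
apply: cis_root_neq1 => //; apply: leq_ltn_trans kq; exact: absn_ge.
Qed.

Lemma avg_ex0 q : (0 < q)%N -> avg q (fmode 0) = 1.
Proof.
move=> q0; rewrite avg_ex_prod big1 // => j _.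
rewrite mxE mul0r mulr0 cis0; under eq_bigr do rewrite expr1n.
by rewrite sumr_const card_ord mulVf // pnatr_eq0 -lt0n.
Qed.

Lemma nm_avg q (f : 'rV[R]_d -> C) M : (forall x, nm (f x) <= M) -> nm (avg q f) <= M.
Proof.
move=> h; have M0 : 0 <= M := le_trans (nm_ge0 _) (h 0).
rewrite /avg nmM nmV nmX.
have -> : nm (q%:R : C) = q%:R.
  by rewrite -[q%:R](rmorph_nat (real_complex R)) nm_real ger0_norm.
apply: (@le_trans _ _ ((q%:R ^+ d)^-1 * (q%:R ^+ d * M))).
  rewrite ler_wpM2l ?invr_ge0 ?exprn_ge0 //; apply: le_trans (ler_nm_sum _ _ _) _.
  apply: (@le_trans _ _ (\sum_(g : {ffun 'I_d -> 'I_q}) M)).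
    by apply: ler_sum => g _.
  by rewrite sumr_const card_ffun !card_ord -[M *+ _]mulr_natl natrX.
case: (eqVneq (q%:R ^+ d : R) 0) => [->|h0]; first by rewrite invr0 mul0r.
by rewrite mulrA mulVf // mul1r.
Qed.

Lemma avg_csum (J : eqType) q (c : J -> C) (e : J -> Z) : csm c ->
  avg q (fun x => csum (fun j => c j * fmode (e j) x)) =
  csum (fun j => c j * avg q (fmode (e j))).
Proof.
move=> hc; rewrite /avg.
have sm (g : {ffun 'I_d -> 'I_q}) : csm (fun j => c j * fmode (e j) (grid g)).
  by apply: (csm_le hc) => j; rewrite nmM nm_ex mulr1.
have [h1 <-] := csm_sum (index_enum {ffun 'I_d -> 'I_q}) (P := xpredT) (fun g _ => sm g).
rewrite -csumZ //; apply: eq_csum => j.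
by rewrite -mulr_sumr mulrCA.
Qed.

Lemma avg_limit (J : eqType) (c : J -> C) (e : J -> Z) (eps : R) : csm c -> 0 < eps ->
  exists q0, forall q, (q0 <= q)%N ->
   nm (avg q (fun x => csum (fun j => c j * fmode (e j) x)) -
       csum (fun j => if e j == 0 then c j else 0)) <= eps.
Proof.
move=> hc e0; have [s us hs] := nsum_tail hc (divr_gt0 e0 (ltr0n R 2)).
(* From this [q0] on, the average is exact on the frequencies [e j] with [j] in [s]; outside [s],
   each of the two series costs at most [eps / 2]. *)
exists (\max_(j <- s) (absn (e j))).+1 => q hq.
rewrite avg_csum // -csumB; last 2 first.
- apply: (csm_le hc) => j; rewrite nmM ler_piMr ?nm_ge0 //.
  by apply: nm_avg => x; rewrite nm_ex.
- by apply: (csm_le hc) => j; case: ifP; rewrite ?nm0 ?nm_ge0.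
have [hs1 _] := csum_split hc us.
apply: (@le_trans _ _ (nsum (fun j => 2 * (if j \in s then 0 else nm (c j))))).
  have hs2 : nsm (fun j => if j \in s then 0 else nm (c j)).
    by apply: (nsm_le hs1) => j; case: ifP; rewrite ?nm0 lexx ?nm_ge0.
  apply: nm_csum_le; first exact: nsmZ.
  move=> j; case: (boolP (j \in s)) => js.
    rewrite mulr0; have jq : (absn (e j) < q)%N.
      apply: leq_ltn_trans hq; exact: (@leq_bigmax_seq _ s xpredT (fun j => absn (e j)) j).
    case: eqP => ej; last by rewrite avg_ex_far ?mulr0 ?subr0 ?nm0 //; apply/eqP.
    by rewrite ej avg_ex0 ?(leq_trans _ jq) // mulr1 subrr nm0.
  apply: le_trans (ler_nmD _ _) _; rewrite nmN mulr_natl mulr2n lerD //.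
    rewrite nmM ler_piMr ?nm_ge0 //.
    by apply: nm_avg => x; rewrite nm_ex.
  by case: ifP; rewrite ?nm0 ?nm_ge0.
rewrite nsumZ //; last first.
  by apply: (nsm_le hs1) => j; case: ifP; rewrite ?nm0 lexx ?nm_ge0.
by rewrite -ler_pdivlMl // mulrC; apply: le_trans hs _; rewrite le_eqVlt eqxx.
Qed.

Definition fser c x : C := csum (fun k => c k * fmode k x).

Lemma fser_sm c x : csm c -> csm (fun k => c k * fmode k x).
Proof. by move=> hc; apply: (csm_le hc) => k; rewrite nmM nm_ex mulr1. Qed.

Lemma csm_prod (J K : eqType) (a : J -> C) (b : K -> C) : csm a -> csm b ->
  csm (fun p : J * K => a p.1 * b p.2) /\
  csum (fun p : J * K => a p.1 * b p.2) = csum a * csum b.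
Proof.
move=> ha hb.
have sm : csm (fun p : J * K => a p.1 * b p.2).
  apply: (@csm_pair _ _ _ (fun j i => a j * b i) (fun j i => nm (a j) * nm (b i))).
  - by move=> j; apply: nsmZ; rewrite ?nm_ge0.
  - rewrite (_ : (fun j => _) = (fun j => nsum (fun i => nm (b i)) * nm (a j))).
      by apply: nsmZ => //; apply: nsum_ge0.
    by apply/funext => j; rewrite nsumZ ?nm_ge0 // mulrC.
  - by move=> j i; rewrite nmM.
split=> //; have [_ _ ->] := csum_pair (f := fun j i => a j * b i) sm.
by rewrite -csumZr //; apply: eq_csum => j; rewrite csumZ.
Qed.

Lemma csm_sq u : csm u -> nsm (fun k => nm (u k) ^+ 2).
Proof.
move=> hu; apply: (nsm_le (nsmZ (nsum_ge0 hu) hu)) => k.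
by rewrite sqr_ge0 /= expr2 ler_wpM2r ?nm_ge0 //; apply: (nsum_ge k hu).
Qed.

(** [|fser u|^2] is a double series with frequencies [k - l]; in the limit of grid averages only the
    diagonal survives. *)
Lemma parseval u (eps : R) : csm u -> 0 < eps -> exists q0, forall q, (q0 <= q)%N ->
  nm (avg q (fun x => (nm (fser u x) ^+ 2)%:C) - (N2 u)%:C) <= eps.
Proof.
move=> hu e0.
have [sm _] := csm_prod hu (csmJ hu).
have [q0 hq] := avg_limit (c := fun p : Z * Z => u p.1 * (conjc (u p.2))) (fun p => p.1 - p.2) sm e0.
exists q0 => q /hq; congr (nm (_ - _) <= _).
  congr avg; apply/funext => x; rewrite nm_sqrJ.
  rewrite -csumJ; last exact: fser_sm.
  have [_ <-] := csm_prod (fser_sm x hu) (csmJ (fser_sm x hu)).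
  apply: eq_csum => -[k l] /=; rewrite exD exN rmorphM /=; ring.
rewrite -csum_real; last exact: csm_sq.
have hd : csm (fun p : Z * Z => if p.1 - p.2 == 0 then u p.1 * (conjc (u p.2)) else 0).
  by apply: (csm_le sm) => p; case: ifP => _ //; rewrite nm0 nm_ge0.
have [_ _ ->] := csum_pair (f := fun k l => if k - l == 0 then u k * (conjc (u l)) else 0) hd.
apply: eq_csum => k; rewrite nm_sqrJ.
have [|_ ->] := @csum_delta R Z (fun l => if k - l == 0 then u k * (conjc (u l)) else 0) k.
  by move=> l lk; rewrite subr_eq0 eq_sym (negbTE lk).
by rewrite subrr eqxx.
Qed.

Definition avgr (q : nat) (f : 'rV[R]_d -> R) : R :=
  (q%:R ^+ d)^-1 * \sum_(g : {ffun 'I_d -> 'I_q}) f (grid g).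

Lemma avgrE q f : avg q (fun x => (f x)%:C) = (avgr q f)%:C.
Proof. by rewrite /avg /avgr rmorphM rmorph_sum fmorphV rmorphXn rmorph_nat. Qed.

Lemma parsevalr u (eps : R) : csm u -> 0 < eps -> exists q0, forall q, (q0 <= q)%N ->
  `|avgr q (fun x => nm (fser u x) ^+ 2) - N2 u| <= eps.
Proof.
move=> hu e0; have [q0 h] := parseval hu e0; exists q0 => q /h.
by rewrite avgrE -rmorphB /= nm_real.
Qed.

(** The passage from pointwise inequalities between functions to inequalities between coefficient
    norms: ellipticity, spanning and domination are all used through it. *)
Lemma pointwise_N2 (I : finType) u (w : I -> Z -> C) (K : R) : 0 <= K ->
  csm u -> (forall i, csm (w i)) ->
  (forall x, nm (fser u x) ^+ 2 <= K * \sum_i nm (fser (w i) x) ^+ 2) ->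
  N2 u <= K * \sum_i N2 (w i).
Proof.
move=> K0 hu hw h; apply/ler_addgt0Pr => e e0.
(* An error [e'] for [u] and an error [K * e'] for each [w i] add up to [e]. *)
pose e' := e / (1 + K * #|I|%:R).
have dn : 0 < 1 + K * #|I|%:R by rewrite ltr_wpDr // mulr_ge0.
have e'0 : 0 < e' by rewrite divr_gt0.
have [q1 h1] := parsevalr hu e'0.
have [q2 h2] : exists q2, forall q, (q2 <= q)%N -> forall i,
    `|avgr q (fun x => nm (fser (w i) x) ^+ 2) - N2 (w i)| <= e'.
  have /choice[f hf] : forall i, exists q0, forall q, (q0 <= q)%N ->
    `|avgr q (fun x => nm (fser (w i) x) ^+ 2) - N2 (w i)| <= e'.
    by move=> i; apply: parsevalr.
  exists (\max_i f i) => q hq i; apply: hf; apply: leq_trans hq; exact: leq_bigmax.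
pose q := maxn q1 q2.
have a1 := h1 q (leq_maxl _ _); have a2 := h2 q (leq_maxr _ _).
have a3 : avgr q (fun x => nm (fser u x) ^+ 2) <=
   K * \sum_i avgr q (fun x => nm (fser (w i) x) ^+ 2).
  rewrite /avgr -mulr_sumr mulrCA ler_wpM2l ?invr_ge0 ?exprn_ge0 //.
  rewrite exchange_big mulr_sumr; apply: ler_sum => g _; exact: h.
have a4 : \sum_i avgr q (fun x => nm (fser (w i) x) ^+ 2) <=
   \sum_i N2 (w i) + #|I|%:R * e'.
  rewrite mulr_natl -sumr_const -big_split; apply: ler_sum => i _ /=.
  by have := a2 i; rewrite ler_norml => /andP[_]; rewrite lerBlDl.
have a5 : N2 u <= avgr q (fun x => nm (fser u x) ^+ 2) + e'.
  by move: a1; rewrite ler_norml => /andP[]; lra.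
apply: le_trans a5 _; apply: le_trans (lerD a3 (lexx _)) _.
apply: le_trans (lerD (ler_wpM2l K0 a4) (lexx _)) _.
rewrite mulrDr -addrA lerD2l.
have -> : e = e' * (1 + K * #|I|%:R) by rewrite /e' divfK // gt_eqF.
by rewrite le_eqVlt; apply/orP; left; apply/eqP; ring.
Qed.

Lemma csum_cv_mult h c (chi : Z -> C) :
  csm (fun k => h k * chi k) -> csm (fun k => c k * chi k) ->
  (forall k, csm (fun l => h (k - l) * c l)) ->
  (forall k l, h k * c l * chi (k + l) = h k * chi k * (c l * chi l)) ->
  csm (fun k => cv h c k * chi k) /\
  csum (fun k => cv h c k * chi k) =
    csum (fun k => h k * chi k) * csum (fun k => c k * chi k).
Proof.
move=> hh hc hcv he; have [sm <-] := csm_prod hh hc.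
have inj : injective (fun p : Z * Z => (p.1 - p.2, p.2)).
  move=> [k l] [k' l'] /= [+ el]; rewrite el => /(congr1 (fun z => z + l')).
  by rewrite !subrK => ->.
have [|sm2 <-] := csum_reindex inj _ sm.
  by move=> [k l] _; exists (k + l, l) => /=; rewrite addrK.
have e : (fun p : Z * Z => h (p.1 - p.2) * c p.2 * chi p.1) =
   (fun p : Z * Z => h p.1 * chi p.1 * (c p.2 * chi p.2)) \o
   (fun p : Z * Z => (p.1 - p.2, p.2)).
  by apply/funext => p /=; rewrite -he subrK.
move: sm2; rewrite -e => sm2.
have [_ sm3 ->] := csum_pair (f := fun k l => h (k - l) * c l * chi k) sm2.
have e2 : (fun k => csum (fun l => h (k - l) * c l * chi k)) =
  (fun k => cv h c k * chi k) by apply/funext => k; rewrite csumZr.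
by move: sm3; rewrite e2.
Qed.

Lemma fser_cv h c x : csm h -> csm c ->
  (forall k, csm (fun l => h (k - l) * c l)) -> fser (cv h c) x = fser h x * fser c x.
Proof.
move=> hh hc hcv; have [] // := @csum_cv_mult h c (fmode^~ x) _ _ hcv.
- exact: fser_sm.
- exact: fser_sm.
- by move=> k l; rewrite exD; ring.
Qed.

End GridAverages.

(** * Operators on the Sobolev scale *)

Section WeightedOperators.
Variables (R : realType) (d : nat).
Local Notation C := R[i].
Local Notation Z := 'rV[int]_d.
Local Notation pr := (@pr R d).
Local Notation br := (@br R d).
Implicit Types (k l : Z) (u v h g : Z -> C) (r s t : int) (A B : (Z -> C) -> Z -> C).

Lemma brz_gt0 k s : 0 < br k ^ s.
Proof. exact/exprz_gt0/br_gt0. Qed.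

Lemma brz_ge0 k s : 0 <= br k ^ s.
Proof. exact/ltW/brz_gt0. Qed.

Lemma br_neq0 k : br k != 0.
Proof. by rewrite gt_eqF // br_gt0. Qed.
Hint Resolve brz_gt0 brz_ge0 br_neq0 : core.

Lemma br_sub k l : br l <= br k * br (k - l).
Proof. by rewrite -[br (k - l)]brN opprB; apply: le_trans (brD R _ _); rewrite addrC subrK. Qed.

Lemma br_subr k l : br k <= br l * br (k - l).
Proof. by apply: le_trans (brD R _ _); rewrite addrC subrK. Qed.

Lemma brz_shift k l s : br k ^ s * br l ^ (- s) <= br (k - l) ^+ `|s|%N.
Proof.
have b0 x : 0 < br x := br_gt0 R x.
case: s => n; rewrite ?NegzE ?opprK ?abszN absz_nat.
  rewrite -exprnP -exprnN ler_pdivrMr ?exprn_gt0 // -exprMn.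
  by rewrite lerXn2r ?nnegrE ?mulr_ge0 ?(ltW (b0 _)) // mulrC br_subr.
rewrite -exprnN -exprnP mulrC ler_pdivrMr ?exprn_gt0 // -exprMn.
by rewrite lerXn2r ?nnegrE ?mulr_ge0 ?(ltW (b0 _)) // mulrC br_sub.
Qed.

Definition wt s v : Z -> C := fun k => (br k ^ s)%:C * v k.

Lemma nm_wt s v k : nm (wt s v k) = br k ^ s * nm (v k).
Proof. by rewrite nmM nm_real ger0_norm. Qed.

Lemma wtD s t v : wt s (wt t v) = wt (s + t) v.
Proof. by apply/funext => k; rewrite /wt mulrA -rmorphM -expfzDr. Qed.

Lemma wt0 v : wt 0 v = v.
Proof. by apply/funext => k; rewrite /wt expr0z mul1r. Qed.

Lemma wt_add s u v : wt s (fun k => u k + v k) = (fun k => wt s u k + wt s v k).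
Proof. by apply/funext => k; rewrite /wt mulrDr. Qed.

Lemma brz_le_pr k s : br k ^ s <= pr k ^ `|s|.
Proof.
have b1 := br_ge1 R k.
apply: (@le_trans _ _ (br k ^ `|s|)); first by apply: ler_weXz2l => //; exact: ler_norm.
by rewrite -abszE -!exprnP lerXn2r ?nnegrE ?(le_trans ler01) ?pr_ge1 // br_le_pr.
Qed.

Lemma ord_wt s r v : ord r v -> ord (`|s| + r) (wt s v).
Proof.
move=> h; apply: (@ord_mulf _ _ _ _ _ _ 1) => // k.
by rewrite nm_real ger0_norm // mul1r brz_le_pr.
Qed.

Lemma sqD u v : sq u -> sq v ->
  sq (fun k => u k + v k) /\ N2 (fun k => u k + v k) <= 2 * (N2 u + N2 v).
Proof.
move=> hu hv; rewrite /N2 /sq -nsumD // -nsumZ //; last exact: nsmD.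
have h k : 0 <= nm (u k + v k) ^+ 2 <= 2 * (nm (u k) ^+ 2 + nm (v k) ^+ 2).
  rewrite sqr_ge0 /=; apply: (@le_trans _ _ ((nm (u k) + nm (v k)) ^+ 2)).
    by rewrite lerXn2r ?nnegrE ?addr_ge0 ?nm_ge0 // ler_nmD.
  by have := sqr_ge0 (nm (u k) - nm (v k)); move: (nm _) (nm _) => a b; nra.
have sm : nsm (fun k => 2 * (nm (u k) ^+ 2 + nm (v k) ^+ 2)).
  by apply: nsmZ => //; apply: nsmD.
split; first exact: (nsm_le sm).
by apply: le_nsum => // k; case/andP: (h k).
Qed.

Lemma sqZ (c : R) v u : sq v -> 0 <= c -> (forall k, nm (u k) <= c * nm (v k)) ->
  sq u /\ N2 u <= c ^+ 2 * N2 v.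
Proof.
move=> hv c0 h.
have b k : 0 <= nm (u k) ^+ 2 <= c ^+ 2 * nm (v k) ^+ 2.
  by rewrite sqr_ge0 -exprMn lerXn2r ?nnegrE ?mulr_ge0 ?nm_ge0.
have sm := nsmZ (sqr_ge0 c) hv.
split; first exact: (nsm_le sm).
by rewrite /N2 -nsumZ ?sqr_ge0 //; apply: le_nsum => // k; case/andP: (b k).
Qed.

Lemma sq_le v u : sq v -> (forall k, nm (u k) <= nm (v k)) -> sq u /\ N2 u <= N2 v.
Proof.
move=> hv h; have [|s] := @sqZ 1 v u hv ler01; last by rewrite expr1n mul1r.
by move=> k; rewrite mul1r.
Qed.

Lemma sq_sum (I : Type) (F : I -> Z -> C) (q : seq I) :
  (forall i, sq (F i)) ->
  sq (fun k => \sum_(i <- q) F i k) /\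
  N2 (fun k => \sum_(i <- q) F i k) <= 2 ^+ size q * \sum_(i <- q) N2 (F i).
Proof.
move=> h; elim: q => [|i q [IH1 IH2]].
  rewrite /sq /N2 (_ : (fun k => _) = (fun=> 0)); last first.
    by apply/funext => k; rewrite big_nil nm0 expr0n.
  by rewrite nsum0 big_nil mulr0; split=> //; apply: nsm0.
rewrite (_ : (fun k => _) = (fun k => F i k + \sum_(i <- q) F i k)); last first.
  by apply/funext => k; rewrite big_cons.
have [h1 h2] := sqD (h i) IH1; split=> //; apply: le_trans h2 _.
rewrite big_cons /= exprS -mulrA ler_pM2l // mulrDr lerD //.
rewrite ler_peMl ?N2_ge0 // exprn_ege1 //; lra.
Qed.

Lemma sq_ord s v : sq (wt s v) -> ord `|s| v.
Proof.
move=> h; exists (1 + N2 (wt s v)) => k.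
have h1 : nm (wt s v k) <= 1 + N2 (wt s v).
  have := nsum_ge k h; rewrite -/(N2 _) /=.
  by have := nm_ge0 (wt s v k); move: (nm _) (N2 _) => a b; nra.
have e : nm (v k) = nm (wt s v k) * br k ^ (- s).
  by rewrite nm_wt mulrAC -expfzDr // subrr expr0z mul1r.
rewrite e; apply: ler_pM; rewrite ?nm_ge0 //.
by rewrite -normrN; apply: brz_le_pr.
Qed.

(** Operators of order [t] on the whole Sobolev scale; quantifying over all [s] makes orders add
    under composition. *)
Definition oo t A : Prop := forall s, exists2 c, 0 <= c & forall v, sq (wt s v) ->
  sq (wt (s - t) (A v)) /\ N2 (wt (s - t) (A v)) <= c * N2 (wt s v).

Lemma oo_comp t t' A B : oo t A -> oo t' B -> oo (t + t') (fun v => A (B v)).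
Proof.
move=> hA hB s; have [c c0 hc] := hB s; have [e e0 he] := hA (s - t').
exists (e * c) => [|v hv]; first exact: mulr_ge0.
have [h1 h2] := hc v hv; have [h3 h4] := he _ h1.
have -> : s - (t + t') = s - t' - t by ring.
split=> //.
by apply: le_trans h4 _; rewrite -mulrA ler_wpM2l.
Qed.

Lemma ooD t A B : oo t A -> oo t B -> oo t (fun v k => A v k + B v k).
Proof.
move=> hA hB s; have [c c0 hc] := hA s; have [e e0 he] := hB s.
exists (2 * (c + e)) => [|v hv]; first by rewrite mulr_ge0 ?addr_ge0.
have [h1 h2] := hc v hv; have [h3 h4] := he v hv; rewrite wt_add.
have [h5 h6] := sqD h1 h3; split=> //; apply: le_trans h6 _.
by rewrite -mulrA ler_pM2l // mulrDl lerD.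
Qed.

Lemma oo_ext t A B : (forall r v, ord r v -> A v = B v) -> oo t A -> oo t B.
Proof.
move=> e hA s; have [c c0 hc] := hA s; exists c => // v hv.
by rewrite -(e _ _ (sq_ord hv)); apply: hc.
Qed.

Lemma oo0 t : oo t (fun _ _ => 0).
Proof.
move=> s; exists 0 => // v hv; rewrite mul0r.
have e k : nm (wt (s - t) (fun=> 0) k) ^+ 2 = 0 by rewrite /wt mulr0 nm0 expr0n.
rewrite /sq /N2 (_ : (fun k => _) = (fun=> 0)); last exact/funext.
by rewrite nsum0; split=> //; apply: nsm0.
Qed.

Lemma oo_sum t (I : Type) (q : seq I) (F : I -> (Z -> C) -> Z -> C) :
  (forall i, oo t (F i)) -> oo t (fun v k => \sum_(i <- q) F i v k).
Proof.
move=> h; elim: q => [|i q IH].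
  apply: oo_ext (oo0 t) => r v _; apply/funext => k; by rewrite big_nil.
apply: oo_ext (ooD (h i) IH) => r v _; apply/funext => k; by rewrite big_cons.
Qed.

(** Peetre's inequality for [br] moves the Sobolev weights across the kernel and leaves an l^1
    kernel in [k - l], to which [young] applies. This costs powers of [br (k - l)], hence the decay
    asked of [a]. *)
Lemma oo_kernel t (a : Z -> R) (K : Z -> Z -> C) A :
  (forall n, nsm (fun k => a k * br k ^+ n)) ->
  (forall k l, nm (K k l) <= a (k - l) * br l ^ t) ->
  (forall r v, ord r v -> A v = (fun k => csum (fun l => K k l * v l))) ->
  oo t A.
Proof.
move=> ha hK hA s; pose b k := a k * br k ^+ `|(s - t)%R|%N.
have hb : nsm b := ha _.
exists (nsum b ^+ 2) => [|v hv]; first exact: sqr_ge0.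
apply: (young hb hv) => k; rewrite (hA _ _ (sq_ord hv)) nm_wt.
have [hs1 _ _] := nsum_conv hb hv.
have [hs2 _] := nsm_shift k hb.
have [hs3 _] := weighted_cauchy hs2 (fun l => nm_ge0 (wt s v l)) (hs1 k).
apply: (@le_trans _ _ (br k ^ (s - t) *
  nsum (fun l => br k ^ (- (s - t)) * (b (k - l) * nm (wt s v l))))); last first.
  by rewrite nsumZ // mulrA -expfzDr // subrr expr0z mul1r.
rewrite ler_wpM2l //; apply: nm_csum_le; first exact: nsmZ.
move=> l; rewrite nm_wt nmM mulrA mulrA ler_wpM2r ?nm_ge0 //.
apply: le_trans (hK k l) _.
have a0 : 0 <= a (k - l) by have [/(_ (k - l)) + _] := ha 0; rewrite expr0 mulr1.
rewrite /b; have h := brz_shift l k (- (s - t)).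
have -> : br l ^ t = br l ^ (- (s - t)) * br l ^ s.
  by rewrite -expfzDr //; congr (_ ^ _); rewrite opprB subrK.
have hp : br l ^ (- (s - t)) <= br k ^ (- (s - t)) * br (k - l) ^+ `|(s - t)%R|%N.
  move: h; rewrite opprK abszN -[br (l - k)]brN (opprB l k) => h.
  have e : br k ^ (s - t) * br k ^ (- (s - t)) = 1.
    by rewrite -expfzDr // subrr expr0z.
  have := ler_wpM2l (brz_ge0 k (- (s - t))) h.
  by rewrite mulrCA [X in _ * X <= _]mulrC e mulr1.
have := ler_wpM2r (brz_ge0 l s) (ler_wpM2l a0 hp).
rewrite -[X in X <= _ -> _]mulrA => hh; apply: le_trans hh _.
by rewrite le_eqVlt; apply/orP; left; apply/eqP; ring.
Qed.

Lemma rapid_br h n : rapid h -> nsm (fun k => nm (h k) * br k ^+ n).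
Proof.
move=> hh; apply: (nsm_le (rapid_nsm n hh)) => k.
rewrite mulr_ge0 ?nm_ge0 ?exprn_ge0 ?(ltW (br_gt0 _ _)) //=.
by rewrite ler_wpM2l ?nm_ge0 // lerXn2r ?nnegrE ?(ltW (br_gt0 _ _)) ?(ltW (pr_gt0 _ _)) // br_le_pr.
Qed.

Lemma oo_cv h : rapid h -> oo 0 (cv h).
Proof.
move=> hh; apply: (@oo_kernel 0 (fun k => nm (h k)) (fun k l => h (k - l))) => //.
  by move=> n; apply: rapid_br.
by move=> k l; rewrite expr0z mulr1.
Qed.

Lemma oo_mult t (m : Z -> C) : (forall k, nm (m k) <= br k ^ t) ->
  oo t (fun v k => m k * v k).
Proof.
move=> hm s; exists 1 => // v hv; rewrite mul1r; apply: sq_le => // k.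
rewrite !nm_wt nmM expfzDr // -mulrA ler_wpM2l // mulrA ler_piMl ?nm_ge0 //.
by rewrite -[leRHS](expr0z (br k)) -[0 in leRHS](addNr t) expfzDr // ler_wpM2l.
Qed.

Lemma oo_wt s : oo s (wt s).
Proof. by apply: oo_mult => k; rewrite nm_real ger0_norm. Qed.

Lemma oo_Dm j : oo 1 (Dm j).
Proof.
apply: oo_mult => k; rewrite nm_int expr1z /br ler_nat ltnW // ltnS.
exact: absn_ge.
Qed.

Definition comm_wt p h v : Z -> C :=
  fun k => cv h (wt p v) k - wt p (cv h v) k.

(** The commutator gains one order: [br k] and [br l] differ by at most [br (k - l)], so the
    difference of the two weights is at most [2 br(k - l)^3 / br(l)^(n + 1)]. *)
Lemma oo_comm_wt n h : (0 < n <= 2)%N -> rapid h ->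
  oo (- n.+1%:Z) (comm_wt (- n%:Z) h).
Proof.
move=> hn hh.
apply: (@oo_kernel _ (fun k => 2 * (nm (h k) * br k ^+ 3))
  (fun k l => h (k - l) * ((br l ^ (- n%:Z)) - (br k ^ (- n%:Z)))%:C)) => //.
- move=> m; rewrite (_ : (fun k => _) = (fun k => 2 * (nm (h k) * br k ^+ (3 + m)))).
    by apply: nsmZ => //; apply: rapid_br.
  by apply/funext => k; rewrite exprD; ring.
- move=> k l; rewrite nmM nm_real -!mulrA mulrCA ler_wpM2l ?nm_ge0 //.
  have b0 x : 0 < br x := br_gt0 R x.
  have hx : br l <= br k * br (k - l) := br_sub k l.
  have hb : br (k - l) >= 1 := br_ge1 _ _.
  have hd : `|br k - br l| <= br (k - l).
    have r1 : br k <= br l + br (k - l).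
      by rewrite -natrD ler_nat; have := absnD (k - l) l; rewrite subrK; lia.
    have r2 : br l <= br k + br (k - l).
      have n2 : (absn l <= absn k + absn (k - l))%N.
        have := absnD (l - k) k; rewrite subrK -[absn (l - k)]absnN opprB.
        by rewrite addnC.
      by rewrite -natrD ler_nat; move: n2; lia.
    by rewrite ler_norml; apply/andP; split; lra.
  move: (br k) (br l) (br (k - l)) (b0 k) (b0 l) (b0 (k - l)) hx hb hd.
  move=> a b c a0 b0' c0 hx hb hd.
  have ia : a^-1 <= c / b by rewrite ler_pdivlMr // mulrC ler_pdivrMr // mulrC.
  have d1 : `|b^-1 - a^-1| <= c ^+ 2 / b ^+ 2.
    have -> : b^-1 - a^-1 = (a - b) * (a^-1 * b^-1) by field; rewrite !gt_eqF.
    rewrite normrM [X in _ * X]ger0_norm; last by rewrite mulr_ge0 // invr_ge0 ltW.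
    apply: (@le_trans _ _ (c * (c / b * b^-1))).
      by rewrite ler_pM // ?mulr_ge0 ?invr_ge0 ?(ltW a0) ?(ltW b0') // ler_wpM2r // invr_ge0 ltW.
    by rewrite le_eqVlt; apply/orP; left; apply/eqP; field; rewrite gt_eqF.
  have c1 : 1 <= c ^+ 2 by rewrite exprn_ege1.
  case: n hn => [|[|[|]]] // _; rewrite -!exprnN.
    rewrite !expr1; apply: le_trans d1 _.
    have -> : 2 * (c * (c * (c / b ^+ 2))) = 2 * c * (c ^+ 2 / b ^+ 2) by ring.
    by rewrite ler_peMl ?divr_ge0 ?exprn_ge0 ?(ltW c0) ?(ltW b0') //; lra.
  have -> : (b ^+ 2)^-1 - (a ^+ 2)^-1 = (b^-1 - a^-1) * (b^-1 + a^-1).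
    by field; rewrite !gt_eqF.
  have ib : 0 <= b^-1 by rewrite invr_ge0 ltW.
  have ia0 : 0 <= a^-1 by rewrite invr_ge0 ltW.
  rewrite normrM [X in _ * X]ger0_norm ?addr_ge0 //.
  apply: (@le_trans _ _ (c ^+ 2 / b ^+ 2 * (2 * (c / b)))).
    apply: ler_pM => //; first by rewrite addr_ge0.
    rewrite mulr_natl mulr2n lerD // ler_peMl //.
  rewrite le_eqVlt; apply/orP; left; apply/eqP; field; rewrite gt_eqF //.
move=> r v hv; apply/funext => k; rewrite /comm_wt /wt /cv.
rewrite -csumZ; last exact: cv_sm hv.
rewrite -csumB; first by apply: eq_csum => l; rewrite rmorphB /=; ring.
  by apply: (cv_sm (r := `|- n%:Z| + r)) => //; apply: ord_wt.
by apply: csmZ; apply: cv_sm hv.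
Qed.

End WeightedOperators.

(** * Vector fields as operators on Fourier coefficients *)

Section VectorFieldOperators.
Variables (R : realType) (d : nat).
Local Notation C := R[i].
Local Notation Z := 'rV[int]_d.
Local Notation field := ('I_d -> Z -> C).
Implicit Types (k : Z) (u v h g : Z -> C) (r s t : int) (x y z : field).

(* On Fourier coefficients: vop z is the operator sum_i z_i D_i, barf z the conjugate
   field, brk the Lie bracket, divbar z the zero order term of the adjoint of vop z. *)
Definition rf z : Prop := forall i, rapid (z i).
Definition vop z v : Z -> C := fun k => \sum_i cv (z i) (Dm i v) k.
Definition barf z : field := fun i => cbar (z i).
Definition brk y z : field := fun i k =>
  \sum_l (cv (y l) (Dm l (z i)) k - cv (z l) (Dm l (y i)) k).
Definition divbar z : Z -> C := fun k => \sum_i Dm i (cbar (z i)) k.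

Lemma ord_vop z v r : rf z -> ord r v -> ord (r + 1) (vop z v).
Proof. by move=> hz hv; apply: ord_sum => i _; apply: ord_cv => //; apply: ord_Dm. Qed.

Lemma rf_barf z : rf z -> rf (barf z).
Proof. by move=> hz i; apply: rapid_cbar. Qed.

Lemma rf_brk y z : rf y -> rf z -> rf (brk y z).
Proof.
move=> hy hz i; apply: rapid_sum => l _.
by apply: rapidB; apply: rapid_cv => //; apply: rapid_Dm.
Qed.

Lemma rapid_divbar z : rf z -> rapid (divbar z).
Proof. by move=> hz; apply: rapid_sum => i _; apply: rapid_Dm; apply: rapid_cbar. Qed.

Lemma oo_vop z : rf z -> oo 1 (vop z).
Proof.
move=> hz; apply: oo_sum => i.
by rewrite -[1]add0r; apply: (oo_comp (A := cv (z i))); [apply: oo_cv | apply: oo_Dm].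
Qed.

Lemma DmN j v : Dm j (fun k => - v k) = (fun k => - Dm j v k).
Proof. by apply/funext => k; rewrite /Dm mulrN. Qed.

Lemma cvNr h v : cv h (fun k => - v k) = (fun k => - cv h v k) :> (Z -> C).
Proof.
apply/funext => k; rewrite /cv /csum.
have e (f : Z -> R) : rsum (fun l => - f l) = - rsum f.
  by rewrite /rsum opprB; congr (_ - _); apply: eq_nsum => l; rewrite /pospart /negpart ?opprK.
rewrite (_ : (fun l => complex.Re _) = (fun l => - complex.Re (h (k - l) * v l))); last first.
  by apply/funext => l; rewrite mulrN; case: (_ * _).
rewrite (_ : (fun l => complex.Im _) = (fun l => - complex.Im (h (k - l) * v l))); last first.
  by apply/funext => l; rewrite mulrN; case: (_ * _).
by rewrite !e.
Qed.

Lemma vopN z v : vop z (fun k => - v k) = (fun k => - vop z v k).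
Proof.
by apply/funext => k; rewrite /vop -sumrN; apply: eq_bigr => i _; rewrite DmN cvNr.
Qed.

Lemma vopD z u v r : rf z -> ord r u -> ord r v ->
  vop z (fun k => u k + v k) = (fun k => vop z u k + vop z v k).
Proof.
move=> hz hu hv; apply/funext => k; rewrite /vop -big_split; apply: eq_bigr => i _.
by rewrite DmD (cvDr (hz i) (ord_Dm i hu) (ord_Dm i hv)).
Qed.

Lemma vopB z u v r : rf z -> ord r u -> ord r v ->
  vop z (fun k => u k - v k) = (fun k => vop z u k - vop z v k).
Proof. by move=> hz hu hv; rewrite (vopD hz hu (ordN hv)) vopN. Qed.

Lemma vop_addl (y z : field) c v r : rf y -> rf z -> ord r v ->
  vop (fun i k => c * y i k + z i k) v = (fun k => c * vop y v k + vop z v k).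
Proof.
move=> hy hz hv; apply/funext => k; rewrite /vop mulr_sumr -big_split.
apply: eq_bigr => i _ /=; rewrite (cvDl _ (hz i) (ord_Dm i hv)); last exact: rapidZ.
by rewrite (cvZl _ (hy i) (ord_Dm i hv)).
Qed.

Lemma vop_oppl z v r : rf z -> ord r v ->
  vop (fun i k => - z i k) v = (fun k => - vop z v k).
Proof.
move=> hz hv; apply/funext => k; rewrite /vop -sumrN; apply: eq_bigr => i _.
rewrite (_ : (fun k => - z i k) = (fun k => -1 * z i k)); last first.
  by apply/funext => ?; rewrite mulN1r.
by rewrite (cvZl _ (hz i) (ord_Dm i hv)) mulN1r.
Qed.

Lemma Dm_sum (I : Type) (q : seq I) j (F : I -> Z -> C) :
  Dm j (fun k => \sum_(i <- q) F i k) = (fun k => \sum_(i <- q) Dm j (F i) k).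
Proof. by apply/funext => k; rewrite /Dm mulr_sumr. Qed.

Lemma vop_vop y z v r : rf y -> rf z -> ord r v ->
  vop y (vop z v) = (fun k =>
    \sum_i cv (fun k => \sum_l cv (y l) (Dm l (z i)) k) (Dm i v) k +
    \sum_i \sum_l cv (cv (y l) (z i)) (Dm l (Dm i v)) k).
Proof.
move=> hy hz hv; apply/funext => k; rewrite /vop.
have o1 i : ord (r + 1) (Dm i v) by apply: ord_Dm.
have o2 l i : ord (r + 1 + 1) (Dm l (Dm i v)) by apply: ord_Dm.
transitivity (\sum_l \sum_i (cv (cv (y l) (Dm l (z i))) (Dm i v) k +
    cv (cv (y l) (z i)) (Dm l (Dm i v)) k)).
  apply: eq_bigr => l _; rewrite Dm_sum.
  rewrite (cv_sumr (r := r + 1 + 1) _ (hy l)); last first.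
    by move=> i _; apply: ord_Dm; apply: ord_cv.
  apply: eq_bigr => i _; rewrite (Dm_cv l (hz i) (o1 i)).
  rewrite (cvDr (r := r + 1 + 1) (hy l)); last 2 first.
  - apply: ord_mono (ord_cv _ (o1 i)); first by rewrite lerDl.
    exact: rapid_Dm.
  - exact: ord_cv.
  by rewrite (cvA (hy l) (rapid_Dm l (hz i)) (o1 i)) (cvA (hy l) (hz i) (o2 l i)).
rewrite exchange_big /= -big_split; apply: eq_bigr => i _ /=.
rewrite big_split; congr (_ + _).
by rewrite (cv_suml _ _ (o1 i)) // => l _; apply: rapid_cv => //; apply: rapid_Dm.
Qed.

(** The second order parts of the two compositions coincide, because convolutions commute and so do
    the [Dm]; the first order parts form the bracket. *)
Lemma vop_brk y z v r : rf y -> rf z -> ord r v ->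
  vop (brk y z) v = (fun k => vop y (vop z v) k - vop z (vop y v) k).
Proof.
move=> hy hz hv; rewrite (vop_vop hy hz hv) (vop_vop hz hy hv).
have o1 i : ord (r + 1) (Dm i v) by apply: ord_Dm.
apply/funext => k.
have -> : \sum_i \sum_l cv (cv (z l) (y i)) (Dm l (Dm i v)) k =
          \sum_i \sum_l cv (cv (y l) (z i)) (Dm l (Dm i v)) k.
  rewrite exchange_big; apply: eq_bigr => i _; apply: eq_bigr => l _.
  by rewrite DmC (cvC (hz i) (hy l)).
rewrite opprD addrACA subrr addr0.
rewrite /vop -sumrB; apply: eq_bigr => i _.
have ha : rapid (fun k => \sum_l cv (y l) (Dm l (z i)) k).
  by apply: rapid_sum => l _; apply: rapid_cv => //; apply: rapid_Dm.
have hb : rapid (fun k => \sum_l cv (z l) (Dm l (y i)) k).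
  by apply: rapid_sum => l _; apply: rapid_cv => //; apply: rapid_Dm.
rewrite (_ : brk y z i = (fun k => \sum_l cv (y l) (Dm l (z i)) k +
   -1 * \sum_l cv (z l) (Dm l (y i)) k)).
  by rewrite (cvDl ha (rapidZ _ hb) (o1 i)) (cvZl _ hb (o1 i)) mulN1r.
by apply/funext => l; rewrite /brk sumrB mulN1r.
Qed.

Lemma cbar_cv h g : rapid h -> rapid g -> cbar (cv h g) = cv (cbar h) (cbar g).
Proof.
move=> hh hg; apply/funext => k; rewrite /cbar /cv -csumJ; last exact: cv_sm (hg 0).
have [|_ <-] := csum_reindex (@oppr_inj Z) _ (csmJ (cv_sm (- k) hh (hg 0))).
  by move=> l _; exists (- l); rewrite opprK.
by apply: eq_csum => l /=; rewrite rmorphM /= opprB addrC opprK.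
Qed.

Lemma cbar_Dm j h : cbar (Dm j h) = (fun k => - Dm j (cbar h) k).
Proof.
apply/funext => k; rewrite /cbar /Dm rmorphM /= rmorph_int mxE rmorphN /= mulNr.
by [].
Qed.

(** The sign comes from [D], which anticommutes with complex conjugation ([cbar_Dm]). *)
Lemma barf_brk y z : rf y -> rf z ->
  barf (brk y z) = (fun i k => - brk (barf y) (barf z) i k).
Proof.
move=> hy hz; apply/funext => i; apply/funext => k.
rewrite /barf /brk /cbar rmorph_sum -sumrN; apply: eq_bigr => l _.
rewrite rmorphB /= -!/(cbar _ k) !cbar_cv //; try exact: rapid_Dm.
by rewrite !cbar_Dm !cvNr opprB opprK addrC.
Qed.

Lemma barfK z : barf (barf z) = z.
Proof. by apply/funext => i; rewrite /barf cbarK. Qed.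

Lemma Dm_wt j s v : Dm j (wt s v) = wt s (Dm j v).
Proof. by apply/funext => k; rewrite /Dm /wt mulrCA. Qed.

Lemma wt_sum (I : Type) (q : seq I) s (F : I -> Z -> C) :
  wt s (fun k => \sum_(i <- q) F i k) = (fun k => \sum_(i <- q) wt s (F i) k).
Proof. by apply/funext => k; rewrite /wt mulr_sumr. Qed.

Lemma oo_vop_comm n z : (0 < n <= 2)%N -> rf z ->
  oo (- n%:Z) (fun v k => vop z (wt (- n%:Z) v) k - wt (- n%:Z) (vop z v) k).
Proof.
move=> hn hz; apply: (oo_ext (A := fun v k => \sum_i comm_wt (- n%:Z) (z i) (Dm i v) k)).
  move=> r v hv; apply/funext => k; rewrite /vop wt_sum -sumrB; apply: eq_bigr => i _.
  by rewrite /comm_wt Dm_wt.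
apply: oo_sum => i.
have e : - n.+1%:Z + 1 = - n%:Z by rewrite -addn1 PoszD opprD subrK.
by have := oo_comp (oo_comm_wt hn (hz i)) (@oo_Dm R d i); rewrite e.
Qed.

(** Cauchy-Schwarz with a free parameter [e], so that a small constant can be put on either
    factor. *)
Lemma ip_sqP u v : sq u -> sq v -> csm (fun k => u k * conjc (v k)) /\
  forall e : R, 0 < e -> 2 * nm (ip u v) <= e * N2 u + e^-1 * N2 v.
Proof.
move=> hu hv.
have key e k : 0 < e -> 2 * nm (u k * conjc (v k)) <= e * nm (u k) ^+ 2 + e^-1 * nm (v k) ^+ 2.
  move=> e0; rewrite nmM nmJ; have i0 : 0 < e^-1 by rewrite invr_gt0.
  have := sqr_ge0 (e * nm (u k) - nm (v k)).
  move: (nm (u k)) (nm (v k)) => a b h.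
  have := mulr_ge0 (ltW i0) h.
  have -> : e^-1 * (e * a - b) ^+ 2 = e * a ^+ 2 + e^-1 * b ^+ 2 - 2 * (a * b).
    by field; rewrite gt_eqF.
  by rewrite subr_ge0.
have sm e : 0 < e -> nsm (fun k => e * nm (u k) ^+ 2 + e^-1 * nm (v k) ^+ 2).
  by move=> e0; apply: nsmD; apply: nsmZ; rewrite ?invr_ge0 ?ltW.
have hs : csm (fun k => u k * conjc (v k)).
  apply: (csm_le (sm 1 ltr01)) => k; apply: le_trans (key 1 k ltr01).
  by rewrite ler_peMl ?nm_ge0 // ler1n.
split=> // e e0; rewrite /N2 -!nsumZ ?invr_ge0 ?(ltW e0) //.
rewrite -nsumD; do ?[by apply: nsmZ; rewrite ?invr_ge0 ?ltW].
apply: (@le_trans _ _ (2 * nsum (fun k => nm (u k * conjc (v k))))).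
  by rewrite ler_pM2l // nm_csum.
by rewrite -nsumZ //; apply: le_nsum => [|k]; [exact: sm | exact: key].
Qed.

Lemma ip_wt s u v : ip u v = ip (wt s u) (wt (- s) v).
Proof.
apply: eq_csum => k; rewrite /wt rmorphM /= conjc_real mulrACA -rmorphM /=.
by rewrite -expfzDr ?br_neq0 // subrr expr0z mul1r.
Qed.

Lemma ip_Dl u v w : csm (fun k => u k * conjc (w k)) -> csm (fun k => v k * conjc (w k)) ->
  ip (fun k => u k - v k) w = ip u w - ip v w.
Proof.
by move=> h1 h2; rewrite /ip -csumB //; apply: eq_csum => k; rewrite mulrBl.
Qed.

(** Integration by parts; the condition on the orders makes the double sums absolutely
    convergent. *)
Lemma ip_vop z u v r s : rf z -> ord r u -> ord s v -> r + s + 1 <= -2 ->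
  ip (vop z u) v = ip u (fun k => vop (barf z) v k + cv (divbar z) v k).
Proof.
move=> hz hu hv rs.
have rs' : r + 1 + s <= -2 by rewrite addrAC.
have rs2 : r + (s + 1) <= -2 by rewrite addrA.
have rs3 : r + s <= -2 by apply: le_trans rs; rewrite lerDl.
have o1 i : ord (r + 1) (cv (z i) (Dm i u)) by apply: ord_cv => //; apply: ord_Dm.
transitivity (\sum_i ip (cv (z i) (Dm i u)) v).
  have [_ <-] := csm_sum (index_enum 'I_d) (P := xpredT) (fun i _ => ip_sm (o1 i) hv rs').
  by apply: eq_csum => k; rewrite mulr_suml.
have hb i : rapid (cbar (z i)) by apply: rapid_cbar.
have e i : ip (cv (z i) (Dm i u)) v =
   ip u (fun k => cv (barf z i) (Dm i v) k + cv (Dm i (cbar (z i))) v k).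
  rewrite (ip_cv (hz i) (ord_Dm i hu) hv rs') ip_Dm (Dm_cv i (hb i) hv).
  by congr ip; apply/funext => k; rewrite addrC.
rewrite (eq_bigr _ (fun i _ => e i)).
have o2 i : ord (s + 1) (fun k => cv (barf z i) (Dm i v) k + cv (Dm i (cbar (z i))) v k).
  apply: ordD; first by apply: ord_cv; [exact: hb | exact: ord_Dm].
  apply: (@ord_mono _ _ s); first by rewrite lerDl.
  by apply: ord_cv => //; apply: rapid_Dm.
have [_ <-] := csm_sum (index_enum 'I_d) (P := xpredT) (fun i _ => ip_sm hu (o2 i) rs2).
apply: eq_csum => k; rewrite -mulr_sumr -rmorph_sum big_split /=; congr (_ * conjc (_ + _)).
by rewrite /divbar (cv_suml _ _ hv) // => i _; apply: rapid_Dm.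
Qed.

Lemma ord_wt_le s r v : s <= 0 -> ord r v -> ord r (wt s v).
Proof.
move=> s0 [c hc]; exists c => k; rewrite nm_wt.
apply: le_trans (hc k); rewrite ler_piMl ?nm_ge0 //.
by rewrite -(expr0z (br R k)); apply: ler_weXz2l => //; apply: br_ge1.
Qed.

Lemma ord_sq r v : r <= -1 -> ord r v -> sq v.
Proof. by move=> hr /(ord_mono hr); apply: nsm_ord1. Qed.

End VectorFieldOperators.

(** * Compactness relative to the energy *)

Section CommutatorEstimates.
Variables (R : realType) (d N : nat).
Local Notation C := R[i].
Local Notation Z := 'rV[int]_d.
Local Notation field := ('I_d -> Z -> C).
Variable X : 'I_N -> field.
Hypothesis X_rapid : forall j, rf (X j).
Hypothesis X_real : forall j, barf (X j) = X j.
Implicit Types (k : Z) (u v h g : Z -> C) (r s t : int) (y z : field)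
  (A B : (Z -> C) -> Z -> C).

Definition energy v : R := \sum_j N2 (vop (X j) v).
Definition energy1 v : R := energy v + N2 v.

(** Test sequences have order -10: after one or two derivatives they are still square summable and
    meet the order conditions of the integrations by parts. *)
Lemma dom_vop z v : rf z -> ord (-10) v -> ord (-9) (vop z v).
Proof. by move=> hz hv; apply: (ord_vop hz hv). Qed.

Lemma dom_sq v : ord (-10) v -> sq v.
Proof. exact: ord_sq. Qed.

Lemma energy_ge0 v : ord (-10) v -> 0 <= energy v.
Proof.
move=> hv; apply: sumr_ge0 => j _; apply: N2_ge0.
exact: ord_sq (dom_vop (X_rapid j) hv).
Qed.

Lemma energy1_ge0 v : ord (-10) v -> 0 <= energy1 v.
Proof. by move=> hv; rewrite addr_ge0 ?energy_ge0 ?N2_ge0 //; apply: dom_sq. Qed.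

Lemma N2_le_energy1 v : ord (-10) v -> N2 v <= energy1 v.
Proof. by move=> hv; rewrite lerDr energy_ge0. Qed.

Lemma vop_le_energy1 j v : ord (-10) v -> N2 (vop (X j) v) <= energy1 v.
Proof.
move=> hv; apply: (@le_trans _ _ (energy v)); last first.
  by rewrite lerDl N2_ge0 //; apply: dom_sq.
rewrite /energy (bigD1 j) //= lerDl; apply: sumr_ge0 => i _; apply: N2_ge0.
exact: ord_sq (dom_vop (X_rapid i) hv).
Qed.

Definition low v : R := N2 (wt (-1) v).

Lemma low_ge0 v : ord (-10) v -> 0 <= low v.
Proof. by move=> hv; apply: N2_ge0; apply: (@ord_sq _ _ (-10)) => //; apply: ord_wt_le. Qed.

(* br^(-1) A is compact relative to the energy (Kohn's subelliptic estimates are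
   stronger, but this is enough and is stable under brackets as well). *)
Definition est A : Prop := forall eta : R, 0 < eta -> exists2 c, 0 <= c &
  forall v, ord (-10) v -> N2 (wt (-1) (A v)) <= eta * energy1 v + c * low v.

Lemma est_ext A B : (forall v, ord (-10) v -> A v = B v) -> est A -> est B.
Proof.
move=> e hA eta h; have [c c0 hc] := hA eta h; exists c => // v hv.
by rewrite -e //; apply: hc.
Qed.

Lemma estD A B : (forall v, ord (-10) v -> ord (-8) (A v)) ->
  (forall v, ord (-10) v -> ord (-8) (B v)) ->
  est A -> est B -> est (fun v k => A v k + B v k).
Proof.
move=> dA dB hA hB eta h; have h4 : 0 < eta / 4 by rewrite divr_gt0.
have [c c0 hc] := hA _ h4; have [e e0 he] := hB _ h4.
exists (2 * (c + e)) => [|v hv]; first by rewrite mulr_ge0 ?addr_ge0.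
have sA : sq (wt (-1) (A v)) by apply: (@ord_sq _ _ (-8)) => //; apply: ord_wt_le => //; apply: dA.
have sB : sq (wt (-1) (B v)) by apply: (@ord_sq _ _ (-8)) => //; apply: ord_wt_le => //; apply: dB.
rewrite wt_add; have [_ h2] := sqD sA sB; apply: le_trans h2 _.
by have := hc v hv; have := he v hv; lra.
Qed.

Lemma estZ a A : (forall v, ord (-10) v -> ord (-8) (A v)) ->
  est A -> est (fun v k => a * A v k).
Proof.
move=> dA hA eta h.
pose m := nm a ^+ 2 + 1.
have m0 : 0 < m by rewrite ltr_wpDl // sqr_ge0.
have [c c0 hc] := hA _ (divr_gt0 h m0).
exists (m * c) => [|v hv]; first by rewrite mulr_ge0 // ltW.
have sA : sq (wt (-1) (A v)) by apply: (@ord_sq _ _ (-8)) => //; apply: ord_wt_le => //; apply: dA.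
have [|_ h2] := @sqZ R d (nm a) (wt (-1) (A v)) (wt (-1) (fun k => a * A v k)) sA (nm_ge0 a).
  by move=> k; rewrite !nm_wt nmM mulrCA.
apply: le_trans h2 _; apply: (@le_trans _ _ (m * N2 (wt (-1) (A v)))).
  by rewrite ler_wpM2r ?N2_ge0 // lerDl.
have := ler_wpM2l (ltW m0) (hc v hv); move/le_trans; apply.
rewrite mulrDr mulrA [m * (eta / m)]mulrC divfK ?gt_eqF // mulrA //.
Qed.

(** Interpolation: [br^(-2) <= eta + eta^(-1) br^(-4)], and [br^(-2) X_j v] is bounded by
    [br^(-1) v] because [X_j] has order 1. *)
Lemma est_X j : est (vop (X j)).
Proof.
move=> eta h; have [c c0 hc] := oo_vop (X_rapid j) (-1).
exists (eta^-1 * c) => [|v hv]; first by rewrite mulr_ge0 // invr_ge0 ltW.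
have s1 : sq (wt (-1) v) by apply: (@ord_sq _ _ (-10)) => //; apply: ord_wt_le.
have [h1 h2] := hc v s1.
have s2 : sq (vop (X j) v) by apply: ord_sq (dom_vop (X_rapid j) hv).
have i0 : 0 < eta^-1 by rewrite invr_gt0.
apply: (@le_trans _ _ (eta * N2 (vop (X j) v) + eta^-1 * N2 (wt (-1 - 1) (vop (X j) v)))).
  rewrite /N2 -!nsumZ ?(ltW h) ?(ltW i0) //.
  have hs1 := nsmZ (ltW h) s2; have hs2 := nsmZ (ltW i0) h1.
  rewrite -(nsumD hs1 hs2); apply: le_nsum; first exact: (nsmD hs1 hs2).
  move=> k; rewrite !nm_wt !exprMn [eta^-1 * _]mulrA -mulrDl ler_wpM2r ?sqr_ge0 //.
  have -> : br R k ^ (-1 - 1) = (br R k ^ (-1)) ^+ 2.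
    by rewrite expr2 -expfzDr ?br_neq0.
  set x := _ ^ _; move: (x ^+ 2) (sqr_ge0 x) => y y0.
  have hs := sqr_ge0 (eta - y); rewrite -(ler_pM2l h) mulrDr.
  rewrite [eta * (eta^-1 * _)]mulrA mulfV ?gt_eqF // mul1r.
  by have := sqr_ge0 eta; have := sqr_ge0 y; nra.
apply: lerD; first by rewrite ler_wpM2l ?vop_le_energy1 // ltW.
by rewrite -mulrA ler_wpM2l // ltW.
Qed.

(** [vop y + cv g] stands for the adjoint of a field. Moving it past [br^(-2) w] leaves three
    errors, all of order -1: the bracket of [y] and [w], the commutator of [y] with [br^(-2)], and
    the zero order term [g]. *)
Lemma commute_past y w g : rf y -> rf w -> rapid g ->
  exists2 P, oo (-1) P & forall v, ord (-10) v ->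
  (fun k => vop y (wt (-2) (vop w v)) k + cv g (wt (-2) (vop w v)) k) =
  (fun k => wt (-2) (vop w (vop y v)) k + P v k).
Proof.
move=> hy hw hg.
exists (fun v k => wt (-2) (vop (brk y w) v) k +
  (vop y (wt (-2) (vop w v)) k - wt (-2) (vop y (vop w v)) k) +
  cv g (wt (-2) (vop w v)) k).
  apply: ooD; first apply: ooD.
  - have := oo_comp (oo_wt R d (-2)) (oo_vop (rf_brk hy hw)); exact.
  - have := oo_comp (oo_vop_comm (n := 2) isT hy) (oo_vop hw); exact.
  - have := oo_comp (oo_cv hg) (oo_comp (oo_wt R d (-2)) (oo_vop hw)); exact.
move=> v hv; apply/funext => k; rewrite (vop_brk hy hw hv) /wt mulrBr; ring.
Qed.

(** With [w] the bracket and [T = br^(-2) w v], the squared norm of [br^(-1) w v] is the pairing of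
    [X z v - z X v] with [T]. After integration by parts, the first term pairs [br^(-1) z v], small
    by hypothesis, with a quantity bounded by the energy; the second pairs [X v], bounded by the
    energy, with a quantity bounded by [br^(-1) (barf z) v] and [low]. The conjugate field enters
    through the adjoint of [z]. *)
Lemma est_brk_X j z : rf z -> est (vop z) -> est (vop (barf z)) ->
  est (vop (brk (X j) z)).
Proof.
move=> hz ez ezb eta heta.
pose w := brk (X j) z; have hw : rf w by apply: rf_brk.
have hzb := rf_barf hz.
have [P1 oP1 eP1] := commute_past (X_rapid j) hw (rapid_divbar (X_rapid j)).
have [P2 oP2 eP2] := commute_past hzb hw (rapid_divbar hz).
have [a1 a10 ha1] := oo_vop hw 0; have [a2 a20 ha2] := oP1 0.
have [a3 a30 ha3] := oo_vop hw (-1); have [a4 a40 ha4] := oP2 (-1).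
(* [a] dominates all the operator bounds; [e] and [eta'] are tuned so that [e * a] and
   [e^-1 * (a * eta')] both equal [eta / 4]. *)
pose a := 2 * (a1 + a2 + a3 + a4) + 1.
have a_gt0 : 0 < a by rewrite ltr_wpDl // mulr_ge0 // !addr_ge0.
pose e := eta / (4 * a); have e0 : 0 < e by rewrite divr_gt0 // mulr_gt0.
pose eta' := eta * e / (4 * a); have eta'0 : 0 < eta'.
  by apply: divr_gt0; apply: mulr_gt0.
have [c1 c10 hc1] := ez _ eta'0; have [c2 c20 hc2] := ezb _ eta'0.
have ie0 : 0 < e^-1 by rewrite invr_gt0.
exists (e^-1 * (c1 + a * c2 + a)) => [|v hv].
  apply: mulr_ge0; first exact: ltW.
  apply: addr_ge0; last exact: ltW.
  apply: addr_ge0 => //; apply: mulr_ge0 => //; exact: ltW.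
set n := low v.
have n0 : 0 <= n by apply: low_ge0.
have oX := dom_vop (X_rapid j) hv; have oZ := dom_vop hz hv.
have oZb := dom_vop hzb hv; have oW := dom_vop hw hv.
pose T := wt (-2) (vop w v).
have oT : ord (-9) T by apply: ord_wt_le.
have sT : sq T by apply: ord_sq oT.
have sZ : sq (wt (-1) (vop z v)) by apply: (@ord_sq _ _ (-9)) => //; apply: ord_wt_le.
have sZb : sq (wt (-1) (vop (barf z) v)) by apply: (@ord_sq _ _ (-9)) => //; apply: ord_wt_le.
have sX : sq (wt 0 (vop (X j) v)) by rewrite wt0; apply: ord_sq oX.
have s0 : sq (wt 0 v) by rewrite wt0; apply: dom_sq.
have s1 : sq (wt (-1) v) by apply: (@ord_sq _ _ (-10)) => //; apply: ord_wt_le.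
have oXZ := ord_vop (X_rapid j) oZ; have oZX := ord_vop hz oX.
have main : (N2 (wt (-1) (vop w v)))%:C =
   ip (vop (X j) (vop z v)) T - ip (vop z (vop (X j) v)) T.
  rewrite -ip_Dl; try by apply: (ip_sm (r := -9 + 1) (s := -9)).
  rewrite -(vop_brk (X_rapid j) hz hv) -/w /N2 -csum_real; last first.
    by apply: (@ord_sq _ _ (-9)) => //; apply: ord_wt_le.
  apply: eq_csum => k; rewrite nm_sqrJ /T /wt !rmorphM /= !conjc_real.
  rewrite mulrACA -rmorphM /= -expfzDr ?br_neq0 //.
  by rewrite mulrCA.
rewrite (ip_vop (X_rapid j) oZ oT) // X_real in main.
rewrite (ip_vop hz oX oT) // in main.
pose R1 := fun k => vop (X j) T k + cv (divbar (X j)) T k.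
pose R2 := fun k => vop (barf z) T k + cv (divbar z) T k.
have [sR1 hR1] : sq (wt 1 R1) /\ N2 (wt 1 R1) <=
    2 * (a1 * N2 (vop (X j) v) + a2 * N2 v).
  rewrite /R1 eP1 // wt_add wtD.
  have [q1 q2] := ha1 _ sX; have [q3 q4] := ha2 _ s0.
  rewrite wt0 in q2; rewrite wt0 in q4.
  have [q5 q6] := sqD q1 q3; split=> //; apply: le_trans q6 _.
  by rewrite ler_pM2l // lerD.
have [sR2 hR2] : sq R2 /\ N2 R2 <= 2 * (a3 * N2 (wt (-1) (vop (barf z) v)) + a4 * n).
  rewrite /R2 eP2 //; have [q1 q2] := ha3 _ sZb; have [q3 q4] := ha4 _ s1.
  rewrite wt0 in q3 q4.
  have [q5 q6] := sqD q1 q3; split=> //; apply: le_trans q6 _.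
  by rewrite ler_pM2l // lerD.
rewrite (ip_wt (-1)) in main.
have [_ /(_ e^-1 ie0)] := ip_sqP sZ sR1; rewrite invrK => b1.
have sX' : sq (vop (X j) v) by move: sX; rewrite wt0.
have [_ /(_ e e0) b2] := ip_sqP sX' sR2.
have b3 : 2 * N2 (wt (-1) (vop w v)) <=
   2 * nm (ip (wt (-1) (vop z v)) (wt 1 R1)) + 2 * nm (ip (vop (X j) v) R2).
  rewrite -mulrDr ler_pM2l //; apply: le_trans (ler_norm _) _.
  by rewrite -nm_real main; apply: le_trans (ler_nmD _ _) _; rewrite nmN.
have f1 := hc1 v hv; have f2 := hc2 v hv.
have f3 := vop_le_energy1 j hv; have f4 := N2_le_energy1 hv.
have g1 := energy1_ge0 hv.
have g4 := N2_ge0 sZb.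
have a_ge1 : 1 <= a by rewrite lerDr mulr_ge0 // !addr_ge0.
have k1 : e * N2 (wt 1 R1) + e * N2 (vop (X j) v) <= e * a * energy1 v.
  rewrite -mulrDr -mulrA ler_wpM2l ?(ltW e0) //.
  have := ler_wpM2l a10 f3; have := ler_wpM2l a20 f4.
  have := mulr_ge0 a30 g1; have := mulr_ge0 a40 g1; rewrite /a; lra.
have k2 : N2 R2 <= a * (N2 (wt (-1) (vop (barf z) v)) + n).
  apply: le_trans hR2 _; rewrite /a.
  have := mulr_ge0 a10 g4; have := mulr_ge0 a20 g4; have := mulr_ge0 a30 n0.
  have := mulr_ge0 a10 n0; have := mulr_ge0 a20 n0; have := mulr_ge0 a40 g4; lra.
have k3 : e * a = eta / 4 by rewrite /e; field; rewrite gt_eqF.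
have k4 : e^-1 * eta' = eta / (4 * a).
  by rewrite /eta'; field; rewrite !gt_eqF.
have k5 : eta / (4 * a) <= eta / 4.
  rewrite ler_wpM2l ?(ltW heta) // lef_pV2 ?posrE ?mulr_gt0 //.
  by rewrite ler_peMr.
have k6 : e^-1 * (a * eta') = eta / 4.
  by rewrite mulrCA k4; field; rewrite gt_eqF.
have m1 : e^-1 * N2 (wt (-1) (vop z v)) <= eta / 4 * energy1 v + e^-1 * c1 * n.
  have := ler_wpM2l (ltW ie0) f1.
  have ar q : e^-1 * (eta' * q + c1 * n) = e^-1 * eta' * q + e^-1 * c1 * n by ring.
  rewrite ar k4 => h; apply: le_trans h _; by rewrite lerD2r ler_wpM2r.
have m2 : e^-1 * N2 R2 <= eta / 4 * energy1 v + e^-1 * (a * c2) * n + e^-1 * a * n.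
  apply: (@le_trans _ _ (e^-1 * (a * (eta' * energy1 v + c2 * n + n)))).
    rewrite ler_wpM2l ?(ltW ie0) //; apply: le_trans k2 _.
    by rewrite ler_wpM2l ?(ltW a_gt0) // lerD2r.
  have ar q : e^-1 * (a * (eta' * q + c2 * n + n)) =
    e^-1 * (a * eta') * q + e^-1 * (a * c2) * n + e^-1 * a * n by ring.
  by rewrite ar k6.
rewrite k3 in k1.
have k7 : 0 <= eta * energy1 v by rewrite mulr_ge0 // ltW.
have t1 : 0 <= e^-1 * c1 * n.
  by apply: mulr_ge0 => //; apply: mulr_ge0 => //; exact: ltW.
have t2 : 0 <= e^-1 * (a * c2) * n.
  apply: mulr_ge0 => //; apply: mulr_ge0; first exact: ltW.
  by apply: mulr_ge0 => //; exact: ltW.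
have t3 : 0 <= e^-1 * a * n.
  by apply: mulr_ge0 => //; apply: mulr_ge0; exact: ltW.
have -> : e^-1 * (c1 + a * c2 + a) * n =
  e^-1 * c1 * n + e^-1 * (a * c2) * n + e^-1 * a * n by ring.
by lra.
Qed.

End CommutatorEstimates.

(** * Propagation of the estimates to the generated Lie algebra *)

Section LieClosure.
Variables (R : realType) (d N : nat).
Local Notation C := R[i].
Local Notation Z := 'rV[int]_d.
Local Notation field := ('I_d -> Z -> C).
Variable X : 'I_N -> field.
Hypothesis X_rapid : forall j, rf (X j).
Hypothesis X_real : forall j, barf (X j) = X j.
Implicit Types (k : Z) (u v h g : Z -> C) (r s t : int) (y z : field).
Local Notation est := (est X).

Definition good z : Prop := [/\ rf z, est (vop z) & est (vop (barf z))].
(** Goodness of two fields does not directly give that of their bracket. The fields whose brackets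
    preserve [good], however, form a Lie algebra by Jacobi's identity, and it contains every
    [X j]. *)
Definition multiplier y : Prop := rf y /\ forall z, good z -> good (brk y z).

Lemma dom_vop8 z v : rf z -> ord (-10) v -> ord (-8) (vop z v).
Proof. by move=> hz hv; apply: ord_mono (dom_vop hz hv). Qed.

Lemma cvNl h v : cv (fun k => - h k) v = (fun k => - cv h v k).
Proof.
rewrite -cvNr; apply/funext => k; rewrite /cv; apply: eq_csum => l.
by rewrite mulNr mulrN.
Qed.

Lemma est_opp z : rf z -> est (vop z) -> est (vop (fun i k => - z i k)).
Proof.
move=> hz ez; apply: (est_ext (A := fun v k => -1 * vop z v k)).
  by move=> v hv; rewrite (vop_oppl hz hv); apply/funext => k; rewrite mulN1r.
by apply: (estZ (-1)) ez => v; apply: dom_vop8.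
Qed.

Lemma good_X j : good (X j).
Proof. by split=> //; rewrite ?X_real; apply: (est_X X_rapid). Qed.

Lemma rf_lin c y z : rf y -> rf z -> rf (fun i k => c * y i k + z i k).
Proof. by move=> hy hz i; apply: rapidD => //; apply: rapidZ. Qed.

Lemma est_lin c y z : rf y -> rf z -> est (vop y) -> est (vop z) ->
  est (vop (fun i k => c * y i k + z i k)).
Proof.
move=> hy hz ey ez; apply: (est_ext (A := fun v k => c * vop y v k + vop z v k)).
  by move=> v hv; rewrite (vop_addl c hy hz hv).
apply: (estD (A := fun v k => c * vop y v k)) ez.
- by move=> v hv; apply: ordZ; apply: dom_vop8.
- by move=> v; apply: dom_vop8.
- by apply: (estZ (c)) ey => v; apply: dom_vop8.
Qed.

Lemma barf_lin c y z : barf (fun i k => c * y i k + z i k) =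
  (fun i k => conjc c * barf y i k + barf z i k).
Proof.
by apply/funext => i; apply/funext => k; rewrite /barf /cbar rmorphD rmorphM.
Qed.

Lemma good_lin c y z : good y -> good z -> good (fun i k => c * y i k + z i k).
Proof.
move=> [ry ey eby] [rz ez ebz]; split; first exact: rf_lin.
  exact: est_lin.
by rewrite barf_lin; apply: est_lin => //; apply: rf_barf.
Qed.

Lemma multiplier_X j : multiplier (X j).
Proof.
split=> // z [rz ez ebz]; split; first exact: rf_brk.
  exact: (est_brk_X X_rapid X_real).
rewrite barf_brk // X_real; apply: est_opp; first by apply: rf_brk => //; apply: rf_barf.
by apply: (est_brk_X X_rapid X_real) => //; [apply: rf_barf | rewrite barfK].
Qed.

Lemma brk_lin c y y' z : rf y -> rf y' -> rf z ->
  brk (fun i k => c * y i k + y' i k) z = (fun i k => c * brk y z i k + brk y' z i k).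
Proof.
move=> hy hy' hz; apply/funext => i; apply/funext => k.
rewrite /brk mulr_sumr -big_split; apply: eq_bigr => l _ /=.
rewrite (cvDl (rapidZ c (hy l)) (hy' l) (rapid_Dm l (hz i) 0)).
rewrite (cvZl c (hy l) (rapid_Dm l (hz i) 0)) DmD.
rewrite (_ : Dm l (fun k => c * y i k) = (fun k => c * Dm l (y i) k)); last first.
  by apply/funext => m; rewrite /Dm mulrCA.
rewrite (cvDr (hz l) (ordZ c (rapid_Dm l (hy i) 0)) (rapid_Dm l (hy' i) 0)).
by rewrite (cvZr c (hz l) (rapid_Dm l (hy i) 0)); ring.
Qed.

Lemma multiplier_lin c y z : multiplier y -> multiplier z ->
  multiplier (fun i k => c * y i k + z i k).
Proof.
move=> [ry hy] [rz hz]; split; first exact: rf_lin.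
move=> w gw; have [rw _ _] := gw; rewrite brk_lin //.
by apply: good_lin; [apply: hy | apply: hz].
Qed.

Lemma brkNr y z : brk y (fun i k => - z i k) = (fun i k => - brk y z i k).
Proof.
apply/funext => i; apply/funext => k; rewrite /brk -sumrN; apply: eq_bigr => l _.
by rewrite DmN cvNr cvNl opprD.
Qed.

Lemma brkNl y z : brk (fun i k => - y i k) z = (fun i k => - brk y z i k).
Proof.
apply/funext => i; apply/funext => k; rewrite /brk -sumrN; apply: eq_bigr => l _.
by rewrite DmN cvNr cvNl opprD.
Qed.

Lemma fieldNN z : (fun i k => - - z i k) = z.
Proof. by apply/funext => i; apply/funext => k; rewrite opprK. Qed.

(** Jacobi's identity is checked on operators, where [vop_brk] turns it into an identity between
    sixfold expansions in compositions. *)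
Lemma est_jacobi y y' z : rf y -> rf y' -> rf z ->
  est (vop (brk y (brk y' z))) -> est (vop (brk y' (brk y z))) ->
  est (vop (brk (brk y y') z)).
Proof.
move=> hy hy' hz e1 e2.
have h1 := rf_brk hy hz; have h2 := rf_brk hy' hz; have h3 := rf_brk hy hy'.
have h4 := rf_brk hy h2; have h5 := rf_brk hy' h1.
apply: (est_ext (A := fun v k => vop (brk y (brk y' z)) v k +
                       -1 * vop (brk y' (brk y z)) v k)).
  move=> v hv.
  have o x : rf x -> ord (-9) (vop x v) by move=> hx; apply: dom_vop.
  have o2 x x' : rf x -> rf x' -> ord (-8) (vop x (vop x' v)).
    by move=> hx hx'; apply: (ord_vop hx (o x' hx')).
  rewrite (vop_brk hy h2 hv) (vop_brk hy' h1 hv) (vop_brk h3 hz hv).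
  rewrite (vop_brk hy' hz hv) (vop_brk hy hz hv) (vop_brk hy hy' hv).
  rewrite (vopB hy (o2 _ _ hy' hz) (o2 _ _ hz hy')).
  rewrite (vopB hy' (o2 _ _ hy hz) (o2 _ _ hz hy)).
  rewrite (vopB hz (o2 _ _ hy hy') (o2 _ _ hy' hy)).
  rewrite (vop_brk hy' hz (o y hy)) (vop_brk hy hz (o y' hy')) (vop_brk hy hy' (o z hz)).
  apply/funext => k.
  move: (vop y (vop y' (vop z v)) k) (vop y (vop z (vop y' v)) k)
    (vop y' (vop z (vop y v)) k) (vop z (vop y' (vop y v)) k)
    (vop y' (vop y (vop z v)) k) (vop z (vop y (vop y' v)) k).
  by move=> a1 a2 a3 a4 a5 a6; ring.
apply: (estD (B := fun v k => -1 * vop (brk y' (brk y z)) v k)) => //.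
- by move=> v; apply: dom_vop8.
- by move=> v hv; apply: ordZ; apply: dom_vop8.
- by apply: (estZ (-1)) e2 => v; apply: dom_vop8.
Qed.

Lemma multiplier_brk y y' : multiplier y -> multiplier y' -> multiplier (brk y y').
Proof.
move=> [hy my] [hy' my']; split; first exact: rf_brk.
move=> z gz; have [hz _ _] := gz.
have [_ e1 b1] := my _ (my' _ gz); have [_ e2 b2] := my' _ (my _ gz).
have rb := rf_barf hz; have ry := rf_barf hy; have ry' := rf_barf hy'.
split; first by apply: rf_brk => //; apply: rf_brk.
  exact: (est_jacobi hy hy' hz).
have bb x x' : rf x -> rf x' -> barf (brk x (brk x' z)) = brk (barf x) (brk (barf x') (barf z)).
  move=> hx hx'; rewrite (barf_brk hx (rf_brk hx' hz)).
  by rewrite (barf_brk hx' hz) brkNr fieldNN.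
rewrite (bb _ _ hy hy') in b1; rewrite (bb _ _ hy' hy) in b2.
rewrite (barf_brk (rf_brk hy hy') hz).
rewrite (barf_brk hy hy') brkNl fieldNN.
exact: (est_jacobi ry ry' rb).
Qed.

(** Both bounds are [h2], at [a = S / n] and at [a = 1]. *)
Lemma sqr_sum_le (I : Type) (q : seq I) (F : I -> R) :
  (\sum_(i <- q) F i) ^+ 2 <= (size q)%:R * \sum_(i <- q) F i ^+ 2 /\
  2 * (\sum_(i <- q) F i) <= (size q)%:R + \sum_(i <- q) F i ^+ 2.
Proof.
have h2 a : 2 * a * (\sum_(i <- q) F i) <= (size q)%:R * a ^+ 2 + \sum_(i <- q) F i ^+ 2.
  elim: q => [|i q IH]; first by rewrite !big_nil mulr0 mul0r addr0.
  have hs := sqr_ge0 (a - F i); rewrite !big_cons /= -natr1.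
  move: IH hs; set S := \sum_(_ <- _) _; set T := \sum_(_ <- _) _.
  by move: S T (F i) => S T f IH hs; nra.
split; last by have := h2 1; rewrite mulr1 expr1n mulr1.
case: (posnP (size q)) => [/size0nil ->|n0]; first by rewrite !big_nil expr0n mul0r.
have n0' : (0 : R) < (size q)%:R by rewrite ltr0n.
set S := \sum_(i <- q) F i; set Q := \sum_(i <- q) _.
have := h2 (S / (size q)%:R); rewrite -/S -/Q; move: ((size q)%:R) n0' => n n0'.
have -> : 2 * (S / n) * S = 2 * (S ^+ 2 / n) by ring.
have -> : n * (S / n) ^+ 2 = S ^+ 2 / n by field; rewrite gt_eqF.
by rewrite mulr_natl mulr2n lerD2l ler_pdivrMr // mulrC.
Qed.

Lemma good_brk y z : multiplier y -> good z -> good (brk y z).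
Proof. by move=> [_]; apply. Qed.

Lemma csm_rapid h : rapid h -> csm h.
Proof. by move=> hh; apply: (nsm_ord2 (hh _)). Qed.

Lemma fser_vop z v x : rf z -> ord (-4) v ->
  fser (vop z v) x = \sum_i fser (z i) x * fser (Dm i v) x.
Proof.
move=> hz hv; rewrite /fser /vop.
have o1 i : ord (-3) (Dm i v) by apply: (ord_Dm i hv).
have s1 i : csm (Dm i v) by apply: nsm_ord2; apply: ord_mono (o1 i).
have s2 i : csm (cv (z i) (Dm i v)).
  by apply: nsm_ord2; apply: (@ord_mono _ _ (-3)) => //; apply: ord_cv.
have [_ e] := csm_sum (index_enum 'I_d) (P := xpredT) (fun i _ => fser_sm x (s2 i)).
transitivity (\sum_i csum (fun k => cv (z i) (Dm i v) k * fmode k x)).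
  by rewrite -e; apply: eq_csum => k; rewrite mulr_suml.
apply: eq_bigr => i _; apply: (@fser_cv R d (z i) (Dm i v) x).
- exact: csm_rapid.
- exact: s1.
- by move=> k; apply: cv_sm (o1 i).
Qed.

(** Since the good fields [y a] span uniformly, the derivatives of [g = br^(-1) v] are bounded by
    the [y a g]. These are the [br^(-1) y a v] up to commutators bounded by [low v], and the norm of
    [v] is comparable to those of [g] and its first derivatives. *)
Lemma compactness_estimate (I : finType) (y : I -> field) (K : R) : 0 <= K ->
  (forall a, good (y a)) ->
  (forall x (p : 'I_d -> C),
     \sum_i nm (p i) ^+ 2 <= K * \sum_a nm (\sum_i fser (y a i) x * p i) ^+ 2) ->
  forall eta : R, 0 < eta -> exists2 c, 0 <= c & forall v, ord (-10) v ->
    N2 v <= eta * energy1 X v + c * low v.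
Proof.
move=> K0 gy hK eta h.
pose m : R := d.+1%:R; have m0 : 0 < m by rewrite ltr0n.
(* [A] collects the factors lost below, so that a share [eta / A] for each [y a] adds up to at most
   [eta]. *)
pose A := m * (1 + K * d%:R * 2 * #|I|.+1%:R).
have A0 : 0 < A.
  rewrite mulr_gt0 // ltr_wpDr //.
  by do ! apply: mulr_ge0 => //.
have [ry ey] : (forall a, rf (y a)) /\ (forall a, est (vop (y a))).
  by split=> a; case: (gy a).
have hA : 0 < eta / A by rewrite divr_gt0.
have /choice[c hc] : forall a, exists c, 0 <= c /\ forall v, ord (-10) v ->
    N2 (wt (-1) (vop (y a) v)) <= eta / A * energy1 X v + c * low v.
  by move=> a; have [c c0 hc] := ey a _ hA; exists c.
have /choice[e he] : forall a, exists e, 0 <= e /\ forall v, ord (-10) v ->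
    N2 (fun k => vop (y a) (wt (-1) v) k - wt (-1) (vop (y a) v) k) <= e * low v /\
    sq (fun k => vop (y a) (wt (-1) v) k - wt (-1) (vop (y a) v) k).
  move=> a; have [e e0 he] := oo_vop_comm (n := 1) isT (ry a) (-1).
  exists e; split=> // v hv.
  have s1 : sq (wt (-1) v) by apply: (@ord_sq _ _ (-10)) => //; apply: ord_wt_le.
  by have [] := he v s1; rewrite subrr wt0.
exists (A * \sum_a (c a + e a) + m).
  rewrite addr_ge0 ?(ltW m0) // mulr_ge0 ?(ltW A0) // sumr_ge0 // => a _.
  by rewrite addr_ge0 //; [case: (hc a) | case: (he a)].
move=> v hv; set n := low v; have n0 : 0 <= n by apply: low_ge0.
set Q := energy1 X v; have Q0 : 0 <= Q by apply: energy1_ge0.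
have eQ : 0 <= eta / A * Q by rewrite mulr_ge0 // ltW.
pose g := wt (-1) v.
have og : ord (-10) g by apply: ord_wt_le.
have sg : sq g by apply: ord_sq og.
have sD i : sq (Dm i g) by apply: (@ord_sq _ _ (-9)) => //; apply: (ord_Dm i og).
have b1 a : N2 (vop (y a) g) <= 2 * (eta / A * Q + (c a + e a) * n).
  have [_ /(_ v hv)[q1 q2]] := he a; have [_ /(_ v hv) q3] := hc a.
  have sW : sq (wt (-1) (vop (y a) v)).
    by apply: (@ord_sq _ _ (-9)) => //; apply: ord_wt_le => //; apply: dom_vop.
  have [_ q4] := sqD sW q2.
  rewrite (_ : (fun k => _) = vop (y a) g) in q4; last first.
    by apply/funext => k; rewrite addrC subrK.
  apply: le_trans q4 _; rewrite ler_pM2l //; apply: le_trans (lerD q3 q1) _.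
  by rewrite -addrA -mulrDl.
have b2 i : N2 (Dm i g) <= K * \sum_a N2 (vop (y a) g).
  apply: pointwise_N2 => //.
  - by apply: nsm_ord2; apply: (@ord_mono _ _ (-9)) => //; apply: (ord_Dm i og).
  - move=> a; apply: nsm_ord2; apply: (@ord_mono _ _ (-9)) => //; exact: dom_vop.
  move=> x; have := hK x (fun i => fser (Dm i g) x).
  have -> : \sum_a nm (\sum_i fser (y a i) x * fser (Dm i g) x) ^+ 2 =
            \sum_a nm (fser (vop (y a) g) x) ^+ 2.
    by apply: eq_bigr => a _; rewrite fser_vop //; apply: ord_mono og.
  apply: le_trans; rewrite (bigD1 i) //= lerDl; apply: sumr_ge0 => l _; exact: sqr_ge0.
have b3 : N2 v <= m * (N2 g + \sum_i N2 (Dm i g)).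
  have [sm sme] := nsm_sum (index_enum 'I_d) (P := xpredT) (fun i _ => sD i).
  rewrite /N2 -sme -nsumD // -nsumZ ?(ltW m0) //; last exact: nsmD.
  apply: le_nsum; first by apply: nsmZ; [exact: ltW | exact: nsmD].
  move=> k.
  have -> : nm (v k) = br R k * nm (g k).
    by rewrite nm_wt mulrA -{1}(expr1z (br R k)) -expfzDr ?br_neq0 // subrr expr0z mul1r.
  have -> : \sum_i nm (Dm i g k) ^+ 2 = (\sum_i `|k 0%R i|%N%:R ^+ 2) * nm (g k) ^+ 2.
    by rewrite mulr_suml; apply: eq_bigr => i _; rewrite nmM nm_int exprMn.
  rewrite exprMn -[X in _ <= m * (X + _)]mul1r -mulrDl mulrA ler_wpM2r ?sqr_ge0 //.
  have -> : br R k = 1 + \sum_i `|k 0%R i|%N%:R.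
    by rewrite /br -natr1 /absn natr_sum addrC.
  have [q1 q2] := sqr_sum_le (enum 'I_d) (fun i => `|k 0%R i|%N%:R : R).
  rewrite !big_enum size_enum_ord /= in q1 q2; rewrite /m -natr1.
  by move: q1 q2; move: (\sum_i _) (\sum_i _) => S T; nra.
have b4 : \sum_a N2 (vop (y a) g) <= 2 * #|I|%:R * (eta / A * Q) + 2 * (\sum_a (c a + e a)) * n.
  apply: (@le_trans _ _ (\sum_a 2 * (eta / A * Q + (c a + e a) * n))).
    by apply: ler_sum => a _.
  rewrite -mulr_sumr big_split /= sumr_const -mulr_suml mulrDr !mulrA.
  by rewrite le_eqVlt; apply/orP; left; apply/eqP; rewrite -mulr_natr; ring.
set T := \sum_a (c a + e a) in b4 *.
have T0 : 0 <= T.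
  by apply: sumr_ge0 => a _; rewrite addr_ge0 //; [case: (hc a) | case: (he a)].
have b5 : \sum_i N2 (Dm i g) <= d%:R * (K * \sum_a N2 (vop (y a) g)).
  have -> : d%:R * (K * \sum_a N2 (vop (y a) g)) = \sum_(i < d) (K * \sum_a N2 (vop (y a) g)).
    by rewrite sumr_const card_ord mulr_natl.
  by apply: ler_sum => i _.
have dK : 0 <= d%:R * K by rewrite mulr_ge0.
apply: le_trans b3 _; rewrite -/n.
apply: (@le_trans _ _ (m * (n + d%:R * K * (2 * #|I|%:R * (eta / A * Q) + 2 * T * n)))).
  rewrite ler_pM2l // lerD2l; apply: le_trans b5 _.
  by rewrite mulrA ler_wpM2l.
have c1 : m * (d%:R * K * (2 * #|I|%:R)) <= A.
  rewrite /A ler_pM2l //.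
  have -> : K * d%:R * 2 * #|I|.+1%:R = d%:R * K * (2 * #|I|%:R) + 2 * (d%:R * K).
    by rewrite -natr1; ring.
  by move: dK; lra.
have c2 : m * (d%:R * K * 2) <= A.
  rewrite /A ler_pM2l //.
  have -> : K * d%:R * 2 * #|I|.+1%:R = d%:R * K * 2 + (d%:R * K) * (2 * #|I|%:R).
    by rewrite -natr1; ring.
  by have := mulr_ge0 dK (mulr_ge0 (ler0n R 2) (ler0n R #|I|)); lra.
have -> : m * (n + d%:R * K * (2 * #|I|%:R * (eta / A * Q) + 2 * T * n)) =
  m * (d%:R * K * (2 * #|I|%:R)) * (eta / A * Q) + m * (d%:R * K * 2) * (T * n) + m * n.
  ring.
have -> : eta * Q + (A * T + m) * n = A * (eta / A * Q) + A * (T * n) + m * n.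
  by field; rewrite gt_eqF.
by rewrite lerD2r lerD // ler_wpM2r // mulr_ge0.
Qed.

End LieClosure.

(** * Weighted energy estimates *)

Section WeightedEnergy.
Variables (R : realType) (d N : nat).
Local Notation C := R[i].
Local Notation Z := 'rV[int]_d.
Local Notation field := ('I_d -> Z -> C).
Variable X : 'I_N -> field.
Hypothesis X_rapid : forall j, rf (X j).
Hypothesis X_real : forall j, barf (X j) = X j.
Implicit Types (k : Z) (u v w f h g : Z -> C) (r s t : int) (m : Z -> R).

Definition wm m v : Z -> C := fun k => (m k)%:C * v k.

Lemma wmJ m v k : conjc (wm m v k) = (m k)%:C * conjc (v k).
Proof. by rewrite /wm rmorphM /= conjc_real. Qed.

Definition adjX j v : Z -> C := fun k => vop (X j) v k + cv (divbar (X j)) v k.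

(* With w = m u these are m X u - X w and m^(-1) X^* m w - X^* w. *)
Definition err m j u : Z -> C := fun k => wm m (vop (X j) u) k - vop (X j) (wm m u) k.
Definition err' m j u : Z -> C := fun k =>
  wm (fun k => (m k)^-1) (adjX j (wm m (wm m u))) k - adjX j (wm m u) k.

(** The three cross terms are split with the parameters 1/2, 2 and 1; together they cost one [N2 a]
    out of the two on the right. *)
Lemma Re_ip_lower (a b c : Z -> C) : sq a -> sq b -> sq c ->
  N2 a <= 2 * complex.Re (ip (fun k => a k + b k) (fun k => a k + c k)) +
          3 * (N2 b + N2 c).
Proof.
move=> ha hb hc.
have [s1 _] := ip_sqP ha ha; have [s2 b2] := ip_sqP ha hc.
have [s3 b3] := ip_sqP hb ha; have [s4 b4] := ip_sqP hb hc.
have -> : ip (fun k => a k + b k) (fun k => a k + c k) = ip a a + ip a c + (ip b a + ip b c).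
  rewrite /ip -(csumD s1 s2) -(csumD s3 s4) -(csumD (csmD s1 s2) (csmD s3 s4)).
  by apply: eq_csum => k; rewrite rmorphD /=; ring.
have -> : ip a a = (N2 a)%:C.
  by rewrite /N2 -csum_real //; apply: eq_csum => k; rewrite nm_sqrJ.
have reD (x y : C) : complex.Re (x + y) = complex.Re x + complex.Re y by case: x; case: y.
rewrite !reD -[complex.Re (N2 a)%:C]/(N2 a).
have half : (0 : R) < 1 / 2 by lra.
have i2 : (1 / 2)^-1 = 2 :> R by rewrite mul1r invrK.
have c2 := b2 _ half; have two : (0 : R) < 2 by []. 
have c3 := b3 _ two; have c4 := b4 _ ltr01; rewrite i2 in c2; rewrite invr1 in c4.
have hneg (x : C) : - complex.Re x <= nm x.
  by apply: le_trans (ler_norm _) _; rewrite normrN Re_le_nm.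
have n2 := hneg (ip a c); have n3 := hneg (ip b a); have n4 := hneg (ip b c).
move: c2 c3 c4 n2 n3 n4; move: (ip a c) (ip b a) (ip b c) => x y z.
by move: (nm x) (nm y) (nm z) (complex.Re x) (complex.Re y) (complex.Re z) => *; lra.
Qed.

(** The order [- p - 8] of [m^2 u] makes its pairing with two derivatives of [u], of order [p + 2],
    absolutely convergent, also after integration by parts. *)
Definition admissible m u f (p : int) : Prop :=
  [/\ forall k, 0 < m k, ord p u, ord (- p - 8) (wm m (wm m u)),
      ord (-10) (wm m u) & sq (wm m f)].

(** The errors may use a small share [kap] of the energy, a possibly large multiple [G1] of the norm
    of [m u], which compactness absorbs, and a fixed amount [G0]. *)
Definition err_bound m u (kap G1 G0 : R) : Prop := forall j,
  [/\ sq (err m j u), sq (err' m j u),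
      N2 (err m j u) <= kap * energy X (wm m u) + G1 * N2 (wm m u) + G0 &
      N2 (err' m j u) <= kap * energy X (wm m u) + G1 * N2 (wm m u) + G0].

Lemma weighted_energy : exists2 kap : R, 0 < kap & forall G1, 0 <= G1 ->
  exists2 c, 0 <= c & forall m u f p G0,
    admissible m u f p -> 0 <= G0 -> err_bound m u kap G1 G0 ->
    (fun k => \sum_j vop (X j) (vop (X j) u) k) = f ->
    energy X (wm m u) <= c * (N2 (wm m f) + N2 (wm m u) + G0).
Proof.
pose n : R := N%:R + 1; have n1 : 1 <= n by rewrite lerDr.
have n0 : 0 < n by rewrite (lt_le_trans ltr01).
(* At most [n] error terms are counted with the factor 9, so this share costs [E / 4] in all, which
   is absorbed. *)
exists (1 / (36 * n)); first by rewrite divr_gt0 // mulr_gt0.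
move=> G1 G10.
have /choice[cg hcg] : forall j, exists c, 0 <= c /\ forall v, sq v ->
    sq (cv (divbar (X j)) v) /\ N2 (cv (divbar (X j)) v) <= c * N2 v.
  move=> j; have [c c0 hc] := oo_cv (rapid_divbar (X_rapid j)) 0.
  by exists c; split=> // v hv; have := hc v; rewrite subr0 !wt0; apply.
pose cG := \sum_j cg j.
have cG0 : 0 <= cG by apply: sumr_ge0 => j _; case: (hcg j).
exists (4 + 36 * n * (G1 + 1) + 24 * n * cG).
  have := mulr_ge0 (ltW n0) G10; have := mulr_ge0 (ltW n0) cG0; nra.
move=> m u f p G0 [m0 hu hmm hw sf] G00 hB hf.
set w := wm m u; set E := energy X w.
have sw : sq w by apply: dom_sq.
have E0 : 0 <= E by apply: energy_ge0.
have sX j : sq (vop (X j) w) by apply: ord_sq (dom_vop (X_rapid j) hw).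
pose B j := err m j u; pose B' j := err' m j u.
pose G j := cv (divbar (X j)) w.
have sG j : sq (G j) by have [_ /(_ w sw) []] := hcg j.
pose Rj j := fun k => G j k + B' j k.
have sR j : sq (Rj j) /\ N2 (Rj j) <= 2 * (cG * N2 w + (1 / (36 * n) * E + G1 * N2 w + G0)).
  have [h1 h2 h3 h4] := hB j; have [h5 h6] := sqD (sG j) h2; split=> //.
  apply: le_trans h6 _; rewrite ler_pM2l //; apply: lerD => //.
  have [_ /(_ w sw)[_ h7]] := hcg j; apply: le_trans h7 _.
  rewrite ler_wpM2r ?N2_ge0 // /cG (bigD1 j) //= lerDl; apply: sumr_ge0 => i _.
  by case: (hcg i).
have oXu j : ord (p + 1) (vop (X j) u) by apply: ord_vop.
have oXXu j : ord (p + 1 + 1) (vop (X j) (vop (X j) u)) by apply: ord_vop.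
have le1 : p + 1 + 1 + (- p - 8) <= -2 by lia.
(* One [X_j] is moved to the other factor. Conjugation by the weight turns the left factor into
   [X_j w] plus [err], and the right one into [X_j w] plus the divergence term and [err']. *)
have ipj j : ip (wm m (vop (X j) (vop (X j) u))) w =
    ip (fun k => vop (X j) w k + B j k) (fun k => vop (X j) w k + Rj j k).
  transitivity (ip (vop (X j) (vop (X j) u)) (wm m w)).
    by apply: eq_csum => k; rewrite [conjc (wm m w k)]wmJ mulrA [in RHS](mulrC _ (m k)%:C).
  rewrite (ip_vop (X_rapid j) (oXu j) hmm); last by lia.
  rewrite X_real -/(adjX j (wm m w)).
  transitivity (ip (wm m (vop (X j) u)) (wm (fun k => (m k)^-1) (adjX j (wm m w)))).
    apply: eq_csum => k; rewrite wmJ {1}/wm mulrACA -rmorphM /=.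
    by rewrite mulfV ?gt_eqF // mul1r.
  congr ip; apply/funext => k; first by rewrite /B /err addrC subrK.
  by rewrite /Rj /G /B' /err' addrA -/(adjX j w k) addrC subrK.
have csmj j : csm (fun k => wm m (vop (X j) (vop (X j) u)) k * conjc (w k)).
  have := ip_sm (oXXu j) hmm le1; congr csm; apply/funext => k.
  by rewrite [conjc (wm m w k)]wmJ mulrA [in LHS](mulrC _ (m k)%:C).
have ipf : ip (wm m f) w = \sum_j ip (wm m (vop (X j) (vop (X j) u))) w.
  have [_ <-] := csm_sum (index_enum 'I_N) (P := xpredT) (fun j _ => csmj j).
  by apply: eq_csum => k; rewrite -hf /wm mulr_sumr mulr_suml.
have key : E <= 2 * complex.Re (ip (wm m f) w) + \sum_j 3 * (N2 (B j) + N2 (Rj j)).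
  have reD : {morph (@complex.Re R) : x y / x + y >-> x + y} by move=> [? ?] [? ?].
  rewrite ipf (big_morph _ reD (erefl _)) mulr_sumr -big_split.
  apply: ler_sum => j _; rewrite ipj.
  have [h1 _ _ _] := hB j; have [h2 _] := sR j.
  exact: Re_ip_lower.
have b1 : 2 * complex.Re (ip (wm m f) w) <= N2 (wm m f) + N2 w.
  have [_ /(_ 1 ltr01)] := ip_sqP sf sw; rewrite invr1 !mul1r; apply: le_trans.
  by rewrite ler_pM2l //; apply: le_trans (ler_norm _) (Re_le_nm _).
set V := 1 / (36 * n) * E + G1 * N2 w + G0 in sR.
have w0 := N2_ge0 sw.
have b2 : \sum_j 3 * (N2 (B j) + N2 (Rj j)) <= N%:R * (9 * V + 6 * (cG * N2 w)).
  apply: (@le_trans _ _ (\sum_(j < N) (9 * V + 6 * (cG * N2 w)))).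
    apply: ler_sum => j _; have [_ h1] := sR j; have [_ _ h2 _] := hB j.
    move: h1 h2; rewrite -/(B j) -/w -/E -/V.
    by move: (N2 (B j)) (N2 (Rj j)) (cG * N2 w) => x y z; lra.
  by rewrite sumr_const card_ord -[X in X <= _]mulr_natl lexx.
have V0 : 0 <= V.
  apply: addr_ge0 => //; apply: addr_ge0; last exact: mulr_ge0.
  by apply: mulr_ge0 => //; apply: divr_ge0 => //; apply: mulr_ge0 => //; exact: ltW.
have b3 : N%:R * (9 * V + 6 * (cG * N2 w)) <= n * (9 * V + 6 * (cG * N2 w)).
  apply: ler_wpM2r; last by rewrite lerDl.
  by apply: addr_ge0; apply: mulr_ge0 => //; exact: mulr_ge0.
have eV : n * (9 * V + 6 * (cG * N2 w)) =
   E / 4 + 9 * n * (G1 * N2 w + G0) + 6 * n * cG * N2 w.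
  by rewrite /V; field; rewrite gt_eqF.
rewrite eV in b3.
have F0 := N2_ge0 sf.
have x1 := mulr_ge0 (ltW n0) G10; have x2 := mulr_ge0 (ltW n0) cG0.
have x3 := mulr_ge0 (ltW n0) w0; have x4 := mulr_ge0 (ltW n0) G00.
have x5 := mulr_ge0 x1 w0; have x6 := mulr_ge0 x1 G00; have x7 := mulr_ge0 x1 F0.
have x8 := mulr_ge0 x2 w0; have x9 := mulr_ge0 x2 G00; have x10 := mulr_ge0 x2 F0.
have x11 := mulr_ge0 (ltW n0) F0.
have b4 : E <= N2 (wm m f) + N2 w + (E / 4 + 9 * n * (G1 * N2 w + G0) + 6 * n * cG * N2 w).
  by apply: le_trans key _; apply: lerD => //; apply: le_trans b2 b3.
have -> : (4 + 36 * n * (G1 + 1) + 24 * n * cG) * (N2 (wm m f) + N2 w + G0) =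
 4 * N2 (wm m f) + 4 * N2 w + 4 * G0 + 36 * (n * G1 * N2 (wm m f)) + 36 * (n * G1 * N2 w) +
 36 * (n * G1 * G0) + 36 * (n * N2 (wm m f)) + 36 * (n * N2 w) + 36 * (n * G0) +
 24 * (n * cG * N2 (wm m f)) + 24 * (n * cG * N2 w) + 24 * (n * cG * G0) by ring.
have e5 : 9 * n * (G1 * N2 w + G0) + 6 * n * cG * N2 w =
  9 * (n * G1 * N2 w) + 9 * (n * G0) + 6 * (n * cG * N2 w) by ring.
move: b4; rewrite -[E / 4 + _ + _]addrA e5.
move: x3 x4 x5 x6 x7 x8 x9 x10 x11 F0 w0 G00 E0.
move: (n * G1 * _) (n * G1 * _) (n * G1 * _) (n * cG * _) (n * cG * _) (n * cG * _).
move: (n * _) (n * _) (n * _) => *; lra.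
Qed.

Definition Nlow (K : nat) v : R :=
  nsum (fun k => if (absn k <= K)%N then nm (v k) ^+ 2 else 0).

(** Beyond the radius [K > 1 / e] one has [br^(-2) <= e], so [low] only costs finitely many
    frequencies. *)
Lemma low_cut (e : R) : 0 < e -> exists K : nat, forall v, sq v ->
  low v <= e * N2 v + Nlow K v.
Proof.
move=> e0; exists (Num.truncn e^-1).+1 => v hv.
set K := (Num.truncn _).+1.
have hl : nsm (fun k => if (absn k <= K)%N then nm (v k) ^+ 2 else 0).
  by apply: (nsm_le hv) => k; case: ifP => _; rewrite ?lexx ?sqr_ge0.
have he := nsmZ (ltW e0) hv.
rewrite /low /N2 -nsumZ ?(ltW e0) // -(nsumD he hl).
apply: le_nsum; first exact: nsmD.
move=> k; rewrite nm_wt exprMn.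
have b0 := br_gt0 R k; have i0 : 0 < (br R k)^-1 by rewrite invr_gt0.
have i1 : (br R k)^-1 <= 1 by rewrite invf_le1 ?br_ge1.
rewrite exprN1; case: ifP => hk.
  rewrite -[leLHS]add0r; apply: lerD; first by apply: mulr_ge0; rewrite ?sqr_ge0 ?(ltW e0).
  by rewrite ler_piMl ?sqr_ge0 // expr2 mulr_ile1 // ltW.
rewrite addr0 ler_wpM2r ?sqr_ge0 //.
have hb : e^-1 <= br R k.
  apply: ltW; apply: lt_le_trans (_ : K%:R <= _).
    by rewrite /K; apply: truncnS_gt.
  by rewrite /br ler_nat; move: hk => /negbT; rewrite -ltnNge => /ltnW/leq_trans; apply.
apply: (@le_trans _ _ ((br R k)^-1)).
  by rewrite expr2 ler_piMl ?(ltW i0).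
by rewrite -[leRHS]invrK lef_pV2 ?posrE ?invr_gt0.
Qed.

Hypothesis compactness : forall eta : R, 0 < eta -> exists2 c, 0 <= c &
  forall v, ord (-10) v -> N2 v <= eta * energy1 X v + c * low v.

(** The order of the quantifiers matters: [kap], then an arbitrary [G1], then [c] and [K], and the
    weight last. Thus all truncations of a weight obey the same bound, in which [m u] enters the
    right side only through finitely many coefficients. *)
Lemma master_estimate : exists2 kap : R, 0 < kap & forall G1, 0 <= G1 ->
  exists c, exists2 K, 0 <= c & forall m u f p G0,
    admissible m u f p -> 0 <= G0 -> err_bound m u kap G1 G0 ->
    (fun k => \sum_j vop (X j) (vop (X j) u) k) = f ->
    N2 (wm m u) <= c * (N2 (wm m f) + G0 + Nlow K (wm m u)).
Proof.
have [kap kap0 hk] := weighted_energy; exists kap => // G1 G10.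
have [c1 c10 hc1] := hk G1 G10.
(* The energy and [low] are each made to cost a quarter of [N2 (wm m u)], which leaves half of it on
   the left. *)
pose eta := 1 / (4 * (c1 + 1)).
have d0 : 0 < 4 * (c1 + 1) by rewrite mulr_gt0 // ltr_wpDl.
have eta0 : 0 < eta by rewrite divr_gt0.
have [c2 c20 hc2] := compactness eta0.
have e0 : 0 < 1 / (4 * (c2 + 1)) by rewrite divr_gt0 // mulr_gt0 // ltr_wpDl.
have [K hK] := low_cut e0.
exists (2 * (1 + c2)), K; first by rewrite mulr_ge0 // addr_ge0.
move=> m u f p G0 adm G00 hB hf; have [m0 hu hmm hw sf] := adm.
set w := wm m u; have sw : sq w by apply: dom_sq.
have b1 := hc1 m u f p G0 adm G00 hB hf; have b2 := hc2 _ hw; have b3 := hK w sw.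
rewrite -/w in b1 b2.
have w0 := N2_ge0 sw; have F0 := N2_ge0 sf.
have l0 : 0 <= Nlow K w.
  apply: nsum_ge0; apply: (nsm_le sw) => k; by case: ifP => _; rewrite ?lexx ?sqr_ge0.
have b4 : eta * energy1 X w <= (N2 (wm m f) + G0) / 4 + N2 w / 4.
  rewrite /energy1; apply: (@le_trans _ _ (eta * ((c1 + 1) * (N2 (wm m f) + N2 w + G0)))).
    rewrite ler_pM2l // mulrDl mul1r lerD // -addrA addrCA lerDl addr_ge0 //.
  have -> : eta * ((c1 + 1) * (N2 (wm m f) + N2 w + G0)) = (N2 (wm m f) + N2 w + G0) / 4.
    by rewrite /eta; field; rewrite gt_eqF // ltr_wpDl.
  lra.
have b5 : c2 * low w <= N2 w / 4 + c2 * Nlow K w.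
  apply: le_trans (ler_wpM2l c20 b3) _; rewrite mulrDr lerD2r.
  apply: (@le_trans _ _ ((c2 + 1) * (1 / (4 * (c2 + 1)) * N2 w))).
    by rewrite ler_wpM2r ?lerDl // mulr_ge0 // ltW.
  rewrite le_eqVlt; apply/orP; left; apply/eqP; field.
  by rewrite gt_eqF // ltr_wpDl.
have b6 : 0 <= c2 * (N2 (wm m f) + G0) by rewrite mulr_ge0 // addr_ge0.
by move: b2 b4 b5 b6; move: (eta * _) (c2 * low w) => x y; rewrite !mulrDr !mulrDl; lra.
Qed.

End WeightedEnergy.

(** * Commutators of weights with multiplications *)

Section WeightErrors.
Variables (R : realType) (d : nat).
Local Notation C := R[i].
Local Notation Z := 'rV[int]_d.
Implicit Types (k l : Z) (u v w f h g : Z -> C) (m : Z -> R).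

(** The commutator of multiplication by [h] with the weight [m], written as an operator on [m v]
    ([wm_cv_errI]); only ratios of weights enter. *)
Definition errI h m v : Z -> C :=
  fun k => csum (fun l => h (k - l) * (m k / m l - 1)%:C * v l).

Lemma errI_young h m v g (al : Z -> R) : nsm al -> sq g ->
  (forall k l, nm (h (k - l)) * `|m k / m l - 1| * nm (v l) <= al (k - l) * nm (g l)) ->
  sq (errI h m v) /\ N2 (errI h m v) <= nsum al ^+ 2 * N2 g.
Proof.
move=> ha hg hb; apply: (young ha hg) => k.
have [hs1 _ _] := nsum_conv ha hg; have [hs2 _] := nsm_shift k ha.
have [hs3 _] := weighted_cauchy hs2 (fun l => nm_ge0 (g l)) (hs1 k).
by apply: nm_csum_le hs3 _ => l; rewrite !nmM nm_real; apply: hb.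
Qed.

Lemma errI0 h m v : (forall k l, h (k - l) != 0 -> m k = m l) -> (forall k, 0 < m k) ->
  errI h m v = (fun=> 0).
Proof.
move=> hm m0; apply/funext => k; rewrite /errI -[RHS](@csum0 R Z).
apply: eq_csum => l; case: (eqVneq (h (k - l)) 0) => [->|/hm ->]; first by rewrite !mul0r.
by rewrite mulfV ?gt_eqF // subrr mulr0 mul0r.
Qed.

Lemma wm_cv_errI h m v r s : rapid h -> ord r v -> ord s (wm m v) -> (forall k, 0 < m k) ->
  (fun k => wm m (cv h v) k - cv h (wm m v) k) = errI h m (wm m v).
Proof.
move=> hh hv hw m0; apply/funext => k; rewrite {1}/wm {1 2}/cv.
rewrite -csumZ; last exact: cv_sm hv.
rewrite -csumB; last exact: cv_sm hw.
  apply: eq_csum => l; rewrite /wm rmorphB rmorphM fmorphV /=.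
  by field; rewrite -(rmorph0 (real_complex R)) (inj_eq (@complexI R)) gt_eqF.
by apply: csmZ; apply: cv_sm hv.
Qed.

Lemma lam_ratio (lam : R) a b n : 1 <= lam -> (a <= b + n)%N -> (b <= a + n)%N ->
  `|lam ^+ a / lam ^+ b - 1| <= lam ^+ n - 1.
Proof.
move=> l1 h1 h2; have l0 : 0 < lam := lt_le_trans ltr01 l1.
have p x : 1 <= lam ^+ x by apply: exprn_ege1.
have p0 x : 0 < lam ^+ x by apply: exprn_gt0.
case: (leqP b a) => ab.
  have e : lam ^+ a = lam ^+ (a - b) * lam ^+ b by rewrite -exprD subnK.
  rewrite e mulfK ?gt_eqF // ger0_norm ?subr_ge0 // lerD2r.
  by apply: ler_weXn2l => //; rewrite leq_subLR.
have e : lam ^+ b = lam ^+ (b - a) * lam ^+ a by rewrite -exprD subnK // ltnW.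
rewrite e invfM mulrA mulrAC mulfV ?gt_eqF // mul1r.
have q : lam ^+ (b - a) <= lam ^+ n by apply: ler_weXn2l => //; rewrite leq_subLR.
have q1 := p (b - a)%N; move: (lam ^+ (b - a)) (p0 (b - a)%N) q q1 => x x0 q q1.
rewrite distrC ger0_norm ?subr_ge0 ?invf_le1 //.
apply: le_trans (_ : x - 1 <= _); last by rewrite lerD2r.
have xi : x * x^-1 = 1 by rewrite mulfV // gt_eqF.
have i0 : 0 < x^-1 by rewrite invr_gt0.
by move: xi i0; move: (x^-1) => y; nra.
Qed.

Lemma lam_pow1 (lam : R) n : 1 <= lam -> lam ^+ n - 1 <= (lam - 1) * (n%:R * lam ^+ n).
Proof.
move=> l1; elim: n => [|n IH]; first by rewrite expr0 subrr mul0r mulr0.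
rewrite exprS -natr1; have p : 1 <= lam ^+ n by apply: exprn_ege1.
have n0 : 0 <= n%:R :> R by [].
move: p n0 IH; move: (lam ^+ n) (n%:R) => x y x1 y0 IH.
have l0 : 0 <= lam - 1 by rewrite subr_ge0.
have := mulr_ge0 l0 (mulr_ge0 y0 (le_trans ler01 x1)).
have := mulr_ge0 l0 (mulr_ge0 l0 (mulr_ge0 y0 (le_trans ler01 x1))).
have := mulr_ge0 l0 (mulr_ge0 l0 (le_trans ler01 x1)).
nra.
Qed.

(** Induction on [p]: with [v] the midpoint of [w] and 1 and [w = x v], one factor [n + 1] is paid
    by [x^n] and the others by [v^n]. *)
Lemma poly_geom (p : nat) (w : R) : 0 <= w < 1 ->
  exists2 c, 0 <= c & forall n, n.+1%:R ^+ p * w ^+ n <= c.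
Proof.
elim: p w => [|p IH] w /andP[w0 w1].
  by exists 1 => // n; rewrite expr0 mul1r exprn_ile1 // ltW.
pose v := (1 + w) / 2; have v0 : 0 < v by rewrite /v; lra.
have [|c c0 hc] := IH v; first by apply/andP; split; rewrite /v; lra.
pose x := w / v; have x0 : 0 <= x by rewrite divr_ge0 // ltW.
have x1 : x < 1 by rewrite /x ltr_pdivrMr // mul1r /v; lra.
exists ((1 - x)^-1 * c); first by rewrite mulr_ge0 // invr_ge0 subr_ge0 ltW.
move=> n; have -> : w = x * v by rewrite /x divfK // gt_eqF.
rewrite exprMn exprS.
have -> : n.+1%:R * n.+1%:R ^+ p * (x ^+ n * v ^+ n) =
  (n.+1%:R * x ^+ n) * (n.+1%:R ^+ p * v ^+ n) by ring.
apply: ler_pM => //; try by rewrite mulr_ge0 // exprn_ge0 // ?ltW.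
rewrite -[leRHS]mul1r ler_pdivlMr ?subr_gt0 //.
apply: le_trans (_ : 1 - x ^+ n.+1 <= _); last by rewrite lerBlDr lerDl exprn_ge0.
elim: n => [|n IHn]; first by rewrite expr0 expr1 !mul1r.
have h1 : x ^+ n.+1 <= x ^+ n by rewrite exprS ler_piMl ?exprn_ge0 // ltW.
have h2 : 0 <= n.+1%:R * (1 - x) * (x ^+ n - x ^+ n.+1).
  by rewrite !mulr_ge0 ?subr_ge0 // ltW.
rewrite -natr1 mulrDl mul1r [x ^+ n.+2]exprS.
by move: IHn h2; move: (n.+1%:R) (x ^+ n) (x ^+ n.+1) => a y z; nra.
Qed.

Lemma prz_le_br k (r : int) : pr R k ^ r <= br R k ^+ (d * `|r|)%N.
Proof.
apply: (@le_trans _ _ (pr R k ^+ `|r|%N)).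
  by rewrite exprnP; apply: ler_weXz2l; [exact: pr_ge1 | rewrite abszE ler_norm].
by rewrite exprM lerXn2r ?nnegrE ?exprn_ge0 ?(ltW (br_gt0 R k)) ?(ltW (pr_gt0 R k)) // pr_le_br.
Qed.

Lemma geom_rapid h (c w : R) : 0 <= c -> 0 <= w < 1 ->
  (forall k, nm (h k) <= c * w ^+ absn k) -> rapid h.
Proof.
move=> c0 hw hh r; have [e e0 he] := poly_geom (d * `|r|%N) hw.
exists (c * e) => k; apply: le_trans (hh k) _; rewrite -mulrA ler_wpM2l //.
have := he (absn k); rewrite -/(br R k) => h1.
have p0 := prz_gt0 R k r; rewrite -ler_pdivrMr //.
apply: le_trans h1; rewrite mulrC ler_wpM2r ?exprn_ge0 //; first by case/andP: hw.
by have := prz_le_br k (- r); rewrite abszN -invr_expz.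
Qed.

Lemma br_rapid h : (forall q : nat, exists c, forall k, br R k ^+ q * nm (h k) <= c) -> rapid h.
Proof.
move=> H r; have [c hc] := H (d * `|r|)%N; exists c => k.
have p0 := prz_gt0 R k r; rewrite -ler_pdivrMr // mulrC.
apply: le_trans (hc k); rewrite ler_wpM2r ?nm_ge0 //.
by have := prz_le_br k (- r); rewrite abszN -invr_expz.
Qed.

Lemma rapid_lam h (c rho lam : R) : 0 <= c -> 0 <= rho -> 0 <= lam -> lam * rho < 1 ->
  (forall k, nm (h k) <= c * rho ^+ absn k) ->
  forall n, nsm (fun k => nm (h k) * lam ^+ absn k * br R k ^+ n).
Proof.
move=> c0 r0 l0 lr hh n.
have : rapid (fun k => h k * (lam ^+ absn k)%:C).
  apply: (@geom_rapid _ c (lam * rho)) => //; first by rewrite mulr_ge0.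
  move=> k; rewrite nmM nm_real ger0_norm ?exprn_ge0 // exprMn mulrC mulrCA.
  by rewrite ler_wpM2l ?exprn_ge0.
move=> /(rapid_br n); congr nsm; apply/funext => k.
by rewrite nmM nm_real ger0_norm // exprn_ge0.
Qed.

End WeightErrors.

(** * Error bounds from weight ratios, and smoothness *)

Section Claims.
Variables (R : realType) (d N : nat).
Local Notation C := R[i].
Local Notation Z := 'rV[int]_d.
Local Notation field := ('I_d -> Z -> C).
Variable X : 'I_N -> field.
Hypothesis X_rapid : forall j, rf (X j).
Hypothesis X_real : forall j, barf (X j) = X j.
Implicit Types (k l : Z) (u v w f h g : Z -> C) (m : Z -> R).

Definition minv m : Z -> R := fun k => (m k)^-1.

Lemma err_errI m j u f p : admissible m u f p ->
  err X m j u = (fun k => \sum_i errI (X j i) m (Dm i (wm m u)) k).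
Proof.
move=> [m0 hu _ hw _]; apply/funext => k.
rewrite /err /wm /vop mulr_sumr -sumrB; apply: eq_bigr => i _.
have e v : Dm i (wm m v) = wm m (Dm i v).
  by apply/funext => l; rewrite /Dm /wm mulrCA.
have ho : ord (-10 + 1) (wm m (Dm i u)) by rewrite -e; apply: ord_Dm.
by rewrite -[fun k => _]/(wm m u) e -(wm_cv_errI (X_rapid j i) (ord_Dm i hu) ho m0).
Qed.

(** Conjugation by [m] makes the adjoint act on [m (m u)]. Seen from the inverse weight [minv m],
    this is again a commutator acting on [m u]. *)
Lemma err'_errI m j u f p : admissible m u f p ->
  err' X m j u = (fun k => \sum_i errI (X j i) (minv m) (Dm i (wm m u)) k +
                  errI (divbar (X j)) (minv m) (wm m u) k).
Proof.
move=> [m0 hu hmm hw _]; apply/funext => k.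
have i0 l : 0 < minv m l by rewrite invr_gt0.
have e mm v i : Dm i (wm mm v) = wm mm (Dm i v).
  by apply/funext => l; rewrite /Dm /wm mulrCA.
have em v : wm (minv m) (wm m v) = v.
  by apply/funext => l; rewrite /wm mulrA -rmorphM mulVf ?gt_eqF // mul1r.
rewrite /err' /adjX {1}/wm mulrDr opprD addrACA; congr (_ + _).
  rewrite /vop mulr_sumr -sumrB; apply: eq_bigr => i _.
  have o1 := ord_Dm i hmm; have o2 := ord_Dm i hw.
  have := wm_cv_errI (X_rapid j i) o1 (s := -10 + 1) (m := minv m).
  rewrite -(e (minv m)) em => /(_ o2 i0)/(congr1 (fun F => F k)) <-.
  by rewrite /wm /minv.
have := wm_cv_errI (rapid_divbar (X_rapid j)) hmm (s := -10) (m := minv m).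
by rewrite em => /(_ hw i0)/(congr1 (fun F => F k)) <-.
Qed.

(** The factor [2^d d] comes from [sq_sum] over the [d] components, the outer 2 from [sqD] with the
    divergence term. *)
Definition errC : R := 2 * (2 ^+ d * d%:R + 1).

Lemma err_bound_errI m u f p (b : R) : admissible m u f p -> 0 <= b ->
  (forall j i, [/\ sq (errI (X j i) m (Dm i (wm m u))),
     sq (errI (X j i) (minv m) (Dm i (wm m u))),
     N2 (errI (X j i) m (Dm i (wm m u))) <= b &
     N2 (errI (X j i) (minv m) (Dm i (wm m u))) <= b]) ->
  (forall j, sq (errI (divbar (X j)) (minv m) (wm m u)) /\
     N2 (errI (divbar (X j)) (minv m) (wm m u)) <= b) ->
  forall j, [/\ sq (err X m j u), sq (err' X m j u),
     N2 (err X m j u) <= errC * b & N2 (err' X m j u) <= errC * b].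
Proof.
move=> adm b0 h1 h2 j; rewrite (err_errI _ adm) (err'_errI _ adm).
have p0 : (0 : R) <= 2 ^+ d by rewrite exprn_ge0.
have q1 : 1 <= errC.
  by rewrite /errC; have := mulr_ge0 p0 (ler0n R d); move: (_ * d%:R) => x; lra.
have sumb (F : 'I_d -> Z -> C) : (forall i, sq (F i) /\ N2 (F i) <= b) ->
   sq (fun k => \sum_i F i k) /\ N2 (fun k => \sum_i F i k) <= 2 ^+ d * d%:R * b.
  move=> hF; have [g1 g2] := sq_sum (enum 'I_d) (fun i => (hF i).1).
  have e : (fun k => \sum_(i <- enum 'I_d) F i k) = (fun k => \sum_i F i k).
    by apply/funext => k; rewrite big_enum.
  rewrite e big_enum size_enum_ord /= in g1 g2; split=> //.
  apply: le_trans g2 _; rewrite -mulrA ler_wpM2l //.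
  apply: (@le_trans _ _ (\sum_(i < d) b)); first by apply: ler_sum => i _; case: (hF i).
  by rewrite sumr_const card_ord -[X in X <= _]mulr_natl lexx.
have [s1 n1] := sumb (fun i => errI (X j i) m (Dm i (wm m u))) (fun i => let: And4 a _ c _ := h1 j i in conj a c).
have [s2 n2] := sumb (fun i => errI (X j i) (minv m) (Dm i (wm m u))) (fun i => let: And4 _ a _ c := h1 j i in conj a c).
have [s3 n3] := h2 j; have [s4 n4] := sqD s2 s3.
split=> //.
  apply: le_trans n1 _; rewrite ler_wpM2r // /errC.
  by have := mulr_ge0 p0 (ler0n R d); move: (_ * d%:R) => x; lra.
apply: le_trans n4 _; rewrite /errC -mulrA ler_pM2l // mulrDl mul1r; exact: lerD.
Qed.

Lemma adm_bounded m u f c : (forall k, 0 < m k <= c) -> rapid u -> rapid f ->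
  admissible m u f 0.
Proof.
move=> hm hu hf; have m0 k : 0 < m k by case/andP: (hm k).
have r g : rapid g -> rapid (wm m g).
  move=> hg s; rewrite -[s]add0r; apply: (@ord_mulf _ _ _ _ _ _ c) => // k.
  by rewrite nm_real expr0z mulr1 gtr0_norm //; case/andP: (hm k).
split; [exact: m0 | exact: (hu 0) | exact: (r _ (r _ hu) _) | exact: (r _ hu _) |].
exact: (nsm_ord1 (r _ hf _)).
Qed.

Lemma N2_ge_one v k (c : R) : sq v -> N2 v <= c -> nm (v k) <= 1 + c.
Proof.
move=> hv hc; have := nsum_ge k hv; rewrite -/(N2 v) /= => h.
have := le_trans h hc; have := nm_ge0 (v k); move: (nm _) => x; nra.
Qed.

Lemma Nlow_le K v g : sq g -> (forall k, (absn k <= K)%N -> nm (v k) <= nm (g k)) ->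
  Nlow K v <= N2 g.
Proof.
move=> hg h; apply: le_nsum => // k; case: ifP => hk; last exact: sqr_ge0.
by rewrite lerXn2r ?nnegrE ?nm_ge0 // h.
Qed.

Definition kernel_sum (om : Z -> R) : R :=
  \sum_j (\sum_i nsum (fun k => nm (X j i k) * om k) ^+ 2 +
          nsum (fun k => nm (divbar (X j) k) * om k) ^+ 2).

(** A single sequence [g] has to dominate the derivatives of [m u], up to a factor [om (k - l)] that
    may grow as fast as the decay of the coefficients of the fields permits. *)
Lemma err_kernel (om : Z -> R) g m u f p : admissible m u f p -> sq g ->
  (forall j i, nsm (fun k => nm (X j i k) * om k)) ->
  (forall j, nsm (fun k => nm (divbar (X j) k) * om k)) ->
  (forall m', m' = m \/ m' = minv m -> forall k l,
     (forall i, `|m' k / m' l - 1| * (`|l 0%R i|%N%:R * nm (wm m u l)) <= om (k - l) * nm (g l)) /\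
     `|m' k / m' l - 1| * nm (wm m u l) <= om (k - l) * nm (g l)) ->
  forall j, [/\ sq (err X m j u), sq (err' X m j u),
     N2 (err X m j u) <= errC * (kernel_sum om * N2 g) &
     N2 (err' X m j u) <= errC * (kernel_sum om * N2 g)].
Proof.
move=> adm hg h1 h2 hb.
have s0 j i : 0 <= nsum (fun k => nm (X j i k) * om k) ^+ 2 by apply: sqr_ge0.
have s0' j : 0 <= nsum (fun k => nm (divbar (X j) k) * om k) ^+ 2 by apply: sqr_ge0.
have s1 j : 0 <= \sum_i nsum (fun k => nm (X j i k) * om k) ^+ 2 by apply: sumr_ge0.
have le1 j i : nsum (fun k => nm (X j i k) * om k) ^+ 2 <= kernel_sum om.
  rewrite /kernel_sum (bigD1 j) //= (bigD1 i) //= -!addrA lerDl.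
  rewrite addr_ge0 ?sumr_ge0 // addr_ge0 // sumr_ge0 // => j' _; exact: addr_ge0.
have le2 j : nsum (fun k => nm (divbar (X j) k) * om k) ^+ 2 <= kernel_sum om.
  rewrite /kernel_sum (bigD1 j) //= addrAC lerDr addr_ge0 //.
  by apply: sumr_ge0 => j' _; exact: addr_ge0.
have gg := N2_ge0 hg.
apply: (err_bound_errI adm).
- rewrite mulr_ge0 // /kernel_sum sumr_ge0 // => j _; exact: addr_ge0.
- move=> j i.
  have H m' : m' = m \/ m' = minv m ->
      sq (errI (X j i) m' (Dm i (wm m u))) /\
      N2 (errI (X j i) m' (Dm i (wm m u))) <= kernel_sum om * N2 g.
    move=> hm'; have [|q1 q2] := @errI_young R d (X j i) m' (Dm i (wm m u)) g _ (h1 j i) hg.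
      move=> k l; have [/(_ i) hi _] := hb m' hm' k l.
      by rewrite nmM nm_int -mulrA -[leRHS]mulrA ler_wpM2l ?nm_ge0.
    split=> //; apply: le_trans q2 _; exact: ler_wpM2r.
  by have [a1 a2] := H m (or_introl erefl); have [a3 a4] := H (minv m) (or_intror erefl).
move=> j; have [|q1 q2] := @errI_young R d (divbar (X j)) (minv m) (wm m u) g _ (h2 j) hg.
  move=> k l; have [_ hi] := hb (minv m) (or_intror erefl) k l.
  by rewrite -mulrA -[leRHS]mulrA ler_wpM2l ?nm_ge0.
split=> //; apply: le_trans q2 _; exact: ler_wpM2r.
Qed.

Lemma pow_ratio (x D de : R) n : 0 <= x <= D -> 1 <= D -> `|x - 1| <= de ->
  `|x ^+ n - 1| <= n%:R * de * D ^+ n.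
Proof.
move=> /andP[x0 xD] D1 hx; have de0 : 0 <= de := le_trans (normr_ge0 _) hx.
elim: n => [|n IH]; first by rewrite !expr0 subrr normr0 !mul0r.
have -> : x ^+ n.+1 - 1 = x * (x ^+ n - 1) + (x - 1) by rewrite exprS; ring.
apply: le_trans (ler_normD _ _) _; rewrite normrM (ger0_norm x0).
apply: le_trans (lerD (ler_pM x0 (normr_ge0 _) xD IH) hx) _.
have p1 : 1 <= D ^+ n.+1 by apply: exprn_ege1.
have -> : n.+1%:R * de * D ^+ n.+1 = D * (n%:R * de * D ^+ n) + de * D ^+ n.+1.
  by rewrite -natr1 exprS; ring.
by rewrite lerD2l ler_peMr.
Qed.

Lemma Nlow_bound K v b : 0 <= b -> (forall k, (absn k <= K)%N -> nm (v k) <= b) ->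
  Nlow K v <= (b * K.+1%:R ^+ d) ^+ 2 * nsum (fun k => (pr R k ^+ 2)^-1).
Proof.
move=> b0 h; have sm := nsmZ (sqr_ge0 (b * K.+1%:R ^+ d)) (nsm_pr2 R d).
rewrite -nsumZ ?sqr_ge0 //; last exact: nsm_pr2.
apply: le_nsum => // k; have p0 := pr_gt0 R k; case: ifP => hk; last first.
  by rewrite mulr_ge0 ?sqr_ge0 // invr_ge0 sqr_ge0.
rewrite ler_pdivlMr ?exprn_gt0 // -exprMn lerXn2r ?nnegrE ?mulr_ge0 ?nm_ge0 ?(ltW p0) ?exprn_ge0 //.
apply: ler_pM; rewrite ?nm_ge0 ?(ltW p0) ?h //.
apply: le_trans (pr_le_br R k) _.
by rewrite lerXn2r ?nnegrE ?(ltW (br_gt0 R k)) // ler_nat ltnS.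
Qed.

(* br^(q - Q) for fixed e > 0, hence bounded on distributions for large Q, and
   increasing to br^q as e tends to 0. *)
Definition smw (q Q : nat) (e : R) : Z -> R := fun k => br R k ^+ q / (1 + e * br R k) ^+ Q.

Lemma br_dist k l : `|br R k - br R l| <= br R (k - l).
Proof.
have r1 : br R k <= br R l + br R (k - l).
  by rewrite -natrD ler_nat; have := absnD (k - l) l; rewrite subrK; lia.
have r2 : br R l <= br R k + br R (k - l).
  have n2 : (absn l <= absn k + absn (k - l))%N.
    by have := absnD (l - k) k; rewrite subrK -[absn (l - k)]absnN opprB addnC.
  by rewrite -natrD ler_nat; move: n2; lia.
by rewrite ler_norml; apply/andP; split; lra.
Qed.

(** Uniform in [e]: the quotients of [br] and of [1 + e br] are both bounded by [br (k - l)] and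
    within [br(k - l)^2 / br(l)] of 1. The factor [1 / br(l)] pays for the derivative in the
    errors. *)
Lemma smw_ratio q Q e k l : 0 < e ->
  `|smw q Q e k / smw q Q e l - 1| <= (q + Q)%:R * br R (k - l) ^+ (q + Q + 2) / br R l.
Proof.
move=> e0; have a0 := br_gt0 R k; have b0 := br_gt0 R l; have c1 := br_ge1 R (k - l).
have hd := br_dist k l; have ab := br_subr R k l; have ba := br_sub R k l.
rewrite /smw; move: (br R k) (br R l) (br R (k - l)) a0 b0 c1 hd ab ba.
move=> a b c a0 b0 c1 hd ab ba; have c0 : 0 < c := lt_le_trans ltr01 c1.
have A0 : 0 < 1 + e * a by rewrite addr_gt0 // mulr_gt0.
have B0 : 0 < 1 + e * b by rewrite addr_gt0 // mulr_gt0.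
pose th := a / b; pose ro := (1 + e * b) / (1 + e * a).
have -> : a ^+ q / (1 + e * a) ^+ Q / (b ^+ q / (1 + e * b) ^+ Q) = th ^+ q * ro ^+ Q.
  rewrite /th /ro !expr_div_n invfM invrK; ring.
pose de := c ^+ 2 / b.
have ia : a^-1 <= c / b by rewrite ler_pdivlMr // mulrC ler_pdivrMr // mulrC.
have ht : 0 <= th <= c.
  apply/andP; split; first by apply: divr_ge0; exact: ltW.
  by rewrite /th ler_pdivrMr // mulrC.
have hr : 0 <= ro <= c.
  apply/andP; split; first by apply: divr_ge0; exact: ltW.
  rewrite /ro ler_pdivrMr // mulrDr mulr1 lerD //.
  by rewrite mulrCA ler_wpM2l ?(ltW e0) // mulrC.
have dt : `|th - 1| <= de.
  have -> : th - 1 = (a - b) / b by rewrite /th; field; rewrite gt_eqF.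
  rewrite normrM normfV (gtr0_norm b0) /de ler_wpM2r ?invr_ge0 ?(ltW b0) //.
  by apply: le_trans hd _; rewrite expr2 ler_peMr // ltW.
have dr : `|ro - 1| <= de.
  have -> : ro - 1 = e * (b - a) / (1 + e * a) by rewrite /ro; field; rewrite gt_eqF.
  rewrite !normrM normfV (gtr0_norm e0) (gtr0_norm A0) distrC.
  apply: (@le_trans _ _ (e * c / (e * a))).
    apply: ler_pM; rewrite ?mulr_ge0 ?invr_ge0 ?(ltW e0) ?(ltW A0) //.
      by rewrite ler_wpM2l // ltW.
    by rewrite lef_pV2 ?posrE ?mulr_gt0 // lerDr.
  have -> : e * c / (e * a) = c * a^-1 by field; rewrite !gt_eqF.
  have -> : de = c * (c / b) by rewrite /de; ring.
  by rewrite ler_wpM2l // ltW.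
have h1 := pow_ratio q ht c1 dt; have h2 := pow_ratio Q hr c1 dr.
have -> : th ^+ q * ro ^+ Q - 1 = th ^+ q * (ro ^+ Q - 1) + (th ^+ q - 1) by ring.
apply: le_trans (ler_normD _ _) _; rewrite normrM.
have [t0 tc] := andP ht.
have d0 : 0 <= de by apply: divr_ge0; rewrite ?exprn_ge0 ?(ltW c0) ?(ltW b0).
have h3 : `|th ^+ q| <= c ^+ q.
  by rewrite ger0_norm ?exprn_ge0 // lerXn2r ?nnegrE // ltW.
apply: le_trans (lerD (ler_pM (normr_ge0 _) (normr_ge0 _) h3 h2) h1) _.
have -> : (q + Q)%:R * c ^+ (q + Q + 2) / b =
  c ^+ q * (Q%:R * de * c ^+ Q) + q%:R * de * (c ^+ q * c ^+ Q).
  by rewrite /de natrD !exprD; ring.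
rewrite lerD2l; apply: ler_wpM2l; first exact: mulr_ge0.
by rewrite ler_peMr ?exprn_ge0 ?(ltW c0) // exprn_ege1.
Qed.

Lemma smw_bound q s e k : 0 < e -> smw q (q + d * s) e k <= (e ^+ (q + d * s))^-1 * pr R k ^ (- s%:Z).
Proof.
move=> e0; have b0 := br_gt0 R k; have p0 := pr_gt0 R k.
have eb : 0 < e * br R k by rewrite mulr_gt0.
apply: (@le_trans _ _ (br R k ^+ q / (e * br R k) ^+ (q + d * s))).
  rewrite /smw ler_wpM2l ?exprn_ge0 ?(ltW b0) // lef_pV2 ?posrE ?exprn_gt0 ?addr_gt0 //.
  by rewrite lerXn2r ?nnegrE ?addr_ge0 ?(ltW eb) // lerDr.
rewrite exprMn invfM mulrCA ler_wpM2l ?invr_ge0 ?exprn_ge0 ?(ltW e0) //.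
rewrite -exprnN exprD invfM mulrA mulfV ?expf_neq0 ?gt_eqF // mul1r.
rewrite lef_pV2 ?posrE ?exprn_gt0 // exprM lerXn2r ?nnegrE ?exprn_ge0 ?(ltW b0) ?(ltW p0) //.
exact: pr_le_br.
Qed.

Hypothesis compactness : forall eta : R, 0 < eta -> exists2 c, 0 <= c &
  forall v, ord (-10) v -> N2 v <= eta * energy1 X v + c * low v.

(* Hormander's hypoellipticity theorem for sums of squares. *)
Theorem smoothness (u f : Z -> C) (p : int) : 0 <= p -> ord p u -> rapid f ->
  (fun k => \sum_j vop (X j) (vop (X j) u) k) = f -> rapid u.
Proof.
move=> p0 hu hf he; apply: br_rapid => q.
have [kap kap0 hk] := master_estimate X_rapid X_real compactness.
(* For fixed [e] the weight decays like [pr^(-s)]; this [s] brings [u], of order [p], into the test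
   class and gives [m^2 u] the order required by [admissible]. *)
pose s := (2 * `|p| + 20)%N; pose Q := (q + d * s)%N.
pose om : Z -> R := fun k => (q + Q)%:R * br R k ^+ (q + Q + 3).
have nsmom h : rapid h -> nsm (fun k => nm (h k) * om k).
  move=> hh; have := nsmZ (ler0n R (q + Q)) (rapid_br (q + Q + 3) hh).
  by congr nsm; apply/funext => k; rewrite /om mulrCA.
have G10 : 0 <= errC * kernel_sum om.
  rewrite mulr_ge0 //; first by rewrite mulr_ge0 // addr_ge0 // mulr_ge0 // exprn_ge0.
  apply: sumr_ge0 => j _; rewrite addr_ge0 ?sqr_ge0 // sumr_ge0 // => i _; exact: sqr_ge0.
have [c [K c0 hc]] := hk _ G10.
pose g k := (br R k ^+ q)%:C * f k; pose gu k := (br R k ^+ q)%:C * u k.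
have sg : sq g.
  apply: (@ord_sq _ _ (`|q%:Z| + (-1 - q%:Z))); first by lia.
  exact: (ord_wt q%:Z (hf _)).
have [cu cu0 hcu] := ordP hu.
pose b := (K.+1%:R : R) ^+ q * (cu * K.+1%:R ^+ (d * `|p|)%N).
have b0 : 0 <= b by rewrite !mulr_ge0 ?exprn_ge0.
pose B := (b * K.+1%:R ^+ d) ^+ 2 * nsum (fun k : Z => (pr R k ^+ 2)^-1).
have m0 e k : 0 < e -> 0 < smw q Q e k <= br R k ^+ q.
  move=> e0; have q0 := br_gt0 R k.
  have A1 : 1 <= (1 + e * br R k) ^+ Q by rewrite exprn_ege1 // lerDl mulr_ge0 // ltW.
  rewrite /smw divr_gt0 ?exprn_gt0 ?addr_gt0 ?mulr_gt0 //=.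
  by rewrite ler_pdivrMr ?(lt_le_trans ltr01) // ler_peMr ?exprn_ge0 // ltW.
have hB e : 0 < e -> Nlow K (wm (smw q Q e) u) <= B.
  move=> e0; apply: Nlow_bound => // k hkK; rewrite nmM nm_real.
  have [/ltW s0 s1] := andP (m0 e k e0).
  have bk : br R k <= K.+1%:R by rewrite ler_nat ltnS.
  have br0 := ltW (br_gt0 R k).
  rewrite ger0_norm //; apply: ler_pM; rewrite ?nm_ge0 //.
    by apply: le_trans s1 _; rewrite lerXn2r ?nnegrE.
  apply: le_trans (hcu k) _; rewrite ler_wpM2l //.
  by apply: le_trans (prz_le_br R k p) _; rewrite lerXn2r ?nnegrE.
have main e : 0 < e -> N2 (wm (smw q Q e) u) <= c * (N2 g + B).
  move=> e0; have sb k : smw q Q e k <= (e ^+ Q)^-1 * pr R k ^ (- s%:Z) by apply: smw_bound.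
  have nsb k : nm (smw q Q e k)%:C <= (e ^+ Q)^-1 * pr R k ^ (- s%:Z).
    by rewrite nm_real gtr0_norm //; case/andP: (m0 e k e0).
  have o1 : ord (- s%:Z + p) (wm (smw q Q e) u) by apply: ord_mulf nsb hu.
  have o2 : ord (- s%:Z + (- s%:Z + p)) (wm (smw q Q e) (wm (smw q Q e) u)).
    by apply: ord_mulf nsb o1.
  have o3 : ord (-10) (wm (smw q Q e) u) by apply: ord_mono o1; rewrite /s; lia.
  have [sf1 sf2] : sq (wm (smw q Q e) f) /\ N2 (wm (smw q Q e) f) <= N2 g.
    apply: sq_le => // k; have [/ltW s0 s1] := andP (m0 e k e0).
    rewrite !nmM !nm_real ger0_norm // ger0_norm ?exprn_ge0 ?(ltW (br_gt0 R k)) //.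
    by rewrite ler_wpM2r ?nm_ge0.
  have adm : admissible (smw q Q e) u f p.
    split=> //; last by apply: ord_mono o2; rewrite /s; lia.
    by move=> k; case/andP: (m0 e k e0).
  have := hc (smw q Q e) u f p 0 adm (lexx 0) _ he; rewrite addr0.
  move=> hh; apply: le_trans (hh _) _; last first.
    by rewrite ler_wpM2l // lerD // hB.
  have sw : sq (wm (smw q Q e) u) by apply: dom_sq.
  move=> j; have [|q1 q2 q3 q4] := err_kernel adm sw (fun j i => nsmom _ (X_rapid j i))
    (fun j => nsmom _ (rapid_divbar (X_rapid j))) _ j.
    move=> m' hm' k l.
    have a0 := br_gt0 R k; have bl0 := br_gt0 R l; have c1 := br_ge1 R (k - l).
    have c0' := br_gt0 R (k - l).
    have nn : 0 <= (q + Q)%:R :> R by [].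
    have r1 : `|m' k / m' l - 1| * br R l <= om (k - l).
      rewrite -ler_pdivlMr //; case: hm' => ->.
        apply: le_trans (smw_ratio q Q k l e0) _.
        rewrite /om ler_wpM2r ?invr_ge0 ?(ltW bl0) // ler_wpM2l //.
        by apply: ler_weXn2l => //; rewrite leq_add2l.
      rewrite /minv invrK mulrC; apply: le_trans (smw_ratio q Q l k e0) _.
      rewrite -[br R (l - k)]brN opprB /om.
      rewrite [(q + Q + 3)%N]addnS exprSr mulrA -[leRHS]mulrA.
      rewrite ler_wpM2l ?mulr_ge0 ?exprn_ge0 ?(ltW c0') //.
      by rewrite ler_pdivlMr // mulrC ler_pdivrMr // mulrC br_sub.
    have l1 i : `|l 0%R i|%N%:R <= br R l.
      by rewrite /br ler_nat ltnW // ltnS absn_ge.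
    have l2 := br_ge1 R l.
    split=> [i|].
      rewrite mulrA ler_wpM2r ?nm_ge0 //; apply: le_trans r1; exact: ler_wpM2l.
    rewrite ler_wpM2r ?nm_ge0 //; apply: le_trans r1; exact: ler_peMr.
  have g2 := energy_ge0 X_rapid o3.
  have g3 : 0 <= kap * energy X (wm (smw q Q e) u) by rewrite mulr_ge0 // ltW.
  split=> //; rewrite addr0; [apply: le_trans q3 _ | apply: le_trans q4 _]; by rewrite mulrA lerDr.
have gg := N2_ge0 sg.
(* For each [k] the estimate is used with [e = 1 / br k], where the weight equals
   [br(k)^q / 2^Q]. *)
exists (2 ^+ Q * (1 + c * (N2 g + B))) => k.
have bk := br_gt0 R k; have e0 : 0 < (br R k)^-1 by rewrite invr_gt0.
have sw : sq (wm (smw q Q (br R k)^-1) u).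
  have nsb l : nm (smw q Q (br R k)^-1 l)%:C <= ((br R k)^-1 ^+ Q)^-1 * pr R l ^ (- s%:Z).
    rewrite nm_real gtr0_norm; first exact: smw_bound.
    by case/andP: (m0 _ l e0).
  by apply: (ord_sq _ (ord_mulf nsb hu)); rewrite /s; lia.
have := N2_ge_one k sw (main _ e0).
rewrite nmM nm_real gtr0_norm; last by case/andP: (m0 _ k e0).
rewrite /smw mulVf ?gt_eqF // -[1 + 1]/(2 : R) mulrAC ler_pdivrMr ?exprn_gt0 //.
by rewrite [2 ^+ Q * _]mulrC.
Qed.

End Claims.

(** * Exponential decay *)

Section PartialFourier.
Variables (R : realType) (d : nat).
Local Notation C := R[i].
Local Notation Z := 'rV[int]_d.
Implicit Types (k l : Z) (u v w f h g : Z -> C) (m : Z -> R) (P : pred 'I_d).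

Definition nrm (P : pred 'I_d) k : nat := (\sum_(i | P i) `|k 0%R i|)%N.

Lemma nrmD P k l : (nrm P (k + l) <= nrm P k + nrm P l)%N.
Proof.
rewrite /nrm -big_split /=; apply: leq_sum => j _; rewrite mxE.
by move: (k 0 j) (l 0 j) => a b; lia.
Qed.

Lemma nrmN P k : nrm P (- k) = nrm P k.
Proof. by apply: eq_bigr => j _; rewrite mxE abszN. Qed.

Lemma nrmB P k l : (nrm P k <= nrm P l + nrm P (k - l))%N.
Proof. by rewrite -{1}(subrK l k) addnC nrmD. Qed.

Lemma nrm_le P k : (nrm P k <= absn k)%N.
Proof. by rewrite /nrm big_mkcond; apply: leq_sum => j _; case: ifP. Qed.

Lemma nrm_ge P k i : P i -> (`|k 0%R i| <= nrm P k)%N.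
Proof. by move=> Pi; rewrite /nrm (bigD1 i) //= leq_addr. Qed.

Lemma nrm0P P k : reflect (forall i, P i -> k 0 i = 0) (nrm P k == 0%N).
Proof.
apply: (iffP idP) => [h i Pi|h].
  by have := nrm_ge k Pi; rewrite (eqP h) leqn0 absz_eq0 => /eqP.
by rewrite /nrm big1 // => i /h ->.
Qed.

Lemma nrm_shift0 P k l : nrm P l = 0%N -> nrm P (k + l) = nrm P k.
Proof.
move=> h; apply/eqP; rewrite eqn_leq; have h1 := nrmD P k l.
have h2 := nrmD P (k + l) (- l); rewrite addrK nrmN in h2; lia.
Qed.

Variables pA pB pC : pred 'I_d.
Hypothesis part : forall i, (pA i + pB i + pC i)%N = 1%N.

Lemma absn_split k : absn k = (nrm pA k + nrm pB k + nrm pC k)%N.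
Proof.
rewrite /nrm (big_mkcond pA) (big_mkcond pB) (big_mkcond pC) -!big_split /=.
apply: eq_bigr => i _; have := part i.
by case: (pA i) (pB i) (pC i) => [] [] [] //= _; rewrite ?addn0.
Qed.

(* The predicates pA, pB, pC select the directions t', t'' and x. *)
Definition projB k : Z := \row_i (if pB i then k 0 i else 0).
Definition isB k : bool := (nrm pA k == 0%N) && (nrm pC k == 0%N).
Definition isA k : bool := (nrm pB k == 0%N) && (nrm pC k == 0%N).

(* Coefficients, on frequencies in the A directions, of the partial Fourier
   coefficient at the frequency z in the B directions. *)
Definition pcoef z h : Z -> C := fun k => if isA k then h (k + z) else 0.

Lemma kindP i : [\/ [/\ pA i, ~~ pB i & ~~ pC i], [/\ ~~ pA i, pB i & ~~ pC i] |
                   [/\ ~~ pA i, ~~ pB i & pC i]].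
Proof.
have := part i; case: (pA i) (pB i) (pC i) => [] [] [] //= _;
  by [constructor 1 | constructor 2 | constructor 3].
Qed.

Lemma isB_projB k : isB (projB k).
Proof.
apply/andP; split; apply/nrm0P => i hi; rewrite mxE; case: (kindP i) => -[a b c].
- by rewrite (negbTE b).
- by move: a; rewrite hi.
- by rewrite (negbTE b).
- by rewrite (negbTE b).
- by move: c; rewrite hi.
- by rewrite (negbTE b).
Qed.

Lemma projB_eq k z : nrm pC k = 0%N -> (z == projB k) = isB z && isA (k - z).
Proof.
move=> /eqP/nrm0P hC; apply/eqP/andP => [->|[/andP[/nrm0P z1 /nrm0P z2] /andP[/nrm0P z3 _]]].
  split; first exact: isB_projB.
  apply/andP; split; apply/nrm0P => i hi; rewrite !mxE.
    by rewrite hi subrr.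
  rewrite hC // sub0r; case: (kindP i) => -[a b c].
  - by rewrite (negbTE b) oppr0.
  - by move: c; rewrite hi.
  - by rewrite (negbTE b) oppr0.
apply/rowP => i; rewrite mxE; case: (kindP i) => -[a b c].
- by rewrite (negbTE b) z1.
- by rewrite b; have := z3 i b; rewrite !mxE => /eqP; rewrite subr_eq0 => /eqP.
- by rewrite (negbTE b) z2.
Qed.

Definition shiftw m z v : Z -> C := fun k => (m k / m (k - z) - 1)%:C * v (k - z).

(** The sum over [l] is grouped by the B part [z] of [k - l]. As the weight is invariant under A
    frequencies, its ratio passes inside the convolution with the partial coefficient, which runs
    over A frequencies only. *)
Lemma errI_partial h m v k r : rapid h -> (forall k, h k != 0 -> nrm pC k = 0%N) ->
  csm (fun l => h (k - l) * (m k / m l - 1)%:C * v l) ->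
  (forall k t, isA t -> m (k + t) = m k) -> ord r v ->
  csm (fun z => if isB z then cv (pcoef z h) (shiftw m z v) k else 0) /\
  errI h m v k = csum (fun z => if isB z then cv (pcoef z h) (shiftw m z v) k else 0).
Proof.
move=> hh hC hsm hm hv.
pose t l := h (k - l) * (m k / m l - 1)%:C * v l.
pose G l z := if z == projB (k - l) then t l else 0.
have sG : csm (fun p : Z * Z => G p.1 p.2).
  have dl l : nsm (fun z => nm (G l z)) /\ nsum (fun z => nm (G l z)) = nm (t l).
    have [h1 h2] := @nsum_fin R Z (fun=> nm (t l)) [:: projB (k - l)] isT (fun=> nm_ge0 _).
    have e : (fun z => nm (G l z)) = (fun z => if z \in [:: projB (k - l)] then nm (t l) else 0).
      by apply/funext => z; rewrite /G inE; case: ifP; rewrite ?nm0.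
    by rewrite e h2 big_seq1; split.
  apply: (csm_pair (f := G) (g := fun l z => nm (G l z))) => //.
    by move=> l; case: (dl l).
  have e : (fun l => nsum (fun z => nm (G l z))) = (fun l => nm (t l)).
    by apply/funext => l; case: (dl l).
  by rewrite e; apply: hsm.
have e1 : errI h m v k = csum (fun l => csum (G l)).
  apply: eq_csum => l; have [|_ ->] := @csum_delta R Z (G l) (projB (k - l)).
    by move=> z hz; rewrite /G (negbTE hz).
  by rewrite /G eqxx.
have [sG2 e2] := csum_swap (f := G) sG.
have [q1 q2 _] := csum_pair (f := fun z l => G l z) sG2.
have e3 z : csum (G^~ z) = if isB z then cv (pcoef z h) (shiftw m z v) k else 0.
  have inj : injective (fun l : Z => l - z) by move=> x y /(congr1 (fun q => q + z)); rewrite !subrK.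
  have [|_ <-] := csum_reindex inj _ (q1 z).
    by move=> l _; exists (l + z); rewrite addrK.
  have e4 l : G (l - z) z = if isB z then pcoef z h (k - l) * shiftw m z v l else 0.
    rewrite /G /t /pcoef /shiftw.
    have ekl : k - (l - z) = k - l + z by rewrite opprB addrA addrAC.
    rewrite ekl; case: (eqVneq (h (k - l + z)) 0) => [->|/hC hC0].
      by rewrite !mul0r !if_same mul0r if_same.
    rewrite (projB_eq z hC0) addrK; case hB: (isB z) => //=.
    case: ifP => hA; last by rewrite mul0r.
    have e5 : m k = m l by rewrite -[in LHS](subrK l k) addrC; apply: hm.
    by rewrite e5 mulrA.
  case hB : (isB z); rewrite /cv.
    by apply: eq_csum => l /=; rewrite e4 hB.
  by rewrite -[RHS](@csum0 R Z); apply: eq_csum => l /=; rewrite e4 hB.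
have e6 : (fun z => csum (G^~ z)) = (fun z => if isB z then cv (pcoef z h) (shiftw m z v) k else 0).
  exact/funext.
by rewrite e1 e2 -e6.
Qed.

Lemma rapid_pcoef z h : rapid h -> rapid (pcoef z h).
Proof.
move=> hh r; have [c c0 hc] := ordP (hh r).
exists (c * pr R z ^+ `|r|%N) => k; rewrite /pcoef; case: ifP => _; last first.
  by rewrite nm0 !mulr_ge0 ?exprn_ge0 ?(ltW (pr_gt0 R z)) // prz_ge0.
apply: le_trans (hc _) _; rewrite -mulrA ler_wpM2l // mulrC.
have := prz_shift R k (k + z) r; rewrite opprD addrA subrr add0r.
by rewrite prN.
Qed.

(** The two sums over [z] left by Cauchy-Schwarz with the weights [nu^|z|] in [partial_young]. *)
Definition Gam (nu lam : R) : R :=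
  nsum (fun z : Z => nu ^+ absn z) *
  nsum (fun z : Z => nu ^+ absn z * ((absn z)%:R * lam ^+ absn z) ^+ 2).

Lemma Gam_sm (nu lam : R) : 0 < nu -> 1 <= lam -> lam ^+ 2 * nu < 1 ->
  nsm (fun z : Z => nu ^+ absn z * ((absn z)%:R * lam ^+ absn z) ^+ 2).
Proof.
move=> n0 l1 ln; have l0 : 0 <= lam := le_trans ler01 l1.
have h0 k : nm ((nu ^+ absn k)%:C : C) <= 1 * nu ^+ absn k.
  by rewrite nm_real mul1r ger0_norm // exprn_ge0 // ltW.
have := @rapid_lam R d (fun k => (nu ^+ absn k)%:C) 1 nu (lam ^+ 2) ler01 (ltW n0)
  (exprn_ge0 2 l0) ln h0 2.
move/nsm_le; apply => k; rewrite nm_real ger0_norm ?exprn_ge0 ?(ltW n0) //.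
apply/andP; split; first by rewrite mulr_ge0 ?sqr_ge0 ?exprn_ge0 ?(ltW n0).
rewrite -[leRHS]mulrA ler_wpM2l ?exprn_ge0 ?(ltW n0) //.
rewrite exprMn mulrC -exprM mulnC exprM ler_wpM2l ?exprn_ge0 //.
by rewrite lerXn2r ?nnegrE ?(ltW (br_gt0 R k)) // /br ler_nat.
Qed.

(** The bound is in terms of [a v] rather than [v]: each partial coefficient is pointwise bounded by
    [|a|], and multiplication by [a], which has A frequencies only, commutes with the shifted
    weights. The variation of the weight provides the factor [(lam - 1)^2], small for [lam] near
    1. *)
Lemma partial_young h a v m (nu lam Ka : R) :
  rapid h -> (forall k, h k != 0 -> nrm pC k = 0%N) ->
  rapid a -> (forall k, a k != 0 -> isA k) -> ord (-4) v ->
  (forall k, 0 < m k) -> (forall k t, isA t -> m (k + t) = m k) ->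
  (forall k z, isB z -> `|m k / m (k - z) - 1| <= lam ^+ absn z - 1) ->
  (forall k, csm (fun l => h (k - l) * (m k / m l - 1)%:C * v l)) ->
  0 < nu -> 1 <= lam -> lam ^+ 2 * nu < 1 -> 0 <= Ka ->
  (forall z x, isB z -> nm (fser (pcoef z h) x) <= Ka * nu ^+ absn z * nm (fser a x)) ->
  sq (errI h m v) /\
  N2 (errI h m v) <= (lam - 1) ^+ 2 * (Ka ^+ 2 * Gam nu lam) * N2 (cv a v).
Proof.
move=> hh hC ha hA hv m0 hm hmz hsm nu0 lam1 ln Ka0 hK.
have lam0 : 0 <= lam := le_trans ler01 lam1.
have nup n : 0 < nu ^+ n by apply: exprn_gt0.
have sS z : isB z -> ord (-4) (shiftw m z v).
  move=> hz; have [c c0 hc] := ordP hv.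
  exists (lam ^+ absn z * (c * pr R z ^+ 4)) => k; rewrite nmM nm_real.
  have b1 : `|m k / m (k - z) - 1| <= lam ^+ absn z.
    by apply: le_trans (hmz k z hz) _; rewrite gerBl.
  apply: le_trans (ler_pM (normr_ge0 _) (nm_ge0 _) b1 (hc _)) _.
  have -> : lam ^+ absn z * (c * pr R z ^+ 4) * pr R k ^ (-4) =
    lam ^+ absn z * (c * (pr R k ^ (-4) * pr R z ^+ 4)) by ring.
  rewrite ler_wpM2l ?exprn_ge0 // ler_wpM2l //.
  by have := prz_shift R k (k - z) (-4); rewrite subKr.
have sq_a : sq (cv a v) by apply: (@ord_sq _ _ (-4)) => //; apply: ord_cv.
have cvS z : isB z -> cv a (shiftw m z v) = shiftw m z (cv a v).
  move=> hz; apply/funext => k; rewrite /shiftw /cv -csumZ; last exact: cv_sm hv.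
  have inj : injective (fun l : Z => l + z) by move=> x y /addIr.
  have [|_ <-] := csum_reindex inj _ (cv_sm k ha (sS z hz)).
    by move=> l _; exists (l - z); rewrite subrK.
  apply: eq_csum => l /=; rewrite /shiftw addrK.
  have -> : k - (l + z) = k - z - l by rewrite opprD addrA addrAC.
  case: (eqVneq (a (k - z - l)) 0) => [->|/hA hAl]; first by rewrite !mul0r mulr0.
  have e1 : m l = m (k - z) by rewrite -(hm l _ hAl) addrC subrK.
  have e2 : m (l + z) = m k.
    by rewrite -(hm (l + z) _ hAl); congr m; rewrite addrC addrA subrK subrK.
  by rewrite e1 e2 mulrCA.
have bz z : isB z -> N2 (cv (pcoef z h) (shiftw m z v)) <=
   (lam - 1) ^+ 2 * Ka ^+ 2 * (nu ^+ absn z * (nu ^+ absn z * ((absn z)%:R * lam ^+ absn z) ^+ 2)) * N2 (cv a v).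
  move=> hz; have rp := rapid_pcoef z hh.
  have c1 : csm (cv a (shiftw m z v)).
    by apply: nsm_ord2; apply: (@ord_mono _ _ (-4)) => //; apply: ord_cv => //; apply: sS.
  have c2 : csm (cv (pcoef z h) (shiftw m z v)).
    by apply: nsm_ord2; apply: (@ord_mono _ _ (-4)) => //; apply: ord_cv => //; apply: sS.
  have cS : csm (shiftw m z v) by apply: nsm_ord2; apply: ord_mono (sS z hz).
  have := @pointwise_N2 R d unit (cv (pcoef z h) (shiftw m z v)) (fun=> cv a (shiftw m z v))
    ((Ka * nu ^+ absn z) ^+ 2) (sqr_ge0 _) c2 (fun=> c1).
  have su (F : R) : \sum_(i : unit) F = F by rewrite sumr_const card_unit mulr1n.
  rewrite su => h1; apply: le_trans (h1 _) _.
    move=> x; rewrite su.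
    rewrite !fser_cv //; last 4 first.
    - exact: csm_rapid.
    - by move=> k; apply: cv_sm (sS z hz).
    - exact: csm_rapid.
    - by move=> k; apply: cv_sm (sS z hz).
    rewrite !nmM -exprMn lerXn2r ?nnegrE ?mulr_ge0 ?nm_ge0 ?(ltW (nup _)) //.
    by rewrite mulrA ler_wpM2r ?nm_ge0 // hK.
  rewrite cvS //.
  have ls : 0 <= lam ^+ absn z - 1 by rewrite subr_ge0 exprn_ege1.
  have s2 : sq (fun k => cv a v (k - z)) /\ N2 (fun k => cv a v (k - z)) = N2 (cv a v).
    exact: (nsm_shiftl z sq_a).
  have [|_ h2] := @sqZ R d (lam ^+ absn z - 1) _ (shiftw m z (cv a v)) s2.1 ls.
    by move=> k; rewrite nmM nm_real ler_wpM2r ?nm_ge0 // hmz.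
  rewrite s2.2 in h2; apply: le_trans (ler_wpM2l (sqr_ge0 _) h2) _.
  rewrite [(Ka * nu ^+ absn z) ^+ 2 * (_ * _)]mulrA ler_wpM2r ?N2_ge0 //.
  have h3 : (lam ^+ absn z - 1) ^+ 2 <= ((lam - 1) * ((absn z)%:R * lam ^+ absn z)) ^+ 2.
    have q := lam_pow1 (absn z) lam1.
    by rewrite lerXn2r ?nnegrE ?(le_trans ls q).
  apply: le_trans (ler_wpM2l (sqr_ge0 _) h3) _.
  rewrite le_eqVlt; apply/orP; left; apply/eqP.
  by move: (nu ^+ _) (lam ^+ _) (absn z)%:R => *; ring.
pose x z k := if isB z then cv (pcoef z h) (shiftw m z v) k else 0.
pose be (z : Z) := nu ^+ absn z : R.
have sbe : nsm be.
  apply: nsm_geomZ; rewrite (ltW nu0) /=; apply: le_lt_trans ln.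
  by rewrite ler_peMl ?(ltW nu0) // exprn_ege1.
have be0 z : 0 < be z by apply: nup.
have key k : nsm (fun z => (be z)^-1 * nm (x z k) ^+ 2) -> 0 <= nm (errI h m v k) ^+ 2 <=
    nsum be * nsum (fun z => (be z)^-1 * nm (x z k) ^+ 2).
  move=> s5; rewrite sqr_ge0 /=.
  have [c1 ->] := errI_partial hh hC (hsm k) hm hv.
  have ex : (fun z => be z * ((be z)^-1 * nm (x z k)) ^+ 2) = (fun z => (be z)^-1 * nm (x z k) ^+ 2).
    apply/funext => z; have := be0 z; move: (be z) (nm (x z k)) => b y' b0.
    by field; rewrite gt_eqF.
  have ex2 : (fun z => be z * ((be z)^-1 * nm (x z k))) = (fun z => nm (x z k)).
    apply/funext => z; have := be0 z; move: (be z) (nm (x z k)) => b y' b0.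
    exact: (mulVKf (lt0r_neq0 b0) y').
  have := @weighted_cauchy R Z be (fun z => (be z)^-1 * nm (x z k)) sbe.
  rewrite ex ex2 => /(_ _ s5)[|_].
    by move=> z; rewrite mulr_ge0 ?nm_ge0 // invr_ge0 ltW.
  apply: le_trans; rewrite lerXn2r ?nnegrE ?nm_ge0 ?nsum_ge0 //; exact: nm_csum.
pose W := (lam - 1) ^+ 2 * Ka ^+ 2 * N2 (cv a v).
have W0 : 0 <= W.
  by apply: mulr_ge0; [apply: mulr_ge0; apply: sqr_ge0 | apply: N2_ge0].
pose y (z : Z) : R := nu ^+ absn z * ((absn z)%:R * lam ^+ absn z) ^+ 2.
have sy : nsm y by apply: Gam_sm.
have xz z : nsm (fun k => (be z)^-1 * nm (x z k) ^+ 2) /\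
     nsum (fun k => (be z)^-1 * nm (x z k) ^+ 2) <= W * y z.
  have i0 : 0 <= (be z)^-1 by rewrite invr_ge0 ltW // nup.
  have y0 : 0 <= y z by case: sy.
  rewrite /x; case hz: (isB z); last first.
    have e : (fun k : Z => (be z)^-1 * nm (0 : C) ^+ 2) = (fun=> 0).
      by apply/funext => k; rewrite nm0 expr0n mulr0.
    by rewrite e nsum0; split; [apply: nsm0 | rewrite mulr_ge0].
  have sx : sq (cv (pcoef z h) (shiftw m z v)).
    apply: (@ord_sq _ _ (-4)) => //; apply: ord_cv; [exact: rapid_pcoef | exact: sS].
  split; first exact: nsmZ.
  rewrite nsumZ // ler_pdivrMl ?nup //; apply: le_trans (bz z hz) _.
  by rewrite le_eqVlt; apply/orP; left; apply/eqP; rewrite /W /y /be; move: (nu ^+ _) (lam ^+ _) (N2 _) (absn z)%:R => *; ring.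
have sN : nsm (fun z => nsum (fun k => (be z)^-1 * nm (x z k) ^+ 2)).
  apply: (nsm_le (nsmZ W0 sy)) => z; have [g1 g2] := xz z.
  by rewrite g2 andbT nsum_ge0.
have [s1 s2] := nsm_pair (f := fun z k => (be z)^-1 * nm (x z k) ^+ 2) (fun z => (xz z).1) sN.
have [s3 s4] := nsm_swap s1.
have [s5 s6] := nsm_pairI (f := fun k z => (be z)^-1 * nm (x z k) ^+ 2) s3.
have [_ s7] := nsm_pair s5 s6.
have g0 : 0 <= nsum be by apply: nsum_ge0.
have sfin := nsmZ g0 s6.
split; first exact: (nsm_le sfin (fun k => key k (s5 k))).
apply: (@le_trans _ _ (nsum be * nsum (fun z => nsum (fun k => (be z)^-1 * nm (x z k) ^+ 2)))).
  have e : nsum (fun z => nsum (fun k => (be z)^-1 * nm (x z k) ^+ 2)) =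
    nsum (fun k => nsum (fun z => (be z)^-1 * nm (x z k) ^+ 2)).
    exact: etrans (esym s2) (etrans (esym s4) s7).
  rewrite e -(nsumZ g0 s6); apply: (le_nsum sfin) => k.
  by case/andP: (key k (s5 k)).
have h1 : nsum (fun z => nsum (fun k => (be z)^-1 * nm (x z k) ^+ 2)) <= W * nsum y.
  rewrite -(nsumZ W0 sy); apply: (le_nsum (nsmZ W0 sy)) => z.
  exact: (xz z).2.
apply: le_trans (ler_wpM2l g0 h1) _.
rewrite /W /Gam -/be -/y; move: (nsum be) (nsum y) (N2 _) (lam - 1) => b1 y1 n1 l1.
by rewrite le_eqVlt; apply/orP; left; apply/eqP; ring.
Qed.

End PartialFourier.

(** * The three exponential weights *)

Section ExponentialDecay.
Variables (R : realType) (d N : nat).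
Local Notation C := R[i].
Local Notation Z := 'rV[int]_d.
Local Notation field := ('I_d -> Z -> C).
Implicit Types (k l : Z) (u v w f h g : Z -> C) (m : Z -> R) (P : pred 'I_d).
Variable X : 'I_N -> field.
Hypothesis X_rapid : forall j, rf (X j).
Hypothesis X_real : forall j, barf (X j) = X j.
Variables u f : Z -> C.
Hypothesis u_rapid : rapid u.
Hypothesis eq_u : (fun k => \sum_j vop (X j) (vop (X j) u) k) = f.
Variables (rho cf cx : R).
Hypotheses (rho0 : 0 <= rho) (rho1 : rho < 1) (cf0 : 0 <= cf) (cx0 : 0 <= cx).
Hypothesis f_geom : forall k, nm (f k) <= cf * rho ^+ absn k.
Hypothesis X_geom : forall j i k, nm (X j i k) <= cx * rho ^+ absn k.

(* Truncating the exponent at L keeps the weight bounded; all the estimates are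
   uniform in L. *)
Definition lamL (lam : R) (psi : Z -> nat) (L : nat) : Z -> R := fun k => lam ^+ minn (psi k) L.

Definition master_at (kap G1 c : R) (K : nat) : Prop := forall m u f p G0,
    admissible m u f p -> 0 <= G0 -> err_bound X m u kap G1 G0 ->
    (fun k => \sum_j vop (X j) (vop (X j) u) k) = f ->
    N2 (wm m u) <= c * (N2 (wm m f) + G0 + Nlow K (wm m u)).

Lemma f_rapid : rapid f.
Proof. by apply: (geom_rapid cf0 _ f_geom); rewrite rho0. Qed.

Section Weight.
Variables (lam : R) (psi : Z -> nat).
Hypotheses (lam1 : 1 <= lam) (lamrho : lam * rho < 1).
Hypothesis psi_le : forall k, (psi k <= absn k)%N.

Lemma lam_gt0 : 0 < lam.
Proof. exact: lt_le_trans lam1. Qed.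

Lemma lamL_gt0 L k : 0 < lamL lam psi L k.
Proof. exact: exprn_gt0 lam_gt0. Qed.

Lemma lamL_adm L : admissible (lamL lam psi L) u f 0.
Proof.
apply: (@adm_bounded _ _ _ _ _ (lam ^+ L)) => //; last exact: f_rapid.
move=> k; rewrite lamL_gt0 /=; apply: ler_weXn2l => //; exact: geq_minr.
Qed.

Lemma lamL_ratio m' L n k l : m' = lamL lam psi L \/ m' = minv (lamL lam psi L) ->
  (psi k <= psi l + n)%N -> (psi l <= psi k + n)%N -> `|m' k / m' l - 1| <= lam ^+ n - 1.
Proof.
move=> hm h1 h2; have [a1 a2] : (minn (psi k) L <= minn (psi l) L + n)%N /\
   (minn (psi l) L <= minn (psi k) L + n)%N by split; lia.
by case: hm => ->; rewrite /minv /lamL ?invrK 1?[_^-1 * _]mulrC; apply: lam_ratio.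
Qed.

(** The bound for the weights truncated at [L] is uniform in [L], and truncating at [L = psi k]
    changes nothing at the frequency [k] itself. The weighted data stay summable because
    [psi <= absn] and [lam * rho < 1]. *)
Lemma claim kap G1 G0 c K : 0 <= c -> master_at kap G1 c K -> 0 <= G0 ->
  (forall L, err_bound X (lamL lam psi L) u kap G1 G0) ->
  exists B, forall k, nm (u k) * lam ^+ psi k <= B.
Proof.
move=> c0 hm G00 hB; have l0 := lam_gt0.
pose F k := (lam ^+ absn k)%:C * f k; pose U k := (lam ^+ K)%:C * u k.
have sF : sq F.
  have rF : rapid F.
    apply: (@geom_rapid R d F cf (lam * rho)) => //.
      by rewrite lamrho mulr_ge0 // ltW.
    move=> k; rewrite /F nmM nm_real ger0_norm ?exprn_ge0 ?(ltW l0) //.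
    by rewrite exprMn mulrCA ler_wpM2l ?exprn_ge0 ?(ltW l0).
  exact: (nsm_ord1 (rF _)).
have sU : sq U by apply: (nsm_ord1 (rapidZ (lam ^+ K)%:C u_rapid _)).
exists (1 + c * (N2 F + G0 + N2 U)) => k.
pose mm := lamL lam psi (psi k).
have adm := lamL_adm (psi k).
have sw : sq (wm mm u) by case: adm => _ _ _ /dom_sq.
have b1 : N2 (wm mm f) <= N2 F.
  have [] // := @sq_le R d F (wm mm f) sF => l.
  rewrite !nmM !nm_real ler_wpM2r ?nm_ge0 // !gtr0_norm ?exprn_gt0 //.
  by apply: ler_weXn2l => //; apply: leq_trans (geq_minl _ _) (psi_le l).
have b2 : Nlow K (wm mm u) <= N2 U.
  apply: Nlow_le => // l hl; rewrite !nmM !nm_real ler_wpM2r ?nm_ge0 // !gtr0_norm ?exprn_gt0 //.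
  by apply: ler_weXn2l => //; apply: leq_trans (geq_minl _ _) (leq_trans (psi_le l) hl).
have b3 := hm mm u f 0 G0 adm G00 (hB _) eq_u.
have b4 : N2 (wm mm u) <= c * (N2 F + G0 + N2 U).
  by apply: le_trans b3 _; rewrite ler_wpM2l // lerD // lerD2r.
have := N2_ge_one k sw b4; rewrite nmM nm_real gtr0_norm ?exprn_gt0 //.
by rewrite /mm /lamL minnn mulrC.
Qed.

End Weight.

Variables pA pB pC : pred 'I_d.
Hypothesis part : forall i, (pA i + pB i + pC i)%N = 1%N.
Local Notation nA := (nrm pA).
Local Notation nB := (nrm pB).
Local Notation nC := (nrm pC).
Local Notation isA := (isA pB pC).
Local Notation isB := (isB pA pC).
Hypothesis X_C : forall j i k, X j i k != 0 -> nC k = 0%N.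
Hypothesis X_AB : forall j i k, ~~ pC i -> X j i k != 0 -> nB k = 0%N.

Lemma errI_zero h m v : (forall k l, h (k - l) != 0 -> m k = m l) -> (forall k, 0 < m k) ->
  sq (errI h m v) /\ N2 (errI h m v) = 0.
Proof.
move=> h1 h2; rewrite errI0 // /sq /N2.
have -> : (fun k : Z => nm (0 : C) ^+ 2) = (fun=> 0).
  by apply/funext => k; rewrite nm0 expr0n.
by rewrite nsum0; split=> //; apply: nsm0.
Qed.

(** A nonzero coefficient of the divergence comes from the [D_i] derivative of some component [i].
    The fields do not depend on [x], so [i] is not in C, and such components do not depend on [t'']
    either. *)
Lemma divbar_supp j k : divbar (X j) k != 0 -> isA k.
Proof.
move=> h; have [i hi] : exists i, Dm i (cbar (X j i)) k != 0.
  apply/existsP; apply: contraNT h; rewrite negb_exists => /forallP hh.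
  by rewrite /divbar big1 // => i _; apply/eqP; have := hh i; rewrite negbK.
have hx : X j i (- k) != 0.
  by apply: contraNneq hi => e; rewrite /Dm /cbar e conjc0 mulr0.
have ki : k 0 i != 0 by apply: contraNneq hi => e; rewrite /Dm e mul0r.
have hC := X_C hx; rewrite nrmN in hC.
have iC : ~~ pC i.
  by apply: contraNN ki => hi'; apply/eqP; move/eqP/nrm0P: hC; apply.
by have := X_AB iC hx; rewrite nrmN /isA hC => ->.
Qed.

(** The fields have no C frequencies, so the weight is constant along their supports and every error
    is zero. *)
Lemma claim_C kap c K : 0 < kap -> 0 <= c -> master_at kap 0 c K ->
  forall lam, 1 <= lam -> lam * rho < 1 -> exists B, forall k, nm (u k) * lam ^+ nC k <= B.
Proof.
move=> kap0 c0 hm lam l1 lr.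
apply: (claim (G0 := 0) l1 lr (fun k => nrm_le pC k) c0 hm (lexx 0)) => L j.
have adm := lamL_adm nC l1 L; set mm := lamL lam nC L in adm *.
have m0 : forall k, 0 < mm k by case: adm.
have i0 : forall k, 0 < minv mm k by move=> k; rewrite invr_gt0.
have eqm h : (forall k, h k != 0 -> nC k = 0%N) -> forall k l, h (k - l) != 0 -> mm k = mm l.
  move=> hC k l /hC e; rewrite /mm /lamL -[in LHS](subrK l k) addrC.
  by rewrite (nrm_shift0 _ e).
have eqi h : (forall k, h k != 0 -> nC k = 0%N) -> forall k l, h (k - l) != 0 -> minv mm k = minv mm l.
  by move=> hC k l hkl; rewrite /minv (eqm h hC k l hkl).
have dC j' k : divbar (X j') k != 0 -> nC k = 0%N by move=> /divbar_supp/andP[_ /eqP].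
have w0 : 0 <= kap * energy X (wm mm u) + 0 * N2 (wm mm u) + 0.
  rewrite mul0r !addr0; apply: mulr_ge0; first exact: ltW.
  by apply: energy_ge0 => //; case: adm.
have [||q1 q2 q3 q4] := @err_bound_errI R d N X X_rapid mm u f 0 0 adm (lexx 0) _ _ j.
- move=> j' i; have [s1 e1] := errI_zero (Dm i (wm mm u)) (eqm _ (X_C (j := j') (i := i))) m0.
  have [s2 e2] := errI_zero (Dm i (wm mm u)) (eqi _ (X_C (j := j') (i := i))) i0.
  by rewrite e1 e2.
- by move=> j'; have [s2 e2] := errI_zero (wm mm u) (eqi _ (dC j')) i0; rewrite e2.
by split=> //; [apply: le_trans q3 _ | apply: le_trans q4 _]; rewrite mulr0.
Qed.

Lemma err_bound_of m kap G1 G0 (b : R) : errC R d * b <= kap * energy X (wm m u) + G1 * N2 (wm m u) + G0 ->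
  (forall j, [/\ sq (err X m j u), sq (err' X m j u),
     N2 (err X m j u) <= errC R d * b & N2 (err' X m j u) <= errC R d * b]) ->
  err_bound X m u kap G1 G0.
Proof.
move=> hb h j; have [h1 h2 h3 h4] := h j.
by split=> //; [apply: le_trans h3 hb | apply: le_trans h4 hb].
Qed.

Lemma nrm_sq_le P k : ((nrm P k)%:R : R) ^+ 2 <= d%:R * \sum_(i | P i) `|k 0%R i|%N%:R ^+ 2.
Proof.
have [h _] := sqr_sum_le (enum 'I_d) (fun i => if P i then `|k 0%R i|%N%:R else 0 : R).
rewrite !big_enum size_enum_ord -big_mkcond /= in h.
rewrite /nrm natr_sum; apply: le_trans h _; rewrite [in leRHS]big_mkcond /=.
by rewrite ler_wpM2l //; apply: ler_sum => i _; case: ifP => // _; rewrite expr0n.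
Qed.

Lemma sum_N2_Dm P w : (forall i, sq (Dm i w)) ->
  nsm (fun k => (\sum_(i | P i) `|k 0%R i|%N%:R ^+ 2) * nm (w k) ^+ 2) /\
  nsum (fun k => (\sum_(i | P i) `|k 0%R i|%N%:R ^+ 2) * nm (w k) ^+ 2) =
  \sum_(i | P i) N2 (Dm i w).
Proof.
move=> hw; have [h1 h2] := nsm_sum (index_enum 'I_d) (P := P) (fun i _ => hw i).
have e : (fun k => \sum_(i | P i) nm (Dm i w k) ^+ 2) =
   (fun k => (\sum_(i | P i) `|k 0%R i|%N%:R ^+ 2) * nm (w k) ^+ 2).
  apply/funext => k; rewrite mulr_suml; apply: eq_bigr => i _.
  by rewrite nmM nm_int exprMn.
by rewrite -e.
Qed.

Variable Ke : R.
Hypothesis Ke0 : 0 <= Ke.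
Hypothesis elliptic : forall i x (p : 'I_d -> C), pA i ->
  nm (p i) ^+ 2 <= Ke * \sum_j nm (\sum_i' fser (X j i') x * p i') ^+ 2.

Lemma elliptic_N2 i w : pA i -> ord (-10) w -> N2 (Dm i w) <= Ke * energy X w.
Proof.
move=> hi hw; apply: pointwise_N2 => //.
- by apply: nsm_ord2; apply: (@ord_mono _ _ (-9)) => //; apply: (ord_Dm i hw).
- by move=> j; apply: nsm_ord2; apply: (@ord_mono _ _ (-9)) => //; apply: dom_vop.
move=> x; apply: le_trans (elliptic x (fun i => fser (Dm i w) x) hi) _.
rewrite le_eqVlt; apply/orP; left; apply/eqP; congr (_ * _).
apply: eq_bigr => j _; rewrite fser_vop //.
exact: ord_mono hw.
Qed.

Lemma kernel_sumZ (c : R) (om : Z -> R) : 0 <= c ->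
  (forall j i, nsm (fun k => nm (X j i k) * om k)) ->
  (forall j, nsm (fun k => nm (divbar (X j) k) * om k)) ->
  kernel_sum X (fun k => c * om k) = c ^+ 2 * kernel_sum X om.
Proof.
move=> c0 h1 h2; rewrite /kernel_sum mulr_sumr; apply: eq_bigr => j _.
rewrite mulrDr mulr_sumr; congr (_ + _).
  apply: eq_bigr => i _; rewrite -exprMn -nsumZ //; congr (_ ^+ 2).
  by apply: eq_nsum => k; rewrite mulrCA.
by rewrite -exprMn -nsumZ //; congr (_ ^+ 2); apply: eq_nsum => k; rewrite mulrCA.
Qed.

(* Truncated subtraction: positive parts, here and in psiB. *)
Definition psiA k := (nA k - (nB k + nC k))%N.

(** The derivative costs a linear factor, paid by raising the rate from [rho] to the midpoint of
    [rho] and 1. *)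
Lemma divbar_geom : exists2 c, 0 <= c & exists2 w, 0 <= w < 1 &
  rho <= w /\ forall j k, nm (divbar (X j) k) <= c * w ^+ absn k.
Proof.
pose v := (1 + rho) / 2.
have [v0 v1 vr] : [/\ 0 < v, v < 1 & rho < v].
  by move: rho0 rho1; rewrite /v => h0 h1; split; lra.
have hx : 0 <= rho / v < 1.
  apply/andP; split; first by apply: divr_ge0 => //; exact: ltW.
  by rewrite ltr_pdivrMr // mul1r.
have [c c0 hc] := poly_geom 1 hx.
exists (d%:R * (c * cx)); first by rewrite !mulr_ge0.
exists v; first by rewrite (ltW v0).
split=> [|j k]; first exact: ltW.
apply: le_trans (ler_nm_sum _ _ _) _.
apply: (@le_trans _ _ (\sum_(i < d) c * cx * v ^+ absn k)).
  apply: ler_sum => i _; rewrite nmM nm_int /cbar nmJ.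
  have := X_geom j i (- k); rewrite absnN => h.
  apply: le_trans (ler_wpM2l (ler0n _ _) h) _.
  have h2 := hc (absn k); rewrite expr1 in h2.
  have h3 : (`|k 0%R i|%N%:R : R) <= (absn k).+1%:R.
    by rewrite ler_nat ltnW // ltnS absn_ge.
  have -> : rho = rho / v * v by rewrite divfK // gt_eqF.
  rewrite exprMn mulrCA mulrA [c * cx]mulrC -!mulrA ler_wpM2l //.
  rewrite mulrA ler_wpM2r ?exprn_ge0 ?(ltW v0) //.
  apply: le_trans h2; rewrite ler_wpM2r // exprn_ge0 //; by case/andP: hx.
by rewrite sumr_const card_ord -[X in X <= _]mulr_natl mulrA lexx.
Qed.

Lemma psiA_lip k l : (psiA k <= psiA l + absn (k - l))%N.
Proof.
have a1 := nrmB pA k l; have b1 := nrmB pB l k; have c1 := nrmB pC l k.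
have := absn_split part (k - l); rewrite /psiA.
rewrite -(nrmN pB (l - k)) opprB in b1; rewrite -(nrmN pC (l - k)) opprB in c1.
move: a1 b1 c1; move: (nrm pA k) (nrm pB k) (nrm pC k) (nrm pA l) (nrm pB l) (nrm pC l) (nrm pA (k - l)) (nrm pB (k - l)) (nrm pC (k - l)) => *.
lia.
Qed.

(** A positive part that changes is nonzero at [k] or at [l], where the A frequency then exceeds the
    others. So at [l] every derivative is controlled by those in the A directions, up to a factor
    depending on [k - l]. *)
Lemma psiA_far k l i : (psiA k != psiA l)%N ->
  (`|l 0%R i| <= 3 * (absn (k - l)).+1 * (nA l).+1)%N.
Proof.
move=> h; have a1 := nrmB pA k l; have b1 := nrmB pB l k; have c1 := nrmB pC l k.
rewrite -(nrmN pB (l - k)) opprB in b1; rewrite -(nrmN pC (l - k)) opprB in c1.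
have e := absn_split part (k - l); have e2 := absn_split part l.
have := absn_ge l i; move: h; rewrite /psiA.
by move: (absn (k - l)) (nA (k - l)) (nB (k - l)) (nC (k - l)) e a1 b1 c1 => n a b c; nia.
Qed.

Lemma N2_gA w : ord (-10) w ->
  sq (fun k => ((nA k).+1%:R)%:C * w k) /\ N2 (fun k => ((nA k).+1%:R)%:C * w k) <= 2 * (d%:R * d%:R * Ke * energy X w + N2 w).
Proof.
move=> hw; have sw : sq w by apply: dom_sq.
have hD i : sq (Dm i w) by apply: (@ord_sq _ _ (-9)) => //; apply: (ord_Dm i hw).
have E0 := energy_ge0 X_rapid hw.
have [s1 e1] := sum_N2_Dm pA hD.
have s3 : nsm (fun k => d%:R * ((\sum_(i | pA i) `|k 0%R i|%N%:R ^+ 2) * nm (w k) ^+ 2) + nm (w k) ^+ 2).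
  by apply: nsmD => //; exact: nsmZ.
have s2 := nsmZ (ler0n R 2) s3.
have key k : nm (((nA k).+1%:R)%:C * w k) ^+ 2 <=
    2 * (d%:R * ((\sum_(i | pA i) `|k 0%R i|%N%:R ^+ 2) * nm (w k) ^+ 2) + nm (w k) ^+ 2).
  rewrite nmM nm_real normr_nat exprMn [X in 2 * (X + _)]mulrA.
  rewrite -[X in _ <= _ * (_ + X)]mul1r -mulrDl mulrA ler_wpM2r ?sqr_ge0 //.
  have := nrm_sq_le pA k; rewrite -natr1; move: ((nA k)%:R : R) (d%:R * _) => x y h.
  by have := sqr_ge0 (x - 1); move: h; rewrite !expr2; lra.
have s4 : sq (fun k => ((nA k).+1%:R)%:C * w k).
  by apply: (nsm_le s2) => k; rewrite sqr_ge0 key.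
split=> //; apply: le_trans (le_nsum s2 key) _.
rewrite nsumZ // ler_pM2l // nsumD //; last exact: nsmZ.
rewrite nsumZ // e1 lerD2r -!mulrA ler_wpM2l //.
apply: (@le_trans _ _ (\sum_(i < d) Ke * energy X w)).
  rewrite [leLHS]big_mkcond; apply: ler_sum => i _; case: ifP => hi; first exact: elliptic_N2.
  exact: mulr_ge0.
by rewrite sumr_const card_ord -[X in X <= _]mulr_natl lexx.
Qed.

Lemma small_lam (c kap w : R) : 0 <= c -> 0 < kap -> 0 <= w < 1 ->
  exists2 l, 1 < l & [/\ l <= 2, l * w < 1 & forall lam, 1 <= lam -> lam <= l ->
   (lam - 1) ^+ 2 * c <= kap].
Proof.
move=> c0 kap0 /andP[w0 w1].
pose a := kap / (c + 1); pose b := (1 - w) / 2.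
have c1 : 0 < c + 1 by rewrite ltr_wpDl.
have a0 : 0 < a by apply: divr_gt0.
have b0 : 0 < b by apply: divr_gt0; rewrite ?subr_gt0.
have b1 : b <= 1 by rewrite /b; lra.
pose e := Num.min a b; have e0 : 0 < e by rewrite lt_min a0.
have [ea eb] : e <= a /\ e <= b by split; rewrite ge_min lexx ?orbT.
exists (1 + e); first by rewrite ltrDl.
split; first by lra.
  rewrite mulrDl mul1r; have : e * w <= b by apply: le_trans eb; rewrite ler_piMr // ltW.
  by rewrite /b; lra.
move=> lam l1 l2; have h1 : 0 <= lam - 1 <= e by rewrite subr_ge0 l1 lerBlDl.
have h2 : (lam - 1) ^+ 2 <= a.
  case/andP: h1 => h1 h3; apply: le_trans ea; apply: le_trans h3.
  by rewrite expr2 ler_piMl //; apply: le_trans (le_trans eb b1); rewrite lerBlDl.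
apply: le_trans (ler_wpM2r c0 h2) _; rewrite /a mulrAC ler_pdivrMr // ler_pM2l //.
by rewrite lerDl.
Qed.

(** By [psiA_far] the errors only see [m u] and its A derivatives, which ellipticity bounds by the
    energy ([N2_gA]); the factor [(lam - 1)^2] brings the share of the energy below [kap]. *)
Lemma claim_A kap : 0 < kap -> (forall G1, 0 <= G1 -> exists c, exists2 K, 0 <= c & master_at kap G1 c K) ->
  exists2 l1, 1 < l1 & forall lam, 1 <= lam -> lam <= l1 ->
  exists B, forall k, nm (u k) * lam ^+ psiA k <= B.
Proof.
move=> kap0 hk; have [cd cd0 [w' w01 [rw dg]]] := divbar_geom.
have w0 : 0 <= w' by case/andP: w01.
have [lM lM1 [lM2 lMw _]] := small_lam ler01 ltr01 w01.
(* [3 br] comes from [psiA_far]. The variation of the weight gives [|z| lM^|z|], whose [|z|] is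
   bounded by the second factor [br]. *)
pose om1 (z : Z) := 3 * (lM ^+ absn z * br R z ^+ 2).
have lM0 : 0 <= lM := le_trans ler01 (ltW lM1).
have omsm h (b c : R) : 0 <= b -> 0 <= c -> lM * c < 1 -> (forall k, nm (h k) <= b * c ^+ absn k) ->
   nsm (fun k => nm (h k) * om1 k).
  move=> b0 c0 lc hh; have := nsmZ (ler0n R 3) (rapid_lam b0 c0 lM0 lc hh 2).
  by congr nsm; apply/funext => k; rewrite /om1; ring.
have o1 j i : nsm (fun k => nm (X j i k) * om1 k).
  apply: (omsm _ cx rho) => //; apply: le_lt_trans lMw.
  exact: ler_wpM2l.
have o2 j : nsm (fun k => nm (divbar (X j) k) * om1 k) by apply: (omsm _ cd w').
pose S := kernel_sum X om1.
have S0 : 0 <= S.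
  apply: sumr_ge0 => j _; rewrite addr_ge0 ?sqr_ge0 // sumr_ge0 // => i _; exact: sqr_ge0.
have eC0 : 0 <= errC R d by rewrite mulr_ge0 // addr_ge0 // mulr_ge0 // exprn_ge0.
pose G1 := errC R d * (S * 2).
have G10 : 0 <= G1 by apply: mulr_ge0 => //; exact: mulr_ge0.
have [c [K c0 hm]] := hk G1 G10.
pose T := errC R d * (S * (2 * (d%:R * d%:R * Ke))).
have T0 : 0 <= T by rewrite /T; do ! apply: mulr_ge0 => //.
have lMi : 0 <= lM^-1 < 1 by rewrite invr_ge0 lM0 invf_lt1 // (lt_trans ltr01).
have [l1 l11 [l12 lw hl]] := small_lam T0 kap0 w01.
pose ll := Num.min l1 lM.
have [ll1 ll2] : ll <= l1 /\ ll <= lM by split; rewrite ge_min lexx ?orbT.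
exists ll; first by rewrite lt_min l11.
move=> lam lam1 lamll; have lamM := le_trans lamll ll2.
have lamr : lam * rho < 1.
  by apply: le_lt_trans lMw; apply: ler_pM => //; exact: le_trans ler01 lam1.
apply: (claim (G0 := 0) lam1 lamr _ c0 hm (lexx 0)).
  by move=> k; rewrite /psiA (leq_trans (leq_subr _ _)) // nrm_le.
move=> L; have adm := lamL_adm psiA lam1 L; set mm := lamL lam psiA L in adm *.
have hw : ord (-10) (wm mm u) by case: adm.
have [sg ng] := N2_gA hw.
have l0 : 0 <= lam - 1 by rewrite subr_ge0.
have oz (f' : Z -> R) : (fun k => f' k * ((lam - 1) * om1 k)) = (fun k : Z => (lam - 1) * (f' k * om1 k)).
  by apply/funext => k; rewrite mulrCA.
have E0 := energy_ge0 X_rapid hw; have n0 := N2_ge0 (dom_sq hw).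
apply: (err_bound_of _ (@err_kernel R d N X X_rapid (fun k => (lam - 1) * om1 k) _ mm u f 0 adm sg _ _ _)).
- rewrite addr0 kernel_sumZ // -/S.
  have h1 : (lam - 1) ^+ 2 <= 1 by rewrite exprn_ile1 // lerBlDl (le_trans lamM).
  have s0 := sqr_ge0 (lam - 1).
  apply: le_trans (ler_wpM2l eC0 (ler_wpM2l (mulr_ge0 s0 S0) ng)) _.
  have -> : errC R d * ((lam - 1) ^+ 2 * S * (2 * (d%:R * d%:R * Ke * energy X (wm mm u) + N2 (wm mm u)))) =
   (lam - 1) ^+ 2 * T * energy X (wm mm u) + (lam - 1) ^+ 2 * (G1 * N2 (wm mm u)).
    by rewrite /T /G1; ring.
  apply: lerD; first by rewrite ler_wpM2r // hl // (le_trans lamll).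
  by rewrite -[leRHS]mul1r ler_wpM2r // mulr_ge0.
- by move=> j i; rewrite oz; apply: nsmZ.
- by move=> j; rewrite oz; apply: nsmZ.
move=> m' hm' k l.
have w'0 := nm_ge0 (wm mm u l).
have ratio := lamL_ratio lam1 lamr hm' (psiA_lip k l).
have hlk : (psiA l <= psiA k + absn (k - l))%N by have := psiA_lip l k; rewrite -(absnN (l - k)) opprB.
have {}ratio := ratio hlk.
have rat2 : `|m' k / m' l - 1| <= (lam - 1) * ((absn (k - l))%:R * lM ^+ absn (k - l)).
  apply: le_trans ratio _; apply: le_trans (lam_pow1 _ lam1) _.
  rewrite ler_wpM2l // ler_wpM2l // lerXn2r // nnegrE //; exact: le_trans ler01 lam1.
have same : psiA k = psiA l -> m' k / m' l - 1 = 0.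
  move=> e; have := lamL_ratio (n := 0) lam1 lamr hm'; rewrite expr0 subrr.
  move=> /(_ k l); rewrite e !addn0 leqnn => /(_ isT isT).
  by rewrite normr_le0 => /eqP.
have b0 : 1 <= br R (k - l) := br_ge1 R (k - l).
have lp : 0 <= lM ^+ absn (k - l) by rewrite exprn_ge0.
have main (x : R) : 0 <= x -> (psiA k != psiA l -> x <= 3 * br R (k - l) * (nA l).+1%:R) ->
   `|m' k / m' l - 1| * (x * nm (wm mm u l)) <=
   (lam - 1) * om1 (k - l) * nm (((nA l).+1%:R)%:C * wm mm u l).
  move=> x0 hx; rewrite nmM nm_real normr_nat.
  have r0 : 0 <= (lam - 1) * om1 (k - l) * ((nA l).+1%:R * nm (wm mm u l)).
    by rewrite !mulr_ge0 // sqr_ge0.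
  case: (eqVneq (psiA k) (psiA l)) => [/same -> | /hx {}hx]; first by rewrite normr0 mul0r.
  apply: le_trans (ler_pM (normr_ge0 _) _ rat2 (ler_wpM2r w'0 hx)) _.
    by rewrite mulr_ge0.
  have -> : (lam - 1) * om1 (k - l) * ((nA l).+1%:R * nm (wm mm u l)) =
    (lam - 1) * (br R (k - l) * lM ^+ absn (k - l)) * (3 * br R (k - l) * (nA l).+1%:R * nm (wm mm u l)).
    rewrite /om1; move: (lM ^+ absn (k - l)) (br R (k - l)) (_.+1%:R) (nm _) => *; ring.
  rewrite ler_wpM2r ?mulr_ge0 // ?(le_trans ler01) // ler_wpM2l // ler_wpM2r //.
  by rewrite /br ler_nat.
split=> [i|].
  apply: main => // h; have := psiA_far i h.
  by rewrite -(ler_nat R) !natrM.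
have := main 1 ler01; rewrite mul1r; apply => _.
have p1 : 1 <= (nA l).+1%:R :> R by rewrite ler1n.
have : 1 * 1 <= br R (k - l) * (nA l).+1%:R by apply: ler_pM.
by rewrite mul1r -mulrA; move: (br R (k - l) * _) => y y1; apply: (le_trans y1); rewrite ler_peMl ?ler1n ?(le_trans ler01 y1).
Qed.

Variables (a : Z -> C) (Ka nu K2 : R).
Hypotheses (a_rapid : rapid a) (a_supp : forall k, a k != 0 -> isA k).
Hypotheses (Ka0 : 0 <= Ka) (nu0 : 0 < nu) (nu1 : nu < 1) (K20 : 0 <= K2).
Hypothesis coef_le : forall j i z x, pC i -> isB z ->
  nm (fser (pcoef pB pC z (X j i)) x) <= Ka * nu ^+ absn z * nm (fser a x).
Hypothesis dominated : forall i x (p : 'I_d -> C), pB i ->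
  nm (fser a x * p i) ^+ 2 <= K2 * (\sum_j nm (\sum_i' fser (X j i') x * p i') ^+ 2 +
    \sum_(i' | pC i') nm (fser a x * p i') ^+ 2).

Lemma isA_z k : isA k -> nB k = 0%N /\ nC k = 0%N.
Proof. by case/andP => /eqP ? /eqP. Qed.

(** [a] has A frequencies only, that is, it is a function of [t']. *)
Lemma cv_a_Dm i w : ~~ pA i -> ord (-10) w -> cv a (Dm i w) = Dm i (cv a w).
Proof.
move=> hi hw; apply/funext => k; rewrite /Dm /cv -csumZ; last exact: cv_sm hw.
apply: eq_csum => l; case: (eqVneq (a (k - l)) 0) => [->|/a_supp/isA_z[hB hC]].
  by rewrite !mul0r mulr0.
have : (k - l) 0 i = 0.
  case: (kindP part i) => -[h1 h2 h3]; first by rewrite h1 in hi.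
    by move/eqP/nrm0P: hB; apply.
  by move/eqP/nrm0P: hC; apply.
by rewrite !mxE => /eqP; rewrite subr_eq0 => /eqP ->; rewrite mulrCA.
Qed.

Lemma cv_a_wm m w : (forall k t, isA t -> m (k + t) = m k) -> ord (-10) w ->
  cv a (wm m w) = wm m (cv a w).
Proof.
move=> hm hw; apply/funext => k; rewrite /wm /cv -csumZ; last exact: cv_sm hw.
apply: eq_csum => l; case: (eqVneq (a (k - l)) 0) => [->|/a_supp h].
  by rewrite !mul0r mulr0.
have -> : m k = m l by rewrite -(hm l _ h) addrC subrK.
by rewrite mulrCA.
Qed.

(** The fields control [D_t''] only after multiplication by [a], and only modulo [a D_x w], which
    [xi_bound] takes care of. *)
Lemma dominated_N2 i w : pB i -> ord (-10) w ->
  N2 (cv a (Dm i w)) <= K2 * (energy X w + \sum_(i' | pC i') N2 (cv a (Dm i' w))).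
Proof.
move=> hi hw.
have oD i' : ord (-9) (Dm i' w) by apply: (ord_Dm i' hw).
have sD i' : csm (Dm i' w) by apply: nsm_ord2; apply: ord_mono (oD i').
have sa : csm a by apply: csm_rapid.
have scv i' : csm (cv a (Dm i' w)).
  by apply: nsm_ord2; apply: (@ord_mono _ _ (-9)) => //; apply: ord_cv.
have sX j : csm (vop (X j) w).
  by apply: nsm_ord2; apply: (@ord_mono _ _ (-9)) => //; apply: dom_vop.
pose g (s : 'I_N + 'I_d) : Z -> C := match s with
  inl j => vop (X j) w | inr i' => if pC i' then cv a (Dm i' w) else fun=> 0 end.
have z0 : csm (fun _ : Z => 0 : C) by exact: csm0.
have f0 x : fser (fun _ : Z => 0 : C) x = 0.
  by rewrite /fser -[RHS](@csum0 R Z); apply: eq_csum => k; rewrite mul0r.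
have n0 : N2 (fun _ : Z => 0 : C) = 0 :> R.
  by rewrite /N2 -[RHS](@nsum0 R Z); apply: eq_nsum => k; rewrite nm0 expr0n.
have sg s : csm (g s) by case: s => [j|i'] /=; [exact: sX | case: ifP].
have hf i' x : fser (cv a (Dm i' w)) x = fser a x * fser (Dm i' w) x.
  by apply: fser_cv => // k; apply: cv_sm (oD i').
have sumE (F : 'I_N + 'I_d -> R) : \sum_s F s = \sum_j F (inl j) + \sum_i' F (inr i').
  exact: big_sumType.
have := pointwise_N2 K20 (scv i) sg; rewrite sumE.
have -> : \sum_i' N2 (g (inr i')) = \sum_(i' | pC i') N2 (cv a (Dm i' w)).
  by rewrite [RHS]big_mkcond; apply: eq_bigr => i' _ /=; case: ifP.
apply => x; rewrite sumE hf; apply: le_trans (dominated x (fun i => fser (Dm i w) x) hi) _.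
rewrite le_eqVlt; apply/orP; left; apply/eqP; congr (_ * (_ + _)).
  by apply: eq_bigr => j _ /=; rewrite fser_vop //; exact: ord_mono hw.
rewrite big_mkcond; apply: eq_bigr => i' _ /=.
by case: ifP => _; rewrite ?f0 ?nm0 ?expr0n ?hf.
Qed.

Definition psiB (M : nat) k := (nB k - M * nC k)%N.

Lemma psiB_A M k t : isA t -> psiB M (k + t) = psiB M k.
Proof. by move=> /isA_z[hB hC]; rewrite /psiB !nrm_shift0. Qed.

Lemma psiB_B M k z : isB z -> (psiB M k <= psiB M (k - z) + absn z)%N /\
  (psiB M (k - z) <= psiB M k + absn z)%N.
Proof.
move=> /andP[/eqP hA /eqP hC]; have e := absn_split part z; rewrite hA hC in e.
have h1 := nrmB pB k (k - z); have h2 := nrmD pB k (- z).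
have ez : k - (k - z) = z by rewrite opprB addrC subrK.
rewrite ez in h1; rewrite nrmN in h2; rewrite /psiB.
have -> : nrm pC (k - z) = nrm pC k by rewrite nrm_shift0 // nrmN.
by move: h1 h2 e; move: (nrm pB k) (nrm pC k) (nrm pB (k - z)) (nrm pB z) (absn z) => *; lia.
Qed.

(** Where [nB <= M nC] the weight is 1 and [w] equals [w0]. Elsewhere the C derivatives are at most
    [1 / M] times the B derivatives, which [dominated_N2] bounds by the energy and the C derivatives
    again, so a large [M] absorbs the latter. In the condition on [M], one factor [d] comes from
    [nrm_sq_le] and the other from the sum over the B directions. *)
Lemma xi_bound M m w w0 : d%:R ^+ 2 * K2 * 2 <= M%:R ^+ 2 -> (0 < M)%N ->
  ord (-10) w -> (forall k, (nB k <= M * nC k)%N -> w k = w0 k) ->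
  (forall k t, isA t -> m (k + t) = m k) -> ord (-10) w0 -> w = wm m w0 ->
  (forall k, (nB k <= M * nC k)%N -> m k = 1) ->
  \sum_(i | pC i) N2 (cv a (Dm i w)) <=
  2 * \sum_(i | pC i) N2 (Dm i (cv a w0)) + energy X w.
Proof.
move=> hM M0 hw hww hm hw0 ew hm1.
have E0 := energy_ge0 X_rapid hw.
set q := cv a w; have oq : ord (-10) q by apply: ord_cv.
have eq0 : q = wm m (cv a w0) by rewrite /q ew cv_a_wm.
have sD v i : ord (-10) v -> sq (Dm i v).
  by move=> hv; apply: (@ord_sq _ _ (-9)) => //; apply: (ord_Dm i hv).
have pCA i : pC i -> ~~ pA i by case: (kindP part i) => -[h1 h2 h3] // h; rewrite h in h3.
have pBA i : pB i -> ~~ pA i by case: (kindP part i) => -[h1 h2 h3] // h; rewrite h in h2.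
have eC : \sum_(i | pC i) N2 (cv a (Dm i w)) = \sum_(i | pC i) N2 (Dm i q).
  by apply: eq_bigr => i /pCA h; rewrite cv_a_Dm.
have [sB eB] := sum_N2_Dm pB (fun i => sD q i oq).
have [sC eqC] := sum_N2_Dm pC (fun i => sD q i oq).
have o0 : ord (-10) (cv a w0) by apply: ord_cv.
have [sU eU] := sum_N2_Dm pC (fun i => sD _ i o0).
rewrite eC; set H := \sum_(i | pC i) N2 (Dm i q) in eqC *.
set U := \sum_(i | pC i) _ in eU *; pose Hb := \sum_(i | pB i) N2 (Dm i q).
have H0 : 0 <= H by apply: sumr_ge0 => i _; apply: N2_ge0; apply: sD.
have b1 : Hb <= d%:R * (K2 * (energy X w + H)).
  apply: (@le_trans _ _ (\sum_(i < d) K2 * (energy X w + H))).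
    rewrite /Hb big_mkcond; apply: ler_sum => i _; case: ifP => hi.
      by rewrite -cv_a_Dm ?pBA // /H -eC; apply: dominated_N2.
    by rewrite mulr_ge0 // addr_ge0.
  by rewrite sumr_const card_ord -[X in X <= _]mulr_natl lexx.
have MR : 0 < M%:R ^+ 2 :> R by rewrite exprn_gt0 // ltr0n.
have b2 : M%:R ^+ 2 * H <= M%:R ^+ 2 * U + d%:R * Hb.
  rewrite -eqC -eU /Hb -eB -!nsumZ ?sqr_ge0 //.
  rewrite -nsumD; last 2 first.
  - by apply: nsmZ => //; exact: sqr_ge0.
  - by apply: nsmZ => //.
  apply: le_nsum.
    by apply: nsmD; [apply: nsmZ => //; exact: sqr_ge0 | apply: nsmZ => //].
  move=> k; set SC := \sum_(i | pC i) _; set SB := \sum_(i | pB i) _.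
  have SC0 : 0 <= SC by apply: sumr_ge0 => i _; exact: sqr_ge0.
  have SB0 : 0 <= SB by apply: sumr_ge0 => i _; exact: sqr_ge0.
  have n1 := sqr_ge0 (nm (q k)); have n2 := sqr_ge0 (nm (cv a w0 k)).
  case: (leqP (nB k) (M * nC k)) => hk.
    by rewrite eq0 /wm hm1 // mul1r lerDl; do 2! apply: mulr_ge0 => //.
  apply: (@le_trans _ _ (d%:R * (SB * nm (q k) ^+ 2))); last first.
    by rewrite lerDr mulr_ge0 ?(ltW MR) // mulr_ge0.
  rewrite [X in X <= _]mulrA [leRHS]mulrA; apply: ler_wpM2r => //.
  have hC : SC <= (nC k)%:R ^+ 2.
    rewrite /SC /nrm natr_sum.
    have hs (s : seq 'I_d) : \sum_(i <- s | pC i) (`|k 0%R i|%N%:R : R) ^+ 2 <=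
       (\sum_(i <- s | pC i) `|k 0%R i|%N%:R) ^+ 2.
      elim: s => [|i s IH]; first by rewrite !big_nil expr0n.
      rewrite !big_cons; case: ifP => // _.
      have p1 : 0 <= (`|k 0%R i|%N%:R : R) by [].
      have p2 : 0 <= \sum_(i0 <- s | pC i0) (`|k 0%R i0|%N%:R : R) by apply: sumr_ge0.
      rewrite sqrrD -addrA lerD2l; apply: le_trans IH _; rewrite lerDr.
      by rewrite mulrn_wge0 // mulr_ge0.
    exact: hs.
  apply: le_trans (ler_wpM2l (ltW MR) hC) _; rewrite -exprMn -natrM.
  apply: (@le_trans _ _ ((nB k)%:R ^+ 2)).
    by rewrite lerXn2r ?nnegrE // ler_nat ltnW.
  exact: nrm_sq_le.
have b3 : d%:R * Hb <= d%:R ^+ 2 * K2 * (energy X w + H).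
  by apply: le_trans (ler_wpM2l (ler0n _ _) b1) _; rewrite expr2 -!mulrA lexx.
have b4 : d%:R ^+ 2 * K2 * 2 * (energy X w + H) <= M%:R ^+ 2 * (energy X w + H).
  by rewrite ler_wpM2r // addr_ge0.
have b5 : M%:R ^+ 2 * H <= M%:R ^+ 2 * (2 * U + energy X w).
  move: b2 b3 b4; rewrite !mulrDr; move: (_ * Hb) (_ * K2) (M%:R ^+ 2) => x y z.
  lra.
by rewrite ler_pM2l // in b5.
Qed.

Lemma csm_ratio h m v k (b : R) : (forall k l, `|m k / m l - 1| <= b) -> rapid h -> ord (-4) v ->
  csm (fun l => h (k - l) * (m k / m l - 1)%:C * v l).
Proof.
move=> hm hh hv; have b0 : 0 <= b := le_trans (normr_ge0 _) (hm 0 0).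
have := nsmZ b0 (cv_sm k hh hv); move/nsm_le; apply => l.
rewrite nm_ge0 /= !nmM nm_real mulrAC mulrC ler_wpM2r ?hm //.
by rewrite mulr_ge0 ?nm_ge0.
Qed.

Lemma Gam_le lam lam' : 1 <= lam -> lam <= lam' -> lam' ^+ 2 * nu < 1 ->
  Gam d nu lam <= Gam d nu lam'.
Proof.
move=> l1 l2 hl; have l0 := le_trans ler01 l1.
have sn : nsm (fun z : Z => nu ^+ absn z) by apply: nsm_geomZ; rewrite (ltW nu0).
rewrite /Gam ler_wpM2l ?nsum_ge0 //; apply: le_nsum => [|z].
  by apply: Gam_sm => //; exact: le_trans l2.
rewrite ler_wpM2l ?exprn_ge0 ?(ltW nu0) //.
have l0' := le_trans l0 l2.
rewrite lerXn2r ?nnegrE ?mulr_ge0 ?exprn_ge0 // ler_wpM2l // lerXn2r //.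
Qed.

(** Components outside C have A frequencies only and commute with the weight. Those in C give errors
    bounded by [a D_x (m u)], hence, through [xi_bound], by a small share of the energy plus a term
    in [u] itself. *)
Lemma claim_B kap c K : 0 < kap -> 0 <= c -> master_at kap 0 c K ->
  exists M, exists2 l1, 1 < l1 & forall lam, 1 <= lam -> lam <= l1 ->
  exists B, forall k, nm (u k) * lam ^+ psiB M k <= B.
Proof.
move=> kap0 c0 hm; pose M := (Num.truncn (d%:R ^+ 2 * K2 * 2)).+1; exists M.
have hM : d%:R ^+ 2 * K2 * 2 <= M%:R ^+ 2.
  have h1 : d%:R ^+ 2 * K2 * 2 <= M%:R by apply: ltW; apply: truncnS_gt.
  apply: le_trans h1 _; rewrite expr2 ler_peMl // ler1n //.
pose w0 := Num.max rho (Num.sqrt nu).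
have w01 : 0 <= w0 < 1.
  rewrite le_max rho0 /= gt_max rho1 /= -sqrtr1 ltr_sqrt // ltr01.
have [lM lM1 [_ lMw _]] := small_lam ler01 ltr01 w01.
have lM0 : 0 <= lM := le_trans ler01 (ltW lM1).
have lMr : lM * rho < 1.
  by apply: le_lt_trans lMw; rewrite ler_wpM2l // le_max lexx.
have lMn : lM ^+ 2 * nu < 1.
  have -> : lM ^+ 2 * nu = (lM * Num.sqrt nu) ^+ 2 by rewrite exprMn sqr_sqrtr ?(ltW nu0).
  rewrite exprn_ilt1 //; first by rewrite mulr_ge0 // sqrtr_ge0.
  by apply: le_lt_trans lMw; rewrite ler_wpM2l // le_max lexx orbT.
have eC0 : 0 <= errC R d by rewrite mulr_ge0 // addr_ge0 // mulr_ge0 // exprn_ge0.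
have sn : nsm (fun z : Z => nu ^+ absn z) by apply: nsm_geomZ; rewrite (ltW nu0).
have Gam0 lam : 1 <= lam -> lam <= lM -> 0 <= Gam d nu lam.
  move=> l1 l2; have l0 := le_trans ler01 l1.
  rewrite /Gam mulr_ge0 ?nsum_ge0 //; apply: Gam_sm => //; apply: le_lt_trans lMn.
  by rewrite ler_wpM2r ?(ltW nu0) // lerXn2r.
have Q0 : 0 <= errC R d * (Ka ^+ 2 * Gam d nu lM).
  by rewrite mulr_ge0 // mulr_ge0 ?sqr_ge0 // Gam0 // ltW.
have [l1 l11 [_ _ hl]] := small_lam Q0 kap0 w01.
pose ll := Num.min l1 lM.
have [ll1 ll2] : ll <= l1 /\ ll <= lM by split; rewrite ge_min lexx ?orbT.
exists ll; first by rewrite lt_min l11.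
move=> lam lam1 lamll; have lamM := le_trans lamll ll2.
have l0 : 0 <= lam := le_trans ler01 lam1.
have lamr : lam * rho < 1 by apply: le_lt_trans lMr; rewrite ler_wpM2r.
have lamn : lam ^+ 2 * nu < 1.
  by apply: le_lt_trans lMn; rewrite ler_wpM2r ?(ltW nu0) // lerXn2r.
have psi_le k : (psiB M k <= absn k)%N by rewrite /psiB (leq_trans (leq_subr _ _)) // nrm_le.
have ou : ord (-10) u by [].
have ocu : ord (-10) (cv a u) by apply: ord_cv.
(* Available because [u] is already known to be rapid; it does not depend on the truncation [L], so
   it can go into [G0]. *)
pose U := \sum_(i | pC i) N2 (Dm i (cv a u)).
have U0 : 0 <= U.
  apply: sumr_ge0 => i _; apply: N2_ge0; apply: (@ord_sq _ _ (-9)) => //.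
  exact: (ord_Dm i ocu).
pose G := Ka ^+ 2 * Gam d nu lam.
have Gp : 0 <= G by rewrite mulr_ge0 ?sqr_ge0 // Gam0.
have s0 := sqr_ge0 (lam - 1).
pose G0 := errC R d * ((lam - 1) ^+ 2 * G * (2 * U)).
have G00 : 0 <= G0 by do ! apply: mulr_ge0 => //.
apply: (claim (G0 := G0) lam1 lamr psi_le c0 hm G00) => L.
have adm := lamL_adm (psiB M) lam1 L; set mm := lamL lam (psiB M) L in adm *.
have hw : ord (-10) (wm mm u) by case: adm.
have m0 k : 0 < mm k by case: adm => h _ _ _ _; apply: h.
have E0 := energy_ge0 X_rapid hw.
have mA k t : isA t -> mm (k + t) = mm k by move=> h; rewrite /mm /lamL psiB_A.
have miA k t : isA t -> minv mm (k + t) = minv mm k by move=> h; rewrite /minv mA.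
have mi0 k : 0 < minv mm k by rewrite invr_gt0.
have m1 k : (nB k <= M * nC k)%N -> mm k = 1.
  by move=> h; rewrite /mm /lamL /psiB (eqP h) min0n expr0.
have weq k : (nB k <= M * nC k)%N -> wm mm u k = u k.
  by move=> h; rewrite /wm m1 // mul1r.
have xi := xi_bound hM (ltn0Sn _) hw weq mA ou erefl m1.
have bnd m' : m' = mm \/ m' = minv mm -> forall k l, `|m' k / m' l - 1| <= lam ^+ L + 1.
  move=> hm' k l; have p1 x : 1 <= lam ^+ x by apply: exprn_ege1.
  have p0 x : 0 < lam ^+ x by apply: lt_le_trans (p1 x).
  have q x y : lam ^+ minn x L / lam ^+ minn y L <= lam ^+ L.
    apply: (@le_trans _ _ (lam ^+ minn x L)).
      by rewrite ler_pdivrMr // ler_peMr // ltW.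
    by apply: ler_weXn2l => //; exact: geq_minr.
  apply: le_trans (ler_normB _ _) _; rewrite normr1 lerD2r.
  case: hm' => ->; rewrite /minv /mm /lamL.
    by rewrite ger0_norm // divr_ge0 // ltW.
  by rewrite invrK mulrC ger0_norm // divr_ge0 // ltW.
have sumC i : pC i -> N2 (cv a (Dm i (wm mm u))) <= 2 * U + energy X (wm mm u).
  move=> hi; apply: le_trans xi; rewrite (bigD1 i) //= lerDl.
  apply: sumr_ge0 => i' _; apply: N2_ge0; apply: (@ord_sq _ _ (-9)) => //.
  by apply: ord_cv => //; apply: (ord_Dm i' hw).
pose b := (lam - 1) ^+ 2 * G * (2 * U + energy X (wm mm u)).
have b0 : 0 <= b.
  apply: mulr_ge0; first exact: mulr_ge0.
  by apply: addr_ge0 => //; exact: mulr_ge0.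
have young m' j i : m' = mm \/ m' = minv mm -> pC i ->
  (forall k, 0 < m' k) -> (forall k t, isA t -> m' (k + t) = m' k) ->
  sq (errI (X j i) m' (Dm i (wm mm u))) /\ N2 (errI (X j i) m' (Dm i (wm mm u))) <= b.
  move=> hm' hi m'0 m'A.
  have o4 : ord (-4) (Dm i (wm mm u)) by apply: ord_mono (ord_Dm i hw).
  have hz k z : isB z -> `|m' k / m' (k - z) - 1| <= lam ^+ absn z - 1.
    by move=> /(psiB_B M k)[h1 h2]; apply: lamL_ratio hm' _ _.
  have hs k := csm_ratio k (bnd m' hm') (X_rapid j i) o4.
  have [y1 y2] := partial_young part (X_rapid j i) (X_C (j := j) (i := i)) a_rapid a_supp o4 m'0 m'A hz hs
    nu0 lam1 lamn Ka0 (fun z x => @coef_le j i z x hi).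
  split=> //; apply: le_trans y2 _; rewrite -/G /b; apply: ler_wpM2l; [exact: mulr_ge0 | exact: sumC].
have zero h m' v : (forall k, h k != 0 -> isA k) -> (forall k, 0 < m' k) ->
  (forall k t, isA t -> m' (k + t) = m' k) ->
  sq (errI h m' v) /\ N2 (errI h m' v) <= b.
  move=> hh m'0 m'A; have [|z1 ->] := @errI_zero h m' v _ m'0; last by split.
  by move=> k l /hh/(m'A l); rewrite addrC subrK.
have XA j i : ~~ pC i -> forall k, X j i k != 0 -> isA k.
  by move=> hi k hk; rewrite /isA (X_C hk) (X_AB hi hk).
apply: (err_bound_of _ (@err_bound_errI R d N X X_rapid mm u f 0 b adm b0 _ _)).
- have -> : errC R d * b = (lam - 1) ^+ 2 * (errC R d * G) * energy X (wm mm u) + G0.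
    by rewrite /b /G0; ring.
  rewrite mul0r addr0 lerD2r ler_wpM2r //.
  apply: le_trans (hl lam lam1 (le_trans lamll ll1)); rewrite ler_wpM2l // ler_wpM2l //.
  by rewrite /G ler_wpM2l ?sqr_ge0 // Gam_le.
- move=> j i; case hi: (pC i).
    have [y1 y2] := young mm j i (or_introl erefl) hi m0 mA.
    by have [y3 y4] := young (minv mm) j i (or_intror erefl) hi mi0 miA.
  have hi' := negbT hi.
  have [y1 y2] := zero _ mm (Dm i (wm mm u)) (XA j i hi') m0 mA.
  by have [y3 y4] := zero _ (minv mm) (Dm i (wm mm u)) (XA j i hi') mi0 miA.
move=> j; exact: zero _ (minv mm) (wm mm u) (@divbar_supp j) mi0 miA.
Qed.

Hypothesis compactness : forall eta : R, 0 < eta -> exists2 c, 0 <= c &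
  forall v, ord (-10) v -> N2 v <= eta * energy1 X v + c * low v.

Theorem exponential_decay : exists c om, [/\ 0 <= c, 0 <= om, om < 1 &
  forall k, nm (u k) <= c * om ^+ absn k].
Proof.
have [kap kap0 hk] := master_estimate X_rapid X_real compactness.
have [c0 [K0 c00 hm]] := hk 0 (lexx 0).
have [M [lB lB1 hB]] := claim_B kap0 c00 hm.
have [lA lA1 hA] := claim_A kap0 hk.
have r01 : 0 <= rho < 1 by rewrite rho0.
have [lC lC1 [_ lCr _]] := small_lam ler01 ltr01 r01.
pose lam := Num.min lA (Num.min lB lC).
have lam1 : 1 < lam by rewrite !lt_min lA1 lB1.
have [lamA [lamB lamC]] : lam <= lA /\ lam <= lB /\ lam <= lC.
  by rewrite /lam !ge_min !lexx !orbT.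
have [bA {}hA] := hA lam (ltW lam1) lamA; have [bB {}hB] := hB lam (ltW lam1) lamB.
have lamr : lam * rho < 1 by apply: le_lt_trans lCr; rewrite ler_wpM2r.
have [bC hC] := claim_C kap0 c00 hm (ltW lam1) lamr.
pose b := Num.max bA (Num.max bB bC).
pose T k := maxn (psiA k) (maxn (psiB M k) (nC k)).
have bT k : nm (u k) * lam ^+ T k <= b.
  rewrite /T /b !le_max; rewrite /maxn; case: ifP => _; last by rewrite hA.
  by case: ifP => _; rewrite ?hB ?hC !orbT.
(* With [T] the largest of the three exponents, [|xi| <= T], [|eta| <= T + M |xi|] and
   [|tau| <= T + |eta| + |xi|], whence [|k| <= (2 M + 5) T]. *)
pose q := (2 * M + 5)%N.
have Tq k : (absn k <= q * T k)%N.
  rewrite (absn_split part) /T /psiA /psiB /q.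
  move: (nrm pA k) (nrm pB k) (nrm pC k) => x y z.
  set t := maxn _ _; have t1 : (x - (y + z) <= t)%N by rewrite leq_maxl.
  have t2 : (y - M * z <= t)%N by rewrite leq_max leq_maxl orbT.
  have t3 : (z <= t)%N by rewrite !leq_max leqnn !orbT.
  clearbody t; clear -t1 t2 t3.
  have : (M * z <= M * t)%N by rewrite leq_mul2l t3 orbT.
  by rewrite mulnDl -mulnA; move: (M * z)%N (M * t)%N t2 => mz mt t2 t4; lia.
have l0 : 0 < lam - 1 by rewrite subr_gt0.
have d0 : 0 < q%:R * 2 ^+ q :> R by rewrite mulr_gt0 ?exprn_gt0 // ltr0n /q addn_gt0 orbT.
(* Chosen so that [(1 + e)^q <= lam], by [lam_pow1]. *)
pose e := Num.min 1 ((lam - 1) / (q%:R * 2 ^+ q)).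
have e0 : 0 < e by rewrite lt_min ltr01 divr_gt0.
have [e1 e2] : e <= 1 /\ e <= (lam - 1) / (q%:R * 2 ^+ q).
  by split; rewrite ge_min lexx ?orbT.
pose x := 1 + e; have x1 : 1 <= x by rewrite lerDl ltW.
have x0 : 0 < x := lt_le_trans ltr01 x1.
have xq : x ^+ q <= lam.
  rewrite -(lerD2r (- 1)); apply: le_trans (lam_pow1 q x1) _.
  rewrite ler_pdivlMr // in e2; apply: le_trans e2.
  have -> : x - 1 = e by rewrite /x addrC addKr.
  by rewrite ler_wpM2l ?(ltW e0) // ler_wpM2l // lerXn2r ?nnegrE ?(ltW x0) // /x; lra.
exists `|b|, x^-1; split=> //.
- by rewrite invr_ge0 ltW.
- by rewrite invf_lt1 // /x ltrDl.
move=> k; have xk : x ^+ absn k <= lam ^+ T k.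
  apply: (@le_trans _ _ (x ^+ (q * T k))); first by apply: ler_weXn2l.
  rewrite exprM lerXn2r // ?nnegrE ?exprn_ge0 ?(ltW x0) //.
  exact: le_trans ler01 (ltW lam1).
rewrite exprVn ler_pdivlMr ?exprn_gt0 //; apply: le_trans (ler_wpM2l (nm_ge0 _) xk) _.
exact: le_trans (bT k) (ler_norm _).
Qed.

End ExponentialDecay.

(** * Fourier coefficients of smooth and analytic functions *)

Section TrigonometricEstimates.
Variable R : realType.
Implicit Types (t : R) (g dg : R -> R).

Lemma mvt_bound g dg (M a b : R) : (forall t, is_derive t (1 : R) g (dg t)) ->
  (forall t, Num.min a b <= t <= Num.max a b -> `|dg t| <= M) ->
  `|g b - g a| <= M * `|b - a|.
Proof.
move=> hd hM.
have main (x y : R) : x < y -> (forall t, x <= t <= y -> `|dg t| <= M) ->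
    `|g y - g x| <= M * `|y - x|.
  move=> xy hxy; have hc : {within `[x, y], continuous g}%classic.
    by apply: derivable_within_continuous => t _; case: (hd t).
  have [c cxy ->] := MVT xy (fun t _ => hd t) hc.
  rewrite normrM ler_wpM2r //; apply: hxy.
  by move: cxy; rewrite in_itv /= => /andP[h1 h2]; rewrite !ltW.
case: (ltgtP a b) => [ab|ba|->]; last by rewrite !subrr normr0 mulr0.
  by apply: main => // t ht; apply: hM; rewrite min_l ?max_r // ltW.
rewrite distrC [`|b - a|]distrC; apply: main => // t ht; apply: hM.
by rewrite min_r ?max_l // ltW.
Qed.

Lemma sin_le t : `|sin t| <= `|t|.
Proof.
have := @mvt_bound (@sin R) (@cos R) 1 0 t (@is_derive_sin R).
rewrite sin0 !subr0 mul1r; apply => s _; by rewrite ler_norml cos_geN1 cos_le1.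
Qed.

Lemma cosB1_le t : `|cos t - 1| <= `|t|.
Proof.
have := @mvt_bound (@cos R) (fun t => - sin t) 1 0 t (@is_derive_cos R).
rewrite cos0 subr0 mul1r; apply => s _; by rewrite normrN ler_norml sin_geN1 sin_le1.
Qed.

Lemma cosB1E t : cos t - 1 = - (2 * sin (t / 2) ^+ 2).
Proof.
have -> : t = (t / 2) *+ 2 by rewrite mulr2n; field.
rewrite cos_mulr2n mulr2n; have := cos2Dsin2 (t / 2).
have -> : (t / 2 + t / 2) / 2 = t / 2 by field.
move=> h; have -> : cos (t / 2) ^+ 2 = 1 - sin (t / 2) ^+ 2 by lra.
ring.
Qed.

Lemma cosB1_sq t : `|cos t - 1| <= t ^+ 2.
Proof.
rewrite cosB1E normrN ger0_norm; last by rewrite mulr_ge0 // sqr_ge0.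
have h : sin (t / 2) ^+ 2 <= (t / 2) ^+ 2.
  have := sin_le (t / 2); rewrite -(@ler_pXn2r _ 2) ?nnegrE //.
  by rewrite !real_normK ?num_real.
have e : (t / 2) ^+ 2 = t ^+ 2 / 4 by field.
by have := sqr_ge0 t; move: h; rewrite e; lra.
Qed.

Lemma sinB_sq t : `|sin t - t| <= t ^+ 2.
Proof.
have hd (s : R) : is_derive s (1 : R) (fun s => sin s - s) (cos s - 1).
  by apply: is_deriveB.
have := @mvt_bound (fun s => sin s - s) (fun s => cos s - 1) `|t| 0 t hd.
rewrite sin0 !subr0 -normrM -expr2 ger0_norm ?sqr_ge0 //; apply => s hs.
apply: le_trans (cosB1_le s) _; move: hs; case: (lerP 0 t) => t0.
  by move=> /andP[h1 h2]; rewrite !ger0_norm.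
by move=> /andP[h1 h2]; rewrite !ler0_norm ?lerN2 // ltW.
Qed.

Lemma cis_taylor t : nm (cis t - 1 - t *i) <= 2 * t ^+ 2.
Proof.
apply: le_trans (nm_le_ReIm _) _; rewrite mulr_natl mulr2n /cis /=.
by apply: lerD; rewrite ?subr0 ?cosB1_sq // ?oppr0 ?addr0 sinB_sq.
Qed.

Lemma cisB1_le t : nm (cis t - 1) <= 2 * `|t|.
Proof.
apply: le_trans (nm_le_ReIm _) _; rewrite mulr_natl mulr2n /cis /=.
by apply: lerD; rewrite ?cosB1_le // subr0 sin_le.
Qed.

(** The mean value theorem gives [sin (t/2) >= (t/2) cos (t/2)]; then
    [sin t = 2 sin (t/2) cos (t/2)] and [cos(t/2)^2 >= 1/2] conclude. *)
Lemma sin_ge_half t : 0 <= t <= pi / 2 -> t / 2 <= sin t.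
Proof.
move=> /andP[]; rewrite le_eqVlt => /orP[/eqP <- _|t0 tp]; first by rewrite sin0 mul0r.
pose s := t / 2; have s0 : 0 < s by rewrite divr_gt0.
have pi0 := pi_gt0 R.
have sp : s <= pi / 4 by rewrite /s; lra.
have cpos : 0 < cos s by apply: cos_gt0_pihalf; apply/andP; split; lra.
have hc : {within `[0, s], continuous (@sin R)}%classic.
  by apply: derivable_within_continuous => x _; case: (is_derive_sin x).
have [c cs e] := MVT s0 (fun t _ => is_derive_sin t) hc.
move: cs; rewrite in_itv /= => /andP[c0 cs]; rewrite sin0 !subr0 in e.
have mono (x y : R) : 0 <= x -> x <= y -> y <= pi -> cos y <= cos x.
  move=> x0; rewrite le_eqVlt => /orP[/eqP -> //|xy] yp; apply: ltW.
  by rewrite ltr_cos // !in_itv /= ?x0 ?yp ?(le_trans (ltW xy)) ?(le_trans x0 (ltW xy)).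
have cc : cos s <= cos c by apply: mono; lra.
have c2 : 1 / 2 <= cos s ^+ 2.
  have h : cos (s *+ 2) = cos s ^+ 2 *+ 2 - 1 by rewrite cos_mulr2n.
  have h2 : 0 <= cos (s *+ 2).
    have -> : s *+ 2 = t by rewrite /s mulr2n; field.
    by apply: cos_ge0_pihalf; apply/andP; split; move: t0 tp pi0; clear; lra.
  by move: h2; rewrite h mulr2n; lra.
have -> : sin t = sin s * cos s *+ 2.
  by rewrite [sin s * _]mulrC -sin_mulr2n; congr sin; rewrite /s mulr2n; field.
rewrite e mulr2n; have h3 : cos s * cos s <= cos c * cos s by rewrite ler_wpM2r // ltW.
have h4 : s * (1 / 2) <= s * (cos c * cos s).
  by rewrite ler_wpM2l ?(ltW s0) // (le_trans _ h3) // -expr2.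
have -> : t / 2 = s * (1 / 2) + s * (1 / 2) by rewrite /s; field.
have -> : cos c * s * cos s = s * (cos c * cos s) by ring.
exact: lerD.
Qed.

(** The modulus of [cis t - 1] is [2 |sin (t/2)|]. *)
Lemma cis_lower t : `|t| <= pi -> `|t| / 2 <= nm (cis t - 1).
Proof.
wlog t0 : t / 0 <= t => [hw|].
  case: (lerP 0 t) => [|/ltW tn]; first exact: hw.
  have := hw (- t); rewrite normrN oppr_ge0 => /(_ tn); rewrite cisN.
  by rewrite -[X in nm (_ - X)]conjc1 -rmorphB nmJ.
rewrite ger0_norm // => tp.
have h := @sin_ge_half (t / 2); rewrite -(@ler_pXn2r _ 2) ?nnegrE ?nm_ge0 ?divr_ge0 //.
have {}h : t / 2 / 2 <= sin (t / 2) by apply: h; apply/andP; split; lra.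
rewrite nm_sqr /cis /=.
have -> : (cos t - 1) ^+ 2 + (sin t - 0) ^+ 2 = - 2 * (cos t - 1).
  have h1 := cos2Dsin2 t; have h2 : sin t ^+ 2 = 1 - cos t ^+ 2 by lra.
  by rewrite subr0 h2; ring.
rewrite cosB1E; have -> : - 2 * - (2 * sin (t / 2) ^+ 2) = (2 * sin (t / 2)) ^+ 2 by ring.
rewrite lerXn2r ?nnegrE ?divr_ge0 //; last lra.
by apply: mulr_ge0 => //; apply: le_trans h; rewrite !divr_ge0.
Qed.

End TrigonometricEstimates.

Section FourierSeries.
Variables (R : realType) (d : nat).
Local Notation C := R[i].
Local Notation Z := 'rV[int]_d.
Implicit Types (k l : Z) (x y : 'rV[R]_d) (c : Z -> C) (j : 'I_d) (f : 'rV[R]_d -> C).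
Local Notation ej := (@basis_vec R d).

(** A quadratic remainder can be summed over the frequencies ([fser_taylor]), so Fourier series are
    differentiated without exchanging limits. *)
Lemma is_derive_taylor (g : 'rV[R]_d -> R) x v (G K : R) :
  (forall h, `|g (x + h *: v) - g x - h * G| <= K * h ^+ 2) -> is_derive x v g G.
Proof.
move=> hK.
have K0 : 0 <= K by have := le_trans (normr_ge0 _) (hK 1); rewrite expr1n mulr1.
have cvg0 : (h^-1 *: ((g \o shift x) (h *: v) - g x) @[h --> (0 : R)^'] --> G)%classic.
  apply/cvgrPdist_le => e e0.
  near=> h.
  have h0 : h != 0 by near: h; exact: nbhs_dnbhs_neq.
  have -> : G - h^-1 *: ((g \o shift x) (h *: v) - g x) = - (h^-1 * (g (x + h *: v) - g x - h * G)).
    by rewrite /= -[_ *: (_ - _)]/(_ * _) [h *: v + x]addrC; field.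
  rewrite normrN normrM normfV ler_pdivrMl ?normr_gt0 //.
  apply: le_trans (hK h) _; rewrite -real_normK ?num_real // expr2 mulrCA ler_wpM2l //.
  apply: (@le_trans _ _ (K * (e / (K + 1)))).
    by rewrite ler_wpM2l //; near: h; apply: dnbhs0_le; rewrite divr_gt0 // ltr_wpDl.
  rewrite mulrCA ler_piMr ?(ltW e0) // ler_pdivrMr ?ltr_wpDl // mul1r lerDl //.
have dg : derivable g x v by apply/cvg_ex; exists G.
by apply: DeriveDef => //; apply: cvg_lim.
Unshelve. all: by end_near.
Qed.

Lemma dot_ej k j (h : R) : dot k (h *: ej j) = h * (k 0 j)%:~R.
Proof.
rewrite /dot (bigD1 j) //= big1 ?addr0 => [|i ij]; first by rewrite !mxE !eqxx mulr1 mulrC.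
by rewrite !mxE eqxx /= (negbTE ij) mulr0 mulr0.
Qed.

Lemma ii_i (t : R) : (t *i)%C = t%:C * 'i.
Proof. by rewrite -complexiE; apply/eqP; rewrite eq_complex /=; apply/andP; split; apply/eqP; ring. Qed.

Lemma fser_taylor c x j : rapid c -> exists K, forall h,
  nm (fser c (x + h *: ej j) - fser c x - h%:C * ('i * fser (Dm j c) x)) <= K * h ^+ 2.
Proof.
move=> hc; have h1 := rapid_Dm j hc; have h2 := rapid_Dm j h1.
have s0 := csm_rapid hc; have s1 := csm_rapid h1; have s2 := csm_rapid h2.
exists (2 * nsum (fun k => nm (Dm j (Dm j c) k))) => h.
have t0 := fser_sm (x + h *: ej j) s0; have t1 := fser_sm x s0.
have t2 := csmZ (h%:C * 'i) (fser_sm x s1).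
rewrite mulrA /fser -csumB // -csumZ; last exact: fser_sm.
rewrite -csumB //; last exact: csmB.
have n2 : nsm (fun k => 2 * h ^+ 2 * nm (Dm j (Dm j c) k)).
  by apply: nsmZ => //; rewrite mulr_ge0 // sqr_ge0.
apply: le_trans (nm_csum_le n2 _) _ => [k|].
  have -> : c k * fmode k (x + h *: ej j) - c k * fmode k x - h%:C * 'i * (Dm j c k * fmode k x) =
    c k * fmode k x * (cis (h * (k 0 j)%:~R) - 1 - (h * (k 0 j)%:~R) *i).
    by rewrite exDr {2}/fmode dot_ej ii_i /Dm rmorphM /= rmorph_int; ring.
  rewrite !nmM nm_ex mulr1; apply: le_trans (ler_wpM2l (nm_ge0 _) (cis_taylor _)) _.
  have e : `|(k 0 j)%:~R| = `|k 0%R j|%N%:R :> R by rewrite -intr_norm -abszE -pmulrn.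
  rewrite !nm_int exprMn -[(k 0 j)%:~R ^+ 2]real_normK ?num_real // e.
  by rewrite le_eqVlt; apply/orP; left; apply/eqP; ring.
have h0 : 0 <= 2 * h ^+ 2 by rewrite mulr_ge0 // sqr_ge0.
by rewrite (nsumZ h0 s2) mulrAC lexx.
Qed.

Lemma Re_mul_i (z : C) : complex.Re ('i * z) = - complex.Im z.
Proof. by rewrite -complexiE; case: z => a b /=; ring. Qed.

Lemma Im_mul_i (z : C) : complex.Im ('i * z) = complex.Re z.
Proof. by rewrite -complexiE; case: z => a b /=; ring. Qed.

Lemma fser_derive c x j : rapid c ->
  is_derive x (ej j) (re_part (fser c)) (- complex.Im (fser (Dm j c) x)) /\
  is_derive x (ej j) (im_part (fser c)) (complex.Re (fser (Dm j c) x)).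
Proof.
move=> hc; have [K hK] := fser_taylor x j hc.
have ReB (a b : C) : complex.Re (a - b) = complex.Re a - complex.Re b by case: a; case: b.
have ImB (a b : C) : complex.Im (a - b) = complex.Im a - complex.Im b by case: a; case: b.
have ReZ (h : R) (a : C) : complex.Re (h%:C * a) = h * complex.Re a by case: a => a b /=; ring.
have ImZ (h : R) (a : C) : complex.Im (h%:C * a) = h * complex.Im a by case: a => a b /=; ring.
split; apply: (@is_derive_taylor _ _ _ _ K) => h; apply: le_trans (hK h).
  by rewrite -Re_mul_i -ReZ /re_part -!ReB; exact: Re_le_nm.
by rewrite -Im_mul_i -ImZ /im_part -!ImB; exact: Im_le_nm.
Qed.

Lemma D_fser j c : rapid c -> D j (fser c) = fser (Dm j c).
Proof.
move=> hc; apply/funext => x; have [h1 h2] := fser_derive x j hc.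
rewrite /D !derive_val -complexiE; case: (fser _ x) => a b /=.
have -> : (('i : C)^-1)%C = (0 -i* 1)%C.
  by apply: (@mulfI _ ('i : C)%C); rewrite ?mulfV; rewrite ?complexiE ?neq0Ci // -complexiE; simpc; rewrite ?mulr1 ?mul0r.
by simpc.
Qed.

Lemma dot_le k x : `|dot k x| <= \sum_j (`|k 0%R j|%N%:R * `|x 0 j|).
Proof.
apply: le_trans (ler_norm_sum _ _ _) _; apply: ler_sum => j _.
by rewrite normrM -intr_norm -abszE -pmulrn.
Qed.

Lemma fser_lip c : rapid c -> exists2 K, 0 <= K &
  forall x y, nm (fser c y - fser c x) <= K * \sum_j `|y 0 j - x 0 j|.
Proof.
move=> hc; have s j : csm (Dm j c) by apply: csm_rapid; apply: rapid_Dm.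
pose K := \sum_j nsum (fun k => nm (Dm j c k)).
have K0 : 0 <= K by apply: sumr_ge0 => j _; exact: nsum_ge0 (s j).
have sc := csm_rapid hc.
exists (2 * K); first exact: mulr_ge0.
move=> x y; rewrite /fser -csumB; try exact: fser_sm.
have e0 j : 0 <= `|y 0 j - x 0 j| by [].
have [sm es] := nsm_sum (index_enum 'I_d) (P := xpredT) (fun j _ => nsmZ (e0 j) (s j)).
apply: le_trans (nm_csum_le (nsmZ (ler0n R 2) sm) _) _ => [k|].
  have -> : c k * fmode k y - c k * fmode k x = c k * fmode k x * (cis (dot k (y - x)) - 1).
    by rewrite -{1}(subrK x y) exDr -[cis _]/(fmode k _); ring.
  rewrite !nmM nm_ex mulr1; apply: le_trans (ler_wpM2l (nm_ge0 _) (cisB1_le _)) _.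
  rewrite mulrCA ler_wpM2l // mulrC; apply: le_trans (ler_wpM2r (nm_ge0 _) (dot_le _ _)) _.
  rewrite mulr_suml; apply: ler_sum => j _; rewrite !mxE /Dm nmM nm_int.
  by rewrite mulrAC mulrC.
rewrite nsumZ // -mulrA ler_wpM2l // es /K mulr_suml; apply: ler_sum => j _.
rewrite (nsumZ (e0 j) (s j)) mulrC ler_wpM2l //; first exact: nsum_ge0 (s j).
by rewrite (bigD1 j) //= lerDl sumr_ge0.
Qed.

Lemma coord_le_norm x j : `|x 0 j| <= `|x|.
Proof.
have -> : `|x| = mx_norm x by [].
by rewrite mx_normrE; exact: (le_bigmax _ (fun ij : 'I_1 * 'I_d => `|x ij.1 ij.2|) (0, j)).
Qed.

Lemma lip_continuous (g : 'rV[R]_d -> R) (K : R) : 0 <= K ->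
  (forall x y, `|g y - g x| <= K * \sum_j `|y 0 j - x 0 j|) -> continuous g.
Proof.
move=> K0 h x.
have : (forall eps : R, 0 < eps -> \forall t \near x, `|g x - g t| <= eps)%classic; last by move/cvgrPdist_le.
move=> e e0.
pose de := e / (K * d%:R + 1).
have dp : 0 < K * d%:R + 1 by rewrite ltr_wpDl // mulr_ge0.
have d0 : 0 < de by apply: divr_gt0.
near=> y.
have hy : `|x - y| < de by near: y; exact: cvgr_dist_lt.
rewrite distrC; apply: le_trans (h x y) _.
apply: (@le_trans _ _ (K * \sum_(j < d) de)).
  rewrite ler_wpM2l //; apply: ler_sum => j _; apply: ltW.
  apply: le_lt_trans hy; rewrite distrC; have := coord_le_norm (x - y) j; by rewrite !mxE.
rewrite sumr_const card_ord -[X in _ * X]mulr_natr mulrCA /de.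
by rewrite mulrAC ler_pdivrMr // ler_pM2l // lerDl.
Unshelve. all: by end_near.
Qed.

Lemma ccontinuous_fser c : rapid c -> ccontinuous (fser c).
Proof.
move=> /fser_lip[K K0 hK].
split; apply: (lip_continuous K0) => x y; apply: le_trans (hK x y).
  rewrite /re_part; move: (fser c y) (fser c x) => a b.
  by have := Re_le_nm (a - b); case: a; case: b.
rewrite /im_part; move: (fser c y) (fser c x) => a b.
by have := Im_le_nm (a - b); case: a; case: b.
Qed.

Lemma fser_periodic c : Defs.periodic (fser c).
Proof.
move=> x j; apply: eq_csum => k; rewrite exDr.
have -> : fmode k ((2 * pi) *: basis_vec R j) = 1.
  by rewrite /fmode dot_ej mulrC cis_int2pi.
by rewrite mulr1.
Qed.

Lemma rapid_foldr (s : seq 'I_d) c : rapid c -> rapid (foldr (@Dm R d) c s).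
Proof. by move=> hc; elim: s => //= j s IH; apply: rapid_Dm. Qed.

Lemma foldr_D_fser (s : seq 'I_d) c : rapid c ->
  foldr (@D R d) (fser c) s = fser (foldr (@Dm R d) c s).
Proof. by move=> hc; elim: s => //= j s ->; rewrite D_fser //; exact: rapid_foldr. Qed.

Lemma Cinfty_fser c : rapid c -> Cinfty (fser c).
Proof.
move=> hc; split; first exact: fser_periodic.
move=> s; rewrite foldr_D_fser //; have hr := rapid_foldr s hc.
split; first exact: ccontinuous_fser.
by move=> j x; have [h1 h2] := fser_derive x j hr; split; apply: ex_derive.
Qed.

Definition Dmm (al : 'I_d -> nat) c : Z -> C := fun k => \prod_j ((k 0 j)%:~R ^+ al j) * c k.

Lemma iter_Dm n j c : iter n (Dm j) c = (fun k => (k 0 j)%:~R ^+ n * c k).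
Proof.
elim: n => [|n IH]; first by apply/funext => k; rewrite expr0 mul1r.
by rewrite iterS IH; apply/funext => k; rewrite /Dm exprS mulrA.
Qed.

Lemma iter_D_fser n j c : rapid c -> iter n (D j) (fser c) = fser (iter n (Dm j) c) /\
  rapid (iter n (Dm j) c).
Proof.
move=> hc; elim: n => [|n [IH1 IH2]] //.
by rewrite !iterS IH1 D_fser //; split=> //; exact: rapid_Dm.
Qed.

Lemma Dmulti_fser al c : rapid c -> Dmulti al (fser c) = fser (Dmm al c).
Proof.
move=> hc; rewrite /Dmulti /Dmm.
have key (s : seq 'I_d) : foldr (fun (i : 'I_d) g => iter (al i) (D i) g) (fser c) s =
    fser (fun k : Z => \prod_(j <- s) ((k 0 j)%:~R ^+ al j) * c k) /\
    rapid (fun k : Z => \prod_(j <- s) ((k 0 j)%:~R ^+ al j) * c k).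
  elim: s => [|j s [IH1 IH2]] /=.
    have -> // : (fun k : Z => \prod_(j <- [::]) ((k 0 j)%:~R ^+ al j) * c k) = c.
    by apply/funext => k; rewrite big_nil mul1r.
  have -> : (fun k : Z => \prod_(j <- j :: s) ((k 0 j)%:~R ^+ al j) * c k) =
    iter (al j) (Dm j) (fun k : Z => \prod_(j <- s) ((k 0 j)%:~R ^+ al j) * c k).
    by apply/funext => k; rewrite iter_Dm big_cons mulrA.
  by rewrite IH1; exact: iter_D_fser.
by rewrite (key (enum 'I_d)).1; congr fser; apply/funext => k; rewrite big_enum.
Qed.

(** ['C(n + p, p) v^n (1 - v)^p] is one term in the expansion of [(v + (1 - v))^(n + p) = 1];
    moreover [n^p <= 'C(n + p, p) p!] and [p! <= p^p]. The result has the shape [C^p p^p] of the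
    analytic class. *)
Lemma pow_geom (p n : nat) (v : R) : 0 <= v < 1 ->
  n%:R ^+ p * v ^+ n <= (p%:R / (1 - v)) ^+ p.
Proof.
move=> /andP[v0 v1]; have w0 : 0 < 1 - v by rewrite subr_gt0.
have h1 : (n ^ p <= 'C(n + p, p) * p`!)%N.
  rewrite bin_ffact; elim: p => [|p IH]; first by rewrite ffactn0.
  by rewrite addnS ffactnS /= expnS leq_mul // (leq_trans (leq_addr p n)).
have h2 : (p`! <= p ^ p)%N.
  rewrite -ffactnn; have h m q : (m ^_ q <= m ^ q)%N.
    elim: q m => [|q IH] m; first by rewrite ffactn0.
    rewrite ffactnS expnS leq_mul2l; apply/orP; right; apply: leq_trans (IH _) _.
    by case: q {IH} => // q; rewrite leq_exp2r // leq_pred.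
  exact: h.
have h3 : 'C(n + p, p)%:R * v ^+ n * (1 - v) ^+ p <= 1 :> R.
  have e := exprDn v (1 - v) (n + p); rewrite addrC subrK expr1n in e.
  have pn : (p < (n + p).+1)%N by rewrite ltnS leq_addl.
  rewrite [leRHS]e (bigD1 (Ordinal pn)) //= addnK.
  rewrite -mulrA mulr_natl lerDl; apply: sumr_ge0 => i _.
  by rewrite mulrn_wge0 // mulr_ge0 // exprn_ge0 // ltW.
rewrite expr_div_n ler_pdivlMr ?exprn_gt0 //.
have h4 : n%:R ^+ p * v ^+ n <= 'C(n + p, p)%:R * p`!%:R * v ^+ n :> R.
  by rewrite ler_wpM2r ?exprn_ge0 // -natrX -natrM ler_nat.
apply: le_trans (ler_wpM2r (exprn_ge0 _ (ltW w0)) h4) _.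
have -> : 'C(n + p, p)%:R * p`!%:R * v ^+ n * (1 - v) ^+ p =
  p`!%:R * ('C(n + p, p)%:R * v ^+ n * (1 - v) ^+ p) :> R by ring.
apply: (@le_trans _ _ (p`!%:R * 1)); first by rewrite ler_wpM2l.
by rewrite mulr1 -natrX ler_nat.
Qed.

(** [w^n] is split as [v^n (w / v)^n] with [v] between [w] and 1: the first factor pays for the
    derivatives, the second for the sum over the frequencies. *)
Lemma Comega_fser c (b w : R) : 0 <= b -> 0 <= w < 1 ->
  (forall k, nm (c k) <= b * w ^+ absn k) -> Comega (fser c).
Proof.
move=> b0 /[dup] w01 /andP[w0 w1] hc.
have rc : rapid c := geom_rapid b0 w01 hc.
split; first exact: Cinfty_fser.
pose v := (1 + w) / 2.
have [v0 v1 vw] : [/\ 0 < v, v < 1 & w < v] by rewrite /v; split; lra.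
have x01 : 0 <= w / v < 1.
  by rewrite divr_ge0 ?(ltW v0) //= ltr_pdivrMr // mul1r.
have sg := nsm_geomZ d x01; pose S := nsum (fun k : Z => (w / v) ^+ absn k).
have S0 : 0 <= S by apply: nsum_ge0.
pose K := (1 - v)^-1 + b * S + 1.
have i0 : 0 < (1 - v)^-1 by rewrite invr_gt0 subr_gt0.
have K1 : (1 - v)^-1 <= K by rewrite /K -addrA lerDl addr_ge0 // mulr_ge0.
have K2 : b * S <= K by rewrite /K; have := mulr_ge0 b0 S0; lra.
have K0 : 0 < K by apply: lt_le_trans i0 K1.
exists K => // al x; set p := mlen al.
rewrite nmE lecR Dmulti_fser //.
have bd k : nm (Dmm al c k * fmode k x) <= b * (p%:R / (1 - v)) ^+ p * (w / v) ^+ absn k.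
  rewrite nmM nm_ex mulr1 nmM nm_prod.
  have h1 : \prod_j nm ((k 0 j)%:~R ^+ al j : C) <= (absn k)%:R ^+ p.
    rewrite /p /mlen expr_sum; apply: ler_prod => j _; rewrite nm_ge0 /= nmX nm_int.
    by rewrite lerXn2r ?nnegrE // ler_nat absn_ge.
  have q0 : 0 <= \prod_j nm ((k 0 j)%:~R ^+ al j : C) by apply: prodr_ge0 => j _; exact: nm_ge0.
  apply: le_trans (ler_pM q0 (nm_ge0 _) h1 (hc k)) _.
  have -> : w ^+ absn k = v ^+ absn k * (w / v) ^+ absn k.
    by rewrite -exprMn mulrC divfK // gt_eqF.
  rewrite mulrCA mulrA [X in X <= _]mulrA; apply: ler_wpM2r; first exact: exprn_ge0 (andP x01).1.
  rewrite -[X in X <= _]mulrA; apply: ler_wpM2l => //.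
  by apply: pow_geom; rewrite (ltW v0).
have q0 : 0 <= b * (p%:R / (1 - v)) ^+ p.
  by rewrite mulr_ge0 // exprn_ge0 // divr_ge0 // subr_ge0 ltW.
apply: le_trans (nm_csum_le (nsmZ q0 sg) bd) _; rewrite nsumZ // -/S exprMn.
have -> : b * (p%:R ^+ p * (1 - v)^-1 ^+ p) * S = (b * S) * (1 - v)^-1 ^+ p * p%:R ^+ p by ring.
rewrite ler_wpM2r ?exprn_ge0 // exprS; apply: ler_pM => //.
- exact: mulr_ge0.
- exact: exprn_ge0 (ltW i0).
by rewrite lerXn2r ?nnegrE ?(ltW i0) ?(ltW K0).
Qed.

End FourierSeries.

(** * Limits of bounded sequences along an ultrafilter *)

Section Ultralimits.
Variable R : realType.
Variable U : set_system nat.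
Hypothesis U_ultra : UltraFilter U.

(** The limit is the supremum of the levels that the sequence reaches on a set of [U]; an
    ultrafilter decides every level. *)
Lemma ultra_lim (s : nat -> R) (M : R) : (forall n, `|s n| <= M) ->
  exists L, forall e, 0 < e -> U [set n | `|s n - L| <= e]%classic.
Proof.
move=> hM; pose A := [set r | U [set n | r <= s n]]%classic.
have [UF] : ProperFilter U by exact: ultra_proper.
have hsup : has_sup A.
  split.
    exists (- M); rewrite /A /=; apply: (@filterS _ U _ setT) => //; last exact: filterT.
    by move=> n _ /=; have := hM n; rewrite ler_norml => /andP[].
  exists M => r hr; have [n hn] := filter_ex hr.
  by apply: le_trans hn _; apply: le_trans (ler_norm _) (hM n).
exists (sup A) => e e0.
have U1 : U [set n | sup A - e <= s n]%classic.
  have [r hr hre] := sup_adherent e0 hsup.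
  apply: filterS hr => n /= hn; apply: le_trans hn; exact: ltW.
have U2 : U [set n | s n <= sup A + e]%classic.
  have [//|h] := in_ultra_setVsetC [set n | s n <= sup A + e]%classic U_ultra.
  have : A (sup A + e).
    by apply: filterS h => n /= /negP; rewrite -ltNge => /ltW.
  by move/(sup_upper_bound hsup); rewrite leNgt ltrDl e0.
apply: filterS2 U1 U2 => n /= h1 h2.
by rewrite ler_norml; apply/andP; split; lra.
Qed.

Lemma ultra_climC (s : nat -> R[i]) (M : R) : (forall n, nm (s n) <= M) ->
  exists L, forall e, 0 < e -> U [set n | nm (s n - L) <= e]%classic.
Proof.
move=> hM; have [UF] : ProperFilter U by exact: ultra_proper.
have [a ha] := @ultra_lim (fun n => complex.Re (s n)) M (fun n => le_trans (Re_le_nm _) (hM n)).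
have [b hb] := @ultra_lim (fun n => complex.Im (s n)) M (fun n => le_trans (Im_le_nm _) (hM n)).
exists (a +i* b) => e e0; have e2 : 0 < e / 2 by apply: divr_gt0.
apply: filterS2 (ha _ e2) (hb _ e2) => n /= h1 h2.
apply: le_trans (nm_le_ReIm _) _; case: (s n) h1 h2 => x y /= h1 h2; lra.
Qed.

End Ultralimits.

(** * Discrete Fourier inversion and decay of coefficients *)

Section Torus.
Variables (R : realType) (d : nat).
Local Notation C := R[i].
Local Notation Z := 'rV[int]_d.
Implicit Types (k l : Z) (x y : 'rV[R]_d) (c : Z -> C) (j : 'I_d) (f : 'rV[R]_d -> C).
Local Notation ej := (@basis_vec R d).

(** Compactness of the closed box in the form of near coverings, for the filter of large constants
    [a]; monotonicity makes the local constants compatible. *)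
Lemma torus_uniform (P : R -> 'rV[R]_d -> Prop) :
  (forall a b x, a <= b -> P a x -> P b x) ->
  (forall x, exists a, \forall y \near x, P a y)%classic ->
  exists a, forall x, (forall j, 0 <= x 0 j <= 2 * pi) -> P a x.
Proof.
move=> hmono hloc.
pose K := [set v : 'rV[R]_d | forall j, `[0, 2 * pi]%classic (v ord0 j)]%classic.
have cK : compact K := @rV_compact R d (fun=> `[0, 2 * pi]%classic) (fun=> @segment_compact R 0 (2 * pi)).
have := (compact_near_coveringP K).1 cK R (pinfty_nbhs R) P _.
case=> [x _|a [ra ha]].
  have [a ha] := hloc x.
  exists ([set y | P a y], [set b | a <= b])%classic.
    split=> //=; exact: nbhs_pinfty_ge (num_real a).
  by move=> [y b] [/= h1 h2]; apply: hmono h1.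
by exists (a + 1) => x hx; apply: (ha (a + 1)); rewrite ?ltrDl // => j; rewrite /= in_itv /=.
Qed.

Lemma periodic_shift f (n : Z) x : Defs.periodic f -> f (x + (2 * pi) *: map_mx (fun m : int => m%:~R) n) = f x.
Proof.
move=> pf.
have h1 j (m : nat) y : f (y + (m%:R * (2 * pi)) *: ej j) = f y.
  elim: m y => [|m IH] y; first by rewrite mul0r scale0r addr0.
  by rewrite -natr1 mulrDl mul1r scalerDl addrA pf IH.
have h2 j (m : int) y : f (y + (m%:~R * (2 * pi)) *: ej j) = f y.
  case: m => m; first by rewrite -pmulrn h1.
  by rewrite NegzE mulrNz mulNr -pmulrn scaleNr -(h1 j m.+1) subrK.
have -> : (2 * pi) *: map_mx (fun m : int => m%:~R) n = \sum_j ((n 0 j)%:~R * (2 * pi)) *: ej j.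
  rewrite [LHS]row_sum_delta; apply: eq_bigr => j _; by rewrite !mxE mulrC.
have h3 (s : seq 'I_d) y : f (y + \sum_(j <- s) ((n 0 j)%:~R * (2 * pi)) *: ej j) = f y.
  elim: s y => [|j s IH] y; first by rewrite big_nil addr0.
  by rewrite big_cons addrA IH h2.
exact: h3.
Qed.

(** The closed bounds match the compact box of [torus_uniform], the strict ones the approximation by
    grid points in [grid_near]. *)
Lemma torus_box x : exists y (n : Z), (forall j, 0 <= y 0 j <= 2 * pi) /\
  (forall j, y 0 j < 2 * pi) /\
  x = y + (2 * pi) *: map_mx (fun m : int => m%:~R) n.
Proof.
have p2 : 0 < 2 * pi :> R by rewrite mulr_gt0 ?pi_gt0.
pose n : Z := \row_j Num.floor (x 0 j / (2 * pi)).
exists (x - (2 * pi) *: map_mx (fun m : int => m%:~R) n), n.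
have h j : 0 <= (x - (2 * pi) *: map_mx (fun m : int => m%:~R) n) 0 j < 2 * pi.
  rewrite !mxE; have /andP[h1 h2] := floor_itv (x 0 j / (2 * pi)).
  move: h1 h2; rewrite intrD ler_pdivlMr // ltr_pdivrMr // mulrDl mul1r.
  by move: (_%:~R) => a; rewrite mulrC [_ * a]mulrC => h1 h2; apply/andP; split; lra.
split; first by move=> j; case/andP: (h j) => -> /ltW.
by split; [move=> j; case/andP: (h j) | rewrite subrK].
Qed.

Lemma torus_bounded f : ccontinuous f -> Defs.periodic f -> exists2 M, 0 <= M & forall x, nm (f x) <= M.
Proof.
move=> [cr ci] pf.
have [|x|M hM] := @torus_uniform (fun a x => nm (f x) <= a).
- by move=> a b x ab h; apply: le_trans ab.
- exists (`|re_part f x| + 1 + (`|im_part f x| + 1)).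
  have h1 := cr x; have h2 := ci x.
  have e1 : (\forall y \near x, `|re_part f x - re_part f y| < 1)%classic by move/cvgrPdist_lt: h1; apply.
  have e2 : (\forall y \near x, `|im_part f x - im_part f y| < 1)%classic by move/cvgrPdist_lt: h2; apply.
  near=> y.
  have b1 : `|re_part f x - re_part f y| < 1 by near: y.
  have b2 : `|im_part f x - im_part f y| < 1 by near: y.
  apply: le_trans (nm_le_ReIm _) _.
  have t (a b : R) : `|a - b| < 1 -> `|b| <= `|a| + 1.
    move=> hab; rewrite -[b](subrK a); apply: le_trans (ler_normD _ _) _.
    by rewrite addrC lerD2l distrC ltW.
  by apply: lerD; apply: t.
exists `|M| => // x; have [y [n [h1 [_ ->]]]] := torus_box x.
by rewrite periodic_shift //; apply: le_trans (hM y h1) (ler_norm _).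
Unshelve. all: by end_near.
Qed.

(** With the mesh as step, finite differences are summed by parts exactly on the grid; they replace
    derivatives in the integration by parts. *)
Definition dlt j (h : R) f x := f (x + h *: ej j) - f x.

Lemma is_derive_translate (g : 'rV[R]_d -> R) x y v (G : R) :
  is_derive (x + y) v g G -> is_derive x v (fun z => g (z + y)) G.
Proof.
case=> h1 h2.
have e : (fun h : R => h^-1 *: (((fun z => g (z + y)) \o shift x) (h *: v) - g (x + y))) =
         (fun h : R => h^-1 *: ((g \o shift (x + y)) (h *: v) - g (x + y))).
  by apply/funext => h /=; rewrite addrA.
apply: DeriveDef; first by rewrite /derivable e.
by rewrite -h2 /derive e.
Qed.

Lemma is_derive_line (g : 'rV[R]_d -> R) x v (t : R) :
  derivable g (x + t *: v) v -> is_derive t (1 : R) (fun s => g (x + s *: v)) ('D_v g (x + t *: v)).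
Proof.
move=> h1.
have e : (fun h : R => h^-1 *: (((fun s => g (x + s *: v)) \o shift t) (h *: (1 : R)) - g (x + t *: v))) =
         (fun h : R => h^-1 *: ((g \o shift (x + t *: v)) (h *: v) - g (x + t *: v))).
  apply/funext => h /=; rewrite -[h *: 1]/(h * 1) mulr1 scalerDl.
  by congr (_ *: (g _ - _)); rewrite addrCA.
by apply: DeriveDef; rewrite /derivable /derive e.
Qed.

Lemma D_re_im j f x : nm (D j f x) = nm ('D_(ej j) (re_part f) x +i* 'D_(ej j) (im_part f) x).
Proof. by rewrite /D nmM nmV -complexiE nm_i invr1 mul1r. Qed.

(** The factor 2 comes from applying the mean value theorem to the real and imaginary parts
    separately. *)
Lemma dlt_le j h f M : 0 <= h -> cderivable j f -> (forall x, nm (D j f x) <= M) ->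
  forall x, nm (dlt j h f x) <= 2 * h * M.
Proof.
move=> h0 df hM x.
have key (g : 'rV[R]_d -> R) : (forall x, derivable g x (ej j)) ->
    (forall x, `|'D_(ej j) g x| <= M) -> `|g (x + h *: ej j) - g x| <= h * M.
  move=> dg hg.
  have := @mvt_bound R (fun s => g (x + s *: ej j)) (fun s => 'D_(ej j) g (x + s *: ej j)) M 0 h.
  rewrite scale0r addr0 subr0 (ger0_norm h0) [M * h]mulrC; apply => t; last by move=> _; apply: hg.
  exact: is_derive_line.
have r1 := key (re_part f) (fun y => (df y).1) _.
have r2 := key (im_part f) (fun y => (df y).2) _.
have {}r1 : `|re_part f (x + h *: ej j) - re_part f x| <= h * M.
  by apply: r1 => y; apply: le_trans (hM y); rewrite D_re_im; exact: (Re_le_nm (_ +i* _)).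
have {}r2 : `|im_part f (x + h *: ej j) - im_part f x| <= h * M.
  by apply: r2 => y; apply: le_trans (hM y); rewrite D_re_im; exact: (Im_le_nm (_ +i* _)).
apply: le_trans (nm_le_ReIm _) _; rewrite /dlt; move: r1 r2; rewrite /re_part /im_part.
by case: (f (x + _)) => a b; case: (f x) => a' b' /=; lra.
Qed.

Lemma D_dlt j h f : cderivable j f -> D j (dlt j h f) = dlt j h (D j f) /\ cderivable j (dlt j h f).
Proof.
move=> df.
have key (g : 'rV[R]_d -> R) x : (forall x, derivable g x (ej j)) ->
  is_derive x (ej j) (fun x => g (x + h *: ej j) - g x) ('D_(ej j) g (x + h *: ej j) - 'D_(ej j) g x).
  move=> dg; apply: is_deriveB; last exact/derivableP.
  by apply: is_derive_translate; apply/derivableP.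
have ReB (a b : C) : complex.Re (a - b) = complex.Re a - complex.Re b by case: a; case: b.
have ImB (a b : C) : complex.Im (a - b) = complex.Im a - complex.Im b by case: a; case: b.
have er : re_part (dlt j h f) = (fun x => re_part f (x + h *: ej j) - re_part f x).
  by apply/funext => x; rewrite /re_part /dlt ReB.
have ei : im_part (dlt j h f) = (fun x => im_part f (x + h *: ej j) - im_part f x).
  by apply/funext => x; rewrite /im_part /dlt ImB.
have k1 x := key (re_part f) x (fun y => (df y).1).
have k2 x := key (im_part f) x (fun y => (df y).2).
split; last by move=> x; rewrite er ei; split; apply: ex_derive.
apply/funext => x; rewrite /dlt /D er ei !derive_val -mulrBr; congr (_ * _).
Qed.

Lemma iter_dlt_le n j h f M : 0 <= h -> (forall m, cderivable j (iter m (D j) f)) ->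
  (forall x, nm (iter n (D j) f x) <= M) ->
  forall x, nm (iter n (dlt j h) f x) <= (2 * h) ^+ n * M.
Proof.
move=> h0; elim: n f M => [|n IH] f M df hM x; first by rewrite expr0 mul1r; exact: hM.
have ed m : iter m (D j) (dlt j h f) = dlt j h (iter m (D j) f).
  by elim: m => //= m ->; have [-> _] := D_dlt h (df m).
rewrite iterSr exprSr -mulrA; apply: IH => [m|y].
  by rewrite ed; have [_] := D_dlt h (df m).
by rewrite ed; apply: dlt_le.
Qed.

Lemma avg_shift q j f : (0 < q)%N -> Defs.periodic f ->
  avg q (fun x => f (x + (2 * pi / q%:R) *: ej j)) = avg q f.
Proof.
move=> q0 pf; rewrite /avg; congr (_ * _).
pose s (g : {ffun 'I_d -> 'I_q}) : {ffun 'I_d -> 'I_q} :=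
  [ffun i => if i == j then ordS (g i) else g i].
have qR : q%:R != 0 :> R by rewrite pnatr_eq0 -lt0n.
have sb : bijective s.
  have [r r1 r2] := ordS_bij q.
  exists (fun g : {ffun 'I_d -> 'I_q} => [ffun i => if i == j then r (g i) else g i] : {ffun 'I_d -> 'I_q}) => g; apply/ffunP => i;
  by rewrite !ffunE; case: eqP; rewrite ?r1 ?r2.
rewrite [RHS](reindex s) /=; last exact: onW_bij.
apply: eq_bigr => g _.
case: (ltnP (g j).+1 q) => hq.
  congr f; apply/rowP => i; rewrite !mxE eqxx /= ffunE; case: eqP => [->|_].
    by rewrite /= modn_small // -natr1; field.
  by rewrite mulr0 addr0.
have eq1 : (g j).+1 = q by apply/eqP; rewrite eqn_leq hq ltn_ord.
rewrite -[RHS](pf _ j); congr f; apply/rowP => i; rewrite !mxE eqxx /= ffunE; case: eqP => [->|_].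
  rewrite /= eq1 modnn mulr0 mul0r add0r -[X in _ * X%:R / _ + _ = _]/(nat_of_ord (g j)).
  have eqR : q%:R = (g j)%:R + 1 :> R by rewrite natr1 eq1.
  by rewrite eqR; field; rewrite -eqR.
by rewrite !mulr0 !addr0.
Qed.

Lemma periodic_dlt j h f : Defs.periodic f -> Defs.periodic (dlt j h f).
Proof. by move=> pf x i; rewrite /dlt -addrA [_ *: _ + _ *: _]addrC addrA !pf. Qed.

Lemma periodic_mul f g : Defs.periodic f -> Defs.periodic g -> Defs.periodic (fun x => f x * g x).
Proof. by move=> pf pg x i; rewrite pf pg. Qed.

Lemma periodic_ex k : Defs.periodic (@fmode R d k).
Proof.
move=> x j; rewrite exDr; have -> : fmode k ((2 * pi) *: ej j) = 1.
  by rewrite /fmode dot_ej mulrC cis_int2pi.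
by rewrite mulr1.
Qed.

Lemma avg_dlt q j f k : (0 < q)%N -> Defs.periodic f ->
  avg q (fun x => dlt j (2 * pi / q%:R) f x * fmode (- k) x) =
  (cis (2 * pi / q%:R * (k 0 j)%:~R) - 1) * avg q (fun x => f x * fmode (- k) x).
Proof.
move=> q0 pf; set h := 2 * pi / q%:R.
have p2 := periodic_mul pf (@periodic_ex (- k)).
rewrite mulrBl mul1r -{1}(avg_shift j q0 p2) -/h /avg.
rewrite [cis _ * (_ * _)]mulrCA -mulrBr; congr (_ * _); rewrite mulr_sumr -sumrB.
apply: eq_bigr => g _.
rewrite /dlt exDr [fmode (- k) (h *: _)]/fmode dot_ej mxE rmorphN /= mulrN.
have := cisD (h * (k 0 j)%:~R) (- (h * (k 0 j)%:~R)); rewrite subrr cis0 => e.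
rewrite mulrBl; congr (_ - _).
by rewrite -[LHS]mulr1 e; ring.
Qed.

(** Summation by parts [n] times with step [h = 2 pi / q]. Each difference costs [2 h] times a
    derivative and has a symbol of size at least [h |k_j| / 2], which needs [2 |k_j| <= q]; the
    quotient gives the 4. *)
Lemma coef_bound q n j f k M : (0 < q)%N -> (2 * `|k 0%R j| <= q)%N -> Defs.periodic f ->
  (forall m, cderivable j (iter m (D j) f)) -> (forall x, nm (iter n (D j) f x) <= M) ->
  nm (avg q (fun x => f x * fmode (- k) x)) * `|k 0%R j|%N%:R ^+ n <= 4 ^+ n * M.
Proof.
move=> q0 kq pf df hM; set h := 2 * pi / q%:R : R.
have qp : 0 < q%:R :> R by rewrite ltr0n.
have h0 : 0 < h by rewrite divr_gt0 // mulr_gt0 // pi_gt0.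
have e m : avg q (fun x => iter m (dlt j h) f x * fmode (- k) x) =
    (cis (h * (k 0 j)%:~R) - 1) ^+ m * avg q (fun x => f x * fmode (- k) x) /\
    Defs.periodic (iter m (dlt j h) f).
  elim: m => [|m [IH1 IH2]]; first by rewrite expr0 mul1r.
  by rewrite iterS avg_dlt // IH1 exprS mulrA; split=> //; exact: periodic_dlt.
have b1 : nm (avg q (fun x => iter n (dlt j h) f x * fmode (- k) x)) <= (2 * h) ^+ n * M.
  apply: nm_avg => x; rewrite nmM nm_ex mulr1; apply: iter_dlt_le => //; exact: ltW.
rewrite (e n).1 nmM nmX in b1.
set a := nm (avg q (fun x => f x * fmode (- k) x)) in b1 *.
have ek : `|(k 0 j)%:~R| = `|k 0%R j|%N%:R :> R by rewrite -intr_norm -abszE -pmulrn.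
have b2 : h * `|k 0%R j|%N%:R / 2 <= nm (cis (h * (k 0 j)%:~R) - 1).
  have := @cis_lower R (h * (k 0 j)%:~R); rewrite normrM ek ger0_norm ?(ltW h0) //; apply.
  rewrite /h mulrAC ler_pdivrMr // -mulrA mulrCA ler_pM2l ?pi_gt0 //.
  by rewrite -natrM ler_nat.
have a0 : 0 <= a by exact: nm_ge0.
have b3 : (h * `|k 0%R j|%N%:R / 2) ^+ n * a <= (2 * h) ^+ n * M.
  apply: le_trans b1; rewrite ler_wpM2r // lerXn2r ?nnegrE ?nm_ge0 //.
  by rewrite divr_ge0 // mulr_ge0 // ltW.
have p0 : 0 < (h / 2) ^+ n by rewrite exprn_gt0 // divr_gt0.
have e4 : (2 * h) ^+ n * M = (h / 2) ^+ n * (4 ^+ n * M).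
  by rewrite [RHS]mulrA -exprMn; congr (_ ^+ _ * _); field.
rewrite -(ler_pM2l p0) -e4.
apply: le_trans b3; rewrite mulrCA [X in _ <= X]mulrC ler_wpM2l // -exprMn.
by rewrite mulrAC lexx.
Qed.

(** Symmetric representatives of the residues modulo [2 H + 1]. *)
Definition freq (H : nat) (g : {ffun 'I_d -> 'I_(2 * H).+1}) : Z := \row_j ((g j)%:Z - H%:Z).

Lemma freq_orth H (g1 g2 : {ffun 'I_d -> 'I_(2 * H).+1}) :
  \sum_(g : {ffun 'I_d -> 'I_(2 * H).+1}) fmode (freq g) (grid R g1 - grid R g2) = if g1 == g2 then ((2 * H).+1%:R ^+ d : C) else 0.
Proof.
set q := (2 * H).+1.
have -> : \sum_(g : {ffun 'I_d -> 'I_q}) fmode (freq g) (grid R g1 - grid R g2) =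
  \prod_j \sum_(i < q) cis (((i : nat)%:Z - H%:Z)%:~R * (grid R g1 - grid R g2) 0 j).
  rewrite bigA_distr_bigA /=; apply: eq_bigr => g _.
  rewrite /fmode /dot (big_morph (@cis R) (@cisD R) (cis0 R)); apply: eq_bigr => j _.
  by rewrite mxE.
have qR : q%:R != 0 :> R by rewrite pnatr_eq0.
case: eqP => [->|/eqP ne].
  rewrite subrr -[d in RHS]card_ord -prodr_const; apply: eq_bigr => j _.
  rewrite (eq_bigr (fun=> 1)) ?sumr_const ?card_ord // => i _.
  by rewrite mxE mulr0 cis0.
have [j hj] : exists j, g1 j != g2 j.
  by apply/existsP; apply: contraNT ne; rewrite negb_exists => /forallP h;
     apply/eqP/ffunP => j; apply/eqP; have := h j; rewrite negbK.
rewrite (bigD1 j) //=.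
pose r : int := (g1 j : nat)%:Z - (g2 j : nat)%:Z.
have eth : (grid R g1 - grid R g2) 0 j = 2 * pi * (r%:~R / q%:R).
  by rewrite !mxE -/q /r rmorphB /= -!pmulrn; field.
have r0 : r != 0 by rewrite subr_eq0 eqz_nat.
have rq : (`|r| < q)%N.
  by rewrite /r; have := ltn_ord (g1 j); have := ltn_ord (g2 j); rewrite -/q; move: (nat_of_ord _) (nat_of_ord _) => a b; lia.
have z0 : \sum_(i < q) cis (2 * pi * (r%:~R / q%:R)) ^+ i = 0 :> C.
  by apply: geom_root; [exact: cis_rootX | exact: cis_root_neq1].
rewrite eth (eq_bigr (fun i : 'I_q => cis (- (H%:R * (2 * pi * (r%:~R / q%:R)))) * cis (2 * pi * (r%:~R / q%:R)) ^+ i)).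
  by rewrite -mulr_sumr z0 mulr0 mul0r.
move=> i _; rewrite -cis_nat -cisD rmorphB /= -!pmulrn; congr cis; ring.
Qed.

Lemma dft_inversion H f (g : {ffun 'I_d -> 'I_(2 * H).+1}) :
  f (grid R g) = \sum_(g' : {ffun 'I_d -> 'I_(2 * H).+1}) avg (2 * H).+1 (fun x => f x * fmode (- freq g') x) * fmode (freq g') (grid R g).
Proof.
rewrite /avg.
have qC : ((2 * H).+1%:R ^+ d : C) != 0 by rewrite expf_neq0 // pnatr_eq0.
transitivity (((2 * H).+1%:R ^+ d)^-1 * \sum_(g2 : {ffun 'I_d -> 'I_(2 * H).+1}) f (grid R g2) *
   \sum_(g' : {ffun 'I_d -> 'I_(2 * H).+1}) fmode (freq g') (grid R g - grid R g2)).
  have e g2 : f (grid R g2) * \sum_(g' : {ffun 'I_d -> 'I_(2 * H).+1}) fmode (freq g') (grid R g - grid R g2) =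
      f (grid R g2) * (if g == g2 then ((2 * H).+1%:R ^+ d : C) else 0).
    by congr (_ * _); exact: freq_orth.
  rewrite (eq_bigr _ (fun g2 _ => e g2)) (bigD1 g) //= eqxx big1 => [|g2 hg]; last first.
    by rewrite eq_sym (negbTE hg) mulr0.
  by rewrite addr0 mulrCA mulVf // mulr1.
rewrite [RHS](eq_bigr (fun g' => ((2 * H).+1%:R ^+ d)^-1 * \sum_(g2 : {ffun 'I_d -> 'I_(2 * H).+1})
   (f (grid R g2) * (fmode (- freq g') (grid R g2) * fmode (freq g') (grid R g))))).
  rewrite -mulr_sumr exchange_big /=; congr (_ * _); apply: eq_bigr => g2 _.
  rewrite mulr_sumr; apply: eq_bigr => g' _; congr (_ * _).
  rewrite exDr mulrC; congr (_ * _); rewrite /fmode dotNl /dot -sumrN; congr cis.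
  by apply: eq_bigr => j _; rewrite !mxE mulrN.
move=> g' _; rewrite -mulrA mulr_suml; congr (_ * _).
by apply: eq_bigr => g2 _; rewrite mulrA.
Qed.

Lemma br_pow_le k (n : nat) (a M : R) : 0 <= a -> a <= M -> (forall j, a * `|k 0%R j|%N%:R ^+ n <= M) ->
  br R k ^+ n * a <= d.+1%:R ^+ n * M.
Proof.
move=> a0 aM h; pose m := \max_j `|k 0%R j|%N.
have h1 : (absn k <= d * m)%N.
  rewrite /absn; apply: (@leq_trans (\sum_(j < d) m)).
    by apply: leq_sum => j _; exact: leq_bigmax.
  by rewrite sum_nat_const card_ord.
have M0 := le_trans a0 aM.
have h2 : br R k <= d.+1%:R * (maxn 1 m)%:R.
  rewrite -natrM /br ler_nat mulSn; apply: (@leq_ltn_trans (d * m)); first exact: h1.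
  rewrite addnC -addn1 leq_add ?leq_mul ?leq_maxr ?leq_maxl //.
have h3 : (maxn 1 m)%:R ^+ n * a <= M.
  case: (leqP m 1) => hm; first by rewrite expr1n mul1r.
  have [j hj] : exists j, m = `|k 0%R j|%N.
    have c : (0 < #|'I_d|)%N.
      rewrite card_ord; case: posnP => // d0; move: hm.
      by rewrite /m big1 // => j _; have := ltn_ord j; rewrite {2}d0.
    by have [j] := @bigop.eq_bigmax _ (fun j : 'I_d => `|k 0%R j|%N) c; exists j.
  by rewrite hj mulrC h.
apply: (@le_trans _ _ ((d.+1%:R * (maxn 1 m)%:R) ^+ n * a)).
  by rewrite ler_wpM2r // lerXn2r ?nnegrE ?(ltW (br_gt0 R k)).
by rewrite exprMn -mulrA ler_wpM2l ?exprn_ge0.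
Qed.

Lemma grid_near x q : (0 < q)%N -> (forall j, 0 <= x 0 j) -> (forall j, x 0 j < 2 * pi) ->
  exists g : {ffun 'I_d -> 'I_q}, forall j, `|x 0 j - grid R g 0 j| <= 2 * pi / q%:R.
Proof.
move=> q0 x0 x1; have p2 : 0 < 2 * pi :> R by rewrite mulr_gt0 ?pi_gt0.
have qR : 0 < q%:R :> R by rewrite ltr0n.
pose a j := x 0 j * q%:R / (2 * pi); have a0 j : 0 <= a j by rewrite divr_ge0 ?(ltW p2) // mulr_ge0.
have aq j : (Num.truncn (a j) < q)%N.
  by rewrite truncn_lt_nat // /a ltr_pdivrMr // mulrC ltr_pM2l.
exists [ffun j => Ordinal (aq j)] => j; rewrite !mxE ffunE /=.
have /andP[h1 h2] := truncn_itv (a0 j); move: h1 h2; rewrite -natr1.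
set t := (Num.truncn (a j))%:R : R.
have qn : q%:R != 0 :> R by rewrite gt_eqF.
have -> : x 0 j = a j * (2 * pi / q%:R) by rewrite /a mulrA divfK ?mulfK // gt_eqF.
have -> : 2 * pi * t / q%:R = t * (2 * pi / q%:R) by ring.
have h : 0 < 2 * pi / q%:R :> R by rewrite divr_gt0.
move=> h1 h2; rewrite -mulrBl normrM [`|2 * pi / _|]gtr0_norm //.
by rewrite ler_piMl ?(ltW h) // ler_norml; apply/andP; split; lra.
Qed.

Lemma norm_le x (e : R) : 0 <= e -> (forall j, `|x 0 j| <= e) -> `|x| <= e.
Proof.
move=> e0 h; have -> : `|x| = mx_norm x by [].
by rewrite mx_normrE; apply: bigmax_le => // -[i j] _; rewrite ord1 h.
Qed.

(* Discrete Fourier inversion on grids of mesh tending to 0; the coefficients are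
   ultralimits of the discrete ones, so no convergence of Riemann sums is needed. *)
Theorem Cinfty_fserP f : Cinfty f -> exists c, [/\ rapid c, f = fser c &
  forall j n M, (forall x, nm (iter n (D j) f x) <= M) ->
  forall k, nm (c k) * `|k 0%R j|%N%:R ^+ n <= 4 ^+ n * M].
Proof.
move=> [pf sf].
have iterE n j : iter n (D j) f = foldr (@D R d) f (nseq n j) by elim: n => //= n ->.
have cdf j n : cderivable j (iter n (D j) f) by rewrite iterE; case: (sf (nseq n j)).
have pit n j : Defs.periodic (iter n (D j) f).
  elim: n => //= n IH x i.
  have key (g : 'rV[R]_d -> R) : (forall x, g (x + (2 * pi) *: ej i) = g x) ->
      (forall x, derivable g x (ej j)) ->
      'D_(ej j) g (x + (2 * pi) *: ej i) = 'D_(ej j) g x.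
    move=> hg dg; have h : is_derive (x + (2 * pi) *: ej i) (ej j) g ('D_(ej j) g (x + (2 * pi) *: ej i)).
      exact/derivableP.
    have := is_derive_translate h; have -> : (fun z => g (z + (2 * pi) *: ej i)) = g by apply/funext.
    by case=> _ ->.
  rewrite /D (key (re_part (iter n (D j) f))); last 2 first.
  - by move=> y; rewrite /re_part IH.
  - by move=> y; case: (cdf j n y).
  rewrite (key (im_part (iter n (D j) f))) //.
  - by move=> y; rewrite /im_part IH.
  by move=> y; case: (cdf j n y).
have bnd n j : exists2 M, 0 <= M & forall x, nm (iter n (D j) f x) <= M.
  apply: torus_bounded => //; rewrite iterE; by case: (sf (nseq n j)).
have [M0 M00 hM0] : exists2 M, 0 <= M & forall x, nm (f x) <= M.
  by apply: torus_bounded => //; case: (sf [::]).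
(* Discrete coefficients on the grid with [2 n + 1] points per direction. Up to frequency [n] they
   obey [coef_bound] with constants independent of [n]; beyond it they are set to 0. *)
pose A n k : C := if [forall j, (`|k 0%R j| <= n)%N] then avg (2 * n).+1 (fun x => f x * fmode (- k) x) else 0.
have AM n k : nm (A n k) <= M0.
  rewrite /A; case: ifP => _; last by rewrite nm0.
  by apply: nm_avg => x; rewrite nmM nm_ex mulr1.
have Aj n k j p M : (forall x, nm (iter p (D j) f x) <= M) ->
    nm (A n k) * `|k 0%R j|%N%:R ^+ p <= 4 ^+ p * M.
  move=> hM; have M1 : 0 <= M := le_trans (nm_ge0 _) (hM 0).
  rewrite /A; case: ifP => [/forallP hk|_]; last by rewrite nm0 mul0r mulr_ge0 // exprn_ge0.
  apply: coef_bound => //; by have := hk j; lia.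
have [U [U_ultra Uoo]] := @ultraFilterLemma nat (\oo)%classic _.
have [UF] : ProperFilter U by exact: ultra_proper.
have /choice[c hc] k : exists L, forall e, 0 < e -> U [set n | nm (A n k - L) <= e]%classic.
  exact: (ultra_climC U_ultra (fun n => AM n k)).
have lim_le k (a b : R) : 0 <= a -> (forall n, nm (A n k) * a <= b) -> nm (c k) * a <= b.
  move=> a0 h; apply/ler_addgt0Pr => e e0.
  have ea : 0 < e / (a + 1) by rewrite divr_gt0 // ltr_wpDl.
  have [n /= hn] := filter_ex (hc k _ ea).
  have h1 : nm (c k) <= nm (A n k) + e / (a + 1).
    have -> : c k = A n k - (A n k - c k) by rewrite subKr.
    apply: le_trans (ler_nmD _ _) _; by rewrite nmN lerD2l.
  apply: le_trans (ler_wpM2r a0 h1) _; rewrite mulrDl lerD //.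
  by rewrite mulrAC ler_pdivrMr ?ltr_wpDl // ler_pM2l // lerDl.
have cj k j p M : (forall x, nm (iter p (D j) f x) <= M) ->
    nm (c k) * `|k 0%R j|%N%:R ^+ p <= 4 ^+ p * M.
  by move=> hM; apply: lim_le => [|n]; [exact: exprn_ge0 | apply: Aj].
have cM k : nm (c k) <= M0.
  by have := @lim_le k 1 M0 ler01; rewrite mulr1; apply => n; rewrite mulr1.
have brb p : exists2 b, 0 <= b & forall v k, nm (v k : C) <= M0 ->
   (forall j M, (forall x, nm (iter p (D j) f x) <= M) -> nm (v k) * `|k 0%R j|%N%:R ^+ p <= 4 ^+ p * M) ->
   br R k ^+ p * nm (v k) <= b.
  have /choice[B hB] j : exists M, 0 <= M /\ forall x, nm (iter p (D j) f x) <= M.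
    by have [M] := bnd p j; exists M.
  pose S := M0 + 4 ^+ p * \sum_j B j.
  have B0 : 0 <= \sum_j B j by apply: sumr_ge0 => j _; case: (hB j).
  have p0 : 0 <= (4 : R) ^+ p by apply: exprn_ge0.
  exists (d.+1%:R ^+ p * S); first by rewrite mulr_ge0 ?exprn_ge0 // addr_ge0 // mulr_ge0.
  move=> v k h1 h2; apply: br_pow_le; first exact: nm_ge0.
    by apply: le_trans h1 _; rewrite lerDl mulr_ge0.
  move=> j; apply: le_trans (h2 j (B j) (hB j).2) _.
  apply: (@le_trans _ _ (4 ^+ p * \sum_j B j)); last by rewrite lerDr.
  rewrite ler_wpM2l // (bigD1 j) //= lerDl; apply: sumr_ge0 => i _; by case: (hB i).
have rc : rapid c.
  apply: br_rapid => p; have [b b0 hb] := brb p; exists b => k.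
  by apply: hb => // j M; exact: cj.
exists c; split=> //; last by move=> j n M h k; exact: cj.
have [b b0 hb] := brb (2 * d)%N.
have prb v k : br R k ^+ (2 * d) * nm (v k : C) <= b -> nm (v k) <= b * (pr R k ^+ 2)^-1.
  move=> h; rewrite ler_pdivlMr ?exprn_gt0 ?pr_gt0 // mulrC; apply: le_trans h.
  rewrite ler_wpM2r ?nm_ge0 // [(2 * d)%N]mulnC exprM lerXn2r ?nnegrE ?(ltW (pr_gt0 R k)) ?exprn_ge0 ?(ltW (br_gt0 R k)) //.
  exact: pr_le_br.
have Apr n k : nm (A n k) <= b * (pr R k ^+ 2)^-1.
  by apply: prb; apply: hb => // j M; exact: Aj.
have cpr k : nm (c k) <= b * (pr R k ^+ 2)^-1 by apply: prb; apply: hb => // j M; exact: cj.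
have spr := nsmZ b0 (nsm_pr2 R d).
have sA n : csm (A n) by exact: (csm_le spr (Apr n)).
have sc : csm c := csm_rapid rc.
have fA n (g : {ffun 'I_d -> 'I_(2 * n).+1}) : f (grid R g) = fser (A n) (grid R g).
  rewrite dft_inversion /fser.
  pose s := map (@freq n) (enum {ffun 'I_d -> 'I_(2 * n).+1}).
  have finj : injective (@freq n).
    move=> g1 g2 /rowP e; apply/ffunP => j; apply/val_inj.
    by have := e j; rewrite !mxE => /addIr [].
  have us : uniq s by rewrite map_inj_uniq // enum_uniq.
  have sE k : (k \in s) = [forall j, (`|k 0%R j| <= n)%N].
    apply/mapP/forallP => [[g' _ ->] j|h].
      by rewrite mxE; have := ltn_ord (g' j); move: (nat_of_ord _) => m; lia.
    have hk j : (`|(k 0 j + n%:Z)%R|%N < (2 * n).+1)%N by have := h j; lia.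
    exists [ffun j => Ordinal (hk j)]; first by rewrite mem_enum.
    apply/rowP => j; rewrite mxE ffunE /=; have := h j; lia.
  have e : (fun k => A n k * fmode k (grid R g)) = (fun k => if k \in s then
     avg (2 * n).+1 (fun x => f x * fmode (- k) x) * fmode k (grid R g) else 0).
    by apply/funext => k; rewrite /A sE; case: ifP => // _; rewrite mul0r.
  rewrite e; have [_ ->] := csum_fin (fun k => avg (2 * n).+1 (fun x => f x * fmode (- k) x) * fmode k (grid R g)) us.
  by rewrite /s big_map big_enum.
have [K K0 hK] := fser_lip rc.
have [cr ci] : ccontinuous f by case: (sf [::]).
have pc := fser_periodic c.
(* Four errors of [e / 4]: moving [x] to a grid point [y] in [f] and in [fser c], and, at [y], where
   [f] equals [fser (A n)] exactly, the head and the tail of the series of [A n - c]. *)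
have box x : (forall j, 0 <= x 0 j) -> (forall j, x 0 j < 2 * pi) -> f x = fser c x.
  move=> x0 x1; apply/eqP; rewrite -subr_eq0; apply/eqP/nm_eq0/le_anti/andP; split; last exact: nm_ge0.
  apply/ler_addgt0Pr => e e0; rewrite add0r.
  have e4 : 0 < e / 4 by apply: divr_gt0.
  have [S [uS hS]] := nsum_tail (nsmZ (ler0n R 2) spr) e4.
  have [del d0 hd] : exists2 del : R, 0 < del & forall y, `|x - y| < del -> nm (f x - f y) <= e / 4.
    have e8 : 0 < e / 8 by apply: divr_gt0.
    have := cr x; move/cvgrPdist_lt => /(_ _ e8) /nbhs_normP[d1 d10 h1].
    have := ci x; move/cvgrPdist_lt => /(_ _ e8) /nbhs_normP[d2 d20 h2].
    exists (Num.min d1 d2) => [|y]; first by rewrite lt_min d10.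
    rewrite lt_min => /andP[/h1 {}h1 /h2 {}h2].
    apply: le_trans (nm_le_ReIm _) _; move: h1 h2; rewrite /= /re_part /im_part.
    by case: (f x) => a1 b1; case: (f y) => a2 b2 /=; lra.
  pose eS := e / 4 / (size S).+1%:R; have eS0 : 0 < eS by apply: divr_gt0.
  have US (s : seq Z) : U [set n | forall k, k \in s -> nm (A n k - c k) <= eS]%classic.
    elim: s => [|k s IH]; first by apply: (@filterS _ U _ setT); [by [] | exact: filterT].
    by apply: filterS2 (hc k _ eS0) IH => n h1 h2 l; rewrite inE => /orP[/eqP ->|/h2].
  pose del' := Num.min del (e / (4 * (K * d%:R + 1))).
  have Kd : 0 < 4 * (K * d%:R + 1) by rewrite mulr_gt0 // ltr_wpDl // mulr_ge0.
  have d'0 : 0 < del' by rewrite lt_min d0 divr_gt0.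
  pose n0 := (Num.truncn (2 * pi / del')).+1.
  have Un : U [set n | (n0 <= n)%N]%classic by apply: Uoo; exists n0.
  have [n [hS1 hn]] := filter_ex (filterI (US S) Un).
  have [g hg] := grid_near (ltn0Sn (2 * n)) x0 x1.
  have hde : 2 * pi / (2 * n).+1%:R < del'.
    rewrite ltr_pdivrMr // [del' * _]mulrC -ltr_pdivrMr //; apply: lt_le_trans (truncnS_gt _) _.
    by rewrite ler_nat; apply: leq_trans hn _; rewrite leqW // leq_pmull.
  set y := grid R g in hg.
  have hxy j : `|x 0 j - y 0 j| <= 2 * pi / (2 * n).+1%:R by exact: hg.
  have p2 : 0 <= 2 * pi / (2 * n).+1%:R :> R by rewrite divr_ge0 // mulr_ge0 // pi_ge0.
  have b1 : nm (f x - f y) <= e / 4.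
    apply: hd; apply: le_lt_trans (_ : 2 * pi / (2 * n).+1%:R < _).
      apply: norm_le => // j; have -> : (x - y) 0 j = x 0 j - y 0 j by move: (y) => z; rewrite !mxE.
      exact: hxy.
    by apply: lt_le_trans hde _; rewrite ge_min lexx.
  have b3 : nm (fser c y - fser c x) <= e / 4.
    apply: le_trans (hK x y) _; apply: (@le_trans _ _ (K * \sum_(j < d) del')).
      rewrite ler_wpM2l //; apply: ler_sum => j _; rewrite distrC.
      exact: le_trans (hxy j) (ltW hde).
    rewrite sumr_const card_ord -[X in _ * X]mulr_natr.
    have : del' <= e / (4 * (K * d%:R + 1)) by rewrite ge_min lexx orbT.
    rewrite ler_pdivlMr // => h; have kd : 0 <= K * d%:R by apply: mulr_ge0.
    have e1 : K * (del' * d%:R) = del' * (K * d%:R) by ring.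
    have e2 : del' * (4 * (K * d%:R + 1)) = 4 * (del' * (K * d%:R)) + 4 * del' by ring.
    by move: h; rewrite e1 e2; move: (del' * _) d'0 => z; lra.
  have b2 : nm (fser (A n) y - fser c y) <= e / 4 + e / 4.
    have sAc : csm (fun k => (A n k - c k) * fmode k y).
      by apply: fser_sm; apply: csmB => //; exact: sA.
    have -> : fser (A n) y - fser c y = csum (fun k => (A n k - c k) * fmode k y).
      rewrite /fser -(csumB (fser_sm y (sA n)) (fser_sm y sc)).
      by apply: eq_csum => k; rewrite mulrBl.
    have [st ->] := csum_split sAc uS; apply: le_trans (ler_nmD _ _) _; apply: lerD.
      apply: le_trans (ler_nm_sum _ _ _) _; rewrite big_seq.
      apply: (@le_trans _ _ (\sum_(k <- S | k \in S) eS)).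
        by apply: ler_sum => k hk; rewrite nmM nm_ex mulr1; apply: hS1.
      rewrite -big_seq big_const_seq count_predT iter_addr_0 -[_ *+ _]mulr_natr /eS.
      by rewrite mulrAC ler_pdivrMr // ler_wpM2l ?(ltW e4) // ler_nat.
    apply: le_trans hS; apply: nm_csum_le.
      apply: (nsm_le (nsmZ (ler0n R 2) spr)) => k; case: ifP => _; rewrite ?lexx ?andbT //.
        by rewrite mulr_ge0 // mulr_ge0 // invr_ge0 sqr_ge0.
      by rewrite mulr_ge0 // mulr_ge0 // invr_ge0 sqr_ge0.
    move=> k; case: ifP => _; first by rewrite nm0.
    rewrite nmM nm_ex mulr1; apply: le_trans (ler_nmD _ _) _; rewrite nmN.
    by have := lerD (Apr n k) (cpr k); rewrite [2 * _]mulr_natl mulr2n.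
  have -> : f x - fser c x = (f x - f y) + (fser (A n) y - fser c y) + (fser c y - fser c x).
    by rewrite -fA -/y; ring.
  apply: le_trans (ler_nmD _ _) _; apply: le_trans (lerD (ler_nmD _ _) (lexx _)) _.
  by move: b1 b2 b3; lra.
apply/funext => x; have [y [n [h1 [h2 ->]]]] := torus_box x.
rewrite !periodic_shift //; apply: box => // j; by case/andP: (h1 j).
Qed.

Lemma root_gt1 (lam : R) (L : nat) : 1 < lam -> exists2 x, 1 < x & x ^+ L <= lam.
Proof.
move=> l1; have l0 : 0 < lam - 1 by rewrite subr_gt0.
case: (posnP L) => [->|L0]; first by exists 2; rewrite ?expr0 ?ltW // ltr1n.
have d0 : 0 < L%:R * 2 ^+ L :> R by rewrite mulr_gt0 ?exprn_gt0 // ltr0n.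
pose e := Num.min 1 ((lam - 1) / (L%:R * 2 ^+ L)).
have e0 : 0 < e by rewrite lt_min ltr01 divr_gt0.
have [e1 e2] : e <= 1 /\ e <= (lam - 1) / (L%:R * 2 ^+ L) by split; rewrite ge_min lexx ?orbT.
exists (1 + e); first by rewrite ltrDl.
have x1 : 1 <= 1 + e by rewrite lerDl ltW.
rewrite -(lerD2r (- 1)); apply: le_trans (lam_pow1 L x1) _.
rewrite ler_pdivlMr // in e2; apply: le_trans e2.
have -> : 1 + e - 1 = e by rewrite addrC addKr.
by rewrite ler_wpM2l ?(ltW e0) // ler_wpM2l // lerXn2r ?nnegrE ?(le_trans ler01 x1) //; lra.
Qed.

(** With [m] the largest entry of [k], [p] derivatives give the bound [K (4 K p / m)^p]. Taking [p]
    to be the integer part of [m / (8 K)] makes it at most [K 2^(-p)]. *)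
Theorem Comega_fserP f : (0 < d)%N -> Comega f -> exists c b w, [/\ 0 <= b, 0 <= w, w < 1,
  forall k, nm (c k) <= b * w ^+ absn k & f = fser c].
Proof.
move=> dp [/Cinfty_fserP[c [rc fc hc]] [K K0 hK]].
have key k j p : nm (c k) * `|k 0%R j|%N%:R ^+ p <= K * (4 * K * p%:R) ^+ p.
  have -> : K * (4 * K * p%:R) ^+ p = 4 ^+ p * (K ^+ p.+1 * p%:R ^+ p) by rewrite !exprMn exprS; ring.
  apply: hc => x; pose al (i : 'I_d) := if i == j then p else 0%N.
  have := hK al x; have -> : mlen al = p.
    by rewrite /mlen /al (bigD1 j) //= eqxx big1 ?addn0 // => i /negbTE ->.
  rewrite nmE lecR; have -> // : Dmulti al f = iter p (D j) f.
  have h (s : seq 'I_d) : uniq s -> foldr (fun (i : 'I_d) g => iter (al i) (D i) g) f s =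
      if j \in s then iter p (D j) f else f.
    elim: s => //= i s IH /andP[his us]; rewrite IH // inE /al [j == i]eq_sym.
    case: (eqVneq i j) his => [->|_] his //=; first by rewrite (negbTE his).
  by rewrite /Dmulti h ?enum_uniq // mem_enum.
(* Then [|k| <= d m <= L (p + 1)], and [x^L <= 2] turns [2^(-p)] into at most [2 x^(-|k|)]. *)
pose L := (d * (Num.truncn (8 * K)).+1)%N.
have [x x1 xL] := @root_gt1 2 L (ltr1n _ 2).
have x0 : 0 < x := lt_trans ltr01 x1.
exists c, (2 * K), x^-1; split=> //.
- by rewrite mulr_ge0 // ltW.
- by rewrite invr_ge0 ltW.
- by rewrite invf_lt1.
move=> k; have K8 : 0 < 8 * K by rewrite mulr_gt0.
pose m := \max_j `|k 0%R j|%N.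
pose p := Num.truncn (m%:R / (8 * K)).
have m0 : 0 <= m%:R / (8 * K) by rewrite divr_ge0 // ltW.
have /andP[p1 p2] := truncn_itv m0; rewrite -/p in p1 p2.
have h1 : nm (c k) <= K * 2^-1 ^+ p.
  case: (posnP p) => [p0|pp].
    rewrite p0 expr0 mulr1; by have := key k (Ordinal dp) 0%N; rewrite !expr0 !mulr1.
  have m1 : (0 < m)%N.
    by rewrite lt0n; apply: contraTneq p1 => ->; rewrite mul0r -ltNge ltr0n.
  have [j hj] : exists j, m = `|k 0%R j|%N.
    have cd : (0 < #|'I_d|)%N.
      rewrite card_ord; case: posnP => // d0; move: m1.
      by rewrite /m big1 // => j _; have := ltn_ord j; rewrite {2}d0.
    by have [j] := @bigop.eq_bigmax _ (fun j : 'I_d => `|k 0%R j|%N) cd; exists j.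
  have := key k j p; rewrite -hj => h.
  have mp : 0 < m%:R ^+ p :> R by rewrite exprn_gt0 // ltr0n.
  rewrite -(ler_pM2r mp); apply: le_trans h _; rewrite -[leRHS]mulrA ler_pM2l // -exprMn.
  rewrite lerXn2r ?nnegrE ?mulr_ge0 ?invr_ge0 ?(ltW K0) //.
  by move: p1; rewrite ler_pdivlMr //; lra.
apply: le_trans h1 _; rewrite [2 * K]mulrC -mulrA ler_pM2l // exprVn.
have mL : (absn k <= L * p.+1)%N.
  apply: (@leq_trans (d * m)).
    rewrite /absn; apply: (@leq_trans (\sum_(j < d) m)); last by rewrite sum_nat_const card_ord.
    by apply: leq_sum => j _; exact: leq_bigmax.
  rewrite /L -mulnA leq_mul2l; apply/orP; right.
  rewrite -(ler_nat R) natrM; move: p2; rewrite ltr_pdivrMr // => /ltW h.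
  apply: le_trans h _; rewrite mulrC ler_wpM2r //; apply: ltW; exact: truncnS_gt.
have h2 : x ^+ absn k <= 2 ^+ p.+1.
  apply: (@le_trans _ _ (x ^+ (L * p.+1))); first by apply: ler_weXn2l => //; exact: ltW.
  by rewrite exprM lerXn2r ?nnegrE // exprn_ge0 // ltW.
rewrite exprVn ler_pdivlMr ?exprn_gt0 // mulrC ler_pdivrMr ?exprn_gt0 //.
by rewrite -exprS.
Qed.

End Torus.

(** * Distributions *)

Section TorusIntegral.
Variable R : realType.
Local Notation C := R[i].

Lemma row_mxE (T : nmodType) d (m : 'rV[T]_1) (l : 'rV[T]_d) :
  (row_mx m l : 'rV[T]_d.+1) 0 ord0 = m 0 0 /\
  forall j : 'I_d, (row_mx m l : 'rV[T]_d.+1) 0 (lift ord0 j) = l 0 j.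
Proof.
split; first by have := @row_mxEl T 1 1 d m l 0 0; congr (_ = _); congr (row_mx m l _ _); apply/val_inj.
by move=> j; have := @row_mxEr T 1 1 d m l 0 j; congr (_ = _); congr (row_mx m l _ _); apply/val_inj.
Qed.

Lemma dot_row d (m : 'rV[int]_1) (l : 'rV[int]_d) (s : R) (y : 'rV[R]_d) :
  dot (row_mx m l : 'rV[int]_d.+1) (row_mx s%:M y : 'rV[R]_d.+1) = dot m (s%:M : 'rV[R]_1) + dot l y.
Proof.
have [m0 ml] := row_mxE m l; have [s0 sy] := row_mxE (s%:M : 'rV[R]_1) y.
rewrite /dot big_ord_recl m0 s0; congr (_ + _); first by rewrite big_ord1.
by apply: eq_bigr => j _; rewrite ml sy.
Qed.

Lemma pr_row d (m : 'rV[int]_1) (l : 'rV[int]_d) :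
  pr R (row_mx m l : 'rV[int]_d.+1) = pr R m * pr R l.
Proof.
have [m0 ml] := row_mxE m l.
rewrite /pr big_ord_recl m0 big_ord1; congr (_ * _).
by apply: eq_bigr => j _; rewrite ml.
Qed.

Lemma scalar_ej (s : R) : (s%:M : 'rV[R]_1) = 0 + s *: basis_vec R (0 : 'I_1).
Proof. by rewrite add0r; apply/rowP => i; rewrite !mxE ord1 !eqxx mulr1. Qed.

(** The fundamental theorem of calculus, for the primitive [c_0 s] plus the series of [c_m / (i m)],
    which is periodic. The factor [a] will carry the powers of [2 pi] from the inner integrals. *)
Lemma circle_integral (c : 'rV[int]_1 -> C) (a : R) : rapid c ->
  Rintegral lebesgue_measure `[0, 2 * pi]%classic (fun s => a * complex.Re (fser c s%:M)) =
  a * (2 * pi * complex.Re (c 0)).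
Proof.
move=> rc; have p2 : 0 < 2 * pi :> R by rewrite mulr_gt0 // pi_gt0.
pose e (m : 'rV[int]_1) : C := if m == 0 then 0 else - 'i * (c m / (m 0 0)%:~R).
have m00 (m : 'rV[int]_1) : m != 0 -> m 0 0 != 0.
  by apply: contraNneq => h; apply/eqP/matrixP => i j; rewrite !ord1 h mxE.
have re : rapid e.
  move=> r; have [b hb] := rc r; exists b => m; apply: le_trans (hb m).
  rewrite /e; case: eqVneq => [_|/m00 hm]; first by rewrite nm0 nm_ge0.
  rewrite !nmM nmN -complexiE nm_i mul1r nmV nm_int ler_piMr ?nm_ge0 //.
  by rewrite invf_le1 ?ltr0n ?ler1n ?absz_gt0.
pose F (s : R) : R := a * (complex.Re (c 0) * s + complex.Re (fser e s%:M)).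
have dF (s : R) : is_derive s (1 : R) F (a * complex.Re (fser c s%:M)).
  have h1 : is_derive s (1 : R) (fun s => complex.Re (fser e s%:M)) (complex.Re (fser c s%:M) - complex.Re (c 0)).
    have [h _] := fser_derive (0 + s *: basis_vec R (0 : 'I_1)) 0 re.
    have := @is_derive_line R 1 (re_part (fser e)) 0 (basis_vec R 0) s ex_derive.
    rewrite derive_val.
    have -> : (fun s => re_part (fser e) (0 + s *: basis_vec R 0)) = (fun s => complex.Re (fser e s%:M)).
      by apply/funext => t; rewrite scalar_ej.
    have -> : - complex.Im (fser (Dm 0 e) (0 + s *: basis_vec R 0)) = complex.Re (fser c s%:M) - complex.Re (c 0).
      have -> : fser (Dm 0 e) (0 + s *: basis_vec R 0) = - 'i * (fser c s%:M - c 0).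
        rewrite -scalar_ej /fser.
        have sc := fser_sm s%:M (csm_rapid rc).
        have [|h3 h4] := @csum_delta R _ (fun m : 'rV[int]_1 => if m == 0 then c 0 else 0) 0.
          by move=> y /negbTE ->.
        rewrite eqxx in h4; rewrite -[X in _ * (_ - X)]h4 -csumB // -csumZ; last exact: csmB.
        apply: eq_csum => m; rewrite /Dm /e; case: eqVneq => [->|/m00 hm].
          by rewrite ex0 mxE mul0r mul0r mulr1 subrr mulr0.
        by rewrite subr0; field; rewrite intr_eq0.
      by rewrite mulNr; move: (fser c _) (c 0) => z w; rewrite -complexiE; case: z => ? ?; case: w => ? ? /=; ring.
    by move=> /(_ _ h).
  have h2 : is_derive s (1 : R) (fun s => complex.Re (c 0) * s) (complex.Re (c 0)).
    by have := @is_deriveZ R R R id (complex.Re (c 0)) s 1 1 _; rewrite [_ *: _]mulr1; apply.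
  have h3 := is_deriveD h2 h1; have := @is_deriveZ R R R _ a s 1 _ h3.
  rewrite -[a *: _]/(a * _); congr (is_derive _ _ _ _); congr (_ * _); ring.
have cont (g dg : R -> R) : (forall s : R, is_derive s (1 : R) g (dg s)) -> continuous g.
  by move=> h s; apply: differentiable_continuous; apply/derivable1_diffP; case: (h s).
have cF := cont _ _ dF.
have cg : continuous (fun s : R => a * complex.Re (fser c s%:M)).
  move=> s; have [cr _] := ccontinuous_fser rc.
  have h : is_derive s (1 : R) (fun s => a * complex.Re (fser c s%:M)) (a * - complex.Im (fser (Dm 0 c) s%:M)).
    have [h _] := fser_derive (0 + s *: basis_vec R (0 : 'I_1)) 0 rc.
    have := @is_derive_line R 1 (re_part (fser c)) 0 (basis_vec R 0) s ex_derive.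
    rewrite derive_val -scalar_ej.
    have -> : (fun s => re_part (fser c) (0 + s *: basis_vec R 0)) = (fun s => complex.Re (fser c s%:M)).
      by apply/funext => t; rewrite scalar_ej.
    by rewrite -scalar_ej in h; move=> /(_ _ h) h1; exact: is_deriveZ.
  by apply: differentiable_continuous; apply/derivable1_diffP; case: h.
have wc : {within `[0, 2 * pi], continuous (fun s : R => a * complex.Re (fser c s%:M))}%classic.
  exact: continuous_subspaceT.
have LR : derivable_oo_LRcontinuous F 0 (2 * pi).
  split=> [s _| |]; first by case: (dF s).
    by apply: cvg_at_right_filter; exact: cF.
  by apply: cvg_at_left_filter; exact: cF.
have dd : {in `]0, 2 * pi[, F^`()%classic =1 (fun s : R => a * complex.Re (fser c s%:M))}.
  by move=> s _; rewrite derive1E derive_val.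
rewrite /Rintegral (continuous_FTC2 p2 wc LR dd) /=.
rewrite /F; have -> : fser e (2 * pi)%:M = fser e 0%:M.
  have := fser_periodic e (0%:M) (0 : 'I_1); rewrite !scalar_ej scale0r !add0r; apply: etrans.
  by [].
by rewrite mulr0; ring.
Qed.

(** Induction along the iterated integral: for a fixed first coordinate [s], the series is a Fourier
    series in the other variables, with coefficients [cs s]. *)
Lemma torus_integral_fser d (c : 'rV[int]_d -> C) : rapid c ->
  torus_integral (re_part (fser c)) = (2 * pi) ^+ d * complex.Re (c 0).
Proof.
elim: d c => [|d IH] c rc.
  rewrite expr0 mul1r /= /re_part /fser.
  have [|_ ->] := @csum_delta R _ (fun k : 'rV[int]_0 => c k * fmode k 0) 0.
    move=> k; have k0 : k = 0 by apply/rowP => i; case: i.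
    by rewrite k0 eqxx.
  by rewrite ex0 mulr1.
pose F (p : 'rV[int]_1 * 'rV[int]_d) : C := c (row_mx p.1 p.2 : 'rV[int]_d.+1).
pose cs (s : R) (l : 'rV[int]_d) : C := csum (fun m : 'rV[int]_1 => F (m, l) * fmode m s%:M).
have rinj : injective (fun p : 'rV[int]_d * 'rV[int]_1 => (row_mx p.2 p.1 : 'rV[int]_d.+1)).
  by move=> [l m] [l' m'] /= /(@eq_row_mx _ 1 1 d) [-> ->].
have rsurj (k : 'rV[int]_d.+1) : exists p : 'rV[int]_d * 'rV[int]_1, (row_mx p.2 p.1 : 'rV[int]_d.+1) = k.
  by exists (@rsubmx _ 1 1 d k, @lsubmx _ 1 1 d k); rewrite /= hsubmxK.
have c1r : rapid (fun m => F (m, 0)).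
  move=> r; have [b hb] := rc r; exists b => m; apply: le_trans (hb _) _.
  rewrite pr_row expfzMl; have -> : pr R (0 : 'rV[int]_d) = 1.
    by rewrite /pr big1 // => j _; rewrite mxE.
  by rewrite exp1rz mulr1.
have prm := nsm_pr2 R 1.
have rcs s : rapid (cs s).
  move=> r; pose r' := if r <= -2 then r else -2.
  apply: (@ord_mono _ _ r'); first by rewrite /r'; case: (lerP r (-2)) => // /ltW.
  have r2 : r' <= -2 by rewrite /r'; case: (lerP r (-2)).
  have [b b0 hb] := ordP (rc r'); exists (b * nsum (fun m : 'rV[int]_1 => (pr R m ^+ 2)^-1)) => l.
  have p0 := prz_ge0 R l r'.
  have sm := nsmZ (mulr_ge0 b0 p0) prm.
  rewrite mulrAC -nsumZ ?mulr_ge0 //; apply: nm_csum_le => // m.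
  rewrite nmM nm_ex mulr1; apply: le_trans (hb _) _; rewrite /= pr_row expfzMl mulrCA -mulrA mulrC.
  rewrite -mulrA ler_wpM2l // ler_wpM2l //.
  have -> : (pr R m ^+ 2)^-1 = pr R m ^ (-2) by [].
  exact: prz_mono.
have fs s y : fser c (row_mx s%:M y : 'rV[R]_d.+1) = fser (cs s) y.
  have sc := fser_sm (row_mx s%:M y : 'rV[R]_d.+1) (csm_rapid rc).
  have [|h1 h2] := csum_reindex rinj _ sc; first by move=> k _.
  rewrite /fser -h2.
  have e : ((fun k => c k * fmode k (row_mx s%:M y : 'rV[R]_d.+1)) \o
      (fun p : 'rV[int]_d * 'rV[int]_1 => (row_mx p.2 p.1 : 'rV[int]_d.+1))) =
      (fun p => (fun l m => F (m, l) * fmode m s%:M * fmode l y) p.1 p.2).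
    by apply/funext => -[l m] /=; rewrite /fmode dot_row cisD mulrA.
  rewrite e in h1 *.
  have [h3 _ ->] := csum_pair (f := fun l m => F (m, l) * fmode m s%:M * fmode l y) h1.
  apply: eq_csum => l; rewrite csumZr //.
  have := h3 l; move/nsm_le; apply => m; by rewrite nm_ge0 /= [leRHS]nmM nm_ex mulr1.
rewrite /=; have -> : (fun s : R => torus_integral (fun y : 'rV_d => re_part (fser c) (row_mx (s%:M : 'cV_1) y))) =
  (fun s : R => (2 * pi) ^+ d * complex.Re (fser (fun m => F (m, 0)) s%:M)).
  apply/funext => s; have -> : (fun y : 'rV_d => re_part (fser c) (row_mx (s%:M : 'cV_1) y)) = re_part (fser (cs s)).
    by apply/funext => y; rewrite /re_part fs.
  by rewrite IH.
rewrite circle_integral // exprSr -!mulrA; congr (_ * (_ * (_ * complex.Re (c _)))).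
by rewrite /= row_mx0.
Qed.

Lemma torus_cintegral_fser d (c : 'rV[int]_d -> C) : rapid c ->
  torus_cintegral (fser c) = ((2 * pi) ^+ d)%:C * c 0.
Proof.
move=> rc; have ri := rapidZ (- 'i) rc.
have e : im_part (fser c) = re_part (fser (fun k => - 'i * c k)).
  apply/funext => x; rewrite /im_part /re_part; have -> : fser (fun k => - 'i * c k) x = - 'i * fser c x.
    rewrite /fser -csumZ; last by apply: fser_sm; exact: csm_rapid.
    by apply: eq_csum => k; rewrite mulrA.
  by rewrite -complexiE; case: (fser c x) => a b /=; ring.
rewrite /torus_cintegral e !torus_integral_fser // -complexiE; case: (c 0) => a b /=.
by apply/eqP; rewrite eq_complex /=; apply/andP; split; apply/eqP; ring.
Qed.

End TorusIntegral.

Section Distributions.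
Variables (R : realType) (d : nat).
Local Notation C := R[i].
Local Notation Z := 'rV[int]_d.
Implicit Types (k l : Z) (c v a : Z -> C) (u : functional R d).

Definition dl k : Z -> C := fun l => if l == k then 1 else 0.

Lemma rapid_dl k : rapid (dl k).
Proof.
move=> r; exists (pr R k ^ r)^-1 => l; rewrite /dl; case: eqVneq => [->|_].
  by rewrite nm1 mulVf // gt_eqF // prz_gt0.
by rewrite nm0 mulr_ge0 ?invr_ge0 ?prz_ge0.
Qed.

Lemma fser_dl k : fser (dl k) = @fmode R d k.
Proof.
apply/funext => x; rewrite /fser; have [|_ ->] := @csum_delta R Z (fun l => dl k l * fmode l x) k.
  by move=> l /negbTE h; rewrite /dl h mul0r.
by rewrite /dl eqxx mul1r.
Qed.

Lemma fserD c v x : rapid c -> rapid v -> fser (fun k => c k + v k) x = fser c x + fser v x.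
Proof.
move=> hc hv; rewrite /fser -csumD; try by apply: fser_sm; exact: csm_rapid.
by apply: eq_csum => k; rewrite mulrDl.
Qed.

Lemma fserZ (t : C) c x : rapid c -> fser (fun k => t * c k) x = t * fser c x.
Proof.
move=> hc; rewrite /fser -csumZ; last by apply: fser_sm; exact: csm_rapid.
by apply: eq_csum => k; rewrite mulrA.
Qed.

Lemma Dmm_le (al : 'I_d -> nat) c k : nm (Dmm al c k) <= br R k ^+ mlen al * nm (c k).
Proof.
rewrite /Dmm nmM nm_prod ler_wpM2r ?nm_ge0 // /mlen expr_sum.
apply: ler_prod => j _; rewrite nm_ge0 /= nmX nm_int.
by rewrite lerXn2r ?nnegrE ?(ltW (br_gt0 R k)) // /br ler_nat leqW // absn_ge.
Qed.

(** Linearity treats the finite partial sums, and the seminorm estimate the tail of the series. *)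
Lemma dist_fser u : Defs.distribution u -> exists2 p, ord p (fun k => u (fmode k)) &
  forall c, rapid c -> u (fser c) = csum (fun k => c k * u (fmode k)).
Proof.
move=> [ulin [p [K hK]]].
have bd c : rapid c -> nm (u (fser c)) <= K * nsum (fun k => br R k ^+ p * nm (c k)).
  move=> rc; rewrite -lecR -nmE.
  have sb : nsm (fun k => br R k ^+ p * nm (c k)).
    by have := rapid_br p rc; congr nsm; apply/funext => k; rewrite mulrC.
  apply: hK; first exact: Cinfty_fser.
  move=> al x hal; rewrite nmE lecR Dmulti_fser //; apply: nm_csum_le => // k.
  rewrite nmM nm_ex mulr1; apply: le_trans (Dmm_le _ _ _) _.
  by rewrite ler_wpM2r ?nm_ge0 // ler_weXn2l // br_ge1.
have uE k : nm (u (fmode k)) <= `|K| * br R k ^+ p.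
  rewrite -fser_dl; apply: le_trans (bd _ (rapid_dl k)) _.
  have [|] := @nsum_fin R Z (fun l => br R l ^+ p) [:: k] isT.
    by move=> l; rewrite exprn_ge0 // ltW // br_gt0.
  rewrite big_seq1 => h1 h2.
  have -> : (fun l => br R l ^+ p * nm (dl k l)) = (fun l => if l \in [:: k] then br R l ^+ p else 0).
    by apply/funext => l; rewrite /dl inE; case: ifP; rewrite ?nm1 ?mulr1 // nm0 mulr0.
  by rewrite h2 ler_wpM2r ?ler_norm // exprn_ge0 // ltW // br_gt0.
have uord : ord p%:Z (fun k => u (fmode k)).
  exists `|K| => k; apply: le_trans (uE k) _; rewrite ler_wpM2l // -exprnP.
  by rewrite lerXn2r ?nnegrE ?(ltW (br_gt0 R k)) ?(ltW (pr_gt0 R k)) // br_le_pr.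
exists p%:Z => // c rc.
have u0 : u (fser (fun=> 0 : C)) = 0.
  have f0 : fser (fun _ : Z => 0 : C) = (fun=> 0).
    by apply/funext => x; rewrite /fser -[RHS](@csum0 R Z); apply: eq_csum => k; rewrite mul0r.
  have C0 := Cinfty_fser (@rapid0 R d).
  have := ulin 1 _ _ C0 C0; rewrite f0.
  have -> : (fun x : 'rV[R]_d => 1 * 0 + 0 : C) = (fun=> 0) by apply/funext => x; rewrite mulr0 addr0.
  by move=> /eqP; rewrite mul1r -subr_eq0 opprD addrA subrr sub0r oppr_eq0 => /eqP.
have usum (s : seq Z) : uniq s -> u (fser c) = \sum_(k <- s) c k * u (fmode k) +
    u (fser (fun k => if k \in s then 0 else c k)).
  elim: s => [|k s IH] /=.
    move=> _; rewrite big_nil add0r; congr u; congr fser.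
  move=> /andP[ks us]; rewrite IH // big_cons -[RHS]addrA [RHS]addrCA; congr (_ + _).
  have rr : rapid (fun l => if l \in k :: s then 0 else c l).
    move=> r; have [b b0 hb] := ordP (rc r); exists b => l; case: ifP => _ //.
    by rewrite nm0 mulr_ge0 // prz_ge0.
  rewrite -(ulin (c k)); last 2 first.
  - by rewrite -fser_dl; apply: Cinfty_fser; exact: rapid_dl.
  - exact: Cinfty_fser.
  congr u; apply/funext => x.
  have -> : c k * fmode k x = fser (fun l => c k * dl k l) x.
    by rewrite fserZ ?fser_dl //; exact: rapid_dl.
  rewrite -(fserD x (rapidZ (c k) (rapid_dl k)) rr).
  congr (fser _ x); apply/funext => l; rewrite inE /dl; case: eqVneq => [->|_] /=.
    by rewrite (negbTE ks) mulr1 addr0.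
  by rewrite mulr0 add0r.
have sb : nsm (fun k => br R k ^+ p * nm (c k)).
  by have := rapid_br p rc; congr nsm; apply/funext => k; rewrite mulrC.
have scu : csm (fun k => c k * u (fmode k)).
  apply: (csm_le (nsmZ (normr_ge0 K) sb)) => k; rewrite nmM mulrA mulrC.
  by rewrite ler_wpM2r ?nm_ge0.
apply/eqP; rewrite -subr_eq0; apply/eqP/nm_eq0/le_anti/andP; split; last exact: nm_ge0.
apply/ler_addgt0Pr => e e0; rewrite add0r.
have eK : 0 < e / (2 * (`|K| + 1)) by rewrite divr_gt0 // mulr_gt0 // ltr_wpDl.
have [s us hs] := nsum_tail sb eK.
have [st ->] := csum_split scu us; rewrite (usum s us) opprD addrACA subrr add0r.
set T := nsum _ in hs.
have rr : rapid (fun l => if l \in s then 0 else c l).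
  move=> r; have [b b0 hb] := ordP (rc r); exists b => l; case: ifP => _ //.
  by rewrite nm0 mulr_ge0 // prz_ge0.
have eT : (fun k => br R k ^+ p * nm (if k \in s then 0 else c k)) =
   (fun k => if k \in s then 0 else br R k ^+ p * nm (c k)).
  by apply/funext => k; case: ifP; rewrite ?nm0 ?mulr0.
have b1 := bd _ rr; rewrite eT -/T in b1.
have sT : nsm (fun k => if k \in s then 0 else br R k ^+ p * nm (c k)).
  apply: (nsm_le sb) => k; have [h0 _] := sb; by case: ifP => _; rewrite ?lexx ?h0.
have T0 : 0 <= T by apply: nsum_ge0.
have b2 : nm (csum (fun k => if k \in s then 0 else c k * u (fmode k))) <= `|K| * T.
  rewrite /T -nsumZ //; apply: nm_csum_le; first exact: nsmZ.
  move=> k; case: ifP => _; first by rewrite nm0 mulr0.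
  by rewrite nmM mulrA mulrC ler_wpM2r ?nm_ge0.
have b3 : K * T <= `|K| * T by rewrite ler_wpM2r // ler_norm.
apply: le_trans (ler_nmD _ _) _; rewrite nmN.
rewrite ler_pdivlMr in hs; last by rewrite mulr_gt0 // ltr_wpDl.
have := mulr_ge0 (normr_ge0 K) T0; move: b1 b2 b3 hs; rewrite mulrCA mulrDr mulr1 [T * _]mulrC; lra.
Qed.

(** The value of [cv c v] at 0 is the duality pairing without conjugation. Here [v k] is the value
    of [u] on the exponential of frequency [- k], so a function is represented by its coefficients
    times [(2 pi)^d] ([repr_dist_of]). *)
Definition represents u v := forall c, rapid c -> u (fser c) = cv c v 0.

Lemma distribution_repr u : Defs.distribution u -> exists2 v, (exists2 p : int, 0 <= p & ord p v) & represents u v.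
Proof.
move=> /dist_fser[p hp hu]; exists (fun k => u (fmode (- k))).
  exists (if 0 <= p then p else 0); first by case: ifP.
  have [b hb] := ord_mono (s := if 0 <= p then p else 0) (ltac:(by case: (lerP 0 p) => // /ltW)) hp.
  by exists b => k; rewrite -(prN R k).
move=> c rc; rewrite hu //; have ninj : injective (fun l : Z => - l) by exact: oppr_inj.
have hv : ord p (fun k => u (fmode (- k))) by have [b hb] := hp; exists b => k; rewrite -(prN R k).
have sm := cv_sm 0 rc hv.
have [|_ e] := csum_reindex ninj _ sm; first by move=> l _; exists (- l); rewrite opprK.
by rewrite /cv -e; apply: eq_csum => l; rewrite /= sub0r !opprK.
Qed.

Lemma repr_inj u v v' : represents u v -> represents u v' -> v = v'.
Proof.
move=> h h'; apply/funext => k; have := h _ (rapid_dl (- k)); rewrite h' ?rapid_dl //; last exact: rapid_dl.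
have key w : cv (dl (- k)) w 0 = w k.
  rewrite /cv; have [|_ ->] := @csum_delta R Z (fun l => dl (- k) (0 - l) * w l) k.
    by move=> l hl; rewrite /dl sub0r eqr_opp (negbTE hl) mul0r.
  by rewrite /dl sub0r eqxx mul1r.
by rewrite !key.
Qed.

(** The sign in [dist_D] cancels the one produced by the frequencies [0 - l] of the pairing. *)
Lemma repr_vf (X : vfield R d) (x : 'I_d -> Z -> C) u v p : (forall i : 'I_d, rapid (x i)) ->
  (forall i : 'I_d, (fun z => X z 0 i) = fser (x i)) -> ord p v -> represents u v -> represents (vf_dist X u) (vop x v).
Proof.
move=> rx hX hv hu c rc; rewrite /vf_dist.
have e (k : 'I_d) : dist_mul (fun z => X z 0 k) (dist_D k u) (fser c) = cv c (cv (x k) (Dm k v)) 0.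
  rewrite /dist_mul /dist_D.
  have -> : (fun z => X z 0 k * fser c z) = fser (cv (x k) c).
    apply/funext => z; rewrite -[X z 0 k]/((fun z => X z 0 k) z) hX fser_cv //; try exact: csm_rapid.
    by move=> l; apply: cv_sm (rc 0).
  have rcv : rapid (cv (x k) c) by apply: rapid_cv.
  have oD := ord_Dm k hv.
  rewrite D_fser // hu ?rapid_Dm //; last exact: rapid_Dm.
  rewrite (cvA rc (rx k) oD) (cvC rc (rx k)) /cv -csumN; last exact: cv_sm (rapid_Dm k rcv) hv.
  by apply: eq_csum => l; rewrite /Dm !mxE sub0r; rewrite rmorphN /=; ring.
rewrite (eq_bigr _ (fun i _ => e i)) /vop.
have oo (k : 'I_d) : ord (p + 1) (cv (x k) (Dm k v)) by apply: ord_cv => //; exact: ord_Dm.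
by rewrite (@cv_sumr R d _ (index_enum 'I_d) xpredT c (fun i => cv (x i) (Dm i v)) (p + 1) rc (fun i _ => oo i)).
Qed.

Lemma repr_dist_of a : rapid a -> represents (dist_of (fser a)) (fun k => ((2 * pi) ^+ d)%:C * a k).
Proof.
move=> ra c rc; rewrite /dist_of.
have -> : (fun x => fser a x * fser c x) = fser (cv c a).
  apply/funext => x; rewrite fser_cv 1?mulrC //; try exact: csm_rapid.
  by move=> l; apply: cv_sm (ra 0).
rewrite torus_cintegral_fser; last exact: rapid_cv.
by rewrite (cvZr _ rc (ra 0)).
Qed.

End Distributions.

(** * Uniform division of dominated germs *)

Section Neumann.
Variables (R : realType) (J : eqType).
Local Notation C := R[i].
Implicit Types (g h : J -> C).
Variables (A : J -> J -> C) (W : J -> R).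
Hypothesis W_gt0 : forall e, 0 < W e.
Hypothesis A_sm : forall e, nsm (fun k => nm (A e k) * W k).
Hypothesis A_le : forall e, nsum (fun k => nm (A e k) * W k) <= W e / 2.

Definition wnorm g := nsum (fun k => nm (g k) * W k).
Definition wfin g := nsm (fun k => nm (g k) * W k).
Definition opA g : J -> C := fun k => csum (fun e => g e * A e k).

Lemma A_entry e k : nm (A e k) <= W e / (2 * W k).
Proof.
have := nsum_ge k (A_sm e); rewrite /= => h.
rewrite ler_pdivlMr ?mulr_gt0 // mulrCA mulrC -ler_pdivlMr //.
exact: le_trans h (A_le e).
Qed.

Lemma opA_sm g k : wfin g -> csm (fun e => g e * A e k).
Proof.
move=> hg; have c0 : 0 <= (2 * W k)^-1 by rewrite invr_ge0 mulr_ge0 // ltW.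
apply: (csm_le (nsmZ c0 hg)) => e; rewrite nmM mulrCA ler_wpM2l ?nm_ge0 // mulrC.
exact: A_entry.
Qed.

Lemma opA_fin g : wfin g -> wfin (opA g) /\ wnorm (opA g) <= wnorm g / 2.
Proof.
move=> hg; have W0 e : 0 <= W e by exact: ltW.
pose f e k := nm (g e) * (nm (A e k) * W k).
have f1 e : nsm (f e) by apply: nsmZ; rewrite ?nm_ge0.
have fE e : nsum (f e) = nm (g e) * nsum (fun k => nm (A e k) * W k).
  by rewrite /f nsumZ ?nm_ge0.
have h2 : (0 : R) <= 2^-1 by rewrite invr_ge0.
have fl e : nsum (f e) <= 2^-1 * (nm (g e) * W e).
  rewrite fE mulrC; apply: le_trans (ler_wpM2r (nm_ge0 (g e)) (A_le e)) _.
  by rewrite le_eqVlt; apply/orP; left; apply/eqP; ring.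
have f2 : nsm (fun e => nsum (f e)).
  apply: (nsm_le (nsmZ h2 hg)) => e; by rewrite fl andbT nsum_ge0.
have [s1 s2] := nsm_pair f1 f2.
have [s3 s4] := nsm_swap s1.
have [s5 s6] := nsm_pairI (f := fun k e => f e k) s3.
have [_ s7] := nsm_pair (f := fun k e => f e k) s5 s6.
have b k : nm (opA g k) * W k <= nsum (fun e => f e k).
  have := nm_csum (opA_sm k hg) => /(ler_wpM2r (W0 k)) h; apply: le_trans h _.
  rewrite mulrC -nsumZ //; last exact: opA_sm.
  by rewrite le_eqVlt; apply/orP; left; apply/eqP; apply: eq_nsum => e; rewrite nmM /f; ring.
split.
  by apply: (nsm_le s6) => k; rewrite b mulr_ge0 ?nm_ge0.
apply: le_trans (le_nsum s6 b) _; rewrite -s7 s4 s2 /wnorm mulrC -nsumZ //.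
apply: le_nsum; first exact: nsmZ.
exact: fl.
Qed.

(** Fubini for the evaluation of [opA g] against [chi]; later [chi] is the family of monomials at a
    point, and each row of [A] can be evaluated explicitly. *)
Lemma opA_pair g (chi : J -> C) : wfin g -> (forall k, nm (chi k) <= W k) ->
  [/\ csm (fun k => opA g k * chi k), csm (fun e => g e * csum (fun k => A e k * chi k)) &
   csum (fun k => opA g k * chi k) = csum (fun e => g e * csum (fun k => A e k * chi k))].
Proof.
move=> hg hchi; have W0 e : 0 <= W e by exact: ltW.
have sAc e : csm (fun k => A e k * chi k).
  by apply: (csm_le (A_sm e)) => k; rewrite nmM ler_wpM2l ?nm_ge0.
pose f e k := nm (g e) * (nm (A e k) * W k).
have f1 e : nsm (f e) by apply: nsmZ; rewrite ?nm_ge0.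
have h2 : (0 : R) <= 2^-1 by rewrite invr_ge0.
have f2 : nsm (fun e => nsum (f e)).
  apply: (nsm_le (nsmZ h2 hg)) => e; rewrite nsum_ge0 //= nsumZ ?nm_ge0 // mulrC.
  apply: le_trans (ler_wpM2r (nm_ge0 (g e)) (A_le e)) _.
  by rewrite le_eqVlt; apply/orP; left; apply/eqP; ring.
have sp : csm (fun p : J * J => (fun e k => g e * A e k * chi k) p.1 p.2).
  apply: (csm_pair (f := fun e k => g e * A e k * chi k) f1 f2) => e k.
  by rewrite !nmM -mulrA ler_wpM2l ?nm_ge0 // ler_wpM2l ?nm_ge0.
have [sp' exch] := csum_swap (f := fun e k => g e * A e k * chi k) sp.
have [_ s1 e1] := csum_pair (f := fun e k => g e * A e k * chi k) sp.
have [_ s2 e2] := csum_pair (f := fun k e => g e * A e k * chi k) sp'.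
have i1 e : csum (fun k => g e * A e k * chi k) = g e * csum (fun k => A e k * chi k).
  by rewrite -csumZ //; apply: eq_csum => k; rewrite mulrA.
have i2 k : csum (fun e => g e * A e k * chi k) = opA g k * chi k.
  by rewrite /opA csumZr //; exact: opA_sm.
have E1 : (fun e => csum (fun k => g e * A e k * chi k)) = (fun e => g e * csum (fun k => A e k * chi k)).
  by apply/funext.
have E2 : (fun k => csum (fun e => g e * A e k * chi k)) = (fun k => opA g k * chi k).
  by apply/funext.
rewrite -E1 -E2; by split.
Qed.

(** The sum of the iterates of [opA], a contraction of factor 1/2 in the weighted norm. *)
Lemma neumann g : wfin g -> exists h, [/\ wfin h, wnorm h <= 2 * wnorm g &
  forall k, h k = g k + opA h k].
Proof.
move=> hg; have W0 e : 0 <= W e by exact: ltW.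
pose G n := iter n opA g.
have N0 : 0 <= wnorm g by apply: nsum_ge0.
have hG n : wfin (G n) /\ wnorm (G n) <= wnorm g * 2^-1 ^+ n.
  elim: n => [|n [IH1 IH2]]; first by rewrite expr0 mulr1.
  have [h1 h2] := opA_fin IH1; split=> //; apply: le_trans h2 _.
  by rewrite exprSr mulrA ler_wpM2r // invr_ge0.
have half : (0 <= (2^-1 : R)) && ((2^-1 : R) < 1) by apply/andP; split; lra.
have [gm ge] : nsm (fun n : nat => wnorm g * 2^-1 ^+ n) /\ nsum (fun n : nat => wnorm g * 2^-1 ^+ n) <= 2 * wnorm g.
  have s := nsm_geom half; split; first exact: nsmZ.
  rewrite nsumZ // mulrC ler_wpM2r //; apply: nsum_le => t ut.
  have : \sum_(n <- t) 2^-1 ^+ n <= 2 :> R.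
    pose m := (\max_(n <- t) n).+1.
    apply: (@le_trans _ _ (\sum_(n <- iota 0 m) 2^-1 ^+ n)).
      apply: sub_sum_le => // n hn.
      by rewrite mem_iota /= add0n ltnS (big_rem n hn) /= leq_maxl.
    rewrite -[iota 0 m]/(index_iota 0 m) big_mkord.
    have := subrX1 (2^-1 : R) m; move: (\sum_(_ < m) _) => x hx.
    have : 0 <= (2^-1 : R) ^+ m by rewrite exprn_ge0 // invr_ge0.
    move: hx; move: ((2^-1 : R) ^+ m) => y; have -> : (2^-1 : R) - 1 = - 2^-1 by field.
    lra.
  by [].
have nf : nsm (fun n => nsum (fun k => nm (G n k) * W k)).
  by apply: (nsm_le gm) => n; have [h1 h2] := hG n; rewrite h2 nsum_ge0.
have [s1 s2] := nsm_pair (f := fun n k => nm (G n k) * W k) (fun n => (hG n).1) nf.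
have [s3 s4] := nsm_swap s1.
have [s5 s6] := nsm_pairI (f := fun k n => nm (G n k) * W k) s3.
have [_ s7] := nsm_pair (f := fun k n => nm (G n k) * W k) s5 s6.
have sG k : csm (fun n => G n k).
  have i0 : 0 <= (W k)^-1 by rewrite invr_ge0.
  by have := nsmZ i0 (s5 k); congr nsm; apply/funext => n; rewrite mulrC mulfK // gt_eqF.
pose h k := csum (fun n => G n k).
have hb k : nm (h k) * W k <= nsum (fun n => nm (G n k) * W k).
  apply: le_trans (ler_wpM2r (W0 k) (nm_csum (sG k))) _.
  by rewrite mulrC -(nsumZ (W0 k) (sG k)) le_eqVlt; apply/orP; left; apply/eqP; apply: eq_nsum => n; rewrite mulrC.
have hf : wfin h by apply: (nsm_le s6) => k; rewrite hb mulr_ge0 ?nm_ge0.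
exists h; split=> //.
  apply: le_trans (le_nsum s6 hb) _; rewrite -s7 s4 s2; apply: le_trans ge; apply: le_nsum gm _ => n.
  by have [] := hG n.
move=> k.
have us : uniq [:: 0%N] by [].
have [t1 t2] := csum_split (sG k) us.
rewrite {1}/h t2 big_seq1; congr (_ + _).
have sinj : injective S by move=> x y [].
have [|t3 <-] := csum_reindex sinj _ t1.
  by move=> [|n]; rewrite /= ?eqxx // => _; exists n.
have e1 : csum ((fun x : nat => if x \in [:: 0%N] then 0 else G x k) \o S) =
    csum (fun n => csum (fun e => G n e * A e k)).
  by apply: eq_csum => n.
rewrite e1.
have sp : csm (fun p : nat * J => (fun n e => G n e * A e k) p.1 p.2).
  have c0 : 0 <= (2 * W k)^-1 by rewrite invr_ge0 mulr_ge0.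
  apply: (csm_le (nsmZ c0 s1)) => -[n e] /=; rewrite nmM mulrCA ler_wpM2l ?nm_ge0 // mulrC.
  exact: A_entry.
have [_ ->] := csum_swap (f := fun n e => G n e * A e k) sp.
by apply: eq_csum => e; rewrite /h csumZr.
Qed.

End Neumann.

(** * Exponents: lexicographic minima, Dickson's lemma, weights *)

Section Exponents.
Variable D : nat.
Local Notation J := {ffun 'I_D -> nat}.
Implicit Types (e f k : J).

Lemma lex_min (P : J -> Prop) : (exists e, P e) -> exists e, P e /\
  forall k, P k -> k <> e -> exists j : 'I_D, (forall i : 'I_D, (i < j)%N -> k i = e i) /\ (e j < k j)%N.
Proof.
move=> [e0 P0].
have main m : (m <= D)%N -> exists e, P e /\ forall k, P k ->
   (forall i : 'I_D, (i < m)%N -> k i = e i) \/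
   exists j : 'I_D, (forall i : 'I_D, (i < j)%N -> k i = e i) /\ (e j < k j)%N.
  elim: m => [|m IH] hm; first by exists e0; split=> // k _; left.
  have [e [Pe he]] := IH (ltnW hm).
  pose j0 := Ordinal hm.
  pose Q n := `[< exists k, [/\ P k, forall i : 'I_D, (i < m)%N -> k i = e i & k j0 = n] >].
  have exQ : exists n, Q n by exists (e j0); apply/asboolP; exists e.
  have [_/asboolP[e' [Pe' he' <-]] hmin] := ex_minnP exQ.
  exists e'; split=> // k Pk; case: (he k Pk) => [hk|[j [hj1 hj2]]].
    have : Q (k j0) by apply/asboolP; exists k.
    move=> /hmin; rewrite leq_eqVlt => /orP[/eqP ek|lk].
      left=> i; rewrite ltnS leq_eqVlt => /orP[/eqP im|im]; last by rewrite hk // he'.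
      by have -> : i = j0 by apply/val_inj.
    by right; exists j0; split=> // i im; rewrite hk // he'.
  case: (ltnP j m) => jm.
    right; exists j; split; last by rewrite he'.
    by move=> i ij; rewrite hj1 // he' // (ltn_trans ij).
  have hk (i : 'I_D) : (i < m)%N -> k i = e i by move=> im; apply: hj1; apply: leq_trans jm.
  have : Q (k j0) by apply/asboolP; exists k.
  move=> /hmin; rewrite leq_eqVlt => /orP[/eqP ek|lk].
    left=> i; rewrite ltnS leq_eqVlt => /orP[/eqP im|im]; last by rewrite hk // he'.
    by have -> : i = j0 by apply/val_inj.
  by right; exists j0; split=> // i im; rewrite hk // he'.
have [e [Pe he]] := main D (leqnn D).
exists e; split=> // k Pk ne; case: (he k Pk) => // h.
by case: ne; apply/ffunP => i; apply: h.
Qed.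

(** Induction on the number [m] of compared entries. Let [B] be the largest entry in position [m]
    within the family obtained for [m]: that family serves all exponents whose entry is at least
    [B], and each of the finitely many smaller values gets its own family. *)
Lemma dickson (P : J -> Prop) : exists F : seq J, (forall f, f \in F -> P f) /\
  forall e, P e -> exists2 f, f \in F & forall j, (f j <= e j)%N.
Proof.
have main m (Q : J -> Prop) : exists F : seq J, (forall f, f \in F -> Q f) /\
    forall e, Q e -> exists2 f, f \in F & forall j : 'I_D, (j < m)%N -> (f j <= e j)%N.
  elim: m Q => [|m IH] Q.
    case: (pselect (exists e, Q e)) => [[e0 Q0]|nQ]; last first.
      by exists [::]; split=> // e Qe; case: nQ; exists e.
    by exists [:: e0]; split=> [f|e _]; [rewrite inE => /eqP -> | exists e0; rewrite ?inE].
  case: (ltnP m D) => hm; last first.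
    have [F [h1 h2]] := IH Q; exists F; split=> // e /h2[f hf h]; exists f => // j _.
    by apply: h; apply: leq_trans (ltn_ord j) hm.
  pose j0 := Ordinal hm.
  have [F0 [h1 h2]] := IH Q.
  pose B := \max_(f <- F0) f j0.
  have /choice[Fc hFc] c : exists Fc : seq J, (forall f, f \in Fc -> Q f /\ f j0 = c) /\
     forall e, Q e -> e j0 = c -> exists2 f, f \in Fc & forall j : 'I_D, (j < m)%N -> (f j <= e j)%N.
    by have [F [g1 g2]] := IH (fun e => Q e /\ e j0 = c); exists F; split=> // e Qe ec; apply: g2.
  exists (F0 ++ flatten [seq Fc c | c <- iota 0 B]); split.
    move=> f; rewrite mem_cat => /orP[/h1 //|/flatten_mapP[c _ /(hFc c).1[]]] //.
  move=> e Qe; have [f hf hfe] := h2 e Qe.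
  case: (leqP B (e j0)) => hB.
    exists f; first by rewrite mem_cat hf.
    move=> j; rewrite ltnS leq_eqVlt => /orP[/eqP jm|/hfe //].
    have -> : j = j0 by apply/val_inj.
    by apply: leq_trans hB; rewrite /B (big_rem f hf) /= leq_maxl.
  have [f' hf' hfe'] := (hFc (e j0)).2 e Qe erefl.
  exists f'; first by rewrite mem_cat; apply/orP; right; apply/flatten_mapP; exists (e j0); rewrite ?mem_iota.
  move=> j; rewrite ltnS leq_eqVlt => /orP[/eqP jm|/hfe' //].
  have -> : j = j0 by apply/val_inj.
  by have [_ ->] := (hFc (e j0)).1 f' hf'.
have [F [h1 h2]] := main D P; exists F; split=> // e /h2[f hf h]; exists f => // j; exact: h.
Qed.

Definition sz e : nat := (\sum_j e j)%N.
(** A linear form with rapidly decreasing coefficients: when [T] is large compared with [f], it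
    places [f] before every lexicographically larger exponent. *)
Definition lw (T : nat) e : nat := (\sum_(j < D) T ^ (D.-1 - j) * e j)%N.
Definition eadd e f : J := [ffun j => e j + f j]%N.
Definition esub e f : J := [ffun j => e j - f j]%N.

Lemma lwD T e f : lw T (eadd e f) = (lw T e + lw T f)%N.
Proof. by rewrite /lw -big_split; apply: eq_bigr => j _; rewrite ffunE mulnDr. Qed.

Lemma eaddK f : injective (eadd^~ f).
Proof. by move=> e e' /ffunP h; apply/ffunP => j; have := h j; rewrite !ffunE => /addIn. Qed.

Lemma esubK e f : (forall j, f j <= e j)%N -> eadd f (esub e f) = e.
Proof. by move=> h; apply/ffunP => j; rewrite !ffunE subnKC. Qed.

Lemma sz_le_lw T e : (0 < T)%N -> (sz e <= lw T e)%N.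
Proof. by move=> T0; apply: leq_sum => j _; rewrite leq_pmull // expn_gt0 T0. Qed.

Lemma lw_le_sz T e : (0 < T)%N -> (lw T e <= T ^ D * sz e)%N.
Proof.
move=> T0; rewrite /lw /sz big_distrr /=; apply: leq_sum => j _.
by rewrite leq_mul2r leq_pexp2l ?orbT //; have := ltn_ord j; lia.
Qed.

(** Before [j] the exponents agree, and the gain at [j] outweighs all that [f] has after [j], which
    is at most [sz f / T] times the weight of position [j]. The second conclusion bounds the size of
    [k] by the gap, so that a power of the gap controls a geometric tail. *)
Lemma lw_lex T f k (j : 'I_D) : (2 * sz f + 2 <= T)%N -> (forall i : 'I_D, (i < j)%N -> k i = f i) ->
  (f j < k j)%N -> (lw T f < lw T k)%N /\ (sz k + 2 * lw T f <= sz f + 2 * lw T k)%N.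
Proof.
move=> hT hlo hj; have T0 : (0 < T)%N by lia.
pose m := (D.-1 - j)%N.
have key : (2 * lw T f + (k j - f j) + \sum_(i < D | (j < i)%N) k i <= 2 * lw T k)%N.
  rewrite /lw (bigID (fun i : 'I_D => (i < j)%N)) [in leqRHS](bigID (fun i : 'I_D => (i < j)%N)) /=.
  have -> : (\sum_(i < D | (i < j)%N) T ^ (D.-1 - i) * k i = \sum_(i < D | (i < j)%N) T ^ (D.-1 - i) * f i)%N.
    by apply: eq_bigr => i ij; rewrite hlo.
  have sp (F : 'I_D -> nat) : (\sum_(i < D | ~~ (i < j)%N) F i = F j + \sum_(i < D | (j < i)%N) F i)%N.
    rewrite (bigD1 j) ?ltnn //=; congr addn; apply: eq_bigl => i.
    by rewrite -leqNgt ltn_neqAle andbC eq_sym.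
  rewrite !sp -/m.
  have h1 : (\sum_(i < D | (j < i)%N) T ^ (D.-1 - i) * f i * T <= T ^ m * sz f)%N.
    rewrite /sz big_distrr /= [leqRHS](bigID (fun i : 'I_D => (j < i)%N)) /=; apply: leq_trans (leq_addr _ _).
    apply: leq_sum => i ji; rewrite mulnAC leq_mul2r -expnSr leq_pexp2l ?orbT // /m.
    by have := ltn_ord i; lia.
  rewrite -big_distrl /= in h1.
  have h2 : (\sum_(i < D | (j < i)%N) k i <= \sum_(i < D | (j < i)%N) T ^ (D.-1 - i) * k i)%N.
    by apply: leq_sum => i _; rewrite leq_pmull // expn_gt0 T0.
  have h3 : (T ^ m * f j + T ^ m * (k j - f j) = T ^ m * k j)%N by rewrite -mulnDr subnKC // ltnW.
  have h4 : (2 * \sum_(i < D | (j < i)%N) T ^ (D.-1 - i) * f i <= T ^ m)%N.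
    have Tm : (0 < T ^ m)%N by rewrite expn_gt0 T0.
    rewrite -(leq_pmul2r T0) -mulnA; move: h1; move: (_ * T)%N => x hx.
    apply: (@leq_trans (2 * (T ^ m * sz f))); first by rewrite leq_mul2l.
    by rewrite mulnCA leq_mul2l; apply/orP; right; lia.
  have Tm : (0 < T ^ m)%N by rewrite expn_gt0 T0.
  have h5 : (T ^ m + (k j - f j) <= 2 * (T ^ m * (k j - f j)))%N.
    have kj : (0 < k j - f j)%N by rewrite subn_gt0.
    by move: Tm kj; move: (T ^ m)%N (k j - f j)%N => t x; nia.
  move: h2 h3 h4 h5; move: (T ^ m * f j)%N (T ^ m * k j)%N (T ^ m * (k j - f j))%N.
  move: (\sum_(i < D | (i < j)%N) _)%N (\sum_(i < D | (j < i)%N) k i)%N.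
  move: (\sum_(i < D | (j < i)%N) _ * k i)%N (\sum_(i < D | (j < i)%N) _ * f i)%N => *.
  lia.
have kj : (0 < k j - f j)%N by rewrite subn_gt0.
split; first by move: key kj; move: (k j - f j)%N; move: (lw _ _) (lw _ _) (\sum_(_ < D | _) _)%N => *; lia.
have sk : (sz k <= sz f + (k j - f j) + \sum_(i < D | (j < i)%N) k i)%N.
  rewrite /sz (bigID (fun i : 'I_D => (i < j)%N)) [X in (_ <= X + _ + _)%N](bigID (fun i : 'I_D => (i < j)%N)) /=.
  have -> : (\sum_(i < D | (i < j)%N) k i = \sum_(i < D | (i < j)%N) f i)%N by apply: eq_bigr => i /hlo.
  have sp (F : 'I_D -> nat) : (\sum_(i < D | ~~ (i < j)%N) F i = F j + \sum_(i < D | (j < i)%N) F i)%N.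
    rewrite (bigD1 j) ?ltnn //=; congr addn; apply: eq_bigl => i.
    by rewrite -leqNgt ltn_neqAle andbC eq_sym.
  rewrite !sp; move: hj; move: (k j) (f j) => x y; move: (\sum_(_ < D | _) _)%N (\sum_(_ < D | _) _)%N (\sum_(_ < D | _) _)%N => *; lia.
by move: key sk; move: (lw _ _) (lw _ _) (\sum_(_ < D | _) _)%N (sz k) (sz f) (k j - f j)%N => *; lia.
Qed.

End Exponents.

Section Domination.
Variables (R : realType) (D : nat).
Local Notation C := R[i].
Local Notation J := {ffun 'I_D -> nat}.
Implicit Types (e f k : J) (g h : J -> C) (y : 'I_D -> C).

Definition mon y e : C := \prod_j y j ^+ e j.
Definition ev g y : C := csum (fun e => g e * mon y e).
Definition absconv (r : R) g : Prop := nsm (fun e => nm (g e) * r ^+ sz e).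

Variables (S : Type) (s : S -> 'I_D -> C) (a : S -> R).
Hypothesis a0 : forall x, 0 <= a x.

(** Here [r] and [b] depend on the germ; removing this dependence is the purpose of
    [domination_uniform]. *)
Definition dominated_germ g : Prop := exists r b, [/\ 0 < r, 0 <= b, absconv r g &
  forall x, (forall j, nm (s x j) <= r) -> nm (ev g (s x)) <= b * a x].

Lemma monD y e f : mon y (eadd e f) = mon y e * mon y f.
Proof. by rewrite /mon -big_split; apply: eq_bigr => j _; rewrite ffunE exprD. Qed.

Lemma nm_mon_le (y : 'I_D -> C) (r : R) e : (forall j, nm (y j) <= r) -> nm (mon y e) <= r ^+ sz e.
Proof.
move=> h; rewrite /mon nm_prod /sz expr_sum; apply: ler_prod => j _.
by rewrite nm_ge0 /= nmX lerXn2r ?nnegrE ?nm_ge0 ?(le_trans (nm_ge0 _) (h j)).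
Qed.

Lemma absconv_le (r r' : R) g : 0 <= r -> r <= r' -> absconv r' g -> absconv r g.
Proof.
move=> r0 rr hg; apply: (nsm_le hg) => e; rewrite mulr_ge0 ?nm_ge0 ?exprn_ge0 //=.
by rewrite ler_wpM2l ?nm_ge0 // lerXn2r ?nnegrE // (le_trans r0).
Qed.

Lemma seq_min (T : eqType) (t : seq T) (F : T -> R) (r0 : R) : 0 < r0 -> (forall x, x \in t -> 0 < F x) ->
  exists2 r, 0 < r & r <= r0 /\ forall x, x \in t -> r <= F x.
Proof.
move=> h0; elim: t => [|x t IH] h; first by exists r0.
have [|r rp [r1 r2]] := IH; first by move=> z hz; apply: h; rewrite inE hz orbT.
exists (Num.min r (F x)); first by rewrite lt_min rp h // mem_head.
split; first by rewrite ge_min r1.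
move=> z; rewrite inE => /orP[/eqP -> |/r2 hz]; first by rewrite ge_min lexx orbT.
by rewrite ge_min hz.
Qed.

Lemma seq_max (T : eqType) (t : seq T) (F : T -> R) : exists2 r, 0 <= r & forall x, x \in t -> F x <= r.
Proof.
elim: t => [|x t [r r0 h]]; first by exists 0.
exists (Num.max r (F x)); first by rewrite le_max r0.
move=> z; rewrite inE => /orP[/eqP -> |/h hz]; first by rewrite le_max lexx orbT.
by rewrite le_max hz.
Qed.

Definition is_lead g f : Prop := g f = 1 /\ forall k, g k != 0 -> k <> f ->
  exists j : 'I_D, (forall i : 'I_D, (i < j)%N -> k i = f i) /\ (f j < k j)%N.

Lemma exists_lead g : (exists e, g e != 0) -> dominated_germ g ->
  exists f g', [/\ g f != 0, is_lead g' f & dominated_germ g'].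
Proof.
move=> /lex_min[f [gf hf]] [r [b [r0 b0 hr hb]]].
exists f, (fun e => (g f)^-1 * g e); split=> //.
  split; first by rewrite mulVf.
  by move=> k; rewrite mulf_eq0 negb_or => /andP[_ h]; exact: hf.
exists r, (nm (g f)^-1 * b); split=> //; first by rewrite mulr_ge0 ?nm_ge0.
  have := nsmZ (nm_ge0 (g f)^-1) hr; congr nsm; apply/funext => e; by rewrite nmM mulrA.
move=> x hx; have -> : ev (fun e => (g f)^-1 * g e) (s x) = (g f)^-1 * ev g (s x).
  rewrite /ev -csumZ.
    by apply: eq_csum => e; rewrite mulrA.
  apply: (csm_le hr) => e; rewrite nmM ler_wpM2l ?nm_ge0 //; exact: nm_mon_le.
by rewrite nmM -mulrA ler_wpM2l ?nm_ge0 // hb.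
Qed.

Lemma quad_split (x : nat) : (0 < x)%N -> (4 * x = 1 + (2 * x - 1 + 2 * x))%N.
Proof. lia. Qed.

Lemma weight_gap (u v p q b : nat) : (u + 2 * p <= v + 2 * q)%N -> (v <= b)%N ->
  (u <= 2 * (q - p) + b)%N.
Proof. lia. Qed.

(* Division by a standard basis: the leading exponents of the dominated germs
   are generated by finitely many of them, and for suitable weights the
   division operator is a perturbation of the identity. *)
Theorem domination_uniform (rho : R) : 0 < rho -> exists2 sg, 0 < sg & exists2 c, 0 <= c &
  forall g, absconv rho g -> dominated_germ g -> forall x, (forall j, nm (s x j) <= sg) ->
  nm (ev g (s x)) <= c * nsum (fun e => nm (g e) * rho ^+ sz e) * a x.
Proof.
move=> rho0.
have [F [F1 F2]] := dickson (fun f => exists g, is_lead g f /\ dominated_germ g).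
have /choice[G hG] f : exists g, f \in F -> is_lead g f /\ dominated_germ g.
  case: (boolP (f \in F)) => [/F1[g hg]|_]; first by exists g.
  by exists (fun=> 0).
have /choice[rr hrr] f : exists rb : R * R, f \in F -> [/\ 0 < rb.1, 0 <= rb.2, absconv rb.1 (G f) &
    forall x, (forall j, nm (s x j) <= rb.1) -> nm (ev (G f) (s x)) <= rb.2 * a x].
  case: (boolP (f \in F)) => [/hG[_ [r [b h]]]|_]; first by exists (r, b).
  by exists (0, 0).
pose r1 := Num.min rho 1; have r10 : 0 < r1 by rewrite lt_min rho0 ltr01.
have [r rp [rr1 hr]] := @seq_min _ F (fun f => (rr f).1) r1 r10 (fun f hf => let: And4 h _ _ _ := hrr f hf in h).
have r_rho : r <= rho by apply: le_trans rr1 _; rewrite ge_min lexx.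
have r_1 : r <= 1 by apply: le_trans rr1 _; rewrite ge_min lexx orbT.
have Gconv f : f \in F -> absconv r (G f).
  move=> hf; have [_ _ h _] := hrr f hf; apply: absconv_le h; [exact: ltW | exact: hr].
pose B := (\max_(f <- F) sz f)%N; pose T := (2 * B + 2)%N.
have szB f : f \in F -> (sz f <= B)%N by move=> hf; rewrite /B (big_rem f hf) /= leq_maxl.
have T0 : (0 < T)%N by rewrite /T addn2.
have [M M0 hM] := seq_max F (fun f => nsum (fun e => nm (G f e) * r ^+ sz e)).
have rB : 0 < r ^+ B by rewrite exprn_gt0.
pose t := Num.min r (r ^+ B / (2 * (M + 1))).
have M1 : 0 < 2 * (M + 1) by rewrite mulr_gt0 // ltr_wpDl.
have t0 : 0 < t by rewrite lt_min rp divr_gt0.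
have tr : t <= r by rewrite ge_min lexx.
have t1 : t <= 1 := le_trans tr r_1.
have tM : t <= r ^+ B / (2 * (M + 1)) by rewrite ge_min lexx orbT.
(* A gap [x >= 1] in weight yields [t^(4 x)]: one factor [t] makes the tails of the generators
   small, and [t^(2 x)] provides the power of [r] needed to sum them. *)
pose sg := t ^+ 4; have sg0 : 0 < sg by rewrite exprn_gt0.
have sg_t : sg <= t by rewrite /sg exprS ler_piMr ?(ltW t0) // exprn_ile1 // ltW.
have sg1 : sg <= 1 := le_trans sg_t t1.
pose W e := sg ^+ lw T e.
have W0 e : 0 < W e by rewrite exprn_gt0.
have WD e f : W (eadd e f) = W e * W f by rewrite /W lwD exprD.
have sgexp (m n : nat) : (m <= n)%N -> sg ^+ n <= sg ^+ m.
  by move=> mn; apply: ler_wiXn2l => //; exact: ltW.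
have W_r e : W e <= r ^+ sz e.
  apply: le_trans (sgexp _ _ (sz_le_lw e T0)) _.
  by rewrite lerXn2r ?nnegrE ?(ltW sg0) ?(ltW rp) // (le_trans sg_t).
have W_rho e : W e <= rho ^+ sz e.
  by apply: le_trans (W_r e) _; rewrite lerXn2r ?nnegrE ?(ltW rho0) ?(ltW rp).
have tail f k : f \in F -> G f k != 0 -> k <> f -> W k <= W f * (t * (r ^+ sz k / r ^+ B)).
  move=> hf hk kf; have [[_ hl] _] := hG f hf; have [j [j1 j2]] := hl k hk kf.
  have hT : (2 * sz f + 2 <= T)%N by rewrite /T leq_add2r leq_mul2l szB.
  have [l1 l2] := lw_lex hT j1 j2.
  have -> : W k = W f * t ^+ (4 * (lw T k - lw T f)).
    by rewrite exprM -/sg /W -exprD subnKC // ltnW.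
  rewrite ler_pM2l //.
  rewrite quad_split ?subn_gt0 // exprD expr1 ler_pM2l //.
  apply: (@le_trans _ _ (t ^+ (2 * (lw T k - lw T f)))).
    by apply: ler_wiXn2l; [exact: ltW | | rewrite leq_addl].
  rewrite ler_pdivlMr //; apply: (@le_trans _ _ (r ^+ (2 * (lw T k - lw T f)) * r ^+ B)).
    by rewrite ler_wpM2r ?(ltW rB) // lerXn2r ?nnegrE ?(ltW t0) ?(ltW rp).
  rewrite -exprD; apply: ler_wiXn2l; [exact: ltW | by [] |].
  exact: weight_gap l2 (szB f hf).
have Gtail f : f \in F -> nsm (fun k => nm (if k == f then 0 else G f k) * W k) /\
    nsum (fun k => nm (if k == f then 0 else G f k) * W k) <= W f / 2.
  move=> hf; pose b k := W f * (t / r ^+ B) * (nm (G f k) * r ^+ sz k).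
  have w0 : 0 <= W f * (t / r ^+ B) by rewrite mulr_ge0 ?divr_ge0 ?(ltW t0) ?(ltW rB) // ltW.
  have sb : nsm b by apply: nsmZ => //; exact: Gconv.
  have le k : nm (if k == f then 0 else G f k) * W k <= b k.
    case: eqVneq => [_|/eqP kf].
      by rewrite nm0 mul0r; case: sb.
    case: (eqVneq (G f k) 0) => [h|h]; first by rewrite h nm0 mul0r; case: sb.
    apply: le_trans (ler_wpM2l (nm_ge0 _) (tail f k hf h kf)) _.
    by rewrite /b le_eqVlt; apply/orP; left; apply/eqP; ring.
  split.
    by apply: (nsm_le sb) => k; rewrite le andbT mulr_ge0 ?nm_ge0 // ltW.
  apply: le_trans (le_nsum sb le) _; rewrite nsumZ //; last exact: Gconv.
  rewrite -mulrA ler_pM2l //; apply: (@le_trans _ _ (t / r ^+ B * M)).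
    by rewrite ler_wpM2l ?divr_ge0 ?(ltW t0) ?(ltW rB) // hM.
  rewrite ler_pdivlMr // in tM; rewrite mulrAC ler_pdivrMr //.
  by move: tM; rewrite mulrDr mulr1 mulrDr => h; lra.
have /choice[ix hix] e : exists f, (exists2 f, f \in F & forall j, (f j <= e j)%N) -> f \in F /\ forall j, (f j <= e j)%N.
  case: (pselect (exists2 f, f \in F & forall j, (f j <= e j)%N)) => [[f h1 h2]|n]; first by exists f.
  by exists e.
pose inE e := `[< exists2 f, f \in F & forall j, (f j <= e j)%N >].
have inEP e : inE e -> ix e \in F /\ eadd (ix e) (esub e (ix e)) = e.
  by move=> /asboolP/hix[h1 h2]; split=> //; exact: esubK.
(* One division step: a monomial [e] in the ideal of leading exponents becomes minus the tail of its
   generator, shifted by [e - ix e]. The choice of [t] gives this map norm at most 1/2. *)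
pose A e k : C := if inE e then
    - (if [forall j, (esub e (ix e) j <= k j)%N] then
         let l := esub k (esub e (ix e)) in if l == ix e then 0 else G (ix e) l else 0) else 0.
have A_E e : inE e -> (fun k => A e k) \o (fun l => eadd l (esub e (ix e))) =
    (fun l => - (if l == ix e then 0 else G (ix e) l)).
  move=> he; apply/funext => l; rewrite /A /= he; congr (- _).
  have -> : [forall j, (esub e (ix e) j <= eadd l (esub e (ix e)) j)%N].
    by apply/forallP => j; rewrite [in leqRHS]ffunE leq_addl.
  have -> // : esub (eadd l (esub e (ix e))) (esub e (ix e)) = l.
  by apply/ffunP => j; rewrite [LHS]ffunE [X in (X - _)%N]ffunE addnK.
have A_supp e k : A e k != 0 -> exists l, eadd l (esub e (ix e)) = k.
  rewrite /A; case: ifP => _; last by rewrite eqxx.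
  case: forallP => [h _|_]; last by rewrite oppr0 eqxx.
  exists (esub k (esub e (ix e))); apply/ffunP => j.
  by rewrite [LHS]ffunE [X in (X + _)%N]ffunE subnK.
have A_ok e : nsm (fun k => nm (A e k) * W k) /\ nsum (fun k => nm (A e k) * W k) <= W e / 2.
  case he: (inE e); last first.
    have -> : (fun k => nm (A e k) * W k) = (fun=> 0).
      by apply/funext => k; rewrite /A he nm0 mul0r.
    rewrite nsum0; split; first exact: nsm0.
    by rewrite divr_ge0 // ltW.
  have [hF ee] := inEP e he; have [g1 g2] := Gtail _ hF.
  pose de := esub e (ix e).
  have comp : (fun k => nm (A e k) * W k) \o (fun l => eadd l de) =
     (fun l => W de * (nm (if l == ix e then 0 else G (ix e) l) * W l)).
    apply/funext => l; rewrite /= WD.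
    by have := congr1 (fun H => H l) (A_E e he); rewrite /= => ->; rewrite nmN; ring.
  have sc := nsmZ (ltW (W0 de)) g1.
  have sA : nsm (fun k => nm (A e k) * W k).
    split=> [k|]; first by rewrite mulr_ge0 ?nm_ge0 // ltW.
    exists (nsum (fun l => W de * (nm (if l == ix e then 0 else G (ix e) l) * W l))) => q uq.
    pose q' := [seq esub k de | k <- q & A e k != 0].
    have uq' : uniq q'.
      rewrite map_inj_in_uniq ?filter_uniq // => k k'; rewrite !mem_filter => /andP[/A_supp[l <-] _] /andP[/A_supp[l' <-] _].
      have ek (z : J) : esub (eadd z de) de = z.
        by apply/ffunP => j; rewrite [LHS]ffunE [X in (X - _)%N]ffunE addnK.
      by rewrite !ek => ->.
    apply: le_trans (nsum_ub sc uq'); rewrite big_map big_filter.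
    rewrite (bigID (fun k => A e k != 0)) /= [X in _ + X]big1 ?addr0; last first.
      by move=> k; rewrite negbK => /eqP ->; rewrite nm0 mul0r.
    apply: ler_sum => k /A_supp[l <-].
    have -> : esub (eadd l (esub e (ix e))) de = l.
      by apply/ffunP => j; rewrite [LHS]ffunE [X in (X - _)%N]ffunE addnK.
    by have := congr1 (fun H => H l) comp; rewrite /= => ->.
  split=> //.
  have [|_ <-] := nsum_reindex (@eaddK D de) _ sA.
    move=> k hk; apply: A_supp; by apply: contraNneq hk => ->; rewrite nm0 mul0r.
  rewrite comp nsumZ ?(ltW (W0 _)) //; apply: le_trans (ler_wpM2l (ltW (W0 _)) g2) _.
  by rewrite mulrA -WD -[in leRHS]ee /de le_eqVlt; apply/orP; left; apply/eqP; congr (W _ / _);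
    apply/ffunP => j; rewrite !ffunE addnC.
have [c2 c20 hc2] := seq_max F (fun f => (rr f).2 / W f).
(* Since [lw T e <= T^D sz e], the monomials at points of size [sig] are bounded by the weights
   [W]. *)
pose sig := sg ^+ (T ^ D).
have sig0 : 0 < sig by rewrite exprn_gt0.
have sigW e : sig ^+ sz e <= W e.
  by rewrite /sig -exprM; apply: sgexp; exact: lw_le_sz.
have sig_r : sig <= r.
  apply: le_trans (le_trans sg_t tr); rewrite -[leRHS]expr1; apply: sgexp.
  by rewrite expn_gt0 T0.
exists sig => //; exists (2 * c2); first by rewrite mulr_ge0.
move=> g gconv gdom x hx.
set N := nsum (fun e => nm (g e) * rho ^+ sz e).
have gW : wfin W g.
  by apply: (nsm_le gconv) => e; rewrite mulr_ge0 ?nm_ge0 ?(ltW (W0 e)) //= ler_wpM2l ?nm_ge0.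
have gN : wnorm W g <= N by apply: le_nsum => // e; rewrite ler_wpM2l ?nm_ge0.
have N0 : 0 <= N by apply: nsum_ge0.
(* [h] solves [g = h - opA h]: its part inside the ideal gives the quotients [qq], its part outside
   the remainder [r_]. *)
have [h [hfin hnorm heq]] := neumann W0 (fun e => (A_ok e).1) (fun e => (A_ok e).2) gW.
have hN : wnorm W h <= 2 * N by apply: le_trans hnorm _; rewrite ler_pM2l.
pose r_ e := if inE e then 0 else h e.
pose qq e : C := if inE e then h e else 0.
have key x' : (forall j, nm (s x' j) <= sig) ->
   csm (fun e => qq e * (mon (s x') (esub e (ix e)) * ev (G (ix e)) (s x'))) /\
   ev g (s x') = ev r_ (s x') + csum (fun e => qq e * (mon (s x') (esub e (ix e)) * ev (G (ix e)) (s x'))) /\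
   nm (csum (fun e => qq e * (mon (s x') (esub e (ix e)) * ev (G (ix e)) (s x')))) <= 2 * c2 * N * a x'.
  move=> hx'.
  have chiW k : nm (mon (s x') k) <= W k by apply: le_trans (nm_mon_le k hx') (sigW k).
  have [p1 p2 p3] := opA_pair W0 (fun e => (A_ok e).1) (fun e => (A_ok e).2) hfin chiW.
  have sh : csm (fun k => h k * mon (s x') k).
    by apply: (csm_le hfin) => k; rewrite nmM ler_wpM2l ?nm_ge0.
  have sr : csm (fun k => r_ k * mon (s x') k).
    apply: (csm_le hfin) => k; rewrite /r_; case: ifP => _.
      by rewrite mul0r nm0 mulr_ge0 ?nm_ge0 // ltW.
    by rewrite nmM ler_wpM2l ?nm_ge0.
  have evA e : csum (fun k => A e k * mon (s x') k) =
      if inE e then mon (s x') e - mon (s x') (esub e (ix e)) * ev (G (ix e)) (s x') else 0.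
    case he: (inE e); last first.
      by rewrite -[RHS](@csum0 R J); apply: eq_csum => k; rewrite /A he mul0r.
    have [hF ee] := inEP e he; pose de := esub e (ix e).
    have sA : csm (fun k => A e k * mon (s x') k).
      by apply: (csm_le (A_ok e).1) => k; rewrite nmM ler_wpM2l ?nm_ge0.
    have [|_ <-] := csum_reindex (@eaddK D de) _ sA.
      move=> k hk; apply: A_supp; by apply: contraNneq hk => ->; rewrite mul0r.
    have sG : csm (fun l => G (ix e) l * mon (s x') l).
      apply: (csm_le (Gconv _ hF)) => l; rewrite nmM ler_wpM2l ?nm_ge0 //.
      by apply: le_trans (nm_mon_le l hx') _; rewrite lerXn2r ?nnegrE ?(ltW sig0) ?(ltW rp).
    have [|d1 d2] := @csum_delta R J (fun l => if l == ix e then mon (s x') (ix e) else 0) (ix e).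
      by move=> l /negbTE ->.
    rewrite eqxx in d2.
    have -> : mon (s x') e = mon (s x') de * mon (s x') (ix e) by rewrite -monD -[in LHS]ee; congr mon;
      apply/ffunP => j; rewrite !ffunE addnC.
    rewrite -mulrBr -d2 -csumB // -csumZ; last exact: csmB.
    apply: eq_csum => l; have := congr1 (fun H => H l) (A_E e he); rewrite /= => ->.
    rewrite monD; case: eqVneq => [->|_]; last by ring.
    by have [[-> _] _] := hG _ hF; ring.
  pose qt e := qq e * (mon (s x') (esub e (ix e)) * ev (G (ix e)) (s x')).
  have a'0 := a0 x'.
  have qb e : nm (qt e) <= c2 * a x' * (nm (h e) * W e).
    rewrite /qt /qq; case he: (inE e); last first.
      by rewrite mul0r nm0 !mulr_ge0 ?nm_ge0 // ltW.
    have [hF ee] := inEP e he; have [q1 q2 _ q3] := hrr _ hF.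
    rewrite !nmM [leRHS]mulrCA; apply: ler_wpM2l; first exact: nm_ge0.
    have b1 : nm (ev (G (ix e)) (s x')) <= (rr (ix e)).2 * a x'.
      by apply: q3 => j; apply: le_trans (hx' j) (le_trans sig_r (hr _ hF)).
    apply: le_trans (ler_pM (nm_ge0 _) (nm_ge0 _) (chiW _) b1) _.
    have b2 := hc2 _ hF; rewrite ler_pdivrMr // in b2.
    have -> : W e = W (esub e (ix e)) * W (ix e) by rewrite -WD -[in LHS]ee; congr W;
      apply/ffunP => j; rewrite !ffunE addnC.
    have -> : c2 * a x' * (W (esub e (ix e)) * W (ix e)) = W (esub e (ix e)) * (c2 * W (ix e) * a x') by ring.
    by rewrite ler_wpM2l ?(ltW (W0 _)) // ler_wpM2r.
  have c2a : 0 <= c2 * a x' by rewrite mulr_ge0.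
  have sqt : csm qt by apply: (csm_le (nsmZ c2a hfin)).
  split; first exact: sqt.
  split; last first.
    apply: le_trans (nm_csum_le (nsmZ c2a hfin) qb) _; rewrite nsumZ // -/(wnorm W h).
    apply: le_trans (ler_wpM2l c2a hN) _.
    by rewrite le_eqVlt; apply/orP; left; apply/eqP; ring.
  have -> : ev g (s x') = csum (fun k => h k * mon (s x') k) - csum (fun k => opA A h k * mon (s x') k).
    rewrite -csumB //; apply: eq_csum => k; rewrite -mulrBl; congr (_ * _).
    by rewrite heq addrK.
  rewrite p3 -csumB // -[ev r_ (s x')]/(csum (fun k => r_ k * mon (s x') k)) -csumD //; apply: eq_csum => e.
  rewrite evA /r_ /qq; case: ifP => _; ring.
have rdom : dominated_germ r_.
  have [rg [bg [rg0 bg0 hgc hgb]]] := gdom.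
  exists (Num.min sig rg), (bg + 2 * c2 * N); split.
  - by rewrite lt_min sig0.
  - by rewrite addr_ge0 // !mulr_ge0.
  - apply: (nsm_le hfin) => e; have m0 : 0 <= Num.min sig rg by rewrite le_min (ltW sig0) ltW.
    rewrite mulr_ge0 ?nm_ge0 ?exprn_ge0 //=.
    apply: (@le_trans _ _ (nm (h e) * Num.min sig rg ^+ sz e)).
      rewrite ler_wpM2r ?exprn_ge0 // /r_; case: ifP; rewrite ?nm0 ?nm_ge0 ?lexx //.
    rewrite ler_wpM2l ?nm_ge0 //; apply: le_trans (sigW e).
    by rewrite lerXn2r ?nnegrE ?(ltW sig0) // ge_min lexx.
  move=> x' hx'; have [|_ [k2 k3]] := key x'.
    by move=> j; apply: le_trans (hx' j) _; rewrite ge_min lexx.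
  have -> : ev r_ (s x') = ev g (s x') - csum (fun e => qq e * (mon (s x') (esub e (ix e)) * ev (G (ix e)) (s x'))).
    by rewrite k2 addrK.
  apply: le_trans (ler_nmD _ _) _; rewrite nmN mulrDl lerD //.
  by apply: hgb => j; apply: le_trans (hx' j) _; rewrite ge_min lexx orbT.
(* The remainder is itself dominated. If it were nonzero, its leading exponent would be that of a
   dominated germ and would lie in the ideal, where [r_] vanishes. *)
have r_0 e : r_ e = 0.
  apply/eqP; apply: contraT => re; have [|f [g' [f1 f2 f3]]] := @exists_lead r_ _ rdom; first by exists e.
  move: f1; rewrite /r_; case: ifP => [|/negP []]; first by rewrite eqxx.
  by apply/asboolP; apply: F2; exists g'.
have [_ [-> hb]] := key x hx.
have -> : ev r_ (s x) = 0.
  by rewrite /ev -[RHS](@csum0 R J); apply: eq_csum => e; rewrite r_0 mul0r.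
by rewrite add0r.
Qed.

End Domination.

(** * Expansion of Fourier series in local coordinates *)

Section BinomialExpansion.
Variable D : nat.

Lemma binomial_box (K : comNzRingType) (n : 'I_D -> nat) (y : 'I_D -> K) (M : nat) :
  (forall i, (n i < M)%N) ->
  \sum_(g : {ffun 'I_D -> 'I_M}) \prod_i ('C(n i, g i)%:R * y i ^+ g i) = \prod_i (1 + y i) ^+ n i.
Proof.
move=> hn; rewrite -(bigA_distr_bigA (fun i (m : 'I_M) => 'C(n i, m)%:R * y i ^+ m)) /=; apply: eq_bigr => i _.
rewrite addrC exprDn -(big_mkord xpredT (fun m => 'C(n i, m)%:R * y i ^+ m)).
rewrite (big_cat_nat _ (hn i)) //= [X in _ + X]big_nat_cond [X in _ + X]big1 ?addr0; last first.
  by move=> m /andP[/andP[h _] _]; rewrite bin_small // mul0r.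
rewrite big_mkord [RHS](reindex_inj rev_ord_inj) /=; apply: eq_bigr => m _.
rewrite subSS subKn; last by rewrite -ltnS.
by rewrite expr1n mulr1 bin_sub ?mulr_natl // -ltnS.
Qed.

Variable R : realType.
Local Notation C := R[i].
Local Notation J := {ffun 'I_D -> nat}.

Definition binc (n : 'I_D -> nat) (e : J) : C := \prod_i 'C(n i, e i)%:R.

Definition box (M : nat) : seq J := [seq [ffun i => g i : nat] | g : {ffun 'I_D -> 'I_M}].

Lemma box_uniq M : uniq (box M).
Proof.
rewrite map_inj_uniq ?enum_uniq // => g g' /ffunP h; apply/ffunP => i.
by apply/val_inj; have := h i; rewrite !ffunE.
Qed.

Lemma binc_box n M e : (forall i, (n i < M)%N) -> e \notin box M -> binc n e = 0.
Proof.
move=> hn he; have [i hi] : exists i, (n i < e i)%N.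
  apply/existsP; apply: contraNT he; rewrite negb_exists => /forallP h.
  have h' i : (e i < M)%N by have := h i; rewrite -leqNgt => /leq_ltn_trans; apply.
  apply/mapP; exists [ffun i => Ordinal (h' i)]; first by rewrite mem_enum.
  by apply/ffunP => i; rewrite !ffunE.
by rewrite /binc (bigD1 i) //= bin_small // mul0r.
Qed.

Lemma binc_sum n y : csm (fun e => binc n e * mon y e) /\ ev (binc n) y = \prod_i (1 + y i) ^+ n i.
Proof.
pose M := (\max_i n i).+1; have hn i : (n i < M)%N by rewrite ltnS leq_bigmax.
have [h1 h2] := csum_fin (fun e => binc n e * mon y e) (box_uniq M).
have e : (fun e => binc n e * mon y e) = (fun e => if e \in box M then binc n e * mon y e else 0).
  by apply/funext => f; case: ifP => // /negbT /(binc_box hn) ->; rewrite mul0r.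
rewrite /ev e h2 big_map big_enum /= -(binomial_box y hn); split=> //.
apply: eq_bigr => g _; rewrite /binc /mon -big_split /=; apply: eq_bigr => i _.
by rewrite !ffunE.
Qed.

Lemma binc_norm n (r : R) : 0 <= r -> nsm (fun e => nm (binc n e) * r ^+ sz e) /\
  nsum (fun e => nm (binc n e) * r ^+ sz e) = \prod_i (1 + r) ^+ n i.
Proof.
move=> r0; pose M := (\max_i n i).+1; have hn i : (n i < M)%N by rewrite ltnS leq_bigmax.
have p0 e : 0 <= nm (binc n e) * r ^+ sz e by rewrite mulr_ge0 ?nm_ge0 ?exprn_ge0.
have [h1 h2] := nsum_fin (box_uniq M) p0.
have e : (fun e => nm (binc n e) * r ^+ sz e) =
  (fun e => if e \in box M then nm (binc n e) * r ^+ sz e else 0).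
  by apply/funext => f; case: ifP => // /negbT /(binc_box hn) ->; rewrite nm0 mul0r.
rewrite e h2 big_map big_enum /= -(binomial_box (fun=> r) hn); split=> //.
apply: eq_bigr => g _; rewrite /binc nm_prod /sz expr_sum -big_split /=; apply: eq_bigr => i _.
by rewrite !ffunE -(rmorph_nat (real_complex R)) nm_real normr_nat.
Qed.

End BinomialExpansion.

Section LocalExpansion.
Variables (R : realType) (d : nat).
Local Notation C := R[i].
Local Notation Z := 'rV[int]_d.
Local Notation J := {ffun 'I_(d + d) -> nat}.
Implicit Types (k l : Z) (x y : 'rV[R]_d) (c : Z -> C).

Definition pos_part (m : int) : nat := if 0 <= m then `|m|%N else 0%N.
Definition neg_part (m : int) : nat := if 0 <= m then 0%N else `|m|%N.

Definition nexp k : 'I_(d + d) -> nat := fun i =>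
  match fintype.split i with inl j => pos_part (k 0 j) | inr j => neg_part (k 0 j) end.

(* Near the origin the torus is embedded in C^(2d) by the coordinates
   cis(x_j) - 1 and cis(- x_j) - 1, in which every exponential is a polynomial. *)
Definition loc x : 'I_(d + d) -> C := fun i =>
  match fintype.split i with inl j => cis (x 0 j) - 1 | inr j => cis (- x 0 j) - 1 end.

Lemma split_l (j : 'I_d) : fintype.split (lshift d j) = inl j.
Proof. exact: (unsplitK (inl j)). Qed.
Lemma split_r (j : 'I_d) : fintype.split (rshift d j) = inr j.
Proof. exact: (unsplitK (inr j)). Qed.

Lemma ex_loc k x : \prod_i (1 + loc x i) ^+ nexp k i = fmode k x.
Proof.
rewrite big_split_ord /= -big_split /= /fmode /dot (big_morph (@cis R) (@cisD R) (cis0 R)).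
apply: eq_bigr => j _; rewrite /loc /nexp split_l split_r ![1 + _]addrC !subrK.
rewrite /pos_part /neg_part; case: ifP => h.
  by rewrite expr0 mulr1 -cis_nat; congr cis; rewrite -[in RHS](gez0_abs h).
rewrite expr0 mul1r -cis_nat; congr cis; move: h => /negbT; rewrite -ltNge => h.
by rewrite -[in RHS](opprK (k 0 j)) -(ltz0_abs h) rmorphN /= mulNr mulrN.
Qed.

Lemma norm_loc k (r : R) : \prod_(i < d + d) (1 + r) ^+ nexp k i = (1 + r) ^+ absn k.
Proof.
rewrite big_split_ord /= -big_split /= /absn expr_sum; apply: eq_bigr => j _.
rewrite /nexp split_l split_r -exprD /pos_part /neg_part; congr (_ ^+ _).
by case: ifP; rewrite ?addn0 ?add0n.
Qed.

Definition pser c x0 : J -> C := fun e => csum (fun k => c k * fmode k x0 * binc R (nexp k) e).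

(** Expanding each exponential by the binomial theorem replaces [|c_k|] by [|c_k| (1 + r)^|k|] in
    the norm of radius [r], whatever the base point [x0]. *)
Lemma pserP c x0 (r : R) : 0 <= r -> nsm (fun k => nm (c k) * (1 + r) ^+ absn k) ->
  [/\ absconv r (pser c x0), nsum (fun e => nm (pser c x0 e) * r ^+ sz e) <= nsum (fun k => nm (c k) * (1 + r) ^+ absn k) &
   forall x, (forall i, nm (loc x i) <= r) -> ev (pser c x0) (loc x) = fser c (x0 + x)].
Proof.
move=> r0 hc.
pose f k e := nm (c k) * (nm (binc R (nexp k) e) * r ^+ sz e).
have bn k := binc_norm (nexp k) r0.
have f1 k : nsm (f k) by apply: nsmZ; [exact: nm_ge0 | case: (bn k)].
have fE k : nsum (f k) = nm (c k) * (1 + r) ^+ absn k.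
  by rewrite /f nsumZ ?nm_ge0 //; case: (bn k) => // _ ->; rewrite norm_loc.
have f2 : nsm (fun k => nsum (f k)) by move: hc; congr nsm; apply/funext => k; rewrite fE.
have [s1 s2] := nsm_pair f1 f2; have [s3 s4] := nsm_swap s1.
have [s5 s6] := nsm_pairI (f := fun e k => f k e) s3.
have [_ s7] := nsm_pair (f := fun e k => f k e) s5 s6.
have b e : 0 <= nm (pser c x0 e) * r ^+ sz e <= nsum (fun k => f k e).
  have re : 0 <= r ^+ sz e by apply: exprn_ge0.
  rewrite mulr_ge0 ?nm_ge0 //=; move: re; rewrite le_eqVlt => /orP[/eqP <-|rp].
    by rewrite mulr0 nsum_ge0.
  rewrite -ler_pdivlMr // mulrC -nsumZ ?invr_ge0 ?(ltW rp) //.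
  apply: nm_csum_le => [|k]; first by apply: nsmZ; rewrite ?invr_ge0 ?(ltW rp).
  rewrite !nmM nm_ex mulr1 /f le_eqVlt; apply/orP; left; apply/eqP; field; by rewrite gt_eqF.
have cv1 : absconv r (pser c x0) by apply: (nsm_le s6) => e; exact: b.
split=> //.
  apply: (@le_trans _ _ (nsum (fun e => nsum (fun k => f k e)))).
    by apply: le_nsum => // e; case/andP: (b e).
  rewrite -s7 s4 s2 le_eqVlt; apply/orP; left; apply/eqP.
  by apply: eq_nsum => k; rewrite fE.
move=> x hx; pose t k e := c k * fmode k x0 * binc R (nexp k) e * mon (loc x) e.
have tb k e : nm (t k e) <= f k e.
  rewrite /t !nmM nm_ex mulr1 -mulrA ler_wpM2l ?nm_ge0 // ler_wpM2l ?nm_ge0 //.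
  exact: nm_mon_le.
have sp : csm (fun p : Z * J => t p.1 p.2) by apply: (csm_pair f1 f2 tb).
have [_ e1] := csum_swap (f := t) sp.
have -> : ev (pser c x0) (loc x) = csum (fun e => csum (t^~ e)).
  apply: eq_csum => e; case: (eqVneq (mon (loc x) e) 0) => [h0|h0].
    by rewrite h0 mulr0 -[LHS](@csum0 R Z); apply: eq_csum => k; rewrite /t h0 mulr0.
  rewrite -csumZr //.
  have := nsmZ (nm_ge0 (mon (loc x) e)^-1) (s5 e); move/nsm_le; apply => k.
  rewrite nm_ge0 /= nmV ler_pdivlMl; last by rewrite lt_neqAle nm_ge0 eq_sym; apply/andP; split=> //;
    apply: contraNneq h0 => /nm_eq0 ->.
  by rewrite -nmM mulrC; exact: tb.
rewrite -e1 /fser; apply: eq_csum => k; rewrite exDr mulrA -(ex_loc k x).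
have [g1 <-] := binc_sum (nexp k) (loc x).
by rewrite /ev -csumZ //; apply: eq_csum => e; rewrite /t mulrA.
Qed.

Variables pA pB pC : pred 'I_d.
Hypothesis part : forall i, (pA i + pB i + pC i)%N = 1%N.
Local Notation isA := (isA pB pC).
Local Notation isB := (isB pA pC).

Definition maskB (y : 'rV[R]_d) : 'rV[R]_d := \row_i (if pB i then y 0 i else 0).

Lemma ex_maskB k y : fmode k (maskB y) = fmode (projB pB k) y.
Proof.
rewrite /fmode /dot; congr cis; apply: eq_bigr => i _; rewrite !mxE.
by case: ifP => _; rewrite ?mulr0 ?mul0r.
Qed.

(** The partial coefficient is the limit of averages over [t''] of [h] times an exponential, the
    function [F]. As [|a|] does not depend on [t''], the averages inherit the pointwise bound. *)
Lemma pcoef_bound h a (K : R) z x : rapid h -> (forall k, h k != 0 -> nrm pC k = 0%N) ->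
  csm a -> (forall k, a k != 0 -> isA k) -> isB z ->
  (forall x, nm (fser h x) <= K * nm (fser a x)) ->
  nm (fser (pcoef pB pC z h) x) <= K * nm (fser a x).
Proof.
move=> rh hC sa hA hz hK.
have sh := csm_rapid rh.
have ea y : fser a (x + maskB y) = fser a x.
  apply: eq_csum => k; case: (eqVneq (a k) 0) => [->|/hA/andP[/nrm0P kB _]]; first by rewrite !mul0r.
  rewrite exDr ex_maskB; have -> : projB pB k = 0.
    by apply/rowP => i; rewrite !mxE; case: ifP => // /kB.
  by rewrite ex0 mulr1.
pose F y := csum (fun k => h k * fmode k x * fmode (projB pB k - z) y).
have FE y : F y = fser h (x + maskB y) * fmode (- z) y.
  rewrite /F /fser -csumZr; last exact: fser_sm.
  by apply: eq_csum => k; rewrite exDr ex_maskB exD; ring.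
have Fb y : nm (F y) <= K * nm (fser a x) by rewrite FE nmM nm_ex mulr1 -(ea y).
have shx := fser_sm x sh.
pose L := csum (fun k => if projB pB k - z == 0 then h k * fmode k x else 0).
have LE : L = fmode z x * fser (pcoef pB pC z h) x.
  rewrite /L /fser -csumZ; last by apply: fser_sm; apply: csm_rapid; exact: rapid_pcoef.
  pose g k := if projB pB k - z == 0 then h k * fmode k x else 0.
  have sg : csm g by apply: (csm_le shx) => k; rewrite /g; case: ifP; rewrite ?nm0 ?nm_ge0.
  have inj : injective (fun l : Z => l + z) by move=> u v /addIr.
  have [|_ <-] := csum_reindex inj _ sg; first by move=> k _; exists (k - z); rewrite subrK.
  apply: eq_csum => k; rewrite /g /= /pcoef.
  case: (eqVneq (h (k + z)) 0) => [->|/hC h0].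
    by rewrite !mul0r !if_same mul0r mulr0.
  rewrite subr_eq0 eq_sym (projB_eq part z h0) hz addrK /=.
  by case: ifP => _; rewrite ?mul0r ?mulr0 // exD; ring.
have -> : nm (fser (pcoef pB pC z h) x) = nm L by rewrite LE nmM nm_ex mul1r.
apply/ler_addgt0Pr => e e0.
have [q0 hq] := avg_limit (fun k => projB pB k - z) shx e0.
have := hq q0.+1 (leqnSn _); rewrite -/L -[fun y => csum _]/F => h1.
have -> : L = avg q0.+1 F - (avg q0.+1 F - L) by rewrite subKr.
apply: le_trans (ler_nmD _ _) _; rewrite nmN; apply: lerD; last by [].
exact: nm_avg.
Qed.

(** [pcoef_bound] makes the partial coefficients dominated germs, without decay in [z]. Uniform
    division replaces the constant by a multiple of the norm of the germ, which is [O(w^|z|)], and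
    compactness of the torus makes that multiple independent of the base point. *)
Lemma pcoef_decay h a (b w K : R) : 0 <= b -> 0 <= w -> w < 1 -> 0 <= K ->
  (forall k, nm (h k) <= b * w ^+ absn k) -> (forall k, h k != 0 -> nrm pC k = 0%N) ->
  csm a -> (forall k, a k != 0 -> isA k) ->
  (forall x, nm (fser h x) <= K * nm (fser a x)) ->
  exists2 c, 0 <= c & forall z x, isB z -> nm (fser (pcoef pB pC z h) x) <= c * w ^+ absn z * nm (fser a x).
Proof.
move=> b0 w0 w1 K0 hb hC sa hA hK.
have rh : rapid h by apply: (geom_rapid b0 _ hb); rewrite w0.
pose r : R := (1 - w) / 2.
have r0 : 0 < r by rewrite divr_gt0 // subr_gt0.
have rw : 0 <= (1 + r) * w < 1.
  rewrite mulr_ge0 ?addr_ge0 ?(ltW r0) //=; rewrite /r.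
  have : (1 - w) * w <= 1 - w by rewrite ler_piMr ?subr_ge0 // ltW.
  have : 0 < 1 - w by rewrite subr_gt0.
  move=> *; have -> : (1 + (1 - w) / 2) * w = w + (1 - w) * w / 2 by field. lra.
have sg := nsm_geomZ d rw; pose S := nsum (fun k : Z => ((1 + r) * w) ^+ absn k).
have S0 : 0 <= S by apply: nsum_ge0.
have pb z k : isB z -> nm (pcoef pB pC z h k) * (1 + r) ^+ absn k <= b * w ^+ absn z * ((1 + r) * w) ^+ absn k.
  move=> /andP[zA zC]; have r1 : 0 <= (1 + r) ^+ absn k by rewrite exprn_ge0 // addr_ge0 // ltW.
  rewrite /pcoef; case: ifP => [/andP[kB kC]|_]; last first.
    by rewrite nm0 mul0r !mulr_ge0 // exprn_ge0 //; case/andP: rw.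
  have e : absn (k + z) = (absn k + absn z)%N.
    rewrite /absn -big_split; apply: eq_bigr => i _; rewrite mxE.
    have := part i; case pi_: (pA i); case pi2: (pB i); case pi3: (pC i) => // _.
    - by rewrite /= ((nrm0P _ _ zA) i pi_) addr0 addn0.
    - by rewrite /= ((nrm0P _ _ kB) i pi2) add0r add0n.
    - by rewrite /= ((nrm0P _ _ kC) i pi3) add0r add0n.
  apply: le_trans (ler_wpM2r r1 (hb _)) _.
  by rewrite e exprD exprMn le_eqVlt; apply/orP; left; apply/eqP; ring.
pose P (c : R) (x : 'rV[R]_d) := forall z, isB z -> nm (fser (pcoef pB pC z h) x) <= c * w ^+ absn z * nm (fser a x).
have [|x0|c hc] := @torus_uniform R d P.
- move=> c c' x cc h1 z hz; apply: le_trans (h1 z hz) _.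
  by rewrite ler_wpM2r ?nm_ge0 // ler_wpM2r ?exprn_ge0.
- have [|sg1 sg10 [c c0 hc]] := @domination_uniform R (d + d) 'rV[R]_d (@loc) (fun x => nm (fser a (x0 + x))) _ r r0.
    by move=> x; exact: nm_ge0.
  exists (c * (b * S)).
  have cvz z : isB z -> nsm (fun k => nm (pcoef pB pC z h k) * (1 + r) ^+ absn k) /\
     nsum (fun k => nm (pcoef pB pC z h k) * (1 + r) ^+ absn k) <= b * w ^+ absn z * S.
    move=> hz; have q0 : 0 <= b * w ^+ absn z by rewrite mulr_ge0 // exprn_ge0.
    split; first by apply: (nsm_le (nsmZ q0 sg)) => k; rewrite pb // andbT mulr_ge0 ?nm_ge0 ?exprn_ge0 ?addr_ge0 ?(ltW r0).
    by rewrite -nsumZ //; apply: le_nsum => [|k]; [exact: nsmZ | exact: pb].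
  near=> y => z hz.
  have [c1 c2] := cvz z hz; have [p1 p2 p3] := pserP x0 (ltW r0) c1.
  have dg : dominated_germ (@loc) (fun x => nm (fser a (x0 + x))) (pser (pcoef pB pC z h) x0).
    exists r, K; split=> // x hx; rewrite p3 //; exact: pcoef_bound.
  have hm i : nm (loc (y - x0) i) <= Num.min sg1 r.
    have yn : `|x0 - y| < Num.min sg1 r / 2.
      by near: y; apply: cvgr_dist_lt => //; rewrite divr_gt0 // lt_min sg10 r0.
    have cn j : 2 * `|(y - x0) 0 j| <= Num.min sg1 r.
      have := coord_le_norm (y - x0) j; rewrite distrC => /le_lt_trans/(_ yn); lra.
    rewrite /loc; case: (fintype.split i) => j; first exact: le_trans (cisB1_le _) (cn j).
    by apply: le_trans (cisB1_le _) _; rewrite normrN; exact: cn.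
  have hy i : nm (loc (y - x0) i) <= sg1.
    by apply: (le_trans (hm i)); rewrite ge_min lexx.
  have hyr : forall i, nm (loc (y - x0) i) <= r.
    move=> i; apply: (@le_trans _ _ (Num.min sg1 r)); last by rewrite ge_min lexx orbT.
    exact: hm.
  have := hc _ p1 dg _ hy; rewrite p3 // addrC subrK => h1; apply: le_trans h1 _.
  rewrite ler_wpM2r ?nm_ge0 // -!mulrA ler_wpM2l //; apply: le_trans p2 (le_trans c2 _).
  by rewrite -mulrA [w ^+ _ * S]mulrC.
exists `|c| => // z x hz.
have [y [n [h1 [_ ->]]]] := torus_box x.
rewrite !periodic_shift; try exact: fser_periodic.
apply: le_trans (hc y h1 z hz) _; rewrite ler_wpM2r ?nm_ge0 // ler_wpM2r ?exprn_ge0 //.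
exact: ler_norm.
Unshelve. all: by end_near.
Qed.

End LocalExpansion.

(** * Analytic hypoellipticity *)

Section FourierRepresentation.
Variables (R : realType) (d : nat).
Local Notation C := R[i].
Local Notation Z := 'rV[int]_d.
Local Notation field := ('I_d -> Z -> C).
Implicit Types (k l : Z) (c : Z -> C) (z : 'rV[R]_d).
Local Notation ej := (@basis_vec R d).

(** The distribution defined by a function determines its representing sequence ([repr_inj]). *)
Lemma fser_inj c c' : rapid c -> rapid c' -> fser c = fser c' -> c = c'.
Proof.
move=> hc hc' e; have h := repr_dist_of hc'; rewrite -e in h.
have := repr_inj (repr_dist_of hc) h => /funeqP h2; apply/funext => k.
have := h2 k; apply: mulfI; rewrite -(rmorph0 (real_complex R)) (inj_eq (@complexI R)).
by rewrite expf_neq0 // mulf_neq0 // gt_eqF // pi_gt0.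
Qed.

Lemma fser_cbar c z : rapid c -> fser (cbar c) z = conjc (fser c z).
Proof.
move=> hc; rewrite /fser -csumJ; last by apply: fser_sm; exact: csm_rapid.
have sm := csmJ (fser_sm z (csm_rapid hc)).
have ninj : injective (fun l : Z => - l) by exact: oppr_inj.
have [|_ <-] := csum_reindex ninj _ sm; first by move=> l _; exists (- l); rewrite opprK.
by apply: eq_csum => k; rewrite /cbar /= exN rmorphM /= conjcK.
Qed.

(** If [k_i] is nonzero, translation by [pi / k_i] multiplies the coefficient [c k] by -1. *)
Lemma fser_indep c (i : 'I_d) : rapid c -> (forall z t, fser c (z + t *: ej i) = fser c z) ->
  forall k, c k != 0 -> k 0 i = 0.
Proof.
move=> hc h k ck; apply/eqP; apply: contraNT ck => ki.
pose t : R := pi / (k 0 i)%:~R.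
have rt : rapid (fun k => c k * cis (t * (k 0 i)%:~R)).
  by move=> r; have [b hb] := hc r; exists b => l; rewrite nmM nm_cis mulr1.
have /funeqP/(_ k) : (fun k => c k * cis (t * (k 0 i)%:~R)) = c.
  apply: fser_inj => //; apply/funext => z; rewrite -(h z t); apply: eq_csum => l.
  by rewrite exDr [fmode l (t *: _)]/fmode dot_ej; ring.
rewrite divfK ?intr_eq0 // /cis cospi sinpi => e.
have {}e : - c k = c k by rewrite -[RHS]e; case: (c k) => x y; simpc; rewrite ?mulr0 ?subr0 ?addr0 ?mulrN1.
by have := congr1 (fun x => x + c k) e; rewrite addNr -mulr2n => /esym/eqP; rewrite mulrn_eq0.
Qed.

Lemma ccont_near (f : 'rV[R]_d -> C) z e : ccontinuous f -> 0 < e ->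
  (\forall y \near z, nm (f y - f z) <= e)%classic.
Proof.
move=> [cr ci] e0; have e2 : 0 < e / 2 by apply: divr_gt0.
have h1 := cr z; have h2 := ci z.
have e1 : (\forall y \near z, `|re_part f z - re_part f y| < e / 2)%classic by move/cvgrPdist_lt: h1; apply.
have e3 : (\forall y \near z, `|im_part f z - im_part f y| < e / 2)%classic by move/cvgrPdist_lt: h2; apply.
near=> y.
have b1 : `|re_part f z - re_part f y| < e / 2 by near: y.
have b2 : `|im_part f z - im_part f y| < e / 2 by near: y.
apply: le_trans (nm_le_ReIm _) _; move: b1 b2; rewrite /re_part /im_part.
rewrite ![`|_ (f z) - _|]distrC; case: (f z) => a b; case: (f y) => a' b' /=; lra.
Unshelve. all: by end_near.
Qed.

(** Perturbation of the inverse [B] at [z0]: [be] bounds the entries of [B], and [de] is so small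
    that the variation of the matrix costs at most half of [s]. *)
Lemma invertible_near r (y : 'I_r -> 'I_r -> Z -> C) z0 : (forall a i, rapid (y a i)) ->
  row_free (\matrix_(a, i) fser (y a i) z0) ->
  exists2 K : R, 0 <= K & (\forall z \near z0, forall p : 'I_r -> C,
    \sum_i nm (p i) ^+ 2 <= K * \sum_a nm (\sum_i fser (y a i) z * p i) ^+ 2)%classic.
Proof.
move=> ry; set M := (\matrix_(a, i) _); rewrite row_free_unit => uM.
pose B := invmx M; pose be := \sum_i \sum_a nm (B i a).
have be0 : 0 <= be by apply: sumr_ge0 => i _; apply: sumr_ge0 => a _; exact: nm_ge0.
pose de := (2 * (be * r%:R + 1))^-1.
have dp : 0 < 2 * (be * r%:R + 1) by rewrite mulr_gt0 // ltr_wpDl // mulr_ge0.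
have de0 : 0 < de by rewrite invr_gt0.
have inv (p : 'I_r -> C) i : p i = \sum_a B i a * \sum_i' M a i' * p i'.
  have := mulmxA B M (\col_i p i); rewrite mulVmx // mul1mx => /matrixP/(_ i 0).
  rewrite !mxE => <-; apply: eq_bigr => a _; congr (_ * _); rewrite mxE.
  by apply: eq_bigr => i' _; rewrite !mxE.
exists ((2 * be) ^+ 2 * r%:R); first by rewrite mulr_ge0 ?sqr_ge0.
have nr : (\forall z \near z0, forall ai : 'I_r * 'I_r, nm (fser (y ai.1 ai.2) z - fser (y ai.1 ai.2) z0) <= de)%classic.
  apply: (@filter_forall _ ('I_r * 'I_r)%type (fun ai => [set z | nm (fser (y ai.1 ai.2) z - fser (y ai.1 ai.2) z0) <= de]%classic) (nbhs z0) _) => -[a i].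
  apply: ccont_near => //; exact: ccontinuous_fser.
near=> z => p.
have hz a i : nm (fser (y a i) z - fser (y a i) z0) <= de by have : forall ai : 'I_r * 'I_r, nm (fser (y ai.1 ai.2) z - fser (y ai.1 ai.2) z0) <= de; [near: z | move=> /(_ (a, i))].
pose q a := nm (\sum_i fser (y a i) z * p i); pose s := \sum_i nm (p i).
have s0 : 0 <= s by apply: sumr_ge0 => i _; exact: nm_ge0.
have q0 : 0 <= \sum_a q a by apply: sumr_ge0 => a _; exact: nm_ge0.
have b1 a : nm (\sum_i' M a i' * p i') <= q a + de * s.
  have -> : \sum_i' M a i' * p i' = \sum_i fser (y a i) z * p i - \sum_i (fser (y a i) z - fser (y a i) z0) * p i.
    by rewrite -sumrB; apply: eq_bigr => i _; rewrite mxE; ring.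
  apply: le_trans (ler_nmD _ _) _; rewrite nmN lerD //; apply: le_trans (ler_nm_sum _ _ _) _.
  by rewrite mulr_sumr; apply: ler_sum => i _; rewrite nmM ler_wpM2r ?nm_ge0.
have b2 : s <= be * (\sum_a q a + r%:R * (de * s)).
  have b3 i : nm (p i) <= (\sum_a nm (B i a)) * (\sum_a q a + r%:R * (de * s)).
    rewrite {1}(inv p i); apply: le_trans (ler_nm_sum _ _ _) _; rewrite mulr_suml.
    apply: ler_sum => a _; rewrite nmM ler_wpM2l ?nm_ge0 //; apply: le_trans (b1 a) _.
    apply: lerD.
      by rewrite (bigD1 a) //= lerDl; apply: sumr_ge0 => a' _; exact: nm_ge0.
    rewrite ler_peMl ?mulr_ge0 // ?(ltW de0) // ler1n; exact: leq_ltn_trans (ltn_ord a).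
  by rewrite /be mulr_suml; apply: ler_sum => i _.
have b4 : be * (r%:R * (de * s)) <= s / 2.
  have -> : be * (r%:R * (de * s)) = be * r%:R * de * s by ring.
  rewrite [s / 2]mulrC ler_wpM2r // /de ler_pdivrMr //.
  by have := mulr_ge0 be0 (ler0n R r); move: (be * _) => x; lra.
have b5 : s <= 2 * be * \sum_a q a.
  rewrite -mulrA; move: b2 b4; rewrite mulrDr; move: (be * \sum_a q a) (be * (r%:R * _)) => x w; lra.
have b6 : \sum_i nm (p i) ^+ 2 <= s ^+ 2.
  rewrite /s; have hs (t : seq 'I_r) : \sum_(i <- t) nm (p i) ^+ 2 <= (\sum_(i <- t) nm (p i)) ^+ 2.
    elim: t => [|i t IH]; first by rewrite !big_nil expr0n.
    rewrite !big_cons sqrrD -addrA lerD2l; apply: le_trans IH _; rewrite lerDr.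
    by rewrite mulrn_wge0 // mulr_ge0 ?nm_ge0 // sumr_ge0 // => i' _; exact: nm_ge0.
  exact: hs.
apply: le_trans b6 _; apply: (@le_trans _ _ ((2 * be * \sum_a q a) ^+ 2)).
  by rewrite lerXn2r ?nnegrE // mulr_ge0 // mulr_ge0.
rewrite exprMn -mulrA ler_wpM2l ?sqr_ge0 //.
have [h _] := sqr_sum_le (enum 'I_r) q.
by rewrite !big_enum size_enum_ord in h.
Unshelve. all: by end_near.
Qed.

Variables (N : nat) (X : 'I_N -> vfield R d) (x : 'I_N -> field).
Hypothesis x_rapid : forall j, rf (x j).
Hypothesis x_real : forall j, barf (x j) = x j.
Hypothesis xE : forall j i, (fun z => X j z 0 i) = fser (x j i).

(** [good] and [multiplier] are carried together: in the bracket step one field acts as multiplier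
    on the other. *)
Lemma lie_coef Y : Lie_generated X Y -> exists y : field,
  [/\ forall i, (fun z => Y z 0 i) = fser (y i), good x y & multiplier x y].
Proof.
elim=> [j|c Y1 Y2 _ [y1 [e1 g1 m1]] _ [y2 [e2 g2 m2]]|Y1 Y2 _ [y1 [e1 g1 m1]] _ [y2 [e2 g2 m2]]].
- by exists (x j); split; [exact: xE | exact: good_X | exact: multiplier_X].
- exists (fun i k => c * y1 i k + y2 i k); split; [|exact: good_lin|exact: multiplier_lin].
  have [r1 _ _] := g1; have [r2 _ _] := g2.
  move=> i; apply/funext => z; rewrite !mxE fserD //; last exact: rapidZ.
  by rewrite fserZ // -e1 -e2.
exists (brk y1 y2); split; [|exact: good_brk|exact: multiplier_brk].
have [r1 _ _] := g1; have [r2 _ _] := g2.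
move=> i; apply/funext => z; rewrite mxE /vf_app e1 e2.
have rD (y : field) (w : Z -> C) : rf y -> rapid w -> rapid (fun k => \sum_l cv (y l) (Dm l w) k).
  by move=> hy hw; apply: rapid_sum => l _; apply: rapid_cv => //; exact: rapid_Dm.
have key (Y' : vfield R d) (y : field) (w : Z -> C) : (forall i, (fun z => Y' z 0 i) = fser (y i)) -> rf y -> rapid w ->
   \sum_l Y' z 0 l * D l (fser w) z = fser (fun k => \sum_l cv (y l) (Dm l w) k) z.
  move=> eY hy hw; rewrite [RHS](fser_vop z hy (hw (-4))); apply: eq_bigr => l _.
  by rewrite D_fser // -eY.
rewrite (key _ _ _ e1) // (key _ _ _ e2) // /brk.
have -> : (fun k0 => \sum_l (cv (y1 l) (Dm l (y2 i)) k0 - cv (y2 l) (Dm l (y1 i)) k0)) =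
   (fun k0 => \sum_l cv (y1 l) (Dm l (y2 i)) k0 + (- 1) * \sum_l cv (y2 l) (Dm l (y1 i)) k0).
  by apply/funext => k0; rewrite sumrB mulN1r.
rewrite fserD ?fserZ ?mulN1r //; try exact: rD.
by apply: rapidZ; exact: rD.
Qed.

(** The filter of finite sets directed by inclusion; near coverings with this filter yield a finite
    subcover. *)
Definition seq_filter (T : eqType) : set_system (seq T) :=
  fun A => exists S0 : seq T, forall S, {subset S0 <= S} -> A S.

Lemma seq_filter_filter (T : eqType) : Filter (@seq_filter T).
Proof.
split; first by exists [::].
- move=> P Q [S1 h1] [S2 h2]; exists (S1 ++ S2) => S hS; split.
    by apply: h1 => u hu; apply: hS; rewrite mem_cat hu.
  by apply: h2 => u hu; apply: hS; rewrite mem_cat hu orbT.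
by move=> P Q PQ [S1 h1]; exists S1 => S /h1; exact: PQ.
Qed.

(** The iterated brackets that span depend on the point. Each choice still spans in a neighbourhood,
    and finitely many neighbourhoods cover the torus. *)
Lemma spanning_family : Hormander X -> exists (I : finType) (y : I -> field) (K : R), [/\ 0 <= K,
  forall a, good x (y a) & forall z (p : 'I_d -> C),
     \sum_i nm (p i) ^+ 2 <= K * \sum_a nm (\sum_i fser (y a i) z * p i) ^+ 2].
Proof.
move=> hX.
have /choice[yK hyK] z0 : exists yK : ('I_d -> field) * R, [/\ forall a, good x (yK.1 a), 0 <= yK.2 &
   (\forall z \near z0, forall p : 'I_d -> C,
    \sum_i nm (p i) ^+ 2 <= yK.2 * \sum_a nm (\sum_i fser (yK.1 a i) z * p i) ^+ 2)%classic].
  have [Y [hY free]] := hX z0.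
  have /choice[y hy] a : exists y : field, [/\ forall i, (fun z => Y a z 0 i) = fser (y i), good x y & multiplier x y].
    exact: lie_coef.
  have ry a i : rapid (y a i) by have [_ [r _ _] _] := hy a.
  have [|K K0 hK] := @invertible_near d y z0 ry.
    move: free; congr (is_true (row_free _)); apply/matrixP => a i; rewrite !mxE.
    by have [e _ _] := hy a; rewrite -e.
  by exists (y, K); split=> // a; have [] := hy a.
pose P (S : seq 'rV[R]_d) (z : 'rV[R]_d) := exists2 z0, z0 \in S & forall p : 'I_d -> C,
    \sum_i nm (p i) ^+ 2 <= (yK z0).2 * \sum_a nm (\sum_i fser ((yK z0).1 a i) z * p i) ^+ 2.
pose Kb := [set v : 'rV[R]_d | forall j, `[0, 2 * pi]%classic (v ord0 j)]%classic.
have cK : compact Kb := @rV_compact R d (fun=> `[0, 2 * pi]%classic) (fun=> @segment_compact R 0 (2 * pi)).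
have := (compact_near_coveringP Kb).1 cK _ (@seq_filter 'rV[R]_d) P (seq_filter_filter _).
case=> [z0 _|S0 /(_ S0 (fun u hu => hu)) hS].
  have [_ _ hz] := hyK z0.
  exists ([set z | forall p : 'I_d -> C,
    \sum_i nm (p i) ^+ 2 <= (yK z0).2 * \sum_a nm (\sum_i fser ((yK z0).1 a i) z * p i) ^+ 2], [set S : seq 'rV[R]_d | z0 \in S])%classic.
    split=> //=; exists [:: z0] => S; apply; exact: mem_head.
  by move=> [z S] [/= h1 h2]; exists z0.
have [K K0 hK] := seq_max S0 (fun z0 => (yK z0).2).
exists ('I_(size S0) * 'I_d)%type, (fun sa : 'I_(size S0) * 'I_d => (yK (nth 0 S0 sa.1)).1 sa.2), K; split=> //.
  by move=> [s a] /=; have [h _ _] := hyK (nth 0 S0 s).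
move=> z p; have [z1 [n [h1 [_ ez]]]] := torus_box z.
have ef c : fser c z = fser c z1 by rewrite ez periodic_shift //; exact: fser_periodic.
have [|z0 zS hz] := hS z1.
  by move=> j; rewrite /= in_itv /=; exact: h1.
apply: le_trans (hz p) _.
have g0 (F : 'I_d -> C) : 0 <= \sum_a nm (F a) ^+ 2 by apply: sumr_ge0 => a _; exact: sqr_ge0.
apply: le_trans (ler_wpM2r (g0 _) (hK _ zS)) _; rewrite ler_wpM2l //.
have hi : (index z0 S0 < size S0)%N by rewrite index_mem.
rewrite -(pair_bigA _ (fun (s : 'I_(size S0)) (a : 'I_d) => nm (\sum_i fser ((yK (nth 0 S0 s)).1 a i) z * p i) ^+ 2)) /=.
rewrite (bigD1 (Ordinal hi)) //= nth_index //.
have -> : \sum_a nm (\sum_i fser ((yK z0).1 a i) z * p i) ^+ 2 = \sum_a nm (\sum_i fser ((yK z0).1 a i) z1 * p i) ^+ 2.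
  by apply: eq_bigr => a _; congr (nm _ ^+ 2); apply: eq_bigr => i _; rewrite ef.
by rewrite lerDl; apply: sumr_ge0 => s _; exact: g0.
Qed.

End FourierRepresentation.

(** * The theorem for an abstract dominating coefficient *)

Section Hypoellipticity.
Variables (R : realType) (d N : nat).
Local Notation C := R[i].
Local Notation Z := 'rV[int]_d.
Local Notation ej := (@basis_vec R d).
Variable X : 'I_N -> vfield R d.
Hypothesis d_gt0 : (0 < d)%N.
Hypothesis X_analytic : forall j k, Comega (fun z => X j z 0 k).
Hypothesis X_real : forall j z k, conjc (X j z 0 k) = X j z 0 k.
Hypothesis X_Hormander : Hormander X.
Variables pA pB pC : pred 'I_d.
Hypothesis part : forall i, (pA i + pB i + pC i)%N = 1%N.
Hypothesis indepC : forall j z k i t, pC i -> X j (z + t *: ej i) 0 k = X j z 0 k.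
Hypothesis indepB : forall j z k i t, ~~ pC k -> pB i -> X j (z + t *: ej i) 0 k = X j z 0 k.
Variable Ke : R.
Hypothesis Ke0 : 0 <= Ke.
Hypothesis elliptic : forall i z (p : 'I_d -> C), pA i ->
  nm (p i) ^+ 2 <= Ke * \sum_j nm (\sum_i' X j z 0 i' * p i') ^+ 2.
Variables (j0 : 'I_N) (k0 : 'I_d) (Kd K2 : R).
Hypotheses (k0C : ~~ pC k0) (Kd0 : 0 <= Kd) (K20 : 0 <= K2).
Hypothesis coef_dominated : forall j i z, pC i -> nm (X j z 0 i) <= Kd * nm (X j0 z 0 k0).
Hypothesis transversal : forall i z (p : 'I_d -> C), pB i ->
  nm (X j0 z 0 k0 * p i) ^+ 2 <= K2 * (\sum_j nm (\sum_i' X j z 0 i' * p i') ^+ 2 +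
    \sum_(i' | pC i') nm (X j0 z 0 k0 * p i') ^+ 2).

(** The coefficient [X j0 _ 0 k0], a function of [t'] alone, stands for all the [a_l]: it dominates
    the coefficients in the [x] directions, and it controls [D_t''] modulo [D_x] through
    [transversal]. *)
Theorem hypoelliptic_of_domination : globally_analytic_hypoelliptic (sum_of_squares X).
Proof.
have /choice[cb hcb] (jk : 'I_N * 'I_d) : exists cb : (Z -> C) * (R * R), [/\ 0 <= cb.2.1, 0 <= cb.2.2, cb.2.2 < 1,
    forall k, nm (cb.1 k) <= cb.2.1 * cb.2.2 ^+ absn k & (fun z => X jk.1 z 0 jk.2) = fser cb.1].
  by have [c [b [w h]]] := Comega_fserP d_gt0 (X_analytic jk.1 jk.2); exists (c, (b, w)).
pose x j k := (cb (j, k)).1.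
have xE j k : (fun z => X j z 0 k) = fser (x j k) by have [] := hcb (j, k).
have xEz j k z : X j z 0 k = fser (x j k) z by rewrite -xE.
move=> u du [fu fuC hfu].
have [a [bf [wf [bf0 wf0 wf1 ha efu]]]] := Comega_fserP d_gt0 fuC.
pose rho := \big[Num.max/wf]_jk (cb jk).2.2.
have rho_ge jk : (cb jk).2.2 <= rho by exact: le_bigmax.
have rho_wf : wf <= rho by exact: bigmax_ge_id.
have rho0 : 0 <= rho := le_trans wf0 rho_wf.
have rho1 : rho < 1 by apply: bigmax_lt => // jk _; have [] := hcb jk.
pose cx := \sum_jk (cb jk).2.1.
have cx0 : 0 <= cx by apply: sumr_ge0 => jk _; have [] := hcb jk.
have geom_le (b w : R) (k : Z) : 0 <= b -> 0 <= w -> w <= rho -> b * w ^+ absn k <= b * rho ^+ absn k.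
  by move=> b0 w0 wr; rewrite ler_wpM2l // lerXn2r ?nnegrE.
have x_geom j i k : nm (x j i k) <= cx * rho ^+ absn k.
  have [b0 w0 _ hb _] := hcb (j, i); apply: le_trans (hb k) _.
  apply: le_trans (geom_le _ _ k b0 w0 (rho_ge _)) _; rewrite ler_wpM2r ?exprn_ge0 //.
  by rewrite /cx (bigD1 (j, i)) //= lerDl; apply: sumr_ge0 => jk _; have [] := hcb jk.
have rho01 : 0 <= rho < 1 by rewrite rho0.
have x_rapid j : rf (x j) by move=> i; apply: (geom_rapid cx0 rho01 (x_geom j i)).
have x_real j : barf (x j) = x j.
  apply/funext => i; apply: (fser_inj (rapid_cbar (x_rapid j i)) (x_rapid j i)).
  by apply/funext => z; rewrite fser_cbar; [move: (X_real j z i); rewrite (xEz j i z) | exact: x_rapid].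
have [I [y [K [K0 gy hK]]]] := spanning_family x_rapid x_real xE X_Hormander.
have comp := compactness_estimate x_rapid K0 gy hK.
have [v [p p0 hv] ruv] := distribution_repr du.
have r2 : represents (sum_of_squares X u) (fun k => \sum_j vop (x j) (vop (x j) v) k).
  move=> c rc; rewrite /sum_of_squares.
  have rj j : represents (vf_dist (X j) u) (vop (x j) v) by apply: (repr_vf (x_rapid j) (xE j) hv ruv).
  have oj j : ord (p + 1) (vop (x j) v) by apply: ord_vop.
  have ojj j : ord (p + 1 + 1) (vop (x j) (vop (x j) v)) by apply: ord_vop.
  have e j : vf_dist (X j) (vf_dist (X j) u) (fser c) = cv c (vop (x j) (vop (x j) v)) 0.
    exact: (repr_vf (x_rapid j) (xE j) (oj j) (rj j)).
  rewrite (eq_bigr _ (fun j _ => e j)).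
  by rewrite (@cv_sumr R d _ (index_enum 'I_N) xpredT c (fun j => vop (x j) (vop (x j) v)) _ rc (fun j _ => ojj j)).
have ra : rapid a by apply: (geom_rapid bf0 _ ha); rewrite wf0.
have r3 : represents (sum_of_squares X u) (fun k => ((2 * pi) ^+ d)%:C * a k).
  move=> c rc; rewrite hfu; last exact: Cinfty_fser.
  by rewrite efu; exact: repr_dist_of.
have eqv := repr_inj r2 r3.
have rf' : rapid (fun k => ((2 * pi) ^+ d)%:C * a k) by exact: rapidZ.
have rv : rapid v := smoothness x_rapid x_real comp p0 hv rf' eqv.
pose cf := (2 * pi) ^+ d * bf.
have pid : 0 <= (2 * pi) ^+ d :> R by rewrite exprn_ge0 // mulr_ge0 // pi_ge0.
have cf0 : 0 <= cf by exact: mulr_ge0.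
have f_geom k : nm (((2 * pi) ^+ d)%:C * a k) <= cf * rho ^+ absn k.
  rewrite nmM nm_real ger0_norm // /cf -mulrA ler_wpM2l //; apply: le_trans (ha k) _.
  exact: geom_le.
have supp j k i : (forall z t, X j (z + t *: ej i) 0 k = X j z 0 k) -> forall l, x j k l != 0 -> l 0 i = 0.
  by move=> h; apply: (fser_indep (x_rapid j k)) => z t; rewrite -(xEz j k (z + t *: ej i)) -(xEz j k z) h.
have X_C j i k : x j i k != 0 -> nrm pC k = 0%N.
  move=> hk; apply/eqP/nrm0P => i' hi'; apply: (supp j i i') hk => z t; exact: indepC.
have X_AB j i k : ~~ pC i -> x j i k != 0 -> nrm pB k = 0%N.
  move=> hi hk; apply/eqP/nrm0P => i' hi'; apply: (supp j i i') hk => z t; exact: indepB.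
have a_supp k : x j0 k0 k != 0 -> isA pB pC k.
  by move=> hk; rewrite /isA (X_C _ _ _ hk) (X_AB _ _ _ k0C hk).
have ell i z (q : 'I_d -> C) : pA i -> nm (q i) ^+ 2 <= Ke * \sum_j nm (\sum_i' fser (x j i') z * q i') ^+ 2.
  move=> hi; apply: le_trans (elliptic z q hi) _; rewrite le_eqVlt; apply/orP; left; apply/eqP; congr (_ * _).
  by apply: eq_bigr => j _; congr (nm _ ^+ 2); apply: eq_bigr => i' _; rewrite xEz.
have dom i z (q : 'I_d -> C) : pB i -> nm (fser (x j0 k0) z * q i) ^+ 2 <=
    K2 * (\sum_j nm (\sum_i' fser (x j i') z * q i') ^+ 2 + \sum_(i' | pC i') nm (fser (x j0 k0) z * q i') ^+ 2).
  move=> hi; have := transversal z q hi; rewrite xEz; congr (_ <= _ * (_ + _)).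
  by apply: eq_bigr => j _; congr (nm _ ^+ 2); apply: eq_bigr => i' _; rewrite xEz.
have sa : csm (x j0 k0) := csm_rapid (x_rapid j0 k0).
have /choice[kc hkc] (ji : 'I_N * 'I_d) : exists c : R, 0 <= c /\ (pC ji.2 -> forall z t, isB pA pC z ->
    nm (fser (pcoef pB pC z (x ji.1 ji.2)) t) <= c * rho ^+ absn z * nm (fser (x j0 k0) t)).
  case hC: (pC ji.2); last by exists 0.
  have [|c c0 hc] := pcoef_decay part cx0 rho0 rho1 Kd0 (x_geom ji.1 ji.2) (X_C ji.1 ji.2) sa a_supp.
    by move=> z; rewrite -!xEz; exact: coef_dominated.
  by exists c.
pose Ka := \sum_ji kc ji.
have Ka0 : 0 <= Ka by apply: sumr_ge0 => ji _; case: (hkc ji).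
pose nu := (1 + rho) / 2.
have [nu0 nu1 rnu] : [/\ 0 < nu, nu < 1 & rho <= nu] by move: rho0 rho1; rewrite /nu => ? ?; split; lra.
have cle j i z t : pC i -> isB pA pC z ->
    nm (fser (pcoef pB pC z (x j i)) t) <= Ka * nu ^+ absn z * nm (fser (x j0 k0) t).
  move=> hi hz; have [c0 hc] := hkc (j, i); apply: le_trans (hc hi z t hz) _.
  rewrite ler_wpM2r ?nm_ge0 //; apply: ler_pM; rewrite ?exprn_ge0 //.
    by rewrite /Ka (bigD1 (j, i)) //= lerDl; apply: sumr_ge0 => ji _; case: (hkc ji).
  by rewrite lerXn2r ?nnegrE // ltW.
have [c [om [c0 om0 om1 hvd]]] := exponential_decay x_rapid x_real rv eqv rho0 rho1 cf0 cx0 f_geom x_geom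
  part X_C X_AB Ke0 ell (x_rapid j0 k0) a_supp Ka0 nu0 nu1 K20 cle dom comp.
pose t : C := (((2 * pi) ^+ d)^-1)%:C.
have p2 : 0 < (2 * pi) ^+ d :> R by rewrite exprn_gt0 // mulr_gt0 // pi_gt0.
have tt : ((2 * pi) ^+ d)%:C * t = 1 :> C by rewrite /t -rmorphM /= mulfV // gt_eqF.
exists (fser (fun k => t * v k)).
  apply: (@Comega_fser R d _ (((2 * pi) ^+ d)^-1 * c) om); rewrite ?om0 //.
    by rewrite mulr_ge0 // invr_ge0 ltW.
  move=> k; rewrite nmM /t nm_real ger0_norm; last by rewrite invr_ge0 ltW.
  by rewrite -mulrA ler_wpM2l // invr_ge0 ltW.
move=> phi /Cinfty_fserP[c' [rc' -> _]]; rewrite (ruv c' rc').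
have rtv : rapid (fun k => t * v k) by exact: rapidZ.
rewrite (repr_dist_of rtv rc'); congr (cv c' _ 0); apply/funext => k.
by rewrite mulrA tt mul1r.
Qed.

End Hypoellipticity.

(** Compactness and periodicity make the local constants of [invertible_near] uniform. *)
Lemma uniformly_elliptic (R : realType) (d N r : nat) (X : 'I_N -> vfield R d)
  (wj : 'I_r -> 'I_N) (wi : 'I_r -> 'I_d) :
  (forall j k, Cinfty (fun z => X j z 0 k)) ->
  (forall z, row_free (\matrix_(a, i) X (wj a) z 0 (wi i))) ->
  exists2 K : R, 0 <= K & forall z (p : 'I_r -> R[i]),
    \sum_i nm (p i) ^+ 2 <= K * \sum_a nm (\sum_i X (wj a) z 0 (wi i) * p i) ^+ 2.
Proof.
move=> hX hfree.
have /choice[x hx] (jk : 'I_N * 'I_d) : exists c, rapid c /\ (fun z => X jk.1 z 0 jk.2) = fser c.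
  by have [c [rc e _]] := Cinfty_fserP (hX jk.1 jk.2); exists c.
pose y (a i : 'I_r) := x (wj a, wi i).
have ry a i : rapid (y a i) by case: (hx (wj a, wi i)).
have yE a i z : X (wj a) z 0 (wi i) = fser (y a i) z by have [_ <-] := hx (wj a, wi i).
pose P K z := forall p : 'I_r -> R[i],
    \sum_i nm (p i) ^+ 2 <= K * \sum_a nm (\sum_i fser (y a i) z * p i) ^+ 2.
have s0 (F : 'I_r -> R[i]) : 0 <= \sum_a nm (F a) ^+ 2 by apply: sumr_ge0 => a _; exact: sqr_ge0.
have [|z|K hK] := @torus_uniform R d P.
- by move=> a b z ab h p; apply: le_trans (h p) _; rewrite ler_wpM2r.
- have [|K K0 hK] := @invertible_near R d r y z ry; last by exists K.
  move: (hfree z); congr (is_true (row_free _)); apply/matrixP => a i; by rewrite !mxE yE.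
exists `|K| => // z p; have [z1 [n [h1 [_ ez]]]] := torus_box z.
have e a : \sum_i X (wj a) z 0 (wi i) * p i = \sum_i fser (y a i) z1 * p i.
  apply: eq_bigr => i _; rewrite yE ez periodic_shift //; exact: fser_periodic.
rewrite (eq_bigr _ (fun a _ => congr1 (fun u => nm u ^+ 2) (e a))).
by apply: le_trans (hK z1 h1 p) _; rewrite ler_wpM2r // ler_norm.
Qed.

(* Indices are 0-based: 1 <= j <= n' is j : 'I_n' (seen in 'I_n or 'I_N by
   widen_ord), and n'+1 <= j is (n' <= j)%N; the values of a, b, q and lam at
   the other indices are irrelevant.  The coefficients a_{ji} of (i) are
   a0 j i, the coefficients a_j of (ii) are a j. *)
Theorem theorem1 (R : realType) (n m n' N : nat)
  (n'_gt0 : (0 < n')%N) (m_gt0 : (0 < m)%N)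
  (lt_n'n : (n' < n)%N) (le_nN : (n <= N)%N)
  (X : 'I_N -> vfield R (n + m))
  (a0 : 'I_n' -> 'I_n' -> 'rV[R]_n' -> R)
  (a : 'I_N -> 'rV[R]_n' -> R)
  (b : 'I_N -> 'I_m -> 'rV[R]_n -> R)
  (q : 'I_N -> 'I_n)
  (X_analytic : forall (j : 'I_N) (k : 'I_(n + m)),
    Comega (fun z => X j z 0 k))
  (* (i) *)
  (a0_analytic : forall j i, Comega_real (a0 j i))
  (X_first : forall (j : 'I_n') (z : 'rV[R]_(n + m)),
    X (widen_ord (leq_trans (ltnW lt_n'n) le_nN) j) z
    = \sum_(i < n') (a0 j i (prime_part (ltnW lt_n'n) (t_part z)))%:C
        *: vf_D (lshift m (widen_ord (ltnW lt_n'n) i)) z)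
  (X_first_free : forall t' : 'rV[R]_n',
    row_free (\matrix_(j < n', i < n') a0 j i t'))
  (* (ii) *)
  (a_analytic : forall j : 'I_N, (n' <= j)%N -> Comega_real (a j))
  (b_analytic : forall (j : 'I_N) (k : 'I_m), (n' <= j)%N -> Comega_real (b j k))
  (q_range : forall j : 'I_N, (n' <= j)%N -> (n' <= q j)%N)
  (q_surj : forall i : 'I_n, (n' <= i)%N ->
    exists2 j : 'I_N, (n' <= j)%N & q j = i)
  (X_last : forall (j : 'I_N) (z : 'rV[R]_(n + m)), (n' <= j)%N ->
    X j z
    = (a j (prime_part (ltnW lt_n'n) (t_part z)))%:C *: vf_D (lshift m (q j)) z
      + \sum_(k < m) (b j k (t_part z))%:C *: vf_D (rshift n k) z)
  (* (iii) *)
  (domination : exists lam : 'I_n -> 'I_N,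
    (forall i : 'I_n, (n' <= i)%N -> (n' <= lam i)%N /\ q (lam i) = i) /\
    exists2 K : R, 0 < K &
      forall (i : 'I_n) (t : 'rV[R]_n), (n' <= i)%N ->
        \sum_(r < N | (n' <= r)%N) \sum_(k < m) `|b r k t|
          <= K * `|a (lam i) (prime_part (ltnW lt_n'n) t)| /\
        \sum_(r < N | (n' <= r)%N) `|a r (prime_part (ltnW lt_n'n) t)|
          <= K * `|a (lam i) (prime_part (ltnW lt_n'n) t)|)
  (* (iv) *)
  (X_Hormander : Hormander X) :
  globally_analytic_hypoelliptic (sum_of_squares X).
Proof.
have hle := ltnW lt_n'n.
pose d := (n + m)%N.
pose T (z : 'rV[R]_(n + m)) := t_part z.
pose Pz (z : 'rV[R]_(n + m)) := prime_part (ltnW lt_n'n) (t_part z).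
pose wj : 'I_n' -> 'I_N := widen_ord (leq_trans (ltnW lt_n'n) le_nN).
pose wi (i : 'I_n') : 'I_(n + m) := lshift m (widen_ord (ltnW lt_n'n) i).
have E1 (j : 'I_n') z k : X (wj j) z 0 k = \sum_i (a0 j i (Pz z))%:C * (k == wi i)%:R.
  by rewrite X_first summxE; apply: eq_bigr => i _; rewrite !mxE eqxx.
have E2 (j : 'I_N) z k : (n' <= j)%N -> X j z 0 k =
    (a j (Pz z))%:C * (k == lshift m (q j))%:R + \sum_l (b j l (T z))%:C * (k == rshift n l)%:R.
  move=> hj; rewrite X_last // !mxE summxE eqxx; congr (_ + _); apply: eq_bigr => l _.
  by rewrite !mxE eqxx.
have jcase (j : 'I_N) : (exists j', j = wj j') \/ (n' <= j)%N.
  case: (ltnP j n') => hj; [left | by right].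
  by exists (Ordinal hj); apply/val_inj.
pose pA (i : 'I_(n + m)) := (i < n')%N.
pose pB (i : 'I_(n + m)) := (n' <= i < n)%N.
pose pC (i : 'I_(n + m)) := (n <= i)%N.
have part i : (pA i + pB i + pC i)%N = 1%N.
  rewrite /pA /pB /pC; case: (ltnP i n') => h1; case: (ltnP i n) => h2 //=.
  by have := leq_trans h1 hle; rewrite leqNgt ltnS h2.
have lr (l : 'I_n) (k : 'I_m) : (lshift m l == rshift n k) = false by exact: eq_lrshift.
have TC z t i : pC i -> T (z + t *: basis_vec R i) = T z.
  move=> hi; apply/rowP => l; rewrite !mxE eqxx /=; case: eqP => [e|]; rewrite ?mulr0 ?addr0 //.
  by move: hi; rewrite /pC -e /= leqNgt ltn_ord.
have PB z t i : pB i -> Pz (z + t *: basis_vec R i) = Pz z.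
  move=> /andP[hi _]; apply/rowP => l; rewrite !mxE eqxx /=; case: eqP => [e|]; rewrite ?mulr0 ?addr0 //.
  by move: hi; rewrite -e /= leqNgt ltn_ord.
have XT j z z' k : T z = T z' -> X j z 0 k = X j z' 0 k.
  move=> e; have eP : Pz z = Pz z' by rewrite /Pz -[t_part z]/(T z) e.
  case: (jcase j) => [[j' ->]|hj]; first by rewrite !E1 eP.
  by rewrite !E2 // eP e.
have XP j z z' k : ~~ pC k -> Pz z = Pz z' -> X j z 0 k = X j z' 0 k.
  move=> hk e; case: (jcase j) => [[j' ->]|hj]; first by rewrite !E1 e.
  rewrite !E2 // e; congr (_ + _); rewrite !big1 // => l _;
  by case: eqP => [ek|]; rewrite ?mulr0 //; move: hk; rewrite /pC ek /= leq_addr.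
have Xreal j z k : exists r : R, X j z 0 k = r%:C.
  case: (jcase j) => [[j' ->]|hj].
    exists (\sum_i a0 j' i (Pz z) * (k == wi i)%:R); rewrite E1 rmorph_sum; apply: eq_bigr => i _.
    by rewrite rmorphM rmorph_nat.
  exists (a j (Pz z) * (k == lshift m (q j))%:R + \sum_l b j l (T z) * (k == rshift n l)%:R).
  rewrite E2 // rmorphD rmorphM rmorph_nat rmorph_sum; congr (_ + _); apply: eq_bigr => l _.
  by rewrite rmorphM rmorph_nat.
have wi_inj : injective wi.
  by move=> i i' /(congr1 val) /= h; apply/val_inj.
have Xwi (j : 'I_n') z (i : 'I_n') : X (wj j) z 0 (wi i) = (a0 j i (Pz z))%:C.
  rewrite E1 (bigD1 i) //= eqxx mulr1 big1 ?addr0 // => i' hi.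
  by rewrite (inj_eq wi_inj) eq_sym (negbTE hi) mulr0.
have [Ke Ke0 hKe] : exists2 Ke : R, 0 <= Ke & forall i z (p : 'I_(n + m) -> R[i]), pA i ->
    nm (p i) ^+ 2 <= Ke * \sum_j nm (\sum_i' X j z 0 i' * p i') ^+ 2.
  have [||K K0 hK] := @uniformly_elliptic R (n + m) N n' X wj wi.
  - by move=> j k; case: (X_analytic j k).
  - move=> z; rewrite row_free_unit.
    have -> : \matrix_(a1, i) X (wj a1) z 0 (wi i) = map_mx (real_complex R) (\matrix_(j, i) a0 j i (Pz z)).
      by apply/matrixP => a1 i; rewrite !mxE Xwi.
    by rewrite map_unitmx -row_free_unit X_first_free.
  exists K => // i z p hi; have ei : i = wi (Ordinal hi) by apply/val_inj.
  apply: le_trans (_ : \sum_i nm (p (wi i)) ^+ 2 <= _).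
    rewrite {1}ei (bigD1 (Ordinal hi)) //= lerDl; apply: sumr_ge0 => i' _; exact: sqr_ge0.
  apply: le_trans (hK z (fun i => p (wi i))) _; rewrite ler_wpM2l //.
  apply: (@le_trans _ _ (\sum_(j < N | (j < n')%N) nm (\sum_i' X j z 0 i' * p i') ^+ 2)).
    rewrite (big_ord_narrow (leq_trans (ltnW lt_n'n) le_nN)) /=; apply: ler_sum => j _.
    rewrite -/(wj j) le_eqVlt; apply/orP; left; apply/eqP; congr (nm _ ^+ 2).
    rewrite [RHS](eq_bigr (fun k => \sum_i (a0 j i (Pz z))%:C * (k == wi i)%:R * p k)); last first.
      by move=> k _; rewrite E1 mulr_suml.
    rewrite exchange_big /=; apply: eq_bigr => i1 _; rewrite Xwi (bigD1 (wi i1)) //= eqxx mulr1.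
    by rewrite big1 ?addr0 // => k /negbTE ->; rewrite mulr0 mul0r.
  by rewrite [leRHS](bigID (fun j : 'I_N => (j < n')%N)) /= lerDl; apply: sumr_ge0 => j _; exact: sqr_ge0.
have [lam [hlam [K K0 hK]]] := domination.
(* Any index beyond [n'] would do: by (iii) the functions [a (lam i)] are mutually comparable, so
   one of them can serve as the dominating coefficient. *)
pose i0 : 'I_n := Ordinal lt_n'n; have i0n : (n' <= i0)%N by [].
pose j0 := lam i0; have [j0n qj0] := hlam i0 i0n.
pose k0 : 'I_(n + m) := lshift m i0.
have Xj (j : 'I_N) (z : 'rV[R]_(n + m)) : (n' <= j)%N -> X j z 0 (lshift m (q j)) = (a j (Pz z))%:C.
  move=> hj; rewrite E2 // eqxx mulr1 big1 ?addr0 // => l _.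
  by rewrite lr mulr0.
have Xk0 z : nm (X j0 z 0 k0) = `|a j0 (Pz z)|.
  by have := Xj j0 z j0n; rewrite /j0 qj0 => ->; rewrite nm_real.
have bK (i : 'I_n) (j : 'I_N) l z : (n' <= i)%N -> (n' <= j)%N -> `|b j l (T z)| <= K * `|a (lam i) (Pz z)|.
  move=> hi hj; have [h _] := hK i (T z) hi; apply: le_trans h.
  rewrite (bigD1 j) //= (bigD1 l) //= -addrA lerDl addr_ge0 ?sumr_ge0 // => r _; exact: sumr_ge0.
have aK (i : 'I_n) (j : 'I_N) z : (n' <= i)%N -> (n' <= j)%N -> `|a j (Pz z)| <= K * `|a (lam i) (Pz z)|.
  move=> hi hj; have [_ h] := hK i (T z) hi; apply: le_trans h.
  by rewrite (bigD1 j) //= lerDl sumr_ge0.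
have Xr (j : 'I_N) z l : (n' <= j)%N -> X j z 0 (rshift n l) = (b j l (T z))%:C.
  move=> hj; rewrite E2 // eq_rlshift mulr0 add0r (bigD1 l) //= eqxx mulr1 big1 ?addr0 // => l' hl.
  by rewrite eq_rshift eq_sym (negbTE hl) mulr0.
(* Comparing [a (lam i0)] with the coefficient of [p i] costs one [K], the [x] terms of the same
   field cost another, and squaring costs the 2 and the number [m] of those terms. *)
pose K2 := 2 * K ^+ 2 * (1 + K ^+ 2 * m%:R).
have KK : 0 <= K := ltW K0.
apply: (@hypoelliptic_of_domination R (n + m) N X _ X_analytic _ X_Hormander pA pB pC part _ _ Ke Ke0 _ j0 k0 K K2).
- by rewrite addn_gt0 m_gt0 orbT.
- by move=> j z k; have [r ->] := Xreal j z k; rewrite conjc_real.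
- by move=> j z k i t hi; apply: XT; exact: TC.
- by move=> j z k i t hk hi; apply: XP => //; exact: PB.
- exact: hKe.
- by rewrite /pC /k0 /= -ltnNge.
- exact: KK.
- by rewrite /K2 !mulr_ge0 ?sqr_ge0 // addr_ge0 // mulr_ge0 // sqr_ge0.
- move=> j i z hi; rewrite Xk0.
  have [l ->] : exists l, i = rshift n l.
    have hl : (i - n < m)%N by rewrite ltn_subLR.
    by exists (Ordinal hl); apply/val_inj; rewrite /= subnKC.
  case: (jcase j) => [[j' ->]|hj].
    rewrite E1 big1 => [|i' _]; first by rewrite nm0 mulr_ge0.
    by rewrite /wi eq_rlshift mulr0.
  by rewrite Xr // nm_real; exact: bK.
move=> i z p /andP[hi1 hi2].
pose i1 : 'I_n := Ordinal hi2; have ei : i = lshift m i1 by apply/val_inj.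
have [j1n qj1] := hlam i1 hi1; set j1 := lam i1 in j1n qj1.
pose al := nm (X j0 z 0 k0); have al0 : 0 <= al := nm_ge0 _.
pose Sj := \sum_i' X j1 z 0 i' * p i'; pose s := nm Sj; have s0 : 0 <= s := nm_ge0 _.
pose W l := al * nm (p (rshift n l)); have W0 l : 0 <= W l by rewrite mulr_ge0 ?nm_ge0.
(* The field [X j1] differentiates only in the direction [i] and in [x], so [a j1 * p i] is
   recovered from its symbol up to the [x] terms. *)
have eS : Sj = (a j1 (Pz z))%:C * p i + \sum_l (b j1 l (T z))%:C * p (rshift n l).
  rewrite /Sj big_split_ord /=; congr (_ + _).
    rewrite (bigD1 i1) //= -ei big1 ?addr0.
      by congr (_ * _); rewrite -(Xj _ _ j1n) qj1 -ei.
    move=> l hl; rewrite E2 // qj1 (inj_eq (@lshift_inj _ _)) (negbTE hl) mulr0 add0r big1 ?mul0r // => l' _.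
    by rewrite lr mulr0.
  by apply: eq_bigr => l _; rewrite Xr.
have h1 : nm (X j0 z 0 k0 * p i) <= K * (s + K * \sum_l W l).
  rewrite nmM Xk0; apply: le_trans (ler_wpM2r (nm_ge0 _) (aK i1 j0 z hi1 j0n)) _.
  rewrite -mulrA ler_wpM2l // -[`|_|]nm_real -nmM -/j1.
  have -> : (a j1 (Pz z))%:C * p i = Sj - \sum_l (b j1 l (T z))%:C * p (rshift n l) by rewrite eS addrK.
  apply: le_trans (ler_nmD _ _) _; rewrite nmN lerD //; apply: le_trans (ler_nm_sum _ _ _) _.
  rewrite mulr_sumr; apply: ler_sum => l _; rewrite nmM nm_real /W mulrA ler_wpM2r ?nm_ge0 //.
  by rewrite /al Xk0; exact: bK.
have h2 : (\sum_l W l) ^+ 2 <= m%:R * \sum_l W l ^+ 2.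
  by have [h _] := sqr_sum_le (enum 'I_m) W; rewrite !big_enum size_enum_ord in h.
have h3 : nm (X j0 z 0 k0 * p i) ^+ 2 <= 2 * K ^+ 2 * (s ^+ 2 + K ^+ 2 * (m%:R * \sum_l W l ^+ 2)).
  have w0 : 0 <= \sum_l W l by apply: sumr_ge0.
  apply: (@le_trans _ _ ((K * (s + K * \sum_l W l)) ^+ 2)).
    by rewrite lerXn2r ?nnegrE ?nm_ge0 // mulr_ge0 // addr_ge0 // mulr_ge0.
  rewrite exprMn (_ : 2 * K ^+ 2 * _ = K ^+ 2 * (2 * (s ^+ 2 + K ^+ 2 * (m%:R * \sum_l W l ^+ 2)))); last by rewrite [2 * K ^+ 2]mulrC [RHS]mulrA.
  rewrite ler_wpM2l ?sqr_ge0 //.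
  have h4 : K ^+ 2 * (\sum_l W l) ^+ 2 <= K ^+ 2 * (m%:R * \sum_l W l ^+ 2) by rewrite ler_wpM2l ?sqr_ge0.
  rewrite -exprMn in h4; move: h4; move: (K * \sum_l W l) (K ^+ 2 * (m%:R * _)) => x y h4.
  by have := sqr_ge0 (s - x); rewrite !expr2 in h4 *; lra.
have eW : \sum_(i' | pC i') nm (X j0 z 0 k0 * p i') ^+ 2 = \sum_l W l ^+ 2.
  rewrite big_split_ord /= big1 ?add0r => [|l]; last by rewrite /pC /= leqNgt ltn_ord.
  by apply: eq_big => [l|l _]; [rewrite /pC /= leq_addr | rewrite nmM].
rewrite eW; apply: le_trans h3 _; rewrite /K2 -[leRHS]mulrA ler_wpM2l ?mulr_ge0 ?sqr_ge0 //.
have b1 : s ^+ 2 <= \sum_j nm (\sum_i' X j z 0 i' * p i') ^+ 2.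
  by rewrite (bigD1 j1) //= lerDl; apply: sumr_ge0 => j _; exact: sqr_ge0.
have b2 : 0 <= \sum_l W l ^+ 2 by apply: sumr_ge0 => l _; exact: sqr_ge0.
have b3 : 0 <= K ^+ 2 * m%:R by rewrite mulr_ge0 ?sqr_ge0.
move: b1 b2 b3; move: (\sum_j _) (\sum_l _) => x y b1 b2 b3.
have -> : K ^+ 2 * (m%:R * x) = K ^+ 2 * m%:R * x by rewrite [LHS]mulrA.
move: (K ^+ 2 * m%:R) b3 => w b3; have s2 := sqr_ge0 s.
by have := mulr_ge0 b3 (le_trans s2 b1); rewrite mulrDl mul1r mulrDr; lra.
Qed.
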